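(* Assume that $u,v\in L^3((0,T);B^s_{\frac94,\infty}(\mathbb{T}^3))$ with $s>1$ and $\int_{\mathbb{T}}\nabla_H\cdot\mathbf{u}_H\,dz=0$, where $\mathbf{u}_H=(u,v)$, such that, together with the associated vertical velocity $w$ determined by $\partial_zw=-\nabla_H\cdot\mathbf{u}_H$, $w|_{z=0}=0$, the velocity field $\mathbf{u}=(u,v,w)$ satisfies, for some pressure $p\in L^1(\mathbb{T}^3\times(0,T))$ and all $\phi_1,\phi_2,\phi_3\in\mathcal{D}(\mathbb{T}^3\times(0,T))$, the weak formulation $$\int_0^T\int_{\mathbb{T}^3}\big[u\,\partial_t\phi_1+u\mathbf{u}\cdot\nabla\phi_1+\Omega v\phi_1+p\,\partial_x\phi_1\big]dx\,dt=0,$$ $$\int_0^T\int_{\mathbb{T}^3}\big[v\,\partial_t\phi_2+v\mathbf{u}\cdot\nabla\phi_2-\Omega u\phi_2+p\,\partial_y\phi_2\big]dx\,dt=0,\qquad\int_0^T\int_{\mathbb{T}^3}p\,\partial_z\phi_3\,dx\,dt=0.$$ Then $D(\mathbf{u})=0$, which implies that energy is conserved: $$\lVert u(t_1,\cdot)\rVert_{L^2}^2+\lVert v(t_1,\cdot)\rVert_{L^2}^2=\lVert u(t_2,\cdot)\rVert_{L^2}^2+\lVert v(t_2,\cdot)\rVert_{L^2}^2\quad\text{for a.e. } t_1,t_2\in(0,T).$$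
   Context: $\mathbb{T}^3$ is the flat unit torus with coordinates $(x,y,z)$ (in integrals over $\mathbb{T}^3$ the spatial variable is also written $x$), $T>0$, $\Omega\in\mathbb{R}$ is the Coriolis parameter, $\nabla_H=(\partial_x,\partial_y)$. $\mathcal{D}(\mathbb{T}^3\times(0,T))$ denotes smooth real functions compactly supported in time in $(0,T)$. The weak formulation is that of the hydrostatic Euler equations $\partial_t u+\nabla\cdot(u\mathbf{u})-\Omega v+\partial_x p=0$, $\partial_t v+\nabla\cdot(v\mathbf{u})+\Omega u+\partial_y p=0$, $\partial_z p=0$, $\nabla\cdot\mathbf{u}=0$, considered on the torus under the symmetry conditions that $u,v,p$ are even in $z$ and $w$ is odd in $z$. Defect term: let $\varphi\in C_c^\infty(\mathbb{R}^3;\mathbb{R})$ be a radial standard mollifier with $\int\varphi=1$, $\varphi_\epsilon(x)=\epsilon^{-3}\varphi(x/\epsilon)$, and $\delta f(\xi;x,t)=f(x+\xi,t)-f(x,t)$. Then $$D(\mathbf{u})(x,t)=\lim_{\epsilon\to0}\int_{\mathbb{R}^3}\nabla\varphi_\epsilon(\xi)\cdot\delta\mathbf{u}(\xi;x,t)\big(|\delta u(\xi;x,t)|^2+|\delta v(\xi;x,t)|^2\big)\,d\xi,$$ the limit being taken in the sense of distributions on $\mathbb{T}^3\times(0,T)$. Besov space: for $s>0$, $1\le r\le\infty$, $B^s_{r,\infty}(\mathbb{T}^n)$ has norm $\lVert f\rVert_{L^r}+\sup_{h\in\mathbb{R}^n\setminus\{0\}}|h|^{-s}\lVert\Delta_h^{\lfloor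 s\rfloor+1}f\rVert_{L^r}$, where $\Delta_h^1f(x)=f(x+h)-f(x)$ and $\Delta_h^mf=\Delta_h(\Delta_h^{m-1}f)$. *)

(* Defs.v *)
From mathcomp Require Import all_boot all_order all_algebra.
From mathcomp Require Import all_classical all_reals all_analysis.
Set Implicit Arguments.
Unset Strict Implicit.
Unset Printing Implicit Defensive.
Import Order.TTheory GRing.Theory Num.Theory.
Import numFieldNormedType.Exports.
Local Open Scope classical_set_scope.
Local Open Scope ring_scope.

(* Functions on the flat unit torus T^3 are 1-periodic functions on R^3, and
   integrals over T^3 are integrals over the unit cube.  A space-time point is
   ((x, y, z), t).  Functions on T^3 x (0,T) are total functions whose values
   at times outside (0,T) are never used. *)

Section Hydrostatic.
Context {R : realType}.

Local Notation pt := (R * R * R)%type.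
Local Notation spt := (R * R * R * R)%type.

Local Notation mu1 := (@lebesgue_measure R).
Local Notation mu3 := (mu1 \x mu1 \x mu1)%E.
Local Notation mu4 := (mu3 \x mu1)%E.

Definition cube : set pt := `[0, 1] `*` `[0, 1] `*` `[0, 1].
Definition cylinder (T : R) : set spt := cube `*` `]0, T[.
Definition slab (T : R) : set spt := [set q | 0 < q.2 < T].

Definition e_x : pt := (1, 0, 0).
Definition e_y : pt := (0, 1, 0).
Definition e_z : pt := (0, 0, 1).
Definition e_t : spt := (0, 1).

Definition enorm (x : pt) : R :=
  Num.sqrt (x.1.1 ^+ 2 + x.1.2 ^+ 2 + x.2 ^+ 2).

Definition torus_periodic (f : pt -> R) : Prop :=
  forall x, [/\ f (x + e_x) = f x, f (x + e_y) = f x & f (x + e_z) = f x].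

Definition slice (f : spt -> R) (t : R) : pt -> R := fun x => f (x, t).

Definition torus_fun (T : R) (f : spt -> R) : Prop :=
  measurable_fun (slab T) f /\
  forall t, 0 < t < T -> torus_periodic (slice f t).

Definition L1_torus (T : R) (f : spt -> R) : Prop :=
  torus_fun T f /\ mu4.-integrable (cylinder T) (EFin \o f).

(* C^infty: every iterated directional derivative exists and is continuous. *)
Definition smooth (V : normedModType R) (f : V -> R) : Prop :=
  forall l : seq V, let g := foldr (fun v h => 'D_v h) f l in
    continuous g /\ forall x v, derivable g x v.

(* The class D(T^3 x (0,T)), extended by zero to all times. *)
Definition test_fun (T : R) (phi : spt -> R) : Prop :=
  [/\ smooth phi, forall t, torus_periodic (slice phi t) &
    exists a b : R, [/\ 0 < a, b < T &
      forall x t, ~~ (a <= t <= b) -> phi (x, t) = 0]].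

Definition weak_partial (T : R) (e : pt) (f g : spt -> R) : Prop :=
  [/\ L1_torus T f, L1_torus T g &
    forall phi, test_fun T phi ->
      \int[mu4]_(q in cylinder T) (f q * 'D_((e, 0) : spt) phi q) =
      - \int[mu4]_(q in cylinder T) (g q * phi q)].

Definition torus_norm (r : \bar R) (f : pt -> R) : \bar R :=
  'N[mu3]_r [EFin \o (f \_ cube)]%E.

Definition difference (h : pt) (f : pt -> R) : pt -> R :=
  fun x => f (x + h) - f x.

(* For s > 0, Num.truncn s is the floor of s as a natural number. *)
Definition besov_norm (s : R) (r : \bar R) (f : pt -> R) : \bar R :=
  (torus_norm r f + ereal_sup
    [set (enorm h `^ (- s))%:E *
         torus_norm r (iter (Num.truncn s).+1 (difference h) f)
      | h in [set h : pt | (h != 0)%R]])%E.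

Definition besov (s : R) (r : \bar R) (f : pt -> R) : Prop :=
  [/\ measurable_fun setT f, torus_periodic f & (besov_norm s r f < +oo)%E].

Definition simple_in (B : (pt -> R) -> Prop) (S : R -> pt -> R) : Prop :=
  exists (n : nat) (A : 'I_n -> set R) (g : 'I_n -> pt -> R),
    (forall i, measurable (A i) /\ B (g i)) /\
    forall t x, S t x = \sum_(i < n) \1_(A i) t * g i x.

(* f in L^q((0,T); B^s_{r,infty}(T^3)) in the sense of Bochner: f is the a.e.
   limit, in the norm of B^s_{r,infty}, of simple functions of time with values
   in that space, and its norm is in L^q(0,T).  The representative f is also
   required to be jointly measurable in (x,t). *)
Definition bochner_besov (T q s : R) (r : \bar R) (f : spt -> R) : Prop :=
  [/\ torus_fun T f,
    exists S : nat -> R -> pt -> R,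
      (forall n, simple_in (besov s r) (S n)) /\
      {ae mu1, forall t, 0 < t < T ->
        besov_norm s r (slice f t \- S n t) @[n --> \oo] --> 0%E} &
    (\int[mu1]_(t in `]0%R, T[) (besov_norm s r (slice f t) `^ q) < +oo)%E].

Definition hdivergence (T : R) (u v d : spt -> R) : Prop :=
  exists ux vy, [/\ weak_partial T e_x u ux, weak_partial T e_y v vy &
    d = ux \+ vy].

(* A point q : R * R * R below stands for (x, y, t). *)
Definition zero_mean_hdivergence (T : R) (u v : spt -> R) : Prop :=
  exists d, hdivergence T u v d /\
    {ae mu3, forall q : pt, 0 < q.2 < T ->
      \int[mu1]_(z in `[0, 1]) d (q.1, z, q.2) = 0}.

(* w is the representative that is continuous in z, so that the trace of w at
   z = 0 is its value there. *)
Definition vertical_velocity (T : R) (u v w : spt -> R) : Prop :=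
  (exists d, hdivergence T u v d /\ weak_partial T e_z w (\- d)) /\
  {ae mu3, forall q : pt, 0 < q.2 < T ->
    continuous (fun z => w (q.1, z, q.2)) /\ w (q.1, 0, q.2) = 0}.

Definition zflip (q : spt) : spt := (q.1.1, - q.1.2, q.2).

Definition even_in_z (T : R) (f : spt -> R) : Prop :=
  {ae mu4, forall q : spt, 0 < q.2 < T -> f (zflip q) = f q}.

Definition odd_in_z (T : R) (f : spt -> R) : Prop :=
  {ae mu4, forall q : spt, 0 < q.2 < T -> f (zflip q) = - f q}.

Definition advect (u v w phi : spt -> R) (q : spt) : R :=
  u q * 'D_((e_x, 0) : spt) phi q + v q * 'D_((e_y, 0) : spt) phi q
  + w q * 'D_((e_z, 0) : spt) phi q.

Definition hydrostatic_euler_weak (T Omega : R) (u v w p : spt -> R) : Prop :=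
  forall phi1 phi2 phi3 : spt -> R,
    test_fun T phi1 -> test_fun T phi2 -> test_fun T phi3 ->
  [/\ \int[mu4]_(q in cylinder T)
        (u q * 'D_e_t phi1 q + u q * advect u v w phi1 q
         + Omega * v q * phi1 q + p q * 'D_((e_x, 0) : spt) phi1 q) = 0,
      \int[mu4]_(q in cylinder T)
        (v q * 'D_e_t phi2 q + v q * advect u v w phi2 q
         - Omega * u q * phi2 q + p q * 'D_((e_y, 0) : spt) phi2 q) = 0 &
      \int[mu4]_(q in cylinder T) (p q * 'D_((e_z, 0) : spt) phi3 q) = 0].

Definition mollifier (phi : pt -> R) : Prop :=
  [/\ smooth phi,
    exists M : R, forall xi, M < enorm xi -> phi xi = 0,
    forall xi eta, enorm xi = enorm eta -> phi xi = phi eta &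
    \int[mu3]_xi phi xi = 1].

Definition rescale (eps : R) (phi : pt -> R) (xi : pt) : R :=
  eps ^- 3 * phi (eps^-1 *: xi).

Definition increment (f : spt -> R) (xi : pt) (q : spt) : R :=
  f (q.1 + xi, q.2) - f q.

Definition defect_eps (phi : pt -> R) (u v w : spt -> R) (eps : R) (q : spt)
    : R :=
  \int[mu3]_xi
    (('D_e_x (rescale eps phi) xi * increment u xi q
      + 'D_e_y (rescale eps phi) xi * increment v xi q
      + 'D_e_z (rescale eps phi) xi * increment w xi q)
     * (increment u xi q ^+ 2 + increment v xi q ^+ 2)).

(* D(u) = L: the distributional limit defining D(u) exists and is the
   distribution L, given by its action on test functions. *)
Definition is_defect (T : R) (phi : pt -> R) (u v w : spt -> R)
    (L : (spt -> R) -> R) : Prop :=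
  forall psi, test_fun T psi ->
    \int[mu4]_(q in cylinder T) (defect_eps phi u v w eps q * psi q)
      @[eps --> 0^'+] --> L psi.

Definition energy (u v : spt -> R) (t : R) : \bar R :=
  (torus_norm 2%:E (slice u t) ^+ 2 + torus_norm 2%:E (slice v t) ^+ 2)%E.

Definition energy_conserved (T : R) (u v : spt -> R) : Prop :=
  exists N : set R, mu1.-negligible N /\
    forall t1 t2, 0 < t1 < T -> 0 < t2 < T -> ~ N t1 -> ~ N t2 ->
      energy u v t1 = energy u v t2.

End Hydrostatic.

(* Main.v *)
Require Import Defs.
From HB Require Import structures.
From mathcomp Require Import all_boot all_order all_algebra.
From mathcomp Require Import all_classical all_reals all_analysis.
From mathcomp Require Import measurable_realfun ring lra.
Set Implicit Arguments.
Unset Strict Implicit.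
Unset Printing Implicit Defensive.
Import Order.TTheory GRing.Theory Num.Theory.
Import numFieldNormedType.Exports.
Local Open Scope classical_set_scope.
Local Open Scope ring_scope.

(** The cubic quantity behind both conclusions is
      m(xi) = int_0^T int_(T^3) |dU| (|du|^2 + |dv|^2) dx dt,
    where d is the increment by xi and U = (u, v, w). The defect is the limit of pairings of
    grad phi_eps with the integrand of m, and the energy of a regularised solution changes at a
    rate that is again such a pairing. Both gradients have total mass of order 1/eps, concentrated
    at distance eps from the origin, so it suffices that m(xi) = o(|xi|); this is [cub_le].

    Where the exponents come from: a Besov norm of order s > 1 controls the first difference
    quotients in L^(9/4) ([AA_besov], a Marchaud inequality), hence |du|, |dv| are of size
    |xi| A(t) in L^(9/4) with A in L^3(0,T). The same bound embeds u and v in L^9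
    ([sobolev]). Testing the divergence condition gives d_z w in L^(9/4), and the trace w = 0 at
    z = 0 then gives w in L^(9/4) ([nm_w]), without any regularity in x and y. Since
    4/9 + 4/9 + 1/9 = 1, Hoelder's inequality bounds m(xi) by |xi| times the integral of
    A^2 |du_H|_9, and this last norm is small: cut u_H at a high level, the excess is small in
    L^9 by dominated convergence, and the bounded part has small increments by interpolation
    between L^(9/4) and the bounded functions. Of w only the norm in L^(9/4) enters, which is why
    the loss of one derivative in w is harmless.

    For the energy the regularising kernel is K(y - x) with K(x) = c_n cos(pi x)^(2n) in each
    variable. By the binomial theorem K(y - x) is a finite sum of products b_i(x) b_i(y) with
    trigonometric monomials b_i. So the sum over J of the squared coefficients
    of u and v on the tensor products e_J is the integral of u (K * u) + v (K * v). Testing the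
    equations with chi(t) e_J(x) says that each coefficient has a weak time derivative
    ([reduction]), so its square can be differentiated between Lebesgue points ([weak_square])
    although the coefficient is defined only almost everywhere. In the sum over J the Coriolis
    force cancels by symmetry, the pressure by incompressibility and its independence of z, and
    the transport terms add up to -1/4 of the cubic flux ([rate_identity]). The flux is bounded by
    moments of the kernel against m ([flux_time]) and tends to 0 as n grows, whereas the sum of
    squares tends to the energy ([coef_loss]). *)

(** * Lebesgue measure on the line, the torus and space-time *)
Section measures.
Context {R : realType}.
Local Notation mu1 := (@lebesgue_measure R).

(** Lebesgue measure, over the Borel sets that products of real lines carry as types. *)
Definition leb : set R -> \bar R := mu1.
HB.instance Definition _ := isMeasure.Build _ R R leb
  (measure0 mu1) (measure_ge0 mu1) (@measure_semi_sigma_additive _ _ _ mu1).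
Lemma leb_sigma_finite : sigma_finite setT leb.
Proof. exact: (@sigma_finiteT _ _ _ mu1). Qed.
HB.instance Definition _ := Measure_isSigmaFinite.Build _ R R leb leb_sigma_finite.

Lemma measurable_itvR (i : interval R) : measurable ([set` i] : set R).
Proof. exact: measurable_itv. Qed.

Lemma ge0_integral_leb (f : R -> \bar R) : measurable_fun setT f ->
  (forall x, 0 <= f x)%E -> (\int[leb]_x f x = \int[mu1]_x f x)%E.
Proof.
move=> mf f0.
have mid : measurable_fun setT (idfun : measurableTypeR R -> R).
  exact: (@measurable_id _ R).
have := @ge0_integral_pushforward _ _ (measurableTypeR R) R R idfun mid mu1 setT f measurableT mf
  (fun y _ => f0 y).
rewrite preimage_setT => <-.
by apply: eq_measure_integral.
Qed.

Lemma integral_leb (f : R -> \bar R) : measurable_fun setT f ->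
  (\int[leb]_x f x = \int[mu1]_x f x)%E.
Proof.
move=> mf; rewrite integralE [RHS]integralE.
by rewrite !ge0_integral_leb//; [exact: measurable_funeneg|exact: measurable_funepos].
Qed.

Lemma I01_lty : (leb `[0%R, 1%R]%classic < +oo)%E.
Proof. by rewrite /leb lebesgue_measure_itv/= lte_fin ltr01 -EFinB ltry. Qed.
(** The factors of the torus: a probability measure on the line, so that torus integrals run
    over a whole type and periodic functions need not be restricted. *)
Definition nu : {finite_measure set R -> \bar R} :=
  mfrestr (measurable_itvR `[0%R, 1%R]) I01_lty.

Lemma I0T_lty (T : R) : (leb `]0%R, T[%classic < +oo)%E.
Proof.
rewrite /leb lebesgue_measure_itv/= lte_fin; case: ifP => // _.
by rewrite -EFinB ltry.
Qed.
Definition tau (T : R) : {finite_measure set R -> \bar R} :=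
  mfrestr (measurable_itvR `]0%R, T[) (I0T_lty T).

End measures.

Section restr.
Local Open Scope ereal_scope.
Context d (T : measurableType d) (R : realType).
Variables (mu : {measure set T -> \bar R}) (D : set T) (mD : measurable D)
  (Doo : mu D < +oo).

Lemma integral_mfrestr (f : T -> \bar R) : measurable_fun setT f ->
  \int[mfrestr mD Doo]_x f x = \int[mu]_(x in D) f x.
Proof.
move=> mf; transitivity (\int[mfrestr mD Doo]_(x in D) f x); last first.
  by by apply: eq_measure_integral => A mA AD; rewrite -[LHS]/(mu (A `&` D)) setIidl.
rewrite [RHS]integral_mkcond.
apply: ae_eq_integral => //.
  by apply/(measurable_restrictT _ mD); exact: measurable_funTS.
exists (~` D); split; first exact: measurableC.
  by rewrite -[LHS]/(mu (~` D `&` D)) setICl measure0.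
move=> x /= h Dx; apply: h => _; rewrite patchE.
by rewrite mem_set.
Qed.
End restr.

Section toolkit.
Local Open Scope ereal_scope.
Context d (T : measurableType d) (R : realType) (mu : {measure set T -> \bar R}).

(** The integral of a nonnegative function is a supremum over the simple functions below it,
    so monotonicity holds for arbitrary functions; Besov norms of slices are compared this way. *)
Lemma int_mono (f g : T -> \bar R) : (forall x, 0 <= f x) ->
  (forall x, f x <= g x) -> \int[mu]_x f x <= \int[mu]_x g x.
Proof.
move=> f0 fg; rewrite !ge0_integralTE//; last by move=> x; exact: le_trans (f0 x) _.
apply: ge_ereal_sup => _ [h hf <-]; apply: ereal_sup_ubound; exists h => // x.
exact: le_trans (fg x).
Qed.

Lemma int_eq0_ae (f : T -> \bar R) : measurable_fun setT f ->
  (forall x, 0 <= f x) -> \int[mu]_x f x = 0 -> {ae mu, forall x, f x = 0}.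
Proof.
move=> mf f0 If0.
have : \int[mu]_x `|f x| = 0 by under eq_integral do rewrite gee0_abs//.
move/(ae_eq_integral_abs mu measurableT mf).
by apply: filterS => x; exact.
Qed.

Lemma int_lty_ae (f : T -> \bar R) : measurable_fun setT f ->
  (forall x, 0 <= f x) -> \int[mu]_x f x < +oo -> {ae mu, forall x, f x < +oo}.
Proof.
move=> mf f0 If0.
have /integrable_ae : mu.-integrable setT f.
  by apply/integrableP; split => //; under eq_integral do rewrite gee0_abs//.
move/(_ measurableT); apply: filterS => x /(_ I).
by rewrite ge0_fin_numE.
Qed.

Lemma measurable_limn_einf (g : (T -> \bar R)^nat) :
  (forall n, measurable_fun setT (g n)) ->
  measurable_fun setT (fun x => limn_einf (g^~ x)).
Proof.
move=> mg; rewrite (_ : (fun _ => _) = (fun x => - limn_esup (-%E \o g^~ x))); last first.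
  by apply/funext => x; rewrite limn_esupN oppeK.
apply: measurableT_comp => //.
by apply: (@measurable_fun_limn_esup _ T R setT (fun n x => - g n x)) => n; exact: measurableT_comp.
Qed.

(** Fatou, in the form in which limits of uniformly bounded norms are taken. *)
Lemma fatou_le (g : (T -> \bar R)^nat) (f : T -> \bar R) (C : \bar R) :
  (forall n, measurable_fun setT (g n)) -> (forall n x, 0 <= g n x) ->
  measurable_fun setT f -> (forall x, 0 <= f x) ->
  {ae mu, forall x, f x <= limn_einf (g^~ x)} ->
  (forall n, \int[mu]_x g n x <= C) -> \int[mu]_x f x <= C.
Proof.
move=> mg g0 mf f0 fg gC.
have mli : measurable_fun setT (fun x => limn_einf (g^~ x)).
  exact: measurable_limn_einf.
have li0 x : 0 <= limn_einf (g^~ x).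
  rewrite limn_einf_lim; apply: lime_ge.
    by apply/cvg_ex; eexists; exact: ereal_nondecreasing_cvgn (nondecreasing_einfs _).
  by apply: nearW => n; apply: le_ereal_inf_tmp => _ [m /= nm <-].
apply: (le_trans (y := \int[mu]_x limn_einf (g^~ x))).
  apply: ae_ge0_le_integral => //.
  by apply: filterS fg => x.
apply: le_trans (fatou _ _ _ _) _ => //.
rewrite limn_einf_lim; apply: lime_le.
  by apply/cvg_ex; eexists; exact: ereal_nondecreasing_cvgn (nondecreasing_einfs _).
apply: nearW => n; apply: le_trans (gC n).
by apply: ereal_inf_lbound; exists n => /=.
Qed.

End toolkit.

Section sfprod.
Local Open Scope ereal_scope.
Context d1 d2 (T1 : measurableType d1) (T2 : measurableType d2) (R : realType).
Variables (m1 : {sigma_finite_measure set T1 -> \bar R})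
  (m2 : {sigma_finite_measure set T2 -> \bar R}).

(** A product that is again known to be sigma-finite, so that it can be iterated. *)
Definition pm : set (T1 * T2) -> \bar R := (m1 \x m2)%E.
HB.instance Definition _ := Measure.on pm.

Lemma pm_sigma_finite : sigma_finite setT pm.
Proof.
have /sigma_finiteP[F [TF ndF Foo]] := sigma_finiteT m1.
have /sigma_finiteP[G [TG ndG Goo]] := sigma_finiteT m2.
exists (fun n => F n `*` G n).
  rewrite -setXTT TF TG predeqE => -[x y]; split.
    move=> [/= [n _ Fnx] [k _ Gky]]; exists (maxn n k) => //; split.
    - by move: x Fnx; exact/subsetPset/ndF/leq_maxl.
    - by move: y Gky; exact/subsetPset/ndG/leq_maxr.
  by move=> [n _ []/= ? ?]; split; exists n.
move=> k; have [? ?] := Foo k; have [? ?] := Goo k.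
split; first exact: measurableX.
by rewrite /pm product_measure1E// lte_mul_pinfty// ge0_fin_numE.
Qed.
HB.instance Definition _ := Measure_isSigmaFinite.Build _ _ R pm pm_sigma_finite.

Lemma pmE A B : measurable A -> measurable B -> pm (A `*` B) = m1 A * m2 B.
Proof. by move=> mA mB; rewrite /pm product_measure1E. Qed.

Lemma tonelli1 (f : T1 * T2 -> \bar R) : measurable_fun setT f ->
  (forall x, 0 <= f x) -> \int[pm]_z f z = \int[m1]_x \int[m2]_y f (x, y).
Proof. by move=> mf f0; exact: fubini_tonelli1. Qed.

Lemma tonelli2 (f : T1 * T2 -> \bar R) : measurable_fun setT f ->
  (forall x, 0 <= f x) -> \int[pm]_z f z = \int[m2]_y \int[m1]_x f (x, y).
Proof. by move=> mf f0; exact: fubini_tonelli2. Qed.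

Lemma tonelli_swap (f : T1 -> T2 -> \bar R) :
  measurable_fun setT (fun z => f z.1 z.2) ->
  (forall x y, 0 <= f x y) ->
  \int[m1]_x \int[m2]_y f x y = \int[m2]_y \int[m1]_x f x y.
Proof.
move=> mf f0; have := @fubini_tonelli _ _ _ _ _ m1 m2 (fun z => f z.1 z.2) mf.
by apply => -[].
Qed.

Lemma measurable_int2 (f : T1 -> T2 -> \bar R) :
  measurable_fun setT (fun z => f z.1 z.2) -> (forall x y, 0 <= f x y) ->
  measurable_fun setT (fun x => \int[m2]_y f x y).
Proof.
move=> mf f0; have := @measurable_fun_fubini_tonelli_F _ _ _ _ _ m2 (fun z => f z.1 z.2) mf.
by apply => -[].
Qed.

Lemma mint2 (f : T1 * T2 -> \bar R) : measurable_fun setT f ->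
  (forall z, 0 <= f z) -> measurable_fun setT (fun x => \int[m2]_y f (x, y)).
Proof. by move=> mf f0; exact: measurable_fun_fubini_tonelli_F. Qed.

Lemma mint1 (f : T1 * T2 -> \bar R) : measurable_fun setT f ->
  (forall z, 0 <= f z) -> measurable_fun setT (fun y => \int[m1]_x f (x, y)).
Proof. by move=> mf f0; exact: measurable_fun_fubini_tonelli_G. Qed.

Lemma ae_pm2 (P : T1 -> T2 -> Prop) : {ae pm, forall z, P z.1 z.2} ->
  {ae m2, forall y, {ae m1, forall x, P x y}}.
Proof.
move=> [N [mN N0 PN]].
have mf : measurable_fun setT (fun y => m1 (ysection N y)).
  exact: measurable_fun_ysection.
have I0 : \int[m2]_y m1 (ysection N y) = 0.
  have := N0; rewrite -[pm N]/(pm N) -[N in pm N]setIT -(integral_indic pm)//.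
  rewrite tonelli2//; last exact/measurable_EFinP.
  move=> <-; apply: eq_integral => y _.
  rewrite -[in LHS](setIT (ysection N y)) -integral_indic//; last exact: measurable_ysection.
  apply: eq_integral => x _; rewrite !indicE; congr ((nat_of_bool _)%:R%:E).
  by rewrite mem_ysection.
have := int_eq0_ae mf (fun=> measure_ge0 _ _) I0.
apply: filterS => y Ny0; exists (ysection N y); split => //.
  exact: measurable_ysection.
by move=> x /= Pxy; rewrite ysectionE/=; apply: PN.
Qed.

End sfprod.

Section measures3.
Context {R : realType}.
Definition m3 : {sigma_finite_measure set (R * R * R)%type -> \bar R} := pm (pm nu nu) nu.
Definition m4 (T : R) : {sigma_finite_measure set (R * R * R * R)%type -> \bar R} :=
  pm m3 (tau T).
Definition leb3 : {sigma_finite_measure set (R * R * R)%type -> \bar R} := pm (pm leb leb) leb.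
End measures3.

Section bridge.
Local Open Scope ereal_scope.
Context {R : realType}.
Local Notation mu1 := (@lebesgue_measure R).
Local Notation mu3 := (mu1 \x mu1 \x mu1)%E.
Local Notation mu4 := (mu3 \x mu1)%E.
Local Notation Rm := (measurableTypeR R).
Implicit Types T : R.

Lemma ge0_nuE (f : R -> \bar R) : measurable_fun setT f -> (forall x, 0 <= f x) ->
  \int[nu]_x f x = \int[mu1]_x (f \_ `[0%R, 1%R]) x.
Proof.
move=> mf f0; rewrite integral_mfrestr// integral_mkcond ge0_integral_leb//.
  by apply/(measurable_restrictT _ (measurable_itvR _)); exact: measurable_funTS.
by move=> x; rewrite patchE; case: ifP.
Qed.

Lemma ge0_tauE T (f : R -> \bar R) : measurable_fun setT f -> (forall x, 0 <= f x) ->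
  \int[tau T]_x f x = \int[mu1]_x (f \_ `]0%R, T[) x.
Proof.
move=> mf f0; rewrite integral_mfrestr// integral_mkcond ge0_integral_leb//.
  by apply/(measurable_restrictT _ (measurable_itvR _)); exact: measurable_funTS.
by move=> x; rewrite patchE; case: ifP.
Qed.

Lemma measurable_cube : measurable (@cube R).
Proof. by apply: measurableX; [apply: measurableX|]; exact: measurable_itvR. Qed.

Lemma measurable_cylinder T : measurable (cylinder T).
Proof. by apply: measurableX; [exact: measurable_cube|exact: measurable_itvR]. Qed.

Lemma measurable_slab T : measurable (slab T).
Proof.
have -> : slab T = snd @^-1` `]0%R, T[.
  by apply/seteqP; split => q /=; rewrite in_itv/=.
rewrite -[X in measurable X]setTI; by apply: measurable_snd => //; exact: measurable_itvR.
Qed.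

Lemma ge0_cubeE (f : R * R * R -> \bar R) : measurable_fun setT f ->
  (forall x, 0 <= f x) ->
  \int[mu3]_(x in cube) f x = \int[m3]_x f x.
Proof.
move=> mf f0; rewrite integral_mkcond.
have mfp : measurable_fun setT (f \_ cube).
  apply/(measurable_restrictT _ measurable_cube); exact: measurable_funTS.
have fp0 x : 0 <= (f \_ cube) x by rewrite patchE; case: ifP.
transitivity (\int[mu1]_a \int[mu1]_b \int[mu1]_c (f \_ cube) (a, b, c)).
  transitivity (\int[pm (pm mu1 mu1) mu1]_x (f \_ cube) x); first by [].
  rewrite (@tonelli1 _ _ _ _ _ (pm mu1 mu1) mu1)//.
  rewrite (@tonelli1 _ _ _ _ _ mu1 mu1)//.
    exact: (@mint2 _ _ (Rm * Rm)%type Rm R mu1 (f \_ cube)).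
  by move=> z; apply: integral_ge0.
rewrite [RHS]tonelli1// [RHS]tonelli1//; last 2 first.
- exact: (@mint2 _ _ _ _ _ nu f).
- by move=> z; apply: integral_ge0.
rewrite ge0_nuE; last 2 first.
- apply: (@mint2 _ _ _ _ _ nu (fun z => \int[nu]_c f (z, c))).
    exact: (@mint2 _ _ _ _ _ nu f).
  by move=> z; apply: integral_ge0.
- by move=> z; apply: integral_ge0 => *; apply: integral_ge0.
apply: eq_integral => a _; rewrite patchE; case: ifPn => [aI|aI]; last first.
  apply: integral0_eq => b _; apply: integral0_eq => c _.
  rewrite patchE memNset//= => -[[/mem_set]].
  by rewrite (negbTE aI).
rewrite ge0_nuE; last 2 first.
- apply: (measurableT_comp (mint2 nu mf f0)); exact: measurable_pair1.
- by move=> z; apply: integral_ge0.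
apply: eq_integral => b _; rewrite patchE; case: ifPn => [bI|bI]; last first.
  apply: integral0_eq => c _.
  rewrite patchE memNset//= => -[[_ /mem_set]].
  by rewrite (negbTE bI).
rewrite ge0_nuE//; last by apply: (measurableT_comp mf); exact: measurable_pair1.
apply: eq_integral => c _; rewrite !patchE; case: ifPn => [cI|cI]; last first.
  rewrite memNset// => /= cI'; move: cI; rewrite mem_set//.
  by split; [split; exact: set_mem|].
by rewrite mem_set//; move: cI => /set_mem[].
Qed.

(** The faces of the cube and the two ends of the time interval are kept on both sides, so the
    two integrals agree exactly. *)
Lemma ge0_cylinderE T (f : R * R * R * R -> \bar R) : measurable_fun setT f ->
  (forall x, 0 <= f x) ->
  \int[mu4]_(x in cylinder T) f x = \int[m4 T]_x f x.
Proof.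
move=> mf f0; rewrite integral_mkcond.
have mfp : measurable_fun setT (f \_ (cylinder T)).
  apply/(measurable_restrictT _ (measurable_cylinder T)); exact: measurable_funTS.
have fp0 x : 0 <= (f \_ (cylinder T)) x by rewrite patchE; case: ifP.
transitivity (\int[mu3]_x \int[mu1]_t (f \_ (cylinder T)) (x, t)).
  transitivity (\int[pm (pm (pm mu1 mu1) mu1) mu1]_x (f \_ (cylinder T)) x); first by [].
  by rewrite (@tonelli1 _ _ _ _ _ (pm (pm mu1 mu1) mu1) mu1).
rewrite [RHS]tonelli1//.
rewrite -ge0_cubeE//; last 2 first.
- exact: mint2.
- by move=> z; apply: integral_ge0.
rewrite [RHS]integral_mkcond; apply: eq_integral => x _.
rewrite patchE; case: ifPn => [xI|xI]; last first.
  apply: integral0_eq => c _.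
  rewrite patchE memNset//= => -[/mem_set].
  by rewrite (negbTE xI).
rewrite ge0_tauE//; last by apply: (measurableT_comp mf); exact: measurable_pair1.
apply: eq_integral => c _; rewrite !patchE; case: ifPn => [cI|cI]; last first.
  rewrite memNset// => /= cI'; move: cI; rewrite mem_set//.
  by split; [exact: set_mem|].
by rewrite mem_set//; move: cI => /set_mem[].
Qed.

Lemma ge0_leb3E (f : R * R * R -> \bar R) : measurable_fun setT f ->
  (forall x, 0 <= f x) -> \int[mu3]_x f x = \int[leb3]_x f x.
Proof.
move=> mf f0.
transitivity (\int[mu1]_a \int[mu1]_b \int[mu1]_c f (a, b, c)).
  transitivity (\int[pm (pm mu1 mu1) mu1]_x f x); first by [].
  rewrite (@tonelli1 _ _ _ _ _ (pm mu1 mu1) mu1)//.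
  rewrite (@tonelli1 _ _ _ _ _ mu1 mu1)//.
    exact: (@mint2 _ _ (Rm * Rm)%type Rm R mu1 f).
  by move=> z; apply: integral_ge0.
rewrite [RHS]tonelli1// [RHS]tonelli1//; last 2 first.
- exact: (@mint2 _ _ _ _ _ leb f).
- by move=> z; apply: integral_ge0.
rewrite ge0_integral_leb; last 2 first.
- apply: (@mint2 _ _ _ _ _ leb (fun z => \int[leb]_c f (z, c))).
    exact: (@mint2 _ _ _ _ _ leb f).
  by move=> z; apply: integral_ge0.
- by move=> z; apply: integral_ge0 => *; apply: integral_ge0.
apply: eq_integral => a _; rewrite ge0_integral_leb; last 2 first.
- apply: (measurableT_comp (mint2 leb mf f0)); exact: measurable_pair1.
- by move=> z; apply: integral_ge0.
apply: eq_integral => b _; rewrite ge0_integral_leb//.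
by apply: (measurableT_comp mf); exact: measurable_pair1.
Qed.

Lemma cylinderE T (f : R * R * R * R -> \bar R) : measurable_fun setT f ->
  \int[mu4]_(x in cylinder T) f x = \int[m4 T]_x f x.
Proof.
move=> mf; rewrite integralE [RHS]integralE.
by rewrite !ge0_cylinderE//; [exact: measurable_funeneg|exact: measurable_funepos].
Qed.

End bridge.

(** * Integrals of periodic functions *)
Section translation.
Local Open Scope ereal_scope.
Context {R : realType}.
Local Notation mu1 := (@lebesgue_measure R).

Lemma leb_translate (a : R) (A : set R) : measurable A ->
  leb [set x | A (x + a)%R] = leb A.
Proof.
move=> mA.
have ma : measurable_fun setT (fun x : measurableTypeR R => x + a : measurableTypeR R)%R.
  exact: (@measurable_funD _ R R setT _ _ (@measurable_id _ R setT) (@measurable_cst _ _ R R setT a)).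
pose F : {mfun measurableTypeR R >-> measurableTypeR R} :=
  HB.pack (fun x : measurableTypeR R => x + a : measurableTypeR R)%R
    (isMeasurableFun.Build _ _ _ _ _ ma).
rewrite -[LHS]/(pushforward mu1 F A) /leb.
apply/esym/lebesgue_measure_unique => //= _ [[b c]] _ <-.
rewrite /pushforward.
have -> : F @^-1` `](b, c).1, (b, c).2]%classic = `](b - a)%R, (c - a)%R]%classic.
  by apply/seteqP; split => x /=; rewrite !in_itv/= ltrBlDr lerBrDr.
rewrite !lebesgue_measure_itv/= !lte_fin ltrD2r; case: ifP => // _.
by rewrite -!EFinB; congr (_%:E); ring.
Qed.

Lemma ge0_integral_translate (f : R -> \bar R) (a : R) : measurable_fun setT f ->
  (forall x, 0 <= f x) -> \int[leb]_x f (x + a)%R = \int[leb]_x f x.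
Proof.
move=> mf f0.
have ma : measurable_fun setT (fun x : R => x + a)%R.
  exact: measurable_funD.
have := @ge0_integral_pushforward _ _ _ _ R _ ma leb setT f measurableT mf
  (fun y _ => f0 y).
rewrite preimage_setT => <-.
by apply: eq_measure_integral => A mA _; exact: leb_translate.
Qed.

Lemma periodic_int (f : R -> R) : (forall x, f (x + 1) = f x)%R ->
  forall (n : int) x, (f (x + n%:~R) = f x)%R.
Proof.
move=> f1; have fn (n : nat) x : (f (x + n%:R) = f x)%R.
  elim: n x => [|n IH] x; first by rewrite addr0.
  by rewrite -natr1 addrA f1 IH.
case=> n x; first exact: fn.
rewrite NegzE mulrNz -[in RHS](subrK n.+1%:~R x); symmetry.
exact: (fn n.+1).
Qed.

(** The interval of integration is translated by the fractional part of [a]; the piece that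
    leaves at one end reappears at the other by periodicity. *)
Lemma ge0_nu_translate (f : R -> \bar R) (a : R) : measurable_fun setT f ->
  (forall x, 0 <= f x) -> (forall x, f (x + 1)%R = f x) ->
  \int[nu]_x f (x + a)%R = \int[nu]_x f x.
Proof.
move=> mf f0 f1.
have fn (n : nat) x : f (x + n%:R)%R = f x.
  elim: n x => [|n IH] x; first by rewrite addr0.
  by rewrite -natr1 addrA f1 IH.
have fz (n : int) x : f (x + n%:~R)%R = f x.
  case: n => n; first exact: fn.
  rewrite NegzE mulrNz -[in RHS](subrK n.+1%:~R x); symmetry.
  exact: (fn n.+1).
wlog a01 : a / (0 <= a < 1)%R.
  move=> /(_ (a - (Num.floor a)%:~R)%R) <-.
    by apply: eq_integral => x _; rewrite addrA -mulrNz fz.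
  by rewrite subr_ge0 Num.Theory.floor_le/= ltrBlDr addrC -intrD1 Num.Theory.floorD1_gt.
have [a0 a1] := andP a01.
have mfa : measurable_fun setT (fun x : R => f (x + a)%R).
  by apply: (measurableT_comp mf); exact: measurable_funD.
have nuI (g : R -> \bar R) : measurable_fun setT g -> (forall x, 0 <= g x) ->
    \int[nu]_x g x = \int[leb]_x (g x * (\1_(`[0, 1[%classic : set R) x)%:E).
  move=> mg g0; rewrite integral_mfrestr//.
  have -> : \int[leb]_(x in `[0%R, 1%R]) g x = \int[leb]_(x in `[0%R, 1%R[) g x.
    apply/esym; rewrite [LHS]integral_mkcond [RHS]integral_mkcond.
    rewrite !integral_leb; [|apply/(measurable_restrictT _ (measurable_itvR _)); exact: measurable_funTS..].
    rewrite -!integral_mkcond; apply: integral_itv_bndo_bndc.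
    exact: measurable_funTS.
  rewrite integral_mkcond; apply: eq_integral => x _.
  by rewrite patchE indicE; case: ifP; rewrite ?mule1 ?mule0.
have m1 (A : set R) : measurable A -> measurable_fun setT (fun x => (\1_A x)%:E : \bar R).
  by move=> mA; apply/measurable_EFinP.
have e0 (x : R) (A : set R) : 0 <= (\1_A x)%:E :> \bar R by rewrite lee_fin.
rewrite !nuI//.
have mfI (i : interval R) : measurable_fun setT (fun x => f x * (\1_([set` i] : set R) x)%:E).
  by apply: emeasurable_funM => //; apply: m1; exact: measurable_itvR.
have fI0 (i : interval R) x : 0 <= f x * (\1_([set` i] : set R) x)%:E by exact: mule_ge0.
have -> : \int[leb]_x (f (x + a)%R * (\1_(`[0, 1[%classic : set R) x)%:E)
    = \int[leb]_x (f x * (\1_(`[a, (1 + a)%R[%classic : set R) x)%:E).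
  rewrite -(@ge0_integral_translate (fun x => f x * (\1_(`[a, (1 + a)%R[%classic : set R) x)%:E) a)//.
  apply: eq_integral => x _; rewrite !indicE; congr (_ * (nat_of_bool _)%:R%:E).
  by rewrite !mem_setE !in_itv/= ltrD2r lerDr.
have split1 x : f x * (\1_(`[a, (1 + a)%R[%classic : set R) x)%:E =
    f x * (\1_(`[a, 1%R[%classic : set R) x)%:E + f x * (\1_(`[1%R, (1 + a)%R[%classic : set R) x)%:E.
  rewrite -ge0_muleDr//; congr (_ * _); rewrite -EFinD; congr (_%:E).
  rewrite !indicE !mem_setE !in_itv/=.
  case: (lerP 1 x) => h1; rewrite ?andbF ?andbT ?addr0 ?add0r//=.
    by rewrite (le_trans (ltW a1) h1).
  by rewrite (lt_le_trans h1) ?andbT ?addr0// lerDl.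
under eq_integral do rewrite split1.
rewrite ge0_integralD//.
have -> : \int[leb]_x (f x * (\1_(`[1%R, (1 + a)%R[%classic : set R) x)%:E) =
    \int[leb]_x (f x * (\1_(`[0%R, a[%classic : set R) x)%:E).
  rewrite -(@ge0_integral_translate (fun x => f x * (\1_(`[1%R, (1 + a)%R[%classic : set R) x)%:E) 1)//.
  apply: eq_integral => x _; rewrite f1 !indicE; congr (_ * (nat_of_bool _)%:R%:E).
  by rewrite !mem_setE !in_itv/= lerDr addrC ltrD2l.
rewrite -ge0_integralD//; apply: eq_integral => x _.
rewrite -ge0_muleDr//; congr (_ * _); rewrite -EFinD; congr (_%:E).
rewrite !indicE !mem_setE !in_itv/=.
case: (lerP a x) => h1; rewrite ?andbF ?andbT ?addr0 ?add0r//=.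
  by rewrite (le_trans a0 h1).
by rewrite (lt_trans h1 a1) andbT.
Qed.

Lemma nu_setT : nu (setT : set R) = 1.
Proof.
rewrite -[LHS]/(leb (setT `&` `[0%R, 1%R]%classic)) setTI.
by rewrite /leb lebesgue_measure_itv/= lte_fin ltr01 oppr0 adde0.
Qed.

End translation.

Section measurability.
Context d (T : measurableType d) {R : realType}.
Local Notation X := (R * R * R)%type.

Lemma mfst d1 d2 (T1 : measurableType d1) (T2 : measurableType d2) (f : T -> T1 * T2) :
  measurable_fun setT f -> measurable_fun setT (fun x => (f x).1).
Proof. by move=> mf; apply: (measurableT_comp measurable_fst mf). Qed.

Lemma msnd d1 d2 (T1 : measurableType d1) (T2 : measurableType d2) (f : T -> T1 * T2) :
  measurable_fun setT f -> measurable_fun setT (fun x => (f x).2).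
Proof. by move=> mf; apply: (measurableT_comp measurable_snd mf). Qed.

Lemma mcomp d1 d2 (T1 : measurableType d1) (T2 : measurableType d2)
    (g : T1 -> T2) (f : T -> T1) : measurable_fun setT g ->
  measurable_fun setT f -> measurable_fun setT (fun x => g (f x)).
Proof. by move=> mg mf; apply: (measurableT_comp mg mf). Qed.

Lemma mprod d1 d2 (T1 : measurableType d1) (T2 : measurableType d2)
    (f : T -> T1) (g : T -> T2) : measurable_fun setT f ->
  measurable_fun setT g -> measurable_fun setT (fun x => (f x, g x)).
Proof. exact: measurable_fun_pair. Qed.

Lemma madd (f g : T -> X) : measurable_fun setT f -> measurable_fun setT g ->
  measurable_fun setT (fun x => f x + g x).
Proof.
move=> mf mg.
have -> : (fun x => f x + g x) =
  (fun x => ((f x).1.1 + (g x).1.1, (f x).1.2 + (g x).1.2, (f x).2 + (g x).2)) by [].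
by apply: mprod; [apply: mprod|]; apply: measurable_funD; do ?[apply: mfst|apply: msnd].
Qed.

Lemma mopp (f : T -> X) : measurable_fun setT f ->
  measurable_fun setT (fun x => - f x).
Proof.
move=> mf.
have -> : (fun x => - f x) = (fun x => (- (f x).1.1, - (f x).1.2, - (f x).2)) by [].
by apply: mprod; [apply: mprod|]; apply: measurable_funN; do ?[apply: mfst|apply: msnd].
Qed.

End measurability.

Section m3.
Context {R : realType}.
Local Notation X := (R * R * R)%type.
Implicit Types (h : X).

Lemma m3_setT : m3 (setT : set X) = 1%E.
Proof.
rewrite -setXTT -[LHS]/(pm (pm nu nu) nu _) pmE// -setXTT -[X in (X * _)%E]/(pm nu nu _) pmE//.
have E (y : \bar R) : (y = 1 -> y * y * y = 1)%E by move=> ->; rewrite !mule1.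
exact: (E _ nu_setT).
Qed.

Definition periodicE (f : X -> \bar R) :=
  forall x, [/\ f (x + e_x) = f x, f (x + e_y) = f x & f (x + e_z) = f x].

Lemma ge0_m3E (f : X -> \bar R) : measurable_fun setT f -> (forall x, 0 <= f x)%E ->
  (\int[m3]_x f x = \int[nu]_a \int[nu]_b \int[nu]_c f (a, b, c))%E.
Proof.
move=> mf f0; rewrite tonelli1// tonelli1//; first exact: mint2.
by move=> z; apply: integral_ge0.
Qed.

Opaque leb nu tau pm m3 m4 leb3.

Lemma ge0_m3_translate (f : X -> \bar R) h :
  measurable_fun setT f -> (forall x, 0 <= f x)%E -> periodicE f ->
  (\int[m3]_x f (x + h)%R = \int[m3]_x f x)%E.
Proof.
move=> mf f0 pf.
have mfh : measurable_fun setT (fun x : X => f (x + h)).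
  by apply: mcomp => //; apply: madd.
have px (a b c : R) : f (a + 1, b, c) = f (a, b, c).
  by have [+ _ _] := pf (a, b, c); rewrite -[_ + _]/(a + 1, b + 0, c + 0) !addr0.
have py (a b c : R) : f (a, b + 1, c) = f (a, b, c).
  by have [_ + _] := pf (a, b, c); rewrite -[_ + _]/(a + 0, b + 1, c + 0) !addr0.
have pz (a b c : R) : f (a, b, c + 1) = f (a, b, c).
  by have [_ _] := pf (a, b, c); rewrite -[_ + _]/(a + 0, b + 0, c + 1) !addr0.
have m2 (g : X -> \bar R) : measurable_fun setT g -> (forall x, 0 <= g x)%E ->
    measurable_fun setT (fun z : R * R => \int[nu]_c g (z, c))%E by exact: mint2.
etransitivity; first by apply: (ge0_m3E mfh).
rewrite (ge0_m3E mf f0).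
transitivity (\int[nu]_a \int[nu]_b \int[nu]_c f (a + h.1.1, b + h.1.2, c + h.2)%R)%E.
  by [].
transitivity (\int[nu]_a \int[nu]_b \int[nu]_c f (a + h.1.1, b + h.1.2, c)%R)%E.
  apply: eq_integral => a _; apply: eq_integral => b _.
  rewrite (@ge0_nu_translate _ (fun c => f (_, _, c)))//.
  by apply: mcomp => //; apply: mprod.
transitivity (\int[nu]_a \int[nu]_b \int[nu]_c f (a + h.1.1, b, c)%R)%E.
  apply: eq_integral => a _.
  rewrite (@ge0_nu_translate _ (fun b => \int[nu]_c f (_, b, c))%E)//.
  - by apply: (mcomp (m2 _ mf f0)); apply: mprod.
  - by move=> x; apply: integral_ge0.
  - by move=> x; apply: eq_integral.
rewrite (@ge0_nu_translate _ (fun a => \int[nu]_b \int[nu]_c f (a, b, c))%E)//.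
- apply: (@mint2 _ _ _ _ _ nu (fun z => \int[nu]_c f (z, c)))%E; first exact: m2.
  by move=> x; apply: integral_ge0.
- by move=> x; apply: integral_ge0 => *; apply: integral_ge0.
- by move=> x; apply: eq_integral => b _; apply: eq_integral => c _.
Qed.

End m3.

(** * Lebesgue norms *)
Section norms.
Context d (T : measurableType d) {R : realType} (mu : {measure set T -> \bar R}).
Implicit Types (f g h : T -> R) (p q r : R) (C : \bar R).

Definition nm p f : \bar R := ('N[mu]_(p%:E)[EFin \o f])%E.

Lemma nm_ge0 p f : (0 <= nm p f)%E. Proof. exact: Lnorm_ge0. Qed.
Hint Resolve nm_ge0 : core.

Lemma nm_pow p f : p != 0 -> (nm p f `^ p = \int[mu]_x (`|f x| `^ p)%:E)%E.
Proof. by move=> p0; rewrite /nm powR_Lnorm. Qed.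

Lemma poweRK p C : p != 0 -> (0 <= C -> (C `^ p) `^ p^-1 = C)%E.
Proof. by move=> p0 C0; rewrite -poweRrM divff// poweRe1. Qed.

Lemma poweR_le p (x y : \bar R) : 0 <= p -> (0 <= x -> x <= y -> x `^ p <= y `^ p)%E.
Proof.
move=> p0 x0 xy; apply: (gt0_ler_poweR p0) => //; rewrite in_itv/= ?x0 ?leey//.
by rewrite (le_trans x0 xy).
Qed.

Lemma nmE p f : p != 0 -> (nm p f = (\int[mu]_x (`|f x| `^ p)%:E) `^ p^-1)%E.
Proof. by move=> p0; rewrite -nm_pow// poweRK. Qed.

Lemma nm_leP p f C : 0 < p -> (0 <= C)%E ->
  ((\int[mu]_x (`|f x| `^ p)%:E) <= C `^ p)%E <-> (nm p f <= C)%E.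
Proof.
move=> p0 C0; have pn0 : p != 0 by rewrite gt_eqF.
rewrite -nm_pow//; split; last by apply: poweR_le => //; exact: ltW.
move=> /(@poweR_le p^-1); rewrite invr_ge0 (ltW p0) poweR_ge0 => /(_ isT isT).
by rewrite !poweRK.
Qed.

Lemma nm_mono p f g : 0 < p -> (forall x, `|f x| <= `|g x|) -> (nm p f <= nm p g)%E.
Proof.
move=> p0 fg; apply/nm_leP => //; rewrite nm_pow ?gt_eqF//.
apply: int_mono => x; first by rewrite lee_fin powR_ge0.
by rewrite lee_fin ge0_ler_powR// ?nnegrE// ltW.
Qed.

Lemma nm_eq p f g : (forall x, `|f x| = `|g x|) -> nm p f = nm p g.
Proof.
move=> fg; rewrite /nm -[LHS]Lnorm_abse -[RHS]Lnorm_abse; apply: eq_Lnorm => x /=.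
by rewrite fg.
Qed.

Lemma nmD p f g : measurable_fun setT f -> measurable_fun setT g -> 1 <= p ->
  (nm p (fun x => f x + g x)%R <= nm p f + nm p g)%E.
Proof. by move=> mf mg p1; exact: minkowski_EFin. Qed.

Lemma nmB p f g : measurable_fun setT f -> measurable_fun setT g -> 1 <= p ->
  (nm p (fun x => f x - g x)%R <= nm p f + nm p g)%E.
Proof.
move=> mf mg p1; apply: le_trans (nmD mf (measurable_funN mg) p1) _.
by rewrite leeD2l// (@nm_eq p (\- g) g)// => x; rewrite normrN.
Qed.

Lemma mpow p f : measurable_fun setT f -> measurable_fun setT (fun x => `|f x| `^ p).
Proof.
move=> mf; apply: (@mcomp _ _ _ _ _ _ (@powR R ^~ p) (fun x => `|f x|)).
  exact: measurable_powR.
exact: measurableT_comp.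
Qed.

Lemma nmZ p f (k : R) : measurable_fun setT f -> 0 < p ->
  (nm p (fun x => k * f x)%R = `|k|%:E * nm p f)%E.
Proof.
move=> mf p0; have pn0 : p != 0 by rewrite gt_eqF.
rewrite [LHS]nmE//.
under eq_integral do rewrite normrM powRM// EFinM.
rewrite ge0_integralZl//; first last.
- by apply/measurable_EFinP; exact: mpow.
rewrite -nm_pow// poweRM ?poweR_ge0 ?lee_fin ?powR_ge0// -poweR_EFin !poweRK//.
Qed.

Lemma nm_powf p q f : 0 < p -> 0 < q ->
  (nm p (fun x => `|f x| `^ q)%R = nm (p * q) f `^ q)%E.
Proof.
move=> p0 q0; rewrite nmE ?gt_eqF//.
under eq_integral do rewrite (ger0_norm (powR_ge0 _ _)) -powRrM.
rewrite nmE ?gt_eqF ?mulr_gt0// -poweRrM (mulrC p).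
by rewrite (_ : (q * p)^-1 * q = p^-1)// invfM mulrAC mulVf ?mul1r// gt_eqF.
Qed.

Lemma hoelder1 p q f g : measurable_fun setT f -> measurable_fun setT g ->
  0 < p -> 0 < q -> p^-1 + q^-1 = 1 ->
  (\int[mu]_x (`|f x * g x|)%:E <= nm p f * nm q g)%E.
Proof.
by move=> mf mg p0 q0 pq; have := @hoelder _ _ _ mu f g p q mf mg p0 q0 pq; rewrite Lnorm1.
Qed.

(** The two-factor inequality applied to the powers [|f|^p] and [|g|^p]. *)
Lemma hoelder_nm p q r f g : measurable_fun setT f -> measurable_fun setT g ->
  0 < p -> 0 < q -> 0 < r -> p^-1 = q^-1 + r^-1 ->
  (nm p (fun x => f x * g x)%R <= nm q f * nm r g)%E.
Proof.
move=> mf mg p0 q0 r0 pqr; apply/nm_leP => //; first exact: mule_ge0.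
rewrite poweRM//.
have -> : nm q f = nm ((q / p) * p) f by congr nm; field; rewrite gt_eqF.
have -> : nm r g = nm ((r / p) * p) g by congr nm; field; rewrite gt_eqF.
rewrite -!nm_powf ?divr_gt0//.
apply: le_trans (hoelder1 (mpow p mf) (mpow p mg) _ _ _); last 3 first.
- by rewrite divr_gt0.
- by rewrite divr_gt0.
- by rewrite !invf_div -mulrDr -pqr divff// gt_eqF.
apply: int_mono => x; first by rewrite lee_fin powR_ge0.
by rewrite lee_fin normrM powRM// [leRHS]ger0_norm// mulr_ge0// powR_ge0.
Qed.

Lemma hoelder3 p q r f g h : measurable_fun setT f -> measurable_fun setT g ->
  measurable_fun setT h -> 0 < p -> 0 < q -> 0 < r -> p^-1 + q^-1 + r^-1 = 1 ->
  (\int[mu]_x (`|f x * g x * h x|)%:E <= nm p f * nm q g * nm r h)%E.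
Proof.
move=> mf mg mh p0 q0 r0 pqr.
have s0 : 0 < (q^-1 + r^-1)^-1 by rewrite invr_gt0 addr_gt0// invr_gt0.
under eq_integral do rewrite -mulrA.
apply: le_trans (hoelder1 mf (measurable_funM mg mh) p0 s0 _) _.
  by rewrite invrK addrA.
by rewrite -muleA lee_wpmul2l//; apply: hoelder_nm => //; rewrite invrK.
Qed.

(** Hoelder's inequality against the constant 1. *)
Lemma nm_incr p q f : mu setT = 1%E -> measurable_fun setT f -> 0 < p -> p < q ->
  (nm p f <= nm q f)%E.
Proof.
move=> mu1 mf p0 pq; have q0 := lt_trans p0 pq.
have r0 : 0 < p^-1 - q^-1 by rewrite subr_gt0 ltf_pV2.
have -> : nm p f = nm p (fun x => f x * 1) by apply: nm_eq => x; rewrite mulr1.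
apply: le_trans (@hoelder_nm p q (p^-1 - q^-1)^-1 f (cst 1) _ _ _ _ _ _) _ => //.
- by rewrite invr_gt0.
- by rewrite invrK; ring.
rewrite [X in (_ * X)%E](_ : _ = 1%E) ?mule1// nmE; last by rewrite gt_eqF// invr_gt0.
under eq_integral do rewrite normr1 powR1.
by rewrite integral_cst// mul1e [X in (X `^ _)%E]mu1 poweR1r.
Qed.

Lemma nm_fatou p (F : nat -> T -> R) f C : 0 < p -> (0 <= C)%E ->
  (forall n, measurable_fun setT (F n)) -> measurable_fun setT f ->
  {ae mu, forall x, F n x @[n --> \oo] --> f x} ->
  (forall n, nm p (F n) <= C)%E -> (nm p f <= C)%E.
Proof.
move=> p0 C0 mF mf Ff FC; apply/nm_leP => //.
apply: (@fatou_le _ _ _ mu (fun n x => (`|F n x| `^ p)%:E)) => //.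
- by move=> n; apply/measurable_EFinP; exact: mpow.
- by apply/measurable_EFinP; exact: mpow.
- apply: filterS Ff => x Fx.
  have [->|fx0] := eqVneq (f x) 0.
    rewrite normr0 powR0 ?gt_eqF// limn_einf_lim; apply: lime_ge.
      by apply/cvg_ex; eexists; exact: ereal_nondecreasing_cvgn (nondecreasing_einfs _).
    by apply: nearW => n; apply: le_ereal_inf_tmp => _ [m /= nm <-]; rewrite lee_fin powR_ge0.
  suff : (`|F n x| `^ p)%:E @[n --> \oo] --> (`|f x| `^ p)%:E.
    by move/cvg_limn_einf_sup => [-> _].
  apply: cvg_EFin; first by near=> n.
  apply: (@continuous_cvg _ _ _ _ _ (fun n => `|F n x|) (@powR R ^~ p) `|f x|).
    apply: differentiable_continuous; apply/derivable1_diffP; apply: derivable_powR.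
    by rewrite in_itv/= andbT normr_gt0.
  exact: cvg_norm.
by move=> n; apply/nm_leP.
Unshelve. all: by end_near. Qed.

(** Along a subsequence with summable errors the sum of the errors is integrable, hence finite
    almost everywhere. *)
Lemma mean_cvg_ae (F : nat -> T -> R) f :
  (forall n, measurable_fun setT (F n)) -> measurable_fun setT f ->
  (forall e : R, 0 < e -> exists n, (\int[mu]_x (`|F n x - f x|)%:E <= e%:E)%E) ->
  exists k : nat -> nat, {ae mu, forall x, F (k n) x @[n --> \oo] --> f x}.
Proof.
move=> mF mf Ff.
have /choice[k kP] : forall n : nat, exists m, (\int[mu]_x (`|F m x - f x|)%:E <= (1 / (2 ^ n.+1)%:R)%:E)%E.
  by move=> n; apply: Ff; rewrite divr_gt0// ltr0n expn_gt0.
exists k.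
pose u n x := (`|F (k n) x - f x|)%:E.
have mu_ n : measurable_fun setT (u n).
  apply/measurable_EFinP; apply: measurableT_comp => //.
  exact: measurable_funB.
have u0 n x : (0 <= u n x)%E by rewrite lee_fin.
have msum : measurable_fun setT (fun x => \sum_(n <oo) u n x)%E.
  by apply: ge0_emeasurable_sum => // n x.
have : (\int[mu]_x (\sum_(n <oo) u n x) < +oo)%E.
  rewrite integral_nneseries//.
  apply: (@le_lt_trans _ _ (\sum_(n <oo) (1 / (2 ^ n.+1)%:R)%:E)%E).
    apply: lee_nneseries => n _; last exact: kP.
    by move=> _; apply: integral_ge0 => x _; exact: u0.
  by apply: le_lt_trans (epsilon_trick0 xpredT ler01) _; rewrite ltry.
move/(int_lty_ae msum) => /(_ (fun x => nneseries_ge0 (fun n _ _ => u0 n x))).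
apply: filterS => x /(@nneseries_tail_cvg R (u ^~ x) xpredT) /(_ (fun n _ => u0 n x)) tail.
have : u n x @[n --> \oo] --> 0%E.
  apply: (squeeze_cvge _ (cvg_cst 0%E) tail); apply: nearW => n; rewrite u0/=.
  apply: le_trans (nneseries_lim_ge n.+1 (fun m _ _ => u0 m x)).
  by rewrite big_nat1.
move=> /fine_cvg /=.
under eq_fun do rewrite /=.
by move/norm_cvg0P => /cvg_sub0; apply; exact: cvg_cst.
Qed.

End norms.
Arguments nm {d T R} mu p%_R f%_R.

Section average.
Context d (T : measurableType d) {R : realType} (mu : {sigma_finite_measure set T -> \bar R}).
Context d' (Y : measurableType d') (P : {sigma_finite_measure set Y -> \bar R}).

(** Convexity of the power, obtained from Hoelder's inequality for the weight [k]. *)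
Lemma jensen p (k g : Y -> R) : 1 < p -> measurable_fun setT k -> (forall y, 0 <= k y) ->
  (\int[P]_y (k y)%:E <= 1)%E -> measurable_fun setT g ->
  ((\int[P]_y (k y * `|g y|)%:E) `^ p <= \int[P]_y (k y * `|g y| `^ p)%:E)%E.
Proof.
move=> p1 mk k0 k1 mg; have p0 : 0 < p by rewrite (lt_trans _ p1).
have pn0 : p != 0 by rewrite gt_eqF.
have q0 : 0 < 1 - p^-1 by rewrite subr_gt0 invf_lt1.
set F := fun y => k y `^ p^-1 * g y; set G := fun y => k y `^ (1 - p^-1).
have mkp (a : R) : measurable_fun setT (fun y => k y `^ a).
  by under eq_fun => y do rewrite -[k y]ger0_norm//; exact: mpow.
have -> : (\int[P]_y (k y * `|g y| `^ p)%:E = nm P p F `^ p)%E.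
  rewrite nm_pow//; apply: eq_integral => y _; congr (_%:E).
  rewrite normrM powRM// (ger0_norm (powR_ge0 _ _)) -powRrM mulVf// powRr1//.
apply: poweR_le; first exact: ltW.
  by apply: integral_ge0 => y _; rewrite lee_fin mulr_ge0.
have -> : (\int[P]_y (k y * `|g y|)%:E = \int[P]_y (`|F y * G y|)%:E)%E.
  apply: eq_integral => y _; congr (_%:E); rewrite /F /G !normrM !(ger0_norm (powR_ge0 _ _)).
  rewrite mulrAC -powRD; last by rewrite addrC subrK oner_eq0.
  by rewrite addrC subrK powRr1.
apply: le_trans (@hoelder1 _ _ _ P p (1 - p^-1)^-1 F G _ _ p0 _ _) _.
- by apply: measurable_funM => //; exact: mkp.
- exact: mkp.
- by rewrite invr_gt0.
- by rewrite invrK addrC subrK.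
rewrite -[leRHS]mule1 lee_wpmul2l// ?nm_ge0//.
apply/nm_leP; rewrite ?invr_gt0// poweR1r.
under eq_integral.
  move=> y _; rewrite (ger0_norm (powR_ge0 _ _)) -powRrM divff ?gt_eqF// powRr1//.
  over.
exact: k1.
Qed.

(** Jensen's inequality pointwise, then Tonelli: smoothing is an average of translates, and so
    does not increase norms. *)
Lemma nm_average p (k : Y -> R) (g : T -> Y -> R) (f : T -> R) (C : \bar R) :
  1 < p -> (0 <= C)%E ->
  measurable_fun setT k -> (forall y, 0 <= k y) -> (\int[P]_y (k y)%:E <= 1)%E ->
  measurable_fun setT (fun z : T * Y => g z.1 z.2) ->
  (forall x, (`|f x|%:E <= \int[P]_y (k y * `|g x y|)%:E)%E) ->
  (forall y, nm mu p (g ^~ y) <= C)%E -> (nm mu p f <= C)%E.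
Proof.
move=> p1 C0 mk k0 k1 mg fg gC; have p0 : 0 < p by rewrite (lt_trans _ p1).
have pn0 : p != 0 by rewrite gt_eqF.
have mgx x : measurable_fun setT (g x).
  exact: (measurable_fun_pair2 x mg).
apply/nm_leP => //.
apply: (@le_trans _ _ (\int[mu]_x \int[P]_y (k y * `|g x y| `^ p)%:E)%E).
  apply: int_mono => x; first by rewrite lee_fin powR_ge0.
  apply: le_trans (jensen p1 mk k0 k1 (mgx x)).
  by rewrite -poweR_EFin; apply: poweR_le; rewrite ?lee_fin ?(ltW p0).
rewrite (@tonelli_swap _ _ _ _ _ mu P (fun x y => (k y * `|g x y| `^ p)%:E)); first last.
- by move=> x y; rewrite lee_fin mulr_ge0// powR_ge0.
- apply/measurable_EFinP; apply: measurable_funM; first exact: (mcomp mk (msnd (@measurable_id _ _ _))).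
  exact: (@mpow _ (T * Y)%type).
apply: (@le_trans _ _ (\int[P]_y ((k y)%:E * C `^ p))%E).
  apply: int_mono => y; first by apply: integral_ge0 => x _; rewrite lee_fin mulr_ge0// powR_ge0.
  under eq_integral do rewrite EFinM.
  have mgy := measurable_fun_pair1 y mg.
  rewrite ge0_integralZl//.
  - by rewrite lee_wpmul2l ?lee_fin//; apply/nm_leP.
  - by apply/measurable_EFinP; exact: mpow mgy.
  - by rewrite lee_fin.
rewrite ge0_integralZr//; [|exact/measurable_EFinP|by move=> y _; rewrite lee_fin|exact: poweR_ge0].
by rewrite -[leRHS]mul1e lee_wpmul2r// poweR_ge0.
Qed.

End average.

(** * One-dimensional calculus and the kernel *)
Section drv.
Context {R : realType}.
Implicit Types (F G f g : R -> R).

(** Derivatives are carried as an explicit function, which keeps them available without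
    differentiability side conditions. *)
Definition drv F f := forall x : R, is_derive x (1 : R) F (f x).

Lemma drv_ext F f g : drv F f -> (forall x, f x = g x) -> drv F g.
Proof. by move=> dF fg x; rewrite -fg. Qed.

Lemma drv_cst (c : R) : drv (fun=> c) (fun=> 0).
Proof. by move=> x; apply: is_derive_cst. Qed.

Lemma drvD F f G g : drv F f -> drv G g -> drv (fun x => F x + G x) (fun x => f x + g x).
Proof. by move=> dF dG x; apply: is_deriveD. Qed.

Lemma drvN F f : drv F f -> drv (fun x => - F x) (fun x => - f x).
Proof. by move=> dF x; apply: is_deriveN. Qed.

Lemma drvM F f G g : drv F f -> drv G g ->
  drv (fun x => F x * G x) (fun x => f x * G x + F x * g x).
Proof.
move=> dF dG x; apply: (@is_derive_eq _ _ _ _ _ _ _ _ (is_deriveM (dF x) (dG x))).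
by rewrite /GRing.scale/= addrC [f x * _]mulrC.
Qed.

Lemma drvZ (c : R) F f : drv F f -> drv (fun x => c * F x) (fun x => c * f x).
Proof.
move=> dF; apply: (drv_ext (drvM (drv_cst c) dF)) => x.
by rewrite mul0r add0r.
Qed.

Lemma drvX n F f : drv F f -> drv (fun x => F x ^+ n) (fun x => n%:R * F x ^+ n.-1 * f x).
Proof.
move=> dF x; have := is_deriveX n (dF x).
by rewrite exprfctE.
Qed.

Lemma drv_comp F f G g : drv F f -> drv G g -> drv (fun x => F (G x)) (fun x => f (G x) * g x).
Proof. by move=> dF dG x; apply: (@is_derive1_comp _ F G). Qed.

Lemma drv_id : drv (fun x => x) (fun=> 1).
Proof. by move=> x; apply: is_derive_id. Qed.

Lemma drv_sum (I : Type) (r : seq I) (F f : I -> R -> R) : (forall i, drv (F i) (f i)) ->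
  drv (fun x => \sum_(i <- r) F i x) (fun x => \sum_(i <- r) f i x).
Proof.
move=> dF; elim: r => [|i r IH].
  apply: (drv_ext (_ : drv _ (fun=> 0))); last by move=> x; rewrite big_nil.
  by under eq_fun do rewrite big_nil; exact: drv_cst.
apply: (drv_ext (_ : drv _ (fun x => f i x + \sum_(j <- r) f j x))); last by move=> x; rewrite big_cons.
by under eq_fun do rewrite big_cons; exact: drvD.
Qed.

Lemma drv_cont F f : drv F f -> continuous F.
Proof.
by move=> dF x; apply: differentiable_continuous; apply/derivable1_diffP; have [] := dF x.
Qed.
End drv.

Section ftc.
Context {R : realType}.
Local Notation mu1 := (@lebesgue_measure R).
Implicit Types (F f : R -> R).

Lemma cont_meas f : continuous f -> measurable_fun setT f.
Proof. exact: continuous_measurable_fun. Qed.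

Lemma FTC_itv F f (a b : R) : drv F f -> continuous f ->
  a <= b -> (\int[mu1]_(x in `[a, b]) (f x)%:E = (F b - F a)%:E)%E.
Proof.
move=> dF cf; rewrite le_eqVlt => /predU1P[->|ab].
  by rewrite set_itv1 integral_set1 subrr.
rewrite (@continuous_FTC2 _ f F)//.
- exact: continuous_subspaceT.
- split; first by move=> x _; have [] := dF x.
  + by apply: cvg_at_right_filter; apply: differentiable_continuous; apply/derivable1_diffP; have [] := dF a.
  + by apply: cvg_at_left_filter; apply: differentiable_continuous; apply/derivable1_diffP; have [] := dF b.
- by move=> x _; rewrite derive1E; have [] := dF x.
Qed.

Lemma FTC_nu F f : drv F f -> continuous f ->
  (\int[nu]_x (f x)%:E = (F 1 - F 0)%:E)%E.
Proof.
move=> dF cf; rewrite -(FTC_itv dF cf ler01).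
have mf := cont_meas cf.
have mfE : measurable_fun setT (EFin \o f) by exact/measurable_EFinP.
transitivity (\int[leb]_(x in `[0%R, 1%R]) (f x)%:E)%E.
  exact: (integral_mfrestr _ _ mfE).
rewrite integral_mkcond [RHS]integral_mkcond integral_leb//.
apply/(measurable_restrictT _ (measurable_itvR _)); exact: measurable_funTS.
Qed.

(** Oscillation is bounded by total variation; the points are kept in the period so that the
    variation is an integral over it. *)
Lemma FTC_le F f (a b : R) : drv F f -> continuous f ->
  0 <= a <= 1 -> 0 <= b <= 1 -> (`|F b - F a|%:E <= \int[nu]_x `|f x|%:E)%E.
Proof.
move=> dF cf; wlog ab : a b / a <= b.
  move=> H ha hb; have [/H|/ltW/H] := lerP a b; first exact.
  by rewrite distrC; exact.
move=> /andP[a0 a1] /andP[b0 b1].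
have mf := cont_meas cf.
have mfE : measurable_fun setT (EFin \o f) by exact/measurable_EFinP.
rewrite -abse_EFin -(FTC_itv dF cf ab).
apply: le_trans (le_abse_integral _ _ _) _ => //; first exact: measurable_funTS.
rewrite [leRHS]ge0_nuE//; last first.
  by apply/measurable_EFinP; exact: measurableT_comp.
rewrite [leLHS]integral_mkcond; apply: int_mono => x.
  by rewrite patchE; case: ifP.
rewrite [leLHS]patchE; case: ifPn => [|_]; last first.
  have := @erestrict_ge0 _ _ (`[0%R, 1%R]%classic : set R) (fun y => `|(f y)%:E|%E) (fun y _ => abse_ge0 _) x.
  by [].
rewrite inE/= in_itv/= => /andP[ax xb].
by rewrite patchE mem_set//= in_itv/= (le_trans a0 ax) (le_trans xb b1).
Qed.
End ftc.

Section kernel1.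
Context {R : realType}.
Implicit Types (x y : R) (n : nat).
Local Notation cs x := (cos (pi * x)).
Local Notation sn x := (sin (pi * x)).

Lemma drv_cs : drv (fun x : R => cs x) (fun x => - (pi * sn x)).
Proof.
apply: (drv_ext (drv_comp (@is_derive_cos R) (drvZ pi drv_id))) => x.
by rewrite mulr1 mulNr mulrC.
Qed.

Lemma drv_sn : drv (fun x : R => sn x) (fun x => pi * cs x).
Proof.
apply: (drv_ext (drv_comp (@is_derive_sin R) (drvZ pi drv_id))) => x.
by rewrite mulr1 mulrC.
Qed.

Lemma cs1 x : cs (x + 1) = - cs x.
Proof. by rewrite mulrDr mulr1 cosDpi. Qed.

Lemma sn1 x : sn (x + 1) = - sn x.
Proof. by rewrite mulrDr mulr1 sinDpi. Qed.

Lemma cs2sn2 x : cs x ^+ 2 = 1 - sn x ^+ 2.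
Proof. by rewrite -(cos2Dsin2 (pi * x)); ring. Qed.

Lemma cont_csX n : continuous (fun x : R => cs x ^+ n).
Proof. exact: drv_cont (drvX _ drv_cs). Qed.

Definition csint n : R := fine (\int[nu]_x ((cs x) ^+ (2 * n))%:E)%E.

Lemma cs2n_ge0 n x : 0 <= cs x ^+ (2 * n).
Proof. by rewrite exprM exprn_ge0// sqr_ge0. Qed.

Lemma mcs n : measurable_fun setT (fun x : R => cs x ^+ (2 * n)).
Proof. by apply: cont_meas; exact: cont_csX. Qed.

Lemma cs2n_le1 n x : cs x ^+ (2 * n) <= 1.
Proof. by rewrite exprM exprn_ile1 ?sqr_ge0// cs2sn2 lerBlDr lerDl sqr_ge0. Qed.

Lemma csintE n : (\int[nu]_x ((cs x) ^+ (2 * n))%:E = (csint n)%:E)%E.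
Proof.
rewrite fineK// ge0_fin_numE; last by apply: integral_ge0 => x _; rewrite lee_fin cs2n_ge0.
apply: (@le_lt_trans _ _ (\int[nu]_(x in setT) (cst 1 : R -> \bar R) x)%E).
  by apply: int_mono => x; rewrite lee_fin ?cs2n_ge0// cs2n_le1.
by rewrite integral_cst// mul1e [X in (X < _)%E]nu_setT ltry.
Qed.

(** The integral over a period of the derivative of [cos^(2n+1) sin] vanishes. *)
Lemma csint_rec n : csint n.+1 * (2 * n%:R + 2) = csint n * (2 * n%:R + 1).
Proof.
have dF := drvM (drvX (2 * n).+1 drv_cs) drv_sn.
have E x : (2 * n).+1%:R * cs x ^+ (2 * n).+1.-1 * - (pi * sn x) * sn x + cs x ^+ (2 * n).+1 * (pi * cs x)
    = pi * ((2 * n%:R + 2) * cs x ^+ (2 * n.+1) - (2 * n%:R + 1) * cs x ^+ (2 * n)).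
  rewrite (mulnS 2 n) addSn add1n !exprS /=.
  have -> : (2 * n).+1%:R = 2 * n%:R + 1 :> R by rewrite -natr1 natrM.
  rewrite (_ : _ * - (pi * sn x) * sn x = - (2 * n%:R + 1) * cs x ^+ (2 * n) * pi * (sn x) ^+ 2); last by ring.
  by rewrite -[sn x ^+ 2](subKr 1) -cs2sn2; ring.
have cf : continuous (fun x => pi * ((2 * n%:R + 2) * cs x ^+ (2 * n.+1) - (2 * n%:R + 1) * cs x ^+ (2 * n))).
  apply: drv_cont; apply: drvZ; apply: drvD; first by apply/drvZ/drvX/drv_cs.
  by apply: drvN; apply/drvZ/drvX/drv_cs.
have := FTC_nu (drv_ext dF E) cf.
rewrite mulr1 mulr0 sinpi sin0 !mulr0 subrr.
under eq_integral do rewrite EFinM EFinB !EFinM.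
have int k : nu.-integrable setT (fun x : R => (cs x ^+ (2 * k))%:E).
  apply/integrableP; split; first by apply/measurable_EFinP; exact: mcs.
  by under eq_integral do rewrite gee0_abs ?lee_fin ?cs2n_ge0//; rewrite csintE ltry.
rewrite integralZl//; last by apply: integrableB => //; apply: integrableZl.
rewrite integralB//; [|exact: integrableZl..].
rewrite (integralZl _ (int n.+1))// (integralZl _ (int n))//.
rewrite !csintE -!EFinM.
move=> -[] /eqP.
rewrite mulf_eq0 gt_eqF ?pi_gt0//= subr_eq0 => /eqP.
by rewrite mulrC [RHS]mulrC.
Qed.

Lemma csint0 : csint 0 = 1.
Proof.
rewrite /csint; under eq_integral do rewrite muln0 expr0.
by rewrite integral_cst// mul1e [X in fine X]nu_setT.
Qed.

Lemma csint_gt0 n : 0 < csint n.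
Proof.
elim: n => [|n IH]; first by rewrite csint0.
have h : 0 < 2 * n%:R + 2 :> R by rewrite ltr_wpDl// mulr_ge0.
rewrite -(pmulr_lgt0 _ h) csint_rec mulr_gt0// ltr_wpDl// mulr_ge0//.
Qed.

(** A probability density of width [n^(-1/2)] which is also a trigonometric polynomial. *)
Definition ker n x := cs x ^+ (2 * n) / csint n.

Lemma ker_ge0 n x : 0 <= ker n x.
Proof. by rewrite divr_ge0 ?cs2n_ge0 ?ltW ?csint_gt0. Qed.

Lemma ker1 n x : ker n (x + 1) = ker n x.
Proof. by rewrite /ker cs1 exprM sqrrN -exprM. Qed.

Lemma kerN n x : ker n (- x) = ker n x.
Proof. by rewrite /ker mulrN cosN. Qed.

Lemma mker n : measurable_fun setT (ker n).
Proof. by apply: measurable_funM => //; exact: mcs. Qed.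

Lemma int_ker n : (\int[nu]_x (ker n x)%:E = 1)%E.
Proof.
under eq_integral do rewrite EFinM.
rewrite ge0_integralZr//; last 3 first.
- by apply/measurable_EFinP; exact: mcs.
- by move=> x _; rewrite lee_fin cs2n_ge0.
- by rewrite lee_fin invr_ge0 ltW// csint_gt0.
by rewrite csintE -EFinM divff// gt_eqF// csint_gt0.
Qed.

Lemma csint_succ n : csint n.+1 = csint n * ((2 * n%:R + 1) / (2 * n%:R + 2)).
Proof.
have h : 0 < 2 * n%:R + 2 :> R by rewrite ltr_wpDl// mulr_ge0.
by rewrite mulrA -csint_rec mulfK// gt_eqF.
Qed.

(** The second moment of the kernel, with the sine for the distance to the integers; it measures
    the width. *)
Lemma int_ker_sn2 n : (\int[nu]_x (ker n x * sn x ^+ 2)%:E = ((2 * n%:R + 2)^-1)%:E)%E.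
Proof.
have c0 := csint_gt0 n.
have E x : ker n x * sn x ^+ 2 = ker n x - cs x ^+ (2 * n.+1) / csint n.
  rewrite -[sn x ^+ 2](subKr 1) -cs2sn2 (mulnS 2 n) /ker exprD; field.
  by rewrite gt_eqF.
under eq_integral do rewrite E EFinB.
have int k : nu.-integrable setT (fun x : R => (cs x ^+ (2 * k) / csint n)%:E).
  apply/integrableP; split; first by apply/measurable_EFinP; apply: measurable_funM => //; exact: mcs.
  under eq_integral do rewrite gee0_abs ?lee_fin ?divr_ge0 ?cs2n_ge0 1?ltW// EFinM.
  rewrite ge0_integralZr//; last 3 first.
  - by apply/measurable_EFinP; exact: mcs.
  - by move=> x _; rewrite lee_fin cs2n_ge0.
  - by rewrite lee_fin invr_ge0 ltW.
  by rewrite csintE -EFinM ltry.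
rewrite integralB//; [|exact: int..]. 
rewrite int_ker; under eq_integral do rewrite EFinM.
rewrite ge0_integralZr//; last 3 first.
- by apply/measurable_EFinP; exact: mcs.
- by move=> x _; rewrite lee_fin cs2n_ge0.
- by rewrite lee_fin invr_ge0 ltW.
rewrite csintE -EFinM -EFinB csint_succ; congr (_%:E); field.
have h : 0 < 2 * n%:R + 2 :> R by rewrite ltr_wpDl// mulr_ge0.
by rewrite !gt_eqF// ltr_wpDl// mulr_ge0.
Qed.

Lemma ker_cs2 n x : ker n x * cs x ^+ 2 = ker n.+1 x * ((2 * n%:R + 1) / (2 * n%:R + 2)).
Proof.
have c0 := csint_gt0 n.
rewrite /ker csint_succ (mulnS 2 n) addSn add1n !exprS; field.
have h k : 0 < k -> 0 < 2 * n%:R + k :> R by move=> k0; rewrite ltr_wpDl// mulr_ge0.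
by rewrite !gt_eqF// h.
Qed.

(** Only second and fourth moments enter the estimates: [cub_le] gives a bound in even powers
    of the distance after multiplication by the distance coming from the gradient. *)
Lemma int_ker_sn4 n :
  (\int[nu]_x (ker n x * sn x ^+ 4)%:E = (3 / ((2 * n%:R + 2) * (2 * n%:R + 4)))%:E)%E.
Proof.
have E x : ker n x * sn x ^+ (2 + 2) = ker n x * sn x ^+ 2
    - ((2 * n%:R + 1) / (2 * n%:R + 2)) * (ker n.+1 x * sn x ^+ 2).
  rewrite [_ * (_ * sn x ^+ 2)]mulrA [_ * ker n.+1 x]mulrC -ker_cs2 cs2sn2; ring.
have h k : 0 < k -> 0 < 2 * n%:R + k :> R by move=> k0; rewrite ltr_wpDl// mulr_ge0.
under eq_integral do rewrite E EFinB [X in (_ - X)%E]EFinM.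
have int k : nu.-integrable setT (fun x : R => (ker k x * sn x ^+ 2)%:E).
  apply/integrableP; split.
    apply/measurable_EFinP; apply: measurable_funM; first exact: mker.
    by apply: cont_meas; exact: (drv_cont (drvX _ drv_sn)).
  have pos x : (0 <= (ker k x * sn x ^+ 2)%:E)%E by rewrite lee_fin mulr_ge0 ?ker_ge0 ?sqr_ge0.
  by under eq_integral do rewrite gee0_abs//; rewrite int_ker_sn2 ltry.
rewrite (integralB measurableT (int n) (integrableZl measurableT _ (int n.+1))).
rewrite (integralZl _ (int n.+1))//.
rewrite !int_ker_sn2 -EFinM -EFinB; congr (_%:E); rewrite -natr1; field.
by rewrite !gt_eqF ?h//.
Qed.

End kernel1.

Import HBSimple.

(** * Approximate identities *)
Section tozero.
Context {R : realType}.
Implicit Types (a b : nat -> \bar R).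

(** Convergence to 0 of nonnegative extended reals, in the form used by comparison arguments. *)
Definition tozero a := forall e : R, 0 < e -> exists N, forall n, (N <= n)%N -> (a n <= e%:E)%E.

Lemma tozero_le a b : (forall n, a n <= b n)%E -> tozero b -> tozero a.
Proof.
move=> ab b0 e /b0[N HN]; exists N => n /HN; exact: le_trans.
Qed.

Lemma tozeroD a b : tozero a -> tozero b -> tozero (fun n => a n + b n)%E.
Proof.
move=> a0 b0 e e0; have e2 : 0 < e / 2 by rewrite divr_gt0.
have [N HN] := a0 _ e2; have [M HM] := b0 _ e2; exists (maxn N M) => n.
rewrite geq_max => /andP[/HN hN /HM hM].
by rewrite [e]splitr EFinD leeD.
Qed.

Lemma tozeroZ (c : R) a : 0 <= c -> tozero a -> tozero (fun n => c%:E * a n)%E.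
Proof.
move=> c0 a0 e e0; have ec : 0 < e / (c + 1) by rewrite divr_gt0// ltr_wpDl.
have [N HN] := a0 _ ec; exists N => n /HN h.
apply: le_trans (lee_wpmul2l _ h) _; first by rewrite lee_fin.
rewrite -EFinM lee_fin mulrCA ler_piMr ?(ltW e0)// ler_pdivrMr ?ltr_wpDl//.
by rewrite mul1r lerDl.
Qed.

Lemma cvg_tozero a : a n @[n --> \oo] --> 0%E -> tozero a.
Proof.
move=> /fine_cvgP[fa /cvgrPdist_le a0] e e0.
have : \forall n \near \oo, (a n <= e%:E)%E.
  near=> n; have fan : a n \is a fin_num by near: n.
  rewrite -(fineK fan) lee_fin (le_trans (ler_norm _))//.
  by rewrite -normrN -sub0r; near: n; exact: a0.
by move=> [N _ HN]; exists N => n /HN.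
Unshelve. all: by end_near. Qed.

Lemma tozero_cvg a : (forall n, 0 <= a n)%E -> tozero a -> a n @[n --> \oo] --> 0%E.
Proof.
move=> a0 az; apply/fine_cvgP; split.
  have [N HN] := az 1 ltr01; near=> n; rewrite ge0_fin_numE//.
  by apply: le_lt_trans (HN n _) (ltry _); near: n; exists N.
apply/cvgrPdist_le => e e0; have [N HN] := az _ e0.
near=> n; rewrite sub0r normrN ger0_norm ?fine_ge0//.
have h : (a n <= e%:E)%E by apply: HN; near: n; exists N.
by rewrite -lee_fin fineK// ge0_fin_numE// (le_lt_trans h)// ltry.
Unshelve. all: by end_near. Qed.
End tozero.

Lemma integral_cst1 d (X : measurableType d) (R : realType) (m : {measure set X -> \bar R})
  (c : \bar R) : m setT = 1%E -> (\int[m]_x c = c)%E.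
Proof.
move=> m1; transitivity (c * m setT)%E; first exact: integral_cst.
by transitivity (c * 1)%E; [congr (_ * _)%E|rewrite mule1].
Qed.

Section approximate_identity.
Local Open Scope ereal_scope.
Context d (X : measurableType d) {R : realType} (m : {sigma_finite_measure set X -> \bar R}).
Variable k : nat -> X -> X -> R.
Implicit Types f g h : X -> R.

(** The mean oscillation at the scale of the kernel; it dominates the smoothing error in [L^1]. *)
Definition osc n f := \int[m]_x \int[m]_y (k n x y * `|f y - f x|)%:E.

Record kernelP : Prop := KernelP {
  k_ge0 : forall n x y, (0 <= k n x y)%R ;
  k_meas : forall n, measurable_fun setT (fun z : X * X => k n z.1 z.2) ;
  k_sym : forall n x y, k n x y = k n y x ;
  k_int : forall n x, \int[m]_y (k n x y)%:E = 1 }.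

Definition approx_id := forall f, measurable_fun setT f ->
  \int[m]_x `|f x|%:E < +oo -> tozero (osc ^~ f).

Hypothesis kP : kernelP.
Hypothesis m1 : m setT = 1.

Let mkf n f : measurable_fun setT f ->
  measurable_fun setT (fun z : X * X => (k n z.1 z.2 * `|f z.2 - f z.1|)%:E).
Proof.
move=> mf; apply/measurable_EFinP; apply: measurable_funM; first exact: (k_meas kP).
apply: measurableT_comp => //; apply: measurable_funB.
  exact: (mcomp mf (msnd (@measurable_id _ _ _))).
exact: (mcomp mf (mfst (@measurable_id _ _ _))).
Qed.

Let kf_ge0 n f x y : 0 <= (k n x y * `|f y - f x|)%:E.
Proof. by rewrite lee_fin mulr_ge0// (k_ge0 kP). Qed.

Lemma osc_pmE n f : measurable_fun setT f ->
  osc n f = \int[pm m m]_z (k n z.1 z.2 * `|f z.2 - f z.1|)%:E.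
Proof. by move=> mf; rewrite tonelli1//; exact: mkf. Qed.

Lemma osc_le n f g h : measurable_fun setT f -> measurable_fun setT g ->
  measurable_fun setT h ->
  (forall x y, `|h y - h x| <= `|f y - f x| + `|g y - g x|)%R ->
  osc n h <= osc n f + osc n g.
Proof.
move=> mf mg mh hfg; rewrite !osc_pmE// -ge0_integralD//; try exact: mkf.
apply: int_mono => z; first exact: kf_ge0.
by rewrite -EFinD lee_fin -mulrDr ler_wpM2l// (k_ge0 kP).
Qed.

Lemma osc_leL1 n f : measurable_fun setT f -> osc n f <= 2%:E * \int[m]_x `|f x|%:E.
Proof.
move=> mf.
have mkm : measurable_fun setT (fun z : X * X => (k n z.1 z.2)%:E).
  by apply/measurable_EFinP; exact: (k_meas kP).
have m_1 : measurable_fun setT (fun z : X * X => (k n z.1 z.2 * `|f z.1|)%:E).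
  apply/measurable_EFinP; apply: measurable_funM; first exact: (k_meas kP).
  apply: measurableT_comp => //; exact: (mcomp mf (mfst (@measurable_id _ _ _))).
have m_2 : measurable_fun setT (fun z : X * X => (k n z.1 z.2 * `|f z.2|)%:E).
  apply/measurable_EFinP; apply: measurable_funM; first exact: (k_meas kP).
  apply: measurableT_comp => //; exact: (mcomp mf (msnd (@measurable_id _ _ _))).
have p1 z : 0 <= (k n z.1 z.2 * `|f z.1|)%:E by rewrite lee_fin mulr_ge0// (k_ge0 kP).
have p2 z : 0 <= (k n z.1 z.2 * `|f z.2|)%:E by rewrite lee_fin mulr_ge0// (k_ge0 kP).
have mkx x : measurable_fun setT (fun y => (k n x y)%:E).
  exact: (measurable_fun_pair2 x mkm).
apply: (@le_trans _ _ (\int[pm m m]_z ((k n z.1 z.2 * `|f z.1|)%:E + (k n z.1 z.2 * `|f z.2|)%:E))).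
  rewrite osc_pmE//; apply: int_mono => z; first exact: kf_ge0.
  rewrite -EFinD lee_fin -mulrDr ler_wpM2l// ?(k_ge0 kP)// [leRHS]addrC.
  exact: ler_normB.
rewrite ge0_integralD// tonelli1// tonelli2//.
have E1 x : \int[m]_y (k n x y * `|f x|)%:E = `|f x|%:E.
  under eq_integral do rewrite EFinM.
  rewrite ge0_integralZr//; last by move=> y _; rewrite lee_fin (k_ge0 kP).
  by rewrite (k_int kP) mul1e.
under eq_integral do rewrite E1.
under [X in _ + X]eq_integral => y _.
  under eq_integral do rewrite (k_sym kP).
  rewrite E1; over.
by rewrite -mule2n muleC -mule_natl muleC.
Qed.

(** The oscillation of [f - g] is at most twice its norm in [L^1], uniformly in [n]. *)
Lemma osc_closed f : measurable_fun setT f ->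
  (forall e : R, (0 < e)%R -> exists g, [/\ measurable_fun setT g, tozero (osc ^~ g) &
     \int[m]_x `|f x - g x|%:E <= e%:E]) -> tozero (osc ^~ f).
Proof.
move=> mf H e e0; have [g [mg g0 fg]] := H (e / 4)%R (divr_gt0 e0 (ltr0n _ 4)).
have [N HN] := g0 (e / 2)%R (divr_gt0 e0 (ltr0n _ 2)); exists N => n /HN hn.
have mfg : measurable_fun setT (fun x => f x - g x)%R by exact: measurable_funB.
apply: le_trans (@osc_le n (fun x => f x - g x)%R g f mfg mg mf _) _.
  move=> x y; rewrite [X in `|X|%R](_ : _ = (f y - g y - (f x - g x)) + (g y - g x))%R; last by ring.
  exact: ler_normD.
rewrite (splitr e) EFinD; apply: leeD; last exact: hn.
apply: le_trans (osc_leL1 n mfg) _; apply: le_trans (lee_wpmul2l _ fg) _ => //.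
by rewrite -EFinM lee_fin; lra.
Qed.

Lemma osc_cst n (c : R) : osc n (cst c) = 0.
Proof. by apply: integral0_eq => x _; apply: integral0_eq => y _; rewrite /= subrr normr0 mulr0. Qed.

Lemma oscZ n (c : R) f : measurable_fun setT f ->
  osc n (fun x => c * f x)%R = `|c|%:E * osc n f.
Proof.
move=> mf; rewrite !osc_pmE//; last exact: measurable_funM.
rewrite -ge0_integralZl//; last exact: mkf.
by apply: eq_integral => z _; rewrite -EFinM -mulrBr normrM mulrCA.
Qed.

Lemma osc_sum (I : Type) (r : seq I) (F : I -> X -> R) :
  (forall i, measurable_fun setT (F i)) -> (forall i, tozero (osc ^~ (F i))) ->
  tozero (osc ^~ (fun x => \sum_(i <- r) F i x)%R).
Proof.
move=> mF F0; elim: r => [|i r IH].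
  under eq_fun => n do under [X in osc _ X]eq_fun do rewrite big_nil.
  by move=> e e0; exists 0%N => n _; rewrite osc_cst lee_fin ltW.
apply: tozero_le (tozeroD (F0 i) IH) => n.
apply: osc_le => //; [exact: measurable_sum|exact: measurable_sum|].
move=> x y; rewrite !big_cons.
rewrite [X in `|X|%R](_ : _ = (F i y - F i x) + (\sum_(j <- r) F j y - \sum_(j <- r) F j x))%R; last by ring.
exact: ler_normD.
Qed.

(** A monotone class argument: the sets whose indicators have vanishing oscillation form a
    Dynkin system by [osc_closed], and simple functions are dense in [L^1]. *)
Lemma approx_id_generator (G : set (set X)) : @measurable _ X = <<s G >> ->
  setI_closed G -> (forall A, G A -> tozero (osc ^~ (\1_A : X -> R))) -> approx_id.
Proof.
move=> GE GI HG.
have mI (A : set X) : measurable A -> measurable_fun setT (\1_A : X -> R).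
  by move=> mA; exact: measurable_indic.
have Hset (A : set X) : measurable A -> tozero (osc ^~ (\1_A : X -> R)).
  move=> mA; have {mA} : <<s G >> A by rewrite -GE.
  move: A; apply: (@dynkin_induction _ X G (fun A => tozero (osc ^~ (\1_A : X -> R))) GE GI); [|exact: HG|..].
  - rewrite indicT => e e0; exists 0%N => n _; rewrite osc_cst.
    by rewrite lee_fin ltW.
  - move=> S mS HS; apply: tozero_le HS => n; rewrite le_eqVlt; apply/orP; left; apply/eqP.
    apply: eq_integral => x _; apply: eq_integral => y _; congr ((_ * _)%:E).
    by rewrite !indicE !in_setC; case: (y \in S); case: (x \in S) => /=; rewrite ?subrr ?subr0 ?sub0r ?normrN ?subrr.
  - move=> F mF tF HF.
    have mU N : measurable (\big[setU/set0]_(i < N) F i) by exact: bigsetU_measurable.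
    have HU N : tozero (osc ^~ (\1_(\big[setU/set0]_(i < N) F i) : X -> R)).
      elim: N => [|N IH].
        rewrite big_ord0 indic0 => e e0; exists 0%N => n _; rewrite osc_cst.
        by rewrite lee_fin ltW.
      rewrite big_ord_recr/=; apply: tozero_le (tozeroD IH (HF N)) => n.
      apply: osc_le; [exact: mI|apply: mI; exact: mF|apply: mI; apply: measurableU; [exact: mU|exact: mF]|].
      move=> x y; rewrite !indicE !in_setU.
      do 4 case: (_ \in _) => //=; rewrite ?subrr ?subr0 ?sub0r ?normrN ?normr0 ?normr1 ?addr0 ?add0r//; lra.
    apply: osc_closed; first by apply: mI; exact: bigcupT_measurable.
    move=> e e0.
    pose B N := \bigcup_k F k `\` \big[setU/set0]_(i < N) F i.
    have mB N : measurable (B N) by apply: measurableD => //; exact: bigcupT_measurable.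
    have : m (B n) @[n --> \oo] --> m (\bigcap_n B n).
      apply: nonincreasing_cvg_mu => //.
      - have : m (B 0%N) <= m setT by apply: le_measure; rewrite ?inE.
        by move=> /le_lt_trans; apply; rewrite m1 ltry.
      - exact: bigcapT_measurable.
      - move=> a b ab; apply/subsetPset; apply: setDS.
        exact: (subset_bigsetU).
    have -> : \bigcap_n B n = set0.
      apply/seteqP; split => // x Bx.
      have [[j _ Fjx] _] := Bx 0%N I.
      have [_] := Bx j.+1 I; apply.
      by rewrite big_ord_recr/=; right.
    rewrite measure0 => /cvg_tozero /(_ e e0)[N HN].
    exists (\1_(\big[setU/set0]_(i < N) F i)); split; [by apply: mI; exact: mU|exact: HU|].
    apply: le_trans (HN N (leqnn _)).
    rewrite -[leRHS]/(m (B N)) -[in leRHS](setIT (B N)) -integral_indic//.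
    apply: int_mono => // x; rewrite lee_fin !indicE /B in_setD.
    case: (boolP (x \in \big[setU/set0]_(i < N) F i)) => /= h; rewrite ?andbF ?andbT.
      rewrite mem_set ?subrr ?normr0// ; move/set_mem: h; apply: bigsetU_bigcup.
    by rewrite subr0 ger0_norm.
move=> f mf If.
have intf : m.-integrable setT (EFin \o f).
  by apply/integrableP; split; [exact/measurable_EFinP|].
have [g_ [ig _ gl]] := approximation_sfun_integrable measurableT intf.
apply: osc_closed => // e e0.
have [N HN] := cvg_tozero gl e0.
exists (g_ N); split; [exact: measurable_funP| |]; last first.
  by apply: le_trans (HN N (leqnn _)); under eq_integral do rewrite -EFinB.
have gE := fimfunEord (g_ N); set s := fset_set _ in gE; rewrite (funext gE).
apply: osc_sum => i.
  by apply: measurable_funM => //; apply: mI; exact: measurable_funPTI.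
have mS : measurable (g_ N @^-1` [set (finmap.enum_fset s)`_i]) by exact: measurable_funPTI.
apply: tozero_le (tozeroZ (normr_ge0 _) (Hset _ mS)) => n.
by rewrite oscZ//; exact: mI.
Qed.

End approximate_identity.

Section approx_id_prod.
Local Open Scope ereal_scope.
Context d d' (X : measurableType d) (Y : measurableType d') {R : realType}.
Variables (m : {sigma_finite_measure set X -> \bar R}) (m' : {sigma_finite_measure set Y -> \bar R}).
Variables (k : nat -> X -> X -> R) (k' : nat -> Y -> Y -> R).
Hypotheses (kP : kernelP m k) (kP' : kernelP m' k').
Hypotheses (m1 : m setT = 1) (m1' : m' setT = 1).

(** Approximate identities are built one variable at a time: the kernel on the torus is a product. *)
Definition kprod n (z z' : X * Y) : R := k n z.1 z'.1 * k' n z.2 z'.2.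

Lemma pm1 : pm m m' setT = 1.
Proof. by rewrite -setXTT pmE// m1 m1' mule1. Qed.

Let mid := @measurable_id.

Lemma kprodP : kernelP (pm m m') kprod.
Proof.
have mk n : measurable_fun setT (fun z : (X * Y) * (X * Y) => k n z.1.1 z.2.1).
  apply: (mcomp (k_meas kP n) (mprod _ _)).
    by apply: mfst; apply: mfst; exact: mid.
  by apply: mfst; apply: msnd; exact: mid.
have mk' n : measurable_fun setT (fun z : (X * Y) * (X * Y) => k' n z.1.2 z.2.2).
  apply: (mcomp (k_meas kP' n) (mprod _ _)).
    by apply: msnd; apply: mfst; exact: mid.
  by apply: msnd; apply: msnd; exact: mid.
have mkk n : measurable_fun setT (fun z : (X * Y) * (X * Y) => kprod n z.1 z.2) by exact: measurable_funM.
split => //.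
- by move=> n x y; rewrite mulr_ge0 ?(k_ge0 kP) ?(k_ge0 kP').
- by move=> n x y; rewrite /kprod (k_sym kP) (k_sym kP').
- move=> n z; rewrite tonelli1//; last 2 first.
  + by apply/measurable_EFinP; exact: (measurable_fun_pair2 z (mkk n)).
  + by move=> z'; rewrite lee_fin mulr_ge0 ?(k_ge0 kP) ?(k_ge0 kP').
  rewrite -[RHS](k_int kP n z.1); apply: eq_integral => x _.
  rewrite /kprod /=; under eq_integral do rewrite EFinM.
  rewrite ge0_integralZl//; first by rewrite (k_int kP') mule1.
  + by apply/measurable_EFinP; exact: (measurable_fun_pair2 z.2 (k_meas kP' n)).
  + by move=> y _; rewrite lee_fin (k_ge0 kP').
  + by rewrite lee_fin (k_ge0 kP).
Qed.

Lemma osc_fst n (f : X -> R) : measurable_fun setT f ->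
  osc (pm m m') kprod n (f \o fst) <= osc m k n f.
Proof.
move=> mf.
have mg : measurable_fun setT (fun z : X * X => (k n z.1 z.2 * `|f z.2 - f z.1|)%R).
  apply: measurable_funM; first exact: (k_meas kP).
  apply: measurableT_comp => //; apply: measurable_funB.
    by apply: (mcomp mf); apply: msnd; exact: mid.
  by apply: (mcomp mf); apply: mfst; exact: mid.
have g0 x y : 0 <= (k n x y * `|f y - f x|)%:E by rewrite lee_fin mulr_ge0// (k_ge0 kP).
apply: (@le_trans _ _ (\int[pm m m']_z (\int[m]_x' (k n z.1 x' * `|f x' - f z.1|)%:E))).
  apply: int_mono => z; first by apply: integral_ge0 => z' _; rewrite lee_fin mulr_ge0// (k_ge0 kprodP).
  rewrite le_eqVlt; apply/orP; left; apply/eqP.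
  rewrite tonelli1//; last 2 first.
  - apply/measurable_EFinP; apply: measurable_funM; first exact: (measurable_fun_pair2 z (k_meas kprodP n)).
    apply: measurableT_comp => //; apply: measurable_funB => //=.
    by apply: (mcomp mf); apply: mfst; exact: mid.
  - by move=> z'; rewrite lee_fin mulr_ge0// (k_ge0 kprodP).
  apply: eq_integral => x' _; rewrite /kprod /=.
  under eq_integral do rewrite mulrAC EFinM.
  rewrite ge0_integralZl//; first by rewrite (k_int kP') mule1.
  + by apply/measurable_EFinP; exact: (measurable_fun_pair2 z.2 (k_meas kP' n)).
  + by move=> y _; rewrite lee_fin (k_ge0 kP').
have mI : measurable_fun setT (fun x => \int[m]_x' (k n x x' * `|f x' - f x|)%:E).
  by apply: (@measurable_int2 _ _ _ _ _ m (fun x x' => (k n x x' * `|f x' - f x|)%:E)) => //; exact/measurable_EFinP.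
rewrite tonelli1//; first last.
- by move=> z; apply: integral_ge0.
- by apply: (mcomp mI); apply: mfst; exact: mid.
apply: int_mono => x; first by apply: integral_ge0 => y _; apply: integral_ge0.
apply: le_trans (lexx _).
by rewrite -[X in _ <= X](integral_cst1 _ m1').
Qed.

Lemma osc_snd n (f : Y -> R) : measurable_fun setT f ->
  osc (pm m m') kprod n (f \o snd) <= osc m' k' n f.
Proof.
move=> mf.
have mg : measurable_fun setT (fun z : Y * Y => (k' n z.1 z.2 * `|f z.2 - f z.1|)%R).
  apply: measurable_funM; first exact: (k_meas kP').
  apply: measurableT_comp => //; apply: measurable_funB.
    by apply: (mcomp mf); apply: msnd; exact: mid.
  by apply: (mcomp mf); apply: mfst; exact: mid.
have g0 x y : 0 <= (k' n x y * `|f y - f x|)%:E by rewrite lee_fin mulr_ge0// (k_ge0 kP').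
apply: (@le_trans _ _ (\int[pm m m']_z (\int[m']_x' (k' n z.2 x' * `|f x' - f z.2|)%:E))).
  apply: int_mono => z; first by apply: integral_ge0 => z' _; rewrite lee_fin mulr_ge0// (k_ge0 kprodP).
  rewrite le_eqVlt; apply/orP; left; apply/eqP.
  rewrite tonelli2//; last 2 first.
  - apply/measurable_EFinP; apply: measurable_funM; first exact: (measurable_fun_pair2 z (k_meas kprodP n)).
    apply: measurableT_comp => //; apply: measurable_funB => //=.
    by apply: (mcomp mf); apply: msnd; exact: mid.
  - by move=> z'; rewrite lee_fin mulr_ge0// (k_ge0 kprodP).
  apply: eq_integral => x' _; rewrite /kprod /=.
  under eq_integral do rewrite -mulrA EFinM.
  rewrite ge0_integralZr//; first by rewrite (k_int kP) mul1e.
  + by apply/measurable_EFinP; exact: (measurable_fun_pair2 z.1 (k_meas kP n)).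
  + by move=> y _; rewrite lee_fin (k_ge0 kP).
have mI : measurable_fun setT (fun x => \int[m']_x' (k' n x x' * `|f x' - f x|)%:E).
  by apply: (@measurable_int2 _ _ _ _ _ m' (fun x x' => (k' n x x' * `|f x' - f x|)%:E)) => //; exact/measurable_EFinP.
rewrite tonelli2//; first last.
- by move=> z; apply: integral_ge0.
- by apply: (mcomp mI); apply: msnd; exact: mid.
apply: int_mono => x; first by apply: integral_ge0 => y _; apply: integral_ge0.
apply: le_trans (lexx _).
by rewrite -[X in _ <= X](integral_cst1 _ m1).
Qed.

(** Rectangles generate, and the indicator of a rectangle oscillates at most as much as
    the sum of those of its two sides. *)
Lemma approx_id_prod : approx_id m k -> approx_id m' k' -> approx_id (pm m m') kprod.
Proof.
move=> Hk Hk'.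
apply: (approx_id_generator kprodP pm1 (measurable_prod_measurableType X Y)).
  move=> _ _ [A1 mA1 [B1 mB1 <-]] [A2 mA2 [B2 mB2 <-]].
  exists (A1 `&` A2); first exact: measurableI.
  exists (B1 `&` B2); first exact: measurableI.
  by rewrite setXI.
move=> _ [A mA [B mB <-]].
have I1 dd (Z : measurableType dd) (mm : {sigma_finite_measure set Z -> \bar R}) (C : set Z) : mm setT = 1 -> measurable C ->
    \int[mm]_x `|(\1_C x : R)|%:E < +oo.
  move=> h mC; apply: (@le_lt_trans _ _ (\int[mm]_x 1)).
    by apply: int_mono => x; rewrite lee_fin// indicE; case: (_ \in _); rewrite ?normr0 ?normr1.
  by rewrite integral_cst1// ltry.
have mA' : measurable_fun setT (\1_A : X -> R) by exact: measurable_indic.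
have mB' : measurable_fun setT (\1_B : Y -> R) by exact: measurable_indic.
apply: tozero_le (tozeroD (Hk _ mA' (I1 _ _ _ _ m1 mA)) (Hk' _ mB' (I1 _ _ _ _ m1' mB))) => n.
apply: le_trans (leeD (osc_fst n mA') (osc_snd n mB')).
apply: (osc_le kprodP).
- by apply: (mcomp mA'); apply: mfst; exact: mid.
- by apply: (mcomp mB'); apply: msnd; exact: mid.
- by apply: measurable_indic; exact: measurableX.
- move=> [x1 y1] [x2 y2] /=; rewrite !indicE !in_setX/=.
  case: (x1 \in A); case: (x2 \in A); case: (y1 \in B); case: (y2 \in B) => /=;
  rewrite ?subrr ?subr0 ?sub0r ?normrN ?normr0 ?normr1 ?addr0 ?add0r//; lra.
Qed.
End approx_id_prod.

Section approx_id_ker.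
Context {R : realType}.
Implicit Types (x y b : R) (n : nat).
Local Notation sn x := (sin (pi * x)).

Definition ker2 n x y : R := ker n (y - x).

Lemma ker2P : kernelP nu ker2.
Proof.
have mk n : measurable_fun setT (fun z : R * R => ker2 n z.1 z.2).
  apply: (mcomp (mker n)); apply: measurable_funB.
    by apply: msnd; exact: measurable_id.
  by apply: mfst; exact: measurable_id.
split => //.
- by move=> n x y; exact: ker_ge0.
- by move=> n x y; rewrite /ker2 -kerN opprB.
- move=> n x; rewrite -[RHS](int_ker n).
  rewrite -(@ge0_nu_translate _ (fun y => (ker n y)%:E) (- x))//.
  + by apply/measurable_EFinP; exact: mker.
  + by move=> y; rewrite lee_fin ker_ge0.
  + by move=> y; rewrite ker1.
Qed.

Lemma sin_lb (a c : R) : 0 < a -> c < 1 ->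
  exists2 k : R, 0 < k & forall y, a <= y <= c -> k <= sn y ^+ 2.
Proof.
move=> a0 c1; have [ac|ca] := lerP a c; last first.
  exists 1 => // y /andP[ay yc]; move: (lt_le_trans ca ay).
  by rewrite ltNge yc.
have cf : {within `[a, c], continuous (fun y : R => sn y ^+ 2)}.
  by apply: continuous_subspaceT; exact: (drv_cont (drvX _ drv_sn)).
have [y0 y0I y0min] := EVT_min ac cf.
have /andP[y0a y0c'] : a <= y0 <= c by move: y0I; rewrite in_itv.
exists (sn y0 ^+ 2).
  apply: exprn_gt0; apply: sin_gt0_pi.
  rewrite mulr_gt0 ?pi_gt0 ?(lt_le_trans a0)//=.
  by rewrite -[ltRHS]mulr1 ltr_pM2l ?pi_gt0// (le_lt_trans y0c').
by move=> y yac; apply: y0min; rewrite in_itv.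
Qed.

Transparent nu leb.
Lemma ae_nu_in : {ae (nu : {measure set R -> \bar R}), forall x, 0 <= x <= 1}.
Proof.
exists (~` `[0, 1]%classic); split.
- by apply: measurableC; exact: measurable_itvR.
- by rewrite -[LHS]/(leb (~` `[0, 1] `&` `[0, 1])%classic) setICl measure0.
- by move=> x /= h; rewrite in_itv.
Qed.

Lemma ae_nu_neq (a : R) : {ae (nu : {measure set R -> \bar R}), forall x, x <> a}.
Proof.
exists [set a]; split; [exact: measurable_set1| |by move=> x /= /contrapT].
apply/eqP; rewrite eq_le measure_ge0 andbT.
rewrite -[leLHS]/(leb ([set a] `&` `[0, 1]%classic)) -(lebesgue_measure_set1 a).
apply: le_measure; rewrite ?inE; last by apply: subIsetl.
- by apply: measurableI; [exact: measurable_set1|exact: measurable_itvR].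
- exact: measurable_set1.
Qed.
Opaque nu leb.

(** Half-lines generate. Away from the jump and from the integers, the increment of the indicator
    is bounded by a multiple of the squared sine, so the second moment of the kernel applies. *)
Lemma approx_id_ker : approx_id nu ker2.
Proof.
apply: (@approx_id_generator _ _ _ nu ker2 ker2P nu_setT (@RGenInftyO.G R)).
- exact: RGenInftyO.measurableE.
- move=> _ _ [b ->] [c ->]; exists (Num.min b c); apply/seteqP; split => x /=.
    by rewrite !in_itv/= lt_min => -[-> ->].
  by rewrite !in_itv/= lt_min => /andP[].
move=> _ [b ->]; set f := (\1__ : R -> R).
have mf : measurable_fun setT f by apply: measurable_indic; exact: measurable_itvR.
have f01 x : f x = (x < b)%R%:R by rewrite /f indicE mem_setE in_itv.
have f1 x y : `|f y - f x| <= 1.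
  by rewrite !f01; case: ltP => _; case: ltP => _; rewrite ?subrr ?subr0 ?sub0r ?normrN ?normr0 ?normr1.
apply: cvg_tozero.
have mkf n : measurable_fun setT (fun z : R * R => (ker2 n z.1 z.2 * `|f z.2 - f z.1|)%:E).
  apply/measurable_EFinP; apply: measurable_funM; first exact: (k_meas ker2P).
  apply: measurableT_comp => //; apply: measurable_funB.
    by apply: (mcomp mf); apply: msnd; exact: measurable_id.
  by apply: (mcomp mf); apply: mfst; exact: measurable_id.
have kf0 n x y : (0 <= (ker2 n x y * `|f y - f x|)%:E)%E by rewrite lee_fin mulr_ge0// (k_ge0 ker2P).
pose g n x : \bar R := (\int[nu]_y (ker2 n x y * `|f y - f x|)%:E)%E.
have g0 n x : (0 <= g n x)%E by apply: integral_ge0.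
have mg n : measurable_fun setT (g n).
  exact: (@measurable_int2 _ _ _ _ _ nu (fun x y => (ker2 n x y * `|f y - f x|)%:E) (mkf n) (kf0 n)).
have g1 n x : (g n x <= 1)%E.
  rewrite -(k_int ker2P n x); apply: int_mono => // y.
  by rewrite lee_fin ler_piMr// (k_ge0 ker2P).
have cv : {ae (nu : {measure set R -> \bar R}), forall x, [set: R] x -> g n x @[n --> \oo] --> 0%E}.
  apply: filterS (filterI (filterI ae_nu_in (ae_nu_neq 0)) (filterI (ae_nu_neq 1) (ae_nu_neq b))).
  move=> x [[/andP[x0 x1] /eqP nx0] [/eqP nx1 /eqP nxb]] _; apply: tozero_cvg => //.
  have {x0 nx0} x0 : 0 < x by rewrite lt_neqAle eq_sym nx0.
  have {x1 nx1} x1 : x < 1 by rewrite lt_neqAle nx1.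
  (* The increment vanishes unless the jump separates x and y. *)
  have [C C0 HC] : exists2 C : R, 0 < C & forall y, 0 <= y <= 1 -> `|f y - f x| <= C * sn (y - x) ^+ 2.
    have [xb|bx] := ltP x b.
      have xb0 : 0 < b - x by rewrite subr_gt0.
      have x1' : 1 - x < 1 by rewrite ltrBlDr ltrDl.
      have [k k0 Hk] := sin_lb xb0 x1'.
      exists k^-1; rewrite ?invr_gt0// => y /andP[y0 y1].
      rewrite !f01 xb; case: ltP => yb; first by rewrite subrr normr0 mulr_ge0 ?invr_ge0 ?(ltW k0) ?sqr_ge0.
      by rewrite sub0r normrN normr1 mulrC ler_pdivlMr// mul1r; apply: Hk; rewrite !lerD2r yb.
    have bx' : b < x by rewrite lt_neqAle eq_sym nxb.
    have xb0 : 0 < x - b by rewrite subr_gt0.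
    have [k k0 Hk] := sin_lb xb0 x1.
    exists k^-1; rewrite ?invr_gt0// => y /andP[y0 y1].
    rewrite !f01 (ltNge x) bx /=; case: ltP => yb; last by rewrite subrr normr0 mulr_ge0 ?invr_ge0 ?(ltW k0) ?sqr_ge0.
    rewrite subr0 normr1 mulrC ler_pdivlMr// mul1r.
    rewrite -(opprB x y) mulrN sinN sqrrN; apply: Hk.
    by rewrite lerD2l lerN2 (ltW yb) lerBlDr lerDl.
  have h n : (g n x <= C%:E * ((2 * n%:R + 2)^-1)%:E)%E.
    rewrite -int_ker_sn2 -(@ge0_nu_translate _ (fun y => (ker n y * sn y ^+ 2)%:E) (- x)); first last.
    + by move=> y; rewrite ker1 sn1 sqrrN.
    + by move=> y; rewrite lee_fin mulr_ge0 ?ker_ge0 ?sqr_ge0.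
    + apply/measurable_EFinP; apply: measurable_funM; first exact: mker.
      by apply: cont_meas; exact: (drv_cont (drvX _ drv_sn)).
    have ms : measurable_fun setT (fun y => (ker n (y - x) * sn (y - x) ^+ 2)%:E).
      apply/measurable_EFinP; apply: measurable_funM; first exact: (measurable_fun_pair2 x (k_meas ker2P n)).
      have msn : measurable_fun setT (fun y : R => sn y ^+ 2).
        by apply: cont_meas; exact: (drv_cont (drvX _ drv_sn)).
      have mB : measurable_fun setT (fun y : R => y - x) by exact: measurable_funB.
      exact: (mcomp msn mB).
    have s0 y : (0 <= (ker n (y - x) * sn (y - x) ^+ 2)%:E)%E by rewrite lee_fin mulr_ge0 ?ker_ge0 ?sqr_ge0.
    rewrite -ge0_integralZl//; last by rewrite lee_fin ltW.
    apply: ae_ge0_le_integral => //.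
    + exact: (measurable_fun_pair2 x (mkf n)).
    + by move=> y _; rewrite mule_ge0// lee_fin ltW.
    + exact: measurable_funeM.
    apply: filterS ae_nu_in => y y01 _; rewrite -EFinM lee_fin mulrCA /ker2 ler_wpM2l ?ker_ge0//.
    exact: HC.
  apply: (tozero_le h); apply: tozeroZ; first exact: ltW.
  move=> e e0; exists (Num.truncn e^-1).+1 => n hn; rewrite lee_fin.
  have n0 : 0 < 2 * n%:R + 2 :> R by rewrite ltr_wpDl// mulr_ge0.
  rewrite -[leRHS]invrK lef_pV2 ?posrE ?invr_gt0//.
  apply: (@le_trans _ _ n%:R); last by rewrite ler_wpDr// ler_peMl// ler1n.
  apply: ltW; apply: (@lt_le_trans _ _ (Num.truncn e^-1).+1%:R); last by rewrite ler_nat.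
  exact: truncnS_gt.
have ig : nu.-integrable setT (fun _ : R => 1%E : \bar R).
  apply/integrableP; split => //.
  by rewrite integral_cst1 ?gee0_abs ?ltry//; exact: nu_setT.
have bd : {ae (nu : {measure set R -> \bar R}), forall x n, [set: R] x -> (`|g n x| <= 1)%E}.
  by apply: aeW => x n _; rewrite gee0_abs.
have [_ _] := dominated_convergence measurableT mg (measurable_cst _) cv ig bd.
by rewrite integral0.
Qed.
End approx_id_ker.

Section approx_id3.
Context {R : realType}.
Local Notation X := (R * R * R)%type.

Definition ker3 n (x : X) : R := ker n x.1.1 * ker n x.1.2 * ker n x.2.

Definition ker32 n (x y : X) : R := ker3 n (y - x).

Lemma ker32P : kernelP (@m3 R) ker32.
Proof. exact: (kprodP (kprodP ker2P ker2P) ker2P). Qed.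

Lemma approx_id_ker3 : approx_id (@m3 R) ker32.
Proof.
have h := @nu_setT R.
apply: (approx_id_prod (kprodP ker2P ker2P) ker2P (pm1 h h) h _ approx_id_ker).
exact: (approx_id_prod ker2P ker2P h h approx_id_ker approx_id_ker).
Qed.
End approx_id3.

(** * Real-valued integrals *)
Section real_integrals.
Context d (X : measurableType d) {R : realType} (mu : {measure set X -> \bar R}).
Implicit Types (f g h : X -> R) (c : R).

Definition ig f := mu.-integrable setT (EFin \o f).

Lemma igP f : ig f <-> measurable_fun setT f /\ (\int[mu]_x `|f x|%:E < +oo)%E.
Proof.
split=> [/integrableP[/measurable_EFinP]|[mf h]] //.
by apply/integrableP; split => //; exact/measurable_EFinP.
Qed.

Lemma ig_meas f : ig f -> measurable_fun setT f. Proof. by move=> /igP[]. Qed.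

Lemma ig_le f g : measurable_fun setT f -> (forall x, `|f x| <= `|g x|) -> ig g -> ig f.
Proof.
move=> mf fg /igP[_ h]; apply/igP; split => //; apply: le_lt_trans h.
by apply: int_mono => x; rewrite ?lee_fin.
Qed.

Lemma ig_norm f : ig f -> ig (fun x => `|f x|).
Proof.
move=> h; apply: ig_le (h) => [|x]; last by rewrite normr_id.
by apply: measurableT_comp => //; exact: ig_meas.
Qed.

Lemma igD f g : ig f -> ig g -> ig (fun x => f x + g x).
Proof. by move=> hf hg; exact: (integrableD measurableT hf hg). Qed.

Lemma igZ c f : ig f -> ig (fun x => c * f x).
Proof. by move=> hf; exact: (integrableZl measurableT c hf). Qed.

Lemma igN f : ig f -> ig (fun x => - f x).
Proof.
move=> hf; apply: ig_le (hf) => [|x]; last by rewrite normrN.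
by apply: measurable_funN; exact: ig_meas.
Qed.

Lemma igB f g : ig f -> ig g -> ig (fun x => f x - g x).
Proof. by move=> hf /igN; exact: igD. Qed.

Lemma ig0 : ig (fun=> 0).
Proof. by apply/igP; split => //; rewrite integral0_eq// => x _; rewrite normr0. Qed.

Lemma ig_sum (I : Type) (r : seq I) (F : I -> X -> R) : (forall i, ig (F i)) ->
  ig (fun x => \sum_(i <- r) F i x).
Proof.
move=> hF; elim: r => [|i r IH].
  by under eq_fun do rewrite big_nil; exact: ig0.
by under eq_fun do rewrite big_cons; exact: igD.
Qed.

(** Bounded multipliers preserve integrability; trigonometric polynomials are always of this kind. *)
Lemma igM M f h : ig f -> measurable_fun setT h -> (forall x, `|h x| <= M) ->
  ig (fun x => f x * h x).
Proof.
move=> hf mh hM; have := igZ M hf; apply: ig_le.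
  by apply: measurable_funM => //; exact: ig_meas.
move=> x; rewrite !normrM mulrC ler_wpM2r//.
by apply: le_trans (hM x) _; exact: ler_norm.
Qed.

Lemma IE f : ig f -> ((\int[mu]_x f x)%:E = \int[mu]_x (f x)%:E)%E.
Proof. by move=> hf; rewrite /Rintegral fineK//; exact: integrable_fin_num. Qed.

Lemma ID f g : ig f -> ig g ->
  \int[mu]_x (f x + g x) = \int[mu]_x f x + \int[mu]_x g x.
Proof. by move=> hf hg; rewrite RintegralD. Qed.

Lemma IB f g : ig f -> ig g ->
  \int[mu]_x (f x - g x) = \int[mu]_x f x - \int[mu]_x g x.
Proof. by move=> hf hg; rewrite RintegralB. Qed.

Lemma IZ c f : ig f -> \int[mu]_x (c * f x) = c * \int[mu]_x f x.
Proof. by move=> hf; rewrite RintegralZl. Qed.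

Lemma IZr c f : ig f -> \int[mu]_x (f x * c) = (\int[mu]_x f x) * c.
Proof. by move=> hf; rewrite RintegralZr. Qed.

Lemma I0 : \int[mu]_x (0 : R) = 0.
Proof. by rewrite /Rintegral integral0_eq. Qed.

Lemma I_sum (I : Type) (r : seq I) (F : I -> X -> R) : (forall i, ig (F i)) ->
  \int[mu]_x (\sum_(i <- r) F i x) = \sum_(i <- r) \int[mu]_x F i x.
Proof.
move=> hF; elim: r => [|i r IH].
  by under eq_Rintegral do rewrite big_nil; rewrite big_nil I0.
under eq_Rintegral do rewrite big_cons.
by rewrite big_cons -IH ID//; exact: ig_sum.
Qed.

Lemma I_eq f g : (forall x, f x = g x) -> \int[mu]_x f x = \int[mu]_x g x.
Proof. by move=> fg; apply: eq_Rintegral => x _; exact: fg. Qed.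

Lemma I_abs f : (`|\int[mu]_x f x|%:E <= \int[mu]_x `|f x|%:E)%E.
Proof.
rewrite /Rintegral integralE.
set a := (\int[mu]_x (_ : X -> \bar R) x)%E; set b := (\int[mu]_x (_ : X -> \bar R) x)%E.
set S := (\int[mu]_x `|f x|%:E)%E.
have a0 : (0 <= a)%E by apply: integral_ge0 => x _; exact: funepos_ge0.
have b0 : (0 <= b)%E by apply: integral_ge0 => x _; exact: funeneg_ge0.
have aS : (a <= S)%E.
  apply: int_mono => x; first exact: funepos_ge0.
  by rewrite funeposE -EFin_max lee_fin ge_max ler_norm normr_ge0.
have bS : (b <= S)%E.
  apply: int_mono => x; first exact: funeneg_ge0.
  by rewrite funenegE -EFinN -EFin_max lee_fin ge_max -normrN ler_norm normr_ge0.
case: (ltP S +oo%E) => [Soo|]; last by rewrite leye_eq => /eqP ->; rewrite leey.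
have fa : a \is a fin_num by rewrite ge0_fin_numE// (le_lt_trans aS).
have fb : b \is a fin_num by rewrite ge0_fin_numE// (le_lt_trans bS).
move: a0 b0 aS bS; rewrite -(fineK fa) -(fineK fb) => a0 b0 aS bS.
rewrite -EFinB /=; move: a0 b0; rewrite !lee_fin => a0 b0; case: (lerP 0 (fine a - fine b)) => h.
  by rewrite ger0_norm//; apply: le_trans aS; rewrite lee_fin lerBlDr lerDl.
by rewrite ltr0_norm//; apply: le_trans bS; rewrite lee_fin opprB lerBlDr lerDl.
Qed.

Lemma I_le0 f (C : R) : (\int[mu]_x `|f x|%:E <= C%:E)%E -> `|\int[mu]_x f x| <= C.
Proof. by move=> h; rewrite -lee_fin; exact: le_trans (I_abs f) h. Qed.

Lemma ae_eqI f g : measurable_fun setT f -> measurable_fun setT g ->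
  {ae mu, forall x, f x = g x} -> \int[mu]_x f x = \int[mu]_x g x.
Proof.
move=> mf mg fg; rewrite /Rintegral; congr fine; apply: ae_eq_integral => //.
- by apply/measurable_EFinP.
- by apply/measurable_EFinP.
- by apply: filterS fg => x /= -> _.
Qed.
End real_integrals.

Section fubini.
Context d d' (X : measurableType d) (Y : measurableType d') {R : realType}.
Variables (m : {sigma_finite_measure set X -> \bar R}) (m' : {sigma_finite_measure set Y -> \bar R}).
Variable f : X * Y -> R.
Hypothesis hf : ig (pm m m') f.

Lemma fubini_ae2 : {ae m', forall y, ig m (fun x => f (x, y))}.
Proof.
have [mf h] := (igP _ _).1 hf.
have mnf : measurable_fun setT (fun z => `|f z|%:E : \bar R).
  by apply/measurable_EFinP; exact: measurableT_comp.
rewrite tonelli2 in h => //.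
have mI := mint1 m mnf (fun z => normr_ge0 (f z)).
have I0 y : (0 <= \int[m]_x `|f (x, y)|%:E)%E by exact: integral_ge0.
apply: filterS (int_lty_ae mI I0 h).
by move=> y Hy; apply/igP; split => //; exact: (measurable_fun_pair1 y mf).
Qed.

Lemma fubini_ig2 : ig m' (fun y => \int[m]_x f (x, y)).
Proof.
apply/integrableP; split.
  apply/measurable_EFinP; apply: measurableT_comp => //.
  exact: (measurable_fubini_G hf).
have [mf h] := (igP _ _).1 hf; rewrite tonelli2 in h => //; last first.
  by apply/measurable_EFinP; exact: measurableT_comp.
by apply: le_lt_trans h; apply: int_mono => // y; exact: I_abs.
Qed.

Lemma fubini2 : \int[pm m m']_z f z = \int[m']_y \int[m]_x f (x, y).
Proof.
rewrite [LHS]/Rintegral [RHS]/Rintegral; congr fine.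
rewrite -[LHS](integral21_prod_meas1 hf).
apply: ae_eq_integral => //.
- exact: (measurable_fubini_G hf).
- by apply/measurable_EFinP; exact: ig_meas fubini_ig2.
apply: filterS fubini_ae2 => y hy _ /=; rewrite -/(EFin _).
by rewrite [RHS](IE hy).
Qed.
End fubini.

Section m3_translate.
Context {R : realType}.
Local Notation X := (R * R * R)%type.

Lemma m3_translate (f : X -> \bar R) h : measurable_fun setT f -> periodicE f ->
  (\int[m3]_x f (x + h)%R = \int[m3]_x f x)%E.
Proof.
move=> mf pf; rewrite [LHS]integralE [RHS]integralE; congr (_ - _)%E.
- have pp : periodicE f^\+%E by move=> x; have [p1 p2 p3] := pf x; rewrite !funeposE p1 p2 p3.
  rewrite -[RHS](ge0_m3_translate h (measurable_funepos mf) _ pp) => [|x]; last exact: funepos_ge0.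
  by apply: eq_integral => x _; rewrite !funeposE.
- have pp : periodicE f^\-%E by move=> x; have [p1 p2 p3] := pf x; rewrite !funenegE p1 p2 p3.
  rewrite -[RHS](ge0_m3_translate h (measurable_funeneg mf) _ pp) => [|x]; last exact: funeneg_ge0.
  by apply: eq_integral => x _; rewrite !funenegE.
Qed.
End m3_translate.

(** * A trigonometric basis for the kernels *)
Section basis.
Context {R : realType}.
Implicit Types (x y : R) (n i : nat).
Local Notation cs x := (cos (pi * x)).
Local Notation sn x := (sin (pi * x)).

(** The square root of the binomial weight, so that the products of a basis function with itself
    at two points sum to the kernel. *)
Definition bcoef n i : R := Num.sqrt ('C(2 * n, i)%:R / csint n).

Definition bas n i x := bcoef n i * (cs x ^+ (2 * n - i) * sn x ^+ i).

Definition dbas n i x := bcoef n i *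
  (((2 * n - i)%:R * cs x ^+ (2 * n - i).-1 * - (pi * sn x)) * sn x ^+ i +
   cs x ^+ (2 * n - i) * (i%:R * sn x ^+ i.-1 * (pi * cs x))).

Lemma drv_bas n i : drv (bas n i) (dbas n i).
Proof. exact: (drvZ _ (drvM (drvX _ drv_cs) (drvX _ drv_sn))). Qed.

Lemma cont_bas n i : continuous (bas n i). Proof. exact: drv_cont (drv_bas n i). Qed.

Lemma cont_dbas n i : continuous (dbas n i).
Proof.
have h1 := drvM (drvX (2 * n - i) (@drv_cs R)) (drvX i (@drv_sn R)).
have h2 := drvM (drvM (drvZ (2 * n - i)%:R (drvX (2 * n - i).-1 (@drv_cs R))) (drvN (drvZ pi (@drv_sn R)))) (drvX i (@drv_sn R)).
have h3 := drvM (drvX (2 * n - i) (@drv_cs R)) (drvM (drvZ i%:R (drvX i.-1 (@drv_sn R))) (drvZ pi (@drv_cs R))).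
exact: (drv_cont (drvZ (bcoef n i) (drvD h2 h3))).
Qed.

Lemma bas1 n i x : (i < (2 * n).+1)%N -> bas n i (x + 1) = bas n i x.
Proof.
rewrite ltnS => hi; rewrite /bas cs1 sn1 -mulN1r -[- sn x]mulN1r !exprMn.
congr (_ * _); rewrite mulrACA -exprD subnK// exprM sqrrN expr1n.
by rewrite expr1n mul1r.
Qed.

(** The binomial theorem for [cos(pi (y - x)) = cos cos + sin sin] raised to the power [2n]. *)
Lemma sum_bas n x y : \sum_(i < (2 * n).+1) bas n i x * bas n i y = ker n (y - x).
Proof.
have c0 := @csint_gt0 R n.
transitivity ((csint n)^-1 * \sum_(i < (2 * n).+1)
    ((cs x * cs y) ^+ (2 * n - i) * (sn x * sn y) ^+ i) *+ 'C(2 * n, i)).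
  rewrite mulr_sumr; apply: eq_bigr => i _; rewrite /bas mulrACA -expr2 sqr_sqrtr; last first.
    by rewrite divr_ge0// ltW.
  by rewrite !exprMn -mulr_natl; field; rewrite gt_eqF.
rewrite -exprDn /ker mulrC mulrBr cosB; congr (_ ^+ _ / _); ring.
Qed.

Definition dker n x : R := (2 * n)%:R * cs x ^+ (2 * n).-1 * - (pi * sn x) * (csint n)^-1.

Lemma drv_ker n : drv (ker n) (dker n).
Proof.
apply: (drv_ext (drvM (drvX (2 * n) drv_cs) (drv_cst (csint n)^-1))) => x.
by rewrite mulr0 addr0.
Qed.

Lemma cont_dker n : continuous (dker n).
Proof.
apply: (drv_cont (drvM (drvM (drvZ (2 * n)%:R (drvX (2 * n).-1 drv_cs)) (drvN (drvZ pi drv_sn))) (drv_cst (csint n)^-1))).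
Qed.

Lemma sum_bas_dbas n x y : \sum_(i < (2 * n).+1) bas n i x * dbas n i y = dker n (y - x).
Proof.
have h1 : drv (fun y => ker n (y - x)) (fun y => dker n (y - x)).
  apply: (drv_ext (drv_comp (drv_ker n) (drvD (drv_id (R := R)) (drv_cst (- x))))) => z.
  by rewrite addr0 mulr1.
have h2 : drv (fun y => ker n (y - x)) (fun y => \sum_(i < (2 * n).+1) bas n i x * dbas n i y).
  rewrite -(funext (fun y => sum_bas n x y)); apply: drv_sum => i.
  by apply: drvZ; exact: drv_bas.
by have [_ <-] := h1 y; have [_ <-] := h2 y.
Qed.

Lemma dkerN n x : dker n (- x) = - dker n x.
Proof. by rewrite /dker [in cos _]mulrN cosN [in sin _]mulrN sinN; ring. Qed.

Lemma ker_succ_le n x : ker n.+1 x <= 2 * ker n x.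
Proof.
have c0 := @csint_gt0 R n; have n0 : 0 <= n%:R :> R by [].
have h := ker_cs2 n x.
have h2 : ker n x * cs x ^+ 2 <= ker n x.
  by rewrite cs2sn2 ler_piMr ?ker_ge0// lerBlDr lerDl sqr_ge0.
have := ker_ge0 n.+1 x; move: h h2.
have -> : (2 * n%:R + 1) / (2 * n%:R + 2) = 1 - (2 * n%:R + 2)^-1 :> R by field; lra.
have : (2 * n%:R + 2)^-1 <= 2^-1 :> R by rewrite lef_pV2 ?posrE//; lra.
move: ((2 * n%:R + 2)^-1) (ker n x) (ker n.+1 x) (cs x ^+ 2) => a k k' c; nra.
Qed.

(** One factor of the cosine is traded for the sine: the derivative of the kernel is the next
    lower kernel times [n] times the distance to the integers. *)
Lemma dker_le n x : `|dker n.+1 x| <= 8 * pi * n.+1%:R * ker n x * `|sn x|.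
Proof.
have c0 := @csint_gt0 R n; have n0 : 0 <= n%:R :> R by [].
have E : dker n.+1 x = - (pi * sn x * cs x * ker n x) * ((2 * n%:R + 2) ^+ 2 / (2 * n%:R + 1)).
  have -> : dker n.+1 x = - ((2 * n%:R + 2) * cs x ^+ (2 * n).+1 * (pi * sn x) / csint n.+1).
    rewrite /dker mulnS add2n /=; rewrite -[in (2 * n).+2%:R]addn2 natrD natrM; ring.
  rewrite csint_succ /ker exprS; field.
  by rewrite !gt_eqF//; lra.
have h1 : (2 * n%:R + 2) ^+ 2 / (2 * n%:R + 1) <= 8 * n.+1%:R :> R.
  by rewrite ler_pdivrMr; [rewrite -natr1; nra|lra].
have h4 : 0 <= (2 * n%:R + 2) ^+ 2 / (2 * n%:R + 1) :> R by rewrite divr_ge0.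
have h2 : `|cs x| <= 1.
  by rewrite -(@ler_pXn2r _ 2)// ?nnegrE// real_normK ?num_real// expr1n cs2sn2 lerBlDr lerDl sqr_ge0.
rewrite {}E; move: (ker_ge0 n x) h1 h4; move: (ker n x) (_ / _) => k q k0 h1 h4.
rewrite normrM normrN !normrM (ger0_norm k0) (gtr0_norm (pi_gt0 R)) (ger0_norm h4).
have h3 : 0 <= pi * `|sn x| * k by rewrite !mulr_ge0// ltW ?pi_gt0.
rewrite [leLHS](_ : _ = (pi * `|sn x| * k) * (`|cs x| * q)); last by ring.
rewrite [leRHS](_ : _ = (pi * `|sn x| * k) * (8 * n.+1%:R)); last by ring.
apply: ler_wpM2l => //; apply: le_trans h1.
by rewrite ler_piMl.
Qed.
End basis.

(** * Smoothing on the torus *)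
Section bounded.
Context {X : Type} {R : realType}.
Implicit Types (f g : X -> R).

Definition bd f := exists M, forall x, `|f x| <= M.

Lemma bd_cst (c : R) : bd (fun=> c). Proof. by exists `|c|. Qed.

Lemma bdD f g : bd f -> bd g -> bd (fun x => f x + g x).
Proof.
by move=> [M hM] [N hN]; exists (M + N) => x; rewrite (le_trans (ler_normD _ _))// lerD.
Qed.

Lemma bdM f g : bd f -> bd g -> bd (fun x => f x * g x).
Proof. by move=> [M hM] [N hN]; exists (M * N) => x; rewrite normrM ler_pM. Qed.

Lemma bdN f : bd f -> bd (fun x => - f x).
Proof. by move=> [M hM]; exists M => x; rewrite normrN. Qed.

Lemma bdX f n : bd f -> bd (fun x => f x ^+ n).
Proof. by move=> [M hM]; exists (M ^+ n) => x; rewrite normrX lerXn2r// ?nnegrE// (le_trans _ (hM x)). Qed.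

Lemma bd_sum (I : Type) (r : seq I) (F : I -> X -> R) : (forall i, bd (F i)) ->
  bd (fun x => \sum_(i <- r) F i x).
Proof.
move=> hF; elim: r => [|i r IH].
  by under eq_fun do rewrite big_nil; exact: bd_cst.
by under eq_fun do rewrite big_cons; exact: bdD.
Qed.
End bounded.

Lemma bd_comp (X Y : Type) (R : realType) (f : Y -> R) (g : X -> Y) : bd f -> bd (fun x => f (g x)).
Proof. by move=> [M hM]; exists M. Qed.

Lemma ig_bd d (X : measurableType d) (R : realType) (mu : {measure set X -> \bar R}) (f : X -> R) :
  mu setT = 1%E -> measurable_fun setT f -> bd f -> ig mu f.
Proof.
move=> m1 mf [M hM]; apply/igP; split => //.
apply: (@le_lt_trans _ _ (\int[mu]_x M%:E)%E); first by apply: int_mono => x; rewrite lee_fin.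
by rewrite (integral_cst1 _ m1) ltry.
Qed.

Lemma igM_bd d (X : measurableType d) (R : realType) (mu : {measure set X -> \bar R}) (f g : X -> R) :
  ig mu f -> measurable_fun setT g -> bd g -> ig mu (fun x => f x * g x).
Proof. by move=> hf mg [M hM]; exact: igM hM. Qed.

Lemma bd_bas (R : realType) n i : bd (@bas R n i).
Proof.
have bc : bd (fun x : R => cos (pi * x)).
  by exists 1 => x; rewrite ler_norml cos_geN1 cos_le1.
have bs : bd (fun x : R => sin (pi * x)).
  by exists 1 => x; rewrite ler_norml sin_geN1 sin_le1.
by apply: bdM; [exact: bd_cst|apply: bdM; exact: bdX].
Qed.

Lemma bd_dbas (R : realType) n i : bd (@dbas R n i).
Proof.
have bc : bd (fun x : R => cos (pi * x)).
  by exists 1 => x; rewrite ler_norml cos_geN1 cos_le1.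
have bs : bd (fun x : R => sin (pi * x)).
  by exists 1 => x; rewrite ler_norml sin_geN1 sin_le1.
apply: bdM; first exact: bd_cst.
apply: bdD.
  apply: bdM; last exact: bdX.
  apply: bdM; first by apply: bdM; [exact: bd_cst|exact: bdX].
  by apply: bdN; apply: bdM; [exact: bd_cst|].
apply: bdM; first exact: bdX.
apply: bdM; first by apply: bdM; [exact: bd_cst|exact: bdX].
by apply: bdM; [exact: bd_cst|].
Qed.

Inductive axis := Ax1 | Ax2 | Ax3.

Section basis3.
Context {R : realType}.
Local Notation X := (R * R * R)%type.
Local Notation sn x := (sin (pi * x)).
Implicit Types (a : axis) (x y : X) (n : nat).

Definition co a x : R := match a with Ax1 => x.1.1 | Ax2 => x.1.2 | Ax3 => x.2 end.
Definition un a : X := match a with Ax1 => e_x | Ax2 => e_y | Ax3 => e_z end.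

Definition isax a a' : bool :=
  match a, a' with Ax1, Ax1 | Ax2, Ax2 | Ax3, Ax3 => true | _, _ => false end.

Definition idx n := ('I_(2 * n).+1 * 'I_(2 * n).+1 * 'I_(2 * n).+1)%type.

Definition bsel (d : bool) n i : R -> R := if d then dbas n i else bas n i.
Definition ksel (d : bool) n : R -> R := if d then dker n else ker n.

(** Tensor products of the one-dimensional basis; [deb] differentiates along one axis. *)
Definition eb n (J : idx n) x : R := bas n J.1.1 x.1.1 * bas n J.1.2 x.1.2 * bas n J.2 x.2.

Definition deb n a (J : idx n) x : R :=
  bsel (isax a Ax1) n J.1.1 x.1.1 * bsel (isax a Ax2) n J.1.2 x.1.2 * bsel (isax a Ax3) n J.2 x.2.

Definition dker3 n a x : R :=
  ksel (isax a Ax1) n x.1.1 * ksel (isax a Ax2) n x.1.2 * ksel (isax a Ax3) n x.2.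

Lemma sum3 n (F G H : 'I_(2 * n).+1 -> R) :
  \sum_(J : idx n) F J.1.1 * G J.1.2 * H J.2 = (\sum_i F i) * (\sum_i G i) * (\sum_i H i).
Proof.
rewrite -(pair_bigA _ (fun (p : 'I_(2 * n).+1 * 'I_(2 * n).+1) k => F p.1 * G p.2 * H k))/=.
rewrite -(pair_bigA _ (fun i j => \sum_k F i * G j * H k))/=.
rewrite !mulr_suml; apply: eq_bigr => i _.
rewrite -mulrA mulr_suml mulr_sumr; apply: eq_bigr => j _.
by rewrite !mulr_sumr; apply: eq_bigr => k _; rewrite mulrA.
Qed.

Lemma sum_eb n x y : \sum_(J : idx n) eb J x * eb J y = ker3 n (y - x).
Proof.
rewrite /ker3 /= -!sum_bas -sum3; apply: eq_bigr => J _; rewrite /eb; ring.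
Qed.

Lemma sum_eb_deb n a x y : \sum_(J : idx n) eb J x * deb a J y = dker3 n a (y - x).
Proof.
have h d r s : \sum_(i < (2 * n).+1) bas n i r * bsel d n i s = ksel d n (s - r).
  by case: d; [exact: sum_bas_dbas|exact: sum_bas].
rewrite /dker3 /= -!h -sum3; apply: eq_bigr => J _; rewrite /eb /deb; ring.
Qed.

Lemma dker3N n a x : dker3 n a (- x) = - dker3 n a x.
Proof. by case: a; rewrite /dker3 /= !dkerN !kerN; ring. Qed.

Lemma sum_deb_eb n a x y : \sum_(J : idx n) deb a J x * eb J y = - dker3 n a (y - x).
Proof.
rewrite -dker3N opprB -sum_eb_deb; apply: eq_bigr => J _; exact: mulrC.
Qed.

Lemma drv_eb n a (J : idx n) x :
  drv (fun r => eb J (x + r *: un a)) (fun r => deb a J (x + r *: un a)).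
Proof.
have hb i c k : drv (fun r : R => bas n i (c + r * k)) (fun r => dbas n i (c + r * k) * k).
  apply: (drv_ext (drv_comp (drv_bas n i) (drvD (drv_cst c) (drvM (drv_id (R := R)) (drv_cst k))))) => r.
  by rewrite add0r mulr0 addr0 mul1r.
apply: (drv_ext (drvM (drvM (hb _ _ _) (hb _ _ _)) (hb _ _ _))) => r.
have E1 : (x + r *: un a).1.1 = x.1.1 + r * (un a).1.1 by [].
have E2 : (x + r *: un a).1.2 = x.1.2 + r * (un a).1.2 by [].
have E3 : (x + r *: un a).2 = x.2 + r * (un a).2 by [].
by rewrite /deb E1 E2 E3; case: a {E1 E2 E3}; rewrite /bsel /=; ring.
Qed.

Lemma eb_periodic n (J : idx n) : torus_periodic (eb J).
Proof.
by move=> x; rewrite /eb /=; split; rewrite !addr0 bas1.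
Qed.

Lemma bd_bsel d n i : bd (bsel d n i). Proof. by case: d; [exact: bd_dbas|exact: bd_bas]. Qed.

Lemma cont_bsel d n i : continuous (bsel d n i).
Proof. by case: d; [exact: cont_dbas|exact: cont_bas]. Qed.

Lemma cont_ksel d n : continuous (ksel d n).
Proof. by case: d; [exact: cont_dker|exact: drv_cont (drv_ker n)]. Qed.

Lemma bd_eb n (J : idx n) : bd (eb J).
Proof. by apply: bdM; [apply: bdM|]; apply: bd_comp; exact: bd_bas. Qed.

Lemma bd_deb n a (J : idx n) : bd (deb a J).
Proof. by apply: bdM; [apply: bdM|]; apply: bd_comp; exact: bd_bsel. Qed.

Lemma m_prod3 (f g h : R -> R) : continuous f -> continuous g -> continuous h ->
  measurable_fun setT (fun x : X => f x.1.1 * g x.1.2 * h x.2).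
Proof.
move=> cf cg ch; have mid := @measurable_id _ X setT.
apply: measurable_funM; [apply: measurable_funM|].
- by apply: (mcomp (cont_meas cf)); apply: mfst; exact: mfst.
- by apply: (mcomp (cont_meas cg)); apply: msnd; exact: mfst.
- by apply: (mcomp (cont_meas ch)); exact: msnd.
Qed.

Lemma m_eb n (J : idx n) : measurable_fun setT (eb J).
Proof. by apply: m_prod3; exact: cont_bas. Qed.

Lemma m_deb n a (J : idx n) : measurable_fun setT (deb a J).
Proof. by apply: m_prod3; exact: cont_bsel. Qed.

Lemma m_dker3 n a : measurable_fun setT (dker3 n a).
Proof. by apply: m_prod3; exact: cont_ksel. Qed.

Lemma m_ker3 n : measurable_fun setT (@ker3 R n).
Proof. by apply: m_prod3; exact: drv_cont (drv_ker n). Qed.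

Lemma ker3_ge0 n x : 0 <= ker3 n x.
Proof. by apply: mulr_ge0; [apply: mulr_ge0|]; exact: ker_ge0. Qed.

Lemma dker3_le n a x : `|dker3 n.+1 a x| <= 32 * pi * n.+1%:R * ker3 n x * `|sn (co a x)|.
Proof.
have P (d k1 k2 l1 l2 c s : R) : 0 <= k1 -> 0 <= k2 -> 0 <= l1 -> 0 <= l2 -> l1 <= 2 * k1 -> l2 <= 2 * k2 ->
    `|d| <= c * s -> `|d| * (l1 * l2) <= 4 * (c * s * (k1 * k2)).
  move=> k10 k20 l10 l20 h1 h2 h.
  rewrite [leRHS](_ : _ = (c * s) * (2 * k1 * (2 * k2))); last by ring.
  apply: ler_pM => //; first by rewrite mulr_ge0.
  exact: ler_pM.
have := P _ _ _ _ _ _ _ (ker_ge0 n _) (ker_ge0 n _) (ker_ge0 n.+1 _) (ker_ge0 n.+1 _) (ker_succ_le n _) (ker_succ_le n _) (dker_le n _).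
move=> {}P.
have Q (v b c d : R) : 0 <= c -> 0 <= d -> v = b * (c * d) -> `|v| = `|b| * (c * d).
  by move=> c0 d0 ->; rewrite normrM (ger0_norm (mulr_ge0 c0 d0)).
have Z (b c d : R) : b = d -> c <= d -> c <= b by move=> ->.
case: a; rewrite /dker3 /ker3 /ksel /=.
- rewrite (Q _ (dker n.+1 x.1.1) (ker n.+1 x.1.2) (ker n.+1 x.2)) ?ker_ge0//; last by ring.
  by apply: Z (P x.1.1 x.1.2 x.2); ring.
- rewrite (Q _ (dker n.+1 x.1.2) (ker n.+1 x.1.1) (ker n.+1 x.2)) ?ker_ge0//; last by ring.
  by apply: Z (P x.1.2 x.1.1 x.2); ring.
- rewrite (Q _ (dker n.+1 x.2) (ker n.+1 x.1.1) (ker n.+1 x.1.2)) ?ker_ge0//; last by ring.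
  by apply: Z (P x.2 x.1.1 x.1.2); ring.
Qed.

Lemma int_dbas n i : (i < (2 * n).+1)%N -> \int[nu]_r dbas n i r = 0 :> R.
Proof.
move=> hi; rewrite /Rintegral (FTC_nu (drv_bas n i) (@cont_dbas _ n i)) /=.
by rewrite -[X in bas n i X]add0r bas1// subrr.
Qed.
End basis3.

Section int_prod.
Context d d' (X : measurableType d) (Y : measurableType d') {R : realType}.
Variables (m : {sigma_finite_measure set X -> \bar R}) (m' : {sigma_finite_measure set Y -> \bar R}).
Hypotheses (m1 : m setT = 1%E) (m1' : m' setT = 1%E).

Lemma int_prod (f : X -> R) (g : Y -> R) : measurable_fun setT f -> bd f ->
  measurable_fun setT g -> bd g ->
  \int[pm m m']_z (f z.1 * g z.2) = (\int[m]_x f x) * \int[m']_y g y.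
Proof.
move=> mf bf mg bg.
have hf : ig m f by exact: ig_bd.
have hg : ig m' g by exact: ig_bd.
rewrite fubini2; last first.
  apply: ig_bd; first exact: pm1.
    apply: measurable_funM; first by apply: (mcomp mf); apply: mfst; exact: measurable_id.
    by apply: (mcomp mg); apply: msnd; exact: measurable_id.
  by apply: bdM; exact: bd_comp.
by rewrite -IZ//; apply: I_eq => y; rewrite /= IZr.
Qed.
End int_prod.

Section smoothing.
Context {R : realType}.
Local Notation X := (R * R * R)%type.
Local Notation sn x := (sin (pi * x)).
Implicit Types (a : axis) (x y : X) (n : nat) (f g : X -> R).

Lemma int_deb n a (J : idx n) : \int[m3]_x deb a J x = 0 :> R.
Proof.
have h := @nu_setT R.
have mb d i : measurable_fun setT (bsel d n i : R -> R) by apply: cont_meas; exact: cont_bsel.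
have hb d i := @bd_bsel R d n i.
rewrite /m3 (@int_prod _ _ _ _ _ (pm nu nu) nu (pm1 h h) h
  (fun p => bsel (isax a Ax1) n J.1.1 p.1 * bsel (isax a Ax2) n J.1.2 p.2) (bsel (isax a Ax3) n J.2))//; last 2 first.
- apply: measurable_funM; [apply: (mcomp (mb _ _)); apply: mfst|apply: (mcomp (mb _ _)); apply: msnd]; exact: measurable_id.
- by apply: bdM; exact: bd_comp.
rewrite int_prod//.
by case: a; rewrite /bsel /= int_dbas// !(mul0r, mulr0).
Qed.

(** Smoothing is the finite sum [sm], so it is a trigonometric polynomial and its derivatives
    are obtained by differentiating the basis functions. *)
Definition coef n f (J : idx n) : R := \int[m3]_x (f x * eb J x).
Definition sm n f x : R := \sum_(J : idx n) coef f J * eb J x.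
Definition dsm n a f x : R := \sum_(J : idx n) coef f J * deb a J x.

Lemma ig_eb n f (J : idx n) : ig m3 f -> ig m3 (fun x => f x * eb J x).
Proof. by move=> hf; apply: igM_bd => //; [exact: m_eb|exact: bd_eb]. Qed.

(** The finite sum is the convolution with the kernel. *)
Lemma smE n f x : ig m3 f -> sm n f x = \int[m3]_y (ker3 n (y - x) * f y).
Proof.
move=> hf; rewrite /sm; transitivity (\int[m3]_y (\sum_(J : idx n) eb J x * (f y * eb J y))).
  rewrite I_sum; last by move=> J; apply: igZ; exact: ig_eb.
  by apply: eq_bigr => J _; rewrite IZ ?ig_eb// mulrC.
apply: I_eq => y; rewrite -sum_eb mulr_suml; apply: eq_bigr => J _; ring.
Qed.

Lemma dsmE n a f x : ig m3 f -> dsm n a f x = \int[m3]_y (- dker3 n a (y - x) * f y).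
Proof.
move=> hf; rewrite /dsm; transitivity (\int[m3]_y (\sum_(J : idx n) deb a J x * (f y * eb J y))).
  rewrite I_sum; last by move=> J; apply: igZ; exact: ig_eb.
  by apply: eq_bigr => J _; rewrite IZ ?ig_eb// mulrC.
apply: I_eq => y; rewrite -sum_deb_eb mulr_suml; apply: eq_bigr => J _; ring.
Qed.

Lemma drv_sm n a f x :
  drv (fun r => sm n f (x + r *: un a)) (fun r => dsm n a f (x + r *: un a)).
Proof. by apply: drv_sum => J; apply: drvZ; exact: drv_eb. Qed.

Lemma m_sm n f : measurable_fun setT (sm n f).
Proof. by apply: measurable_sum => J; apply: measurable_funM => //; exact: m_eb. Qed.

Lemma m_dsm n a f : measurable_fun setT (dsm n a f).
Proof. by apply: measurable_sum => J; apply: measurable_funM => //; exact: m_deb. Qed.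

Lemma bd_sm n f : bd (sm n f).
Proof. by apply: bd_sum => J; apply: bdM; [exact: bd_cst|exact: bd_eb]. Qed.

Lemma bd_dsm n a f : bd (dsm n a f).
Proof. by apply: bd_sum => J; apply: bdM; [exact: bd_cst|exact: bd_deb]. Qed.

Lemma sm_periodic n f : torus_periodic (sm n f).
Proof.
by move=> x; split; apply: eq_bigr => J _; have [h1 h2 h3] := eb_periodic J x; rewrite ?h1 ?h2 ?h3.
Qed.

Lemma ker3_periodic n : torus_periodic (@ker3 R n).
Proof. by move=> x; rewrite /ker3 /=; split; rewrite !addr0 ker1. Qed.

Lemma periodic_shift f h : torus_periodic f -> torus_periodic (fun x => f (x + h)).
Proof.
by move=> pf x; split; rewrite addrAC; have [h1 h2 h3] := pf (x + h); rewrite ?h1 ?h2 ?h3.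
Qed.

Lemma m_shift f h : measurable_fun setT f -> measurable_fun setT (fun x : X => f (x + h)).
Proof.
move=> mf; apply: (mcomp mf).
exact: (madd (@measurable_id _ _ _) (measurable_cst h)).
Qed.

Lemma sm_shift n f h x : ig m3 f -> ig m3 (fun x => f (x + h)) -> torus_periodic f ->
  sm n f (x + h) = sm n (fun x => f (x + h)) x.
Proof.
move=> hf hfh pf; rewrite !smE// /Rintegral; congr fine.
rewrite -[LHS](@m3_translate _ (fun y => (ker3 n (y - (x + h)) * f y)%:E) h).
- by apply: eq_integral => y _; rewrite /= opprD addrACA subrr addr0.
- apply/measurable_EFinP; apply: measurable_funM; last exact: ig_meas hf.
  exact: (m_shift (- (x + h)) (m_ker3 n)).
- move=> y; have [h1 h2 h3] := pf y.
  have [k1 k2 k3] := periodic_shift (- (x + h)) (@ker3_periodic n) y.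
  by rewrite k1 k2 k3 h1 h2 h3.
Qed.

Lemma sm_le n f x : ig m3 f -> torus_periodic f ->
  (`|sm n f x|%:E <= \int[m3]_xi (ker3 n xi * `|f (x + xi)|)%:E)%E.
Proof.
move=> hf pf; rewrite smE//; apply: le_trans (I_abs _ _) _.
have mf := ig_meas hf.
have mk : measurable_fun setT (fun y => (`|ker3 n (y - x) * f y|)%:E).
  apply/measurable_EFinP; apply: measurableT_comp => //; apply: measurable_funM => //.
  exact: (m_shift (- x) (m_ker3 n)).
rewrite -(ge0_m3_translate x mk) => [|y|y].
- apply: int_mono => y; first by rewrite lee_fin.
  by rewrite addrK lee_fin normrM ger0_norm ?ker3_ge0// [y + x]addrC.
- by rewrite lee_fin.
- have [h1 h2 h3] := pf y.
  have [k1 k2 k3] := periodic_shift (- x) (@ker3_periodic n) y.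
  by rewrite k1 k2 k3 h1 h2 h3.
Qed.

Lemma int_ker3 n : (\int[m3]_x (ker3 n x)%:E = 1 :> \bar R)%E.
Proof. by rewrite -[RHS](k_int ker32P n 0); apply: eq_integral => x _; rewrite /ker32 subr0. Qed.

Lemma nm_shift p f h : 0 < p -> measurable_fun setT f -> torus_periodic f ->
  nm m3 p (fun x => f (x + h)) = nm m3 p f.
Proof.
move=> p0 mf pf; have p0' : p != 0 by rewrite gt_eqF.
rewrite (nmE _ _ p0') [RHS](nmE _ _ p0').
rewrite (@ge0_m3_translate _ (fun x => (`|f x| `^ p)%:E) h)//.
- by apply/measurable_EFinP; exact: mpow.
- by move=> x; have [h1 h2 h3] := pf x; rewrite h1 h2 h3.
Qed.

Lemma nm_sm p n f : 1 < p -> ig m3 f -> torus_periodic f -> (nm m3 p (sm n f) <= nm m3 p f)%E.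
Proof.
move=> p1 hf pf; have p0 : 0 < p by exact: lt_trans p1.
have mf := ig_meas hf.
apply: (@nm_average _ _ _ m3 _ _ m3 p (ker3 n) (fun x xi => f (x + xi)) (sm n f) (nm m3 p f)) => //.
- exact: nm_ge0.
- exact: m_ker3.
- exact: ker3_ge0.
- by rewrite int_ker3.
- apply: (mcomp mf); apply: madd; [apply: mfst|apply: msnd]; exact: measurable_id.
- by move=> x; exact: sm_le.
by move=> xi; rewrite nm_shift.
Qed.

(** Tonelli, since the kernel is a probability density. *)
Lemma sm_osc n f : ig m3 f -> (\int[m3]_x `|sm n f x - f x|%:E <= osc m3 ker32 n f)%E.
Proof.
move=> hf; apply: int_mono => x; first by rewrite lee_fin.
have hk : ig m3 (fun y => ker3 n (y - x)).
  apply/igP; split; first exact: (m_shift (- x) (m_ker3 n)).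
  rewrite (@le_lt_trans _ _ 1%E) ?ltry//.
  rewrite -(k_int ker32P n x); apply: int_mono => y; first by rewrite lee_fin.
  by rewrite ger0_norm ?ker3_ge0.
have hkf : ig m3 (fun y => ker3 n (y - x) * f y).
  have E y : ker3 n (y - x) * f y = \sum_(J : idx n) eb J x * (f y * eb J y).
    rewrite -sum_eb mulr_suml; apply: eq_bigr => J _; ring.
  rewrite (funext E); apply: ig_sum => J; apply: igZ; exact: ig_eb.
have -> : sm n f x - f x = \int[m3]_y (ker3 n (y - x) * (f y - f x)).
  transitivity (\int[m3]_y (ker3 n (y - x) * f y - ker3 n (y - x) * f x)); last first.
    by apply: I_eq => y; rewrite mulrBr.
  rewrite IB//; last first.
    by under eq_fun do rewrite mulrC; exact: igZ.
  rewrite -smE// IZr//; congr (_ - _).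
  rewrite [X in X * _](_ : _ = 1) ?mul1r//.
  by rewrite /Rintegral (k_int ker32P n x).
apply: le_trans (I_abs _ _) _; apply: int_mono => y; first by rewrite lee_fin.
by rewrite normrM ger0_norm ?ker3_ge0.
Qed.

Lemma sm_tozero f : ig m3 f -> tozero (fun n => \int[m3]_x `|sm n f x - f x|%:E)%E.
Proof.
move=> hf; apply: (tozero_le (fun n => sm_osc n hf)).
by have [mf h] := (igP _ _).1 hf; exact: approx_id_ker3.
Qed.

(** Almost everywhere convergence along a subsequence is all that the Fatou arguments need. *)
Lemma sm_cvg_ae f : ig m3 f -> exists k : nat -> nat,
  {ae (m3 : {measure set X -> \bar R}), forall x, sm (k n) f x @[n --> \oo] --> f x}.
Proof.
move=> hf; apply: (@mean_cvg_ae _ _ _ m3 (fun n => sm n f) f); [by move=> n; exact: m_sm|exact: ig_meas hf|].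
by move=> e e0; have [N HN] := sm_tozero hf e0; exists N; exact: HN.
Qed.

End smoothing.

(** * Increments and difference quotients *)
Section sequences.
Context {R : realType}.
Implicit Types (h : nat -> R) (F : R -> R).

Lemma cvg_harm h : (forall k, 0 <= h k <= k.+1%:R^-1) -> h n @[n --> \oo] --> 0.
Proof.
move=> hh; apply: (@squeeze_cvgr _ _ _ _ (fun=> 0) (@harmonic R)).
- by apply: nearW.
- exact: cvg_cst.
- exact: cvg_harmonic.
Qed.

Lemma drv_quotient F f x h : drv F f -> (forall k, h k != 0) -> h n @[n --> \oo] --> 0 ->
  (h n)^-1 * (F (x + h n) - F x) @[n --> \oo] --> f x.
Proof.
move=> dF h0 hc; have [dv <-] := dF x.
have hd : h n @[n --> \oo] --> 0^'.
  move=> A hA.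
  have hc' : \forall n \near \oo, h n != 0 -> A (h n) by exact: (hc _ hA).
  by apply: filterS hc' => n; apply; exact: h0.
have := cvg_comp _ _ hd dv; apply: cvg_trans; apply: near_eq_cvg; apply: nearW => n /=.
by rewrite scaler1 [h n + x]addrC.
Qed.

Lemma drv_seq F f x h : drv F f -> h n @[n --> \oo] --> x -> F (h n) @[n --> \oo] --> F x.
Proof. by move=> dF hx; exact: (cvg_comp _ _ hx (drv_cont dF (x := x))). Qed.

Lemma limn_einf_freq (a : nat -> \bar R) (A e : R) : (limn_einf a <= A%:E)%E -> 0 < e ->
  exists j : nat -> nat, forall k, (k <= j k)%N /\ (a (j k) <= (A + e)%:E)%E.
Proof.
move=> ha e0.
have H k : exists j, (k <= j)%N /\ (a j <= (A + e)%:E)%E.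
  apply: contrapT => /forallNP H.
  have : ((A + e)%:E <= limn_einf a)%E.
    rewrite limn_einf_lim; apply: (@le_trans _ _ (einfs a k)); last first.
      rewrite (cvg_lim _ (@cvg_einfs_sup _ a))//.
      by apply: ereal_sup_ubound; exists k.
    apply: le_ereal_inf_tmp => _ [i /= ki <-]; rewrite leNgt; apply/negP => /ltW hi.
    exact: (H i).
  by move=> /le_trans /(_ ha); rewrite lee_fin leNgt ltrDl e0.
have [j hj] := choice H; by exists j.
Qed.
End sequences.

Section static.
Context {R : realType}.
Local Notation X := (R * R * R)%type.
Local Notation sn x := (sin (pi * x)).
Implicit Types (a : axis) (x y h : X) (n : nat) (f g : X -> R) (A : R).

(** The exponent for which two factors in [L^pp] leave room for exactly one factor in [L^9]. *)
Definition pp : R := 9 / 4.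

Lemma pp1 : 1 < pp. Proof. by rewrite /pp; lra. Qed.
Lemma pp0 : 0 < pp. Proof. by rewrite /pp; lra. Qed.
Lemma ppn0 : pp != 0. Proof. by rewrite gt_eqF ?pp0. Qed.

Definition dif h f x := f (x + h) - f x.

(** Difference quotients along dyadic steps. A lower limit over countably many steps is
    measurable in parameters, which a supremum over all steps would not obviously be. *)
Definition dq a f (j : nat) : \bar R :=
  ((2 ^+ j)%:E * nm m3 pp (dif ((2 ^+ j)^-1 *: un a) f))%E.

(** The size of a function and of its weak first derivatives in [L^pp], without mention of weak
    derivatives: boundedness along infinitely many dyadic steps is enough. *)
Record stat f A : Prop := Stat {
  stat_meas : measurable_fun setT f ;
  stat_per : torus_periodic f ;
  stat_nm : (nm m3 pp f <= A%:E)%E ;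
  stat_dq : forall a, (limn_einf (dq a f) <= A%:E)%E }.

Lemma ig_nm p f : 1 < p -> measurable_fun setT f -> (nm m3 p f < +oo)%E -> ig m3 f.
Proof.
move=> p1 mf h; apply/igP; split => //.
rewrite (_ : (\int[m3]_x `|f x|%:E)%E = nm m3 1 f).
  by apply: le_lt_trans h; apply: nm_incr => //; exact: m3_setT.
rewrite (nmE _ _ (oner_neq0 R)) invr1 poweRe1; last by apply: integral_ge0 => x _; rewrite lee_fin powR_ge0.
by apply: eq_integral => x _; rewrite powRr1.
Qed.

Lemma stat_ig f A : stat f A -> ig m3 f.
Proof.
by move=> [mf _ h _]; apply: (ig_nm pp1 mf); apply: le_lt_trans h _; rewrite ltry.
Qed.

Lemma stat_ge0 f A : stat f A -> 0 <= A.
Proof. by move=> [_ _ h _]; rewrite -lee_fin; apply: le_trans h; exact: nm_ge0. Qed.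

Lemma m_dif h f : measurable_fun setT f -> measurable_fun setT (dif h f).
Proof. by move=> mf; apply: measurable_funB => //; exact: m_shift. Qed.

Lemma dif_per h f : torus_periodic f -> torus_periodic (dif h f).
Proof.
move=> pf x; have [h1 h2 h3] := pf x; have [k1 k2 k3] := periodic_shift h pf x.
by split; rewrite /dif ?k1 ?k2 ?k3 ?h1 ?h2 ?h3.
Qed.

Lemma ig_shift h f : ig m3 f -> torus_periodic f -> ig m3 (fun x => f (x + h)).
Proof.
move=> /igP[mf i] pf; apply/igP; split; first exact: m_shift.
rewrite (@ge0_m3_translate _ (fun x => `|f x|%:E) h)//.
- by apply/measurable_EFinP; exact: measurableT_comp.
- by move=> x; have [h1 h2 h3] := pf x; rewrite h1 h2 h3.
Qed.

Lemma ig_dif h f : ig m3 f -> torus_periodic f -> ig m3 (dif h f).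
Proof. by move=> i pf; apply: igB => //; exact: ig_shift. Qed.

Lemma smB n f g x : ig m3 f -> ig m3 g -> sm n (fun x => f x - g x) x = sm n f x - sm n g x.
Proof.
move=> hf hg; rewrite /sm -sumrB; apply: eq_bigr => J _; rewrite -mulrBl; congr (_ * _).
rewrite /coef -IB; [|exact: ig_eb|exact: ig_eb].
by apply: I_eq => y; rewrite mulrBl.
Qed.

Lemma dif_sm n h f x : ig m3 f -> torus_periodic f -> dif h (sm n f) x = sm n (dif h f) x.
Proof.
move=> hf pf; rewrite /dif smB ?sm_shift//; exact: ig_shift.
Qed.

Lemma dq_sm a n f j : ig m3 f -> torus_periodic f -> (dq a (sm n f) j <= dq a f j)%E.
Proof.
move=> hf pf; apply: lee_wpmul2l; first by rewrite lee_fin exprn_ge0.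
rewrite (funext (fun x => dif_sm n ((2 ^+ j)^-1 *: un a) x hf pf)).
by apply: nm_sm; [exact: pp1|exact: ig_dif|exact: dif_per].
Qed.

Lemma nm_dif_mul p h f (k : nat) (C : R) : 1 <= p -> measurable_fun setT f -> torus_periodic f ->
  (nm m3 p (dif h f) <= C%:E)%E -> (nm m3 p (dif (k%:R *: h) f) <= (k%:R * C)%:E)%E.
Proof.
move=> p1 mf pf hC; have p0 : 0 < p by apply: lt_le_trans p1.
elim: k => [|k IH].
  rewrite scale0r mul0r; apply: (nm_leP _ _ p0 (lexx _)).1.
  rewrite integral0_eq ?poweR_ge0// => x _.
  by rewrite /dif addr0 subrr normr0 powR0// gt_eqF.
have -> : dif (k.+1%:R *: h) f = fun x => dif (k%:R *: h) f (x + h) + dif h f x.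
  apply/funext => x; rewrite /dif -natr1 scalerDl scale1r.
  by rewrite [k%:R *: h + h]addrC addrA addrA subrK.
apply: le_trans (@nmD _ _ _ m3 p (fun x => dif (k%:R *: h) f (x + h)) (dif h f) _ _ p1) _.
- by apply: m_shift; exact: m_dif.
- exact: m_dif.
rewrite -natr1 mulrDl mul1r EFinD; apply: leeD => //.
by rewrite nm_shift//; [exact: m_dif|exact: dif_per].
Qed.

Lemma dyadic_harm (j : nat -> nat) : (forall k, (k <= j k)%N) ->
  forall k, 0 <= (2 ^+ j k)^-1 :> R /\ (2 ^+ j k)^-1 <= k.+1%:R^-1 :> R.
Proof.
move=> hj k; split; first by rewrite invr_ge0 exprn_ge0.
rewrite lef_pV2 ?posrE ?exprn_gt0//.
rewrite -natrX ler_nat; apply: leq_trans (ltn_expl k (ltnSn 1)) _.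
by rewrite leq_exp2l.
Qed.

Section estimates.
Variables (f : X -> R) (A : R).
Hypothesis sf : stat f A.

Let if_ := stat_ig sf.
Let pf := stat_per sf.
Let mf := stat_meas sf.
Let A0 := stat_ge0 sf.

Lemma dq_freq a e : 0 < e -> exists j : nat -> nat, (forall k, (k <= j k)%N) /\
  forall k n, (nm m3 pp (dif ((2 ^+ j k)^-1 *: un a) (sm n f)) <= ((2 ^+ j k)^-1 * (A + e))%:E)%E.
Proof.
move=> e0; have [j hj] := limn_einf_freq (stat_dq sf a) e0.
exists j; split=> [k|k n]; first by have [] := hj k.
have [_ h] := hj k; have := le_trans (dq_sm a n (j k) if_ pf) h.
rewrite /dq muleC -lee_pdivlMr ?exprn_gt0//.
by rewrite muleC -EFinM.
Qed.

(** Smoothing commutes with differences and does not increase norms; the difference quotient of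
    the smooth function converges to its derivative along the dyadic steps, and Fatou applies. *)
Lemma nm_dsm a n : (nm m3 pp (dsm n a f) <= A%:E)%E.
Proof.
apply/lee_addgt0Pr => e e0; rewrite -EFinD.
have [j [jk hj]] := dq_freq a e0.
have hh k : 0 <= ((2 ^+ j k)^-1 : R) <= k.+1%:R^-1 by apply/andP; exact: dyadic_harm.
apply: (@nm_fatou _ _ _ m3 pp (fun k x => 2 ^+ j k * dif ((2 ^+ j k)^-1 *: un a) (sm n f) x)).
- exact: pp0.
- by rewrite lee_fin addr_ge0// ltW.
- by move=> k; apply: measurable_funM => //; apply: m_dif; exact: m_sm.
- exact: m_dsm.
- apply: aeW => x.
  have h0 k : (2 ^+ j k)^-1 != 0 :> R by rewrite invr_neq0// expf_neq0.
  have := @drv_quotient _ _ _ 0 _ (drv_sm n a f x) h0 (cvg_harm hh).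
  rewrite scale0r addr0.
  by apply: cvg_trans; apply: near_eq_cvg; apply: nearW => k /=; rewrite invrK add0r.
- move=> k; rewrite nmZ; [|by apply: m_dif; exact: m_sm|exact: pp0].
  rewrite ger0_norm ?exprn_ge0//; apply: le_trans (lee_wpmul2l _ (hj k n)) _.
    by rewrite lee_fin exprn_ge0.
  by rewrite -EFinM mulVKf// expf_neq0.
Qed.

(** An arbitrary step is approximated by multiples of small dyadic steps, and a multiple is
    crossed by repeating the small step. *)
Lemma nm_dif_sm a n r : 0 <= r -> (nm m3 pp (dif (r *: un a) (sm n f)) <= (r * A)%:E)%E.
Proof.
move=> r0; apply/lee_addgt0Pr => e' e'0; rewrite -EFinD.
have [e e0 re] : exists2 e, 0 < e & r * e <= e'.
  exists (e' / (r + 1)); first by rewrite divr_gt0// ltr_wpDl.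
  by rewrite mulrCA ler_piMr ?(ltW e'0)// ler_pdivrMr ?ltr_wpDl// mul1r lerDl.
have [j [jk hj]] := dq_freq a e0.
have hh k : 0 <= ((2 ^+ j k)^-1 : R) <= k.+1%:R^-1 by apply/andP; exact: dyadic_harm.
pose m k := Num.truncn (r * 2 ^+ j k).
have mP k : (m k)%:R <= r * 2 ^+ j k < (m k).+1%:R by apply: truncn_itv; rewrite mulr_ge0// exprn_ge0.
have mle k : (m k)%:R * (2 ^+ j k)^-1 <= r.
  by have /andP[h _] := mP k; rewrite ler_pdivrMr ?exprn_gt0.
have mr : (m k)%:R * (2 ^+ j k)^-1 @[k --> \oo] --> r.
  have : (r - (m k)%:R * (2 ^+ j k)^-1) @[k --> \oo] --> 0.
    apply: cvg_harm => k; rewrite subr_ge0 mle /=.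
    have /andP[_ h2] := hh k; apply: le_trans h2.
    have /andP[_ h] := mP k.
    rewrite lerBlDr -[X in X + _]mul1r -mulrDl nat1r.
    by rewrite ler_pdivlMr ?exprn_gt0// ltW.
  move=> h0; have -> : (fun k => (m k)%:R * (2 ^+ j k)^-1) = (fun k => r - (r - (m k)%:R * (2 ^+ j k)^-1)).
    by apply/funext => k; rewrite opprB addrC subrK.
  by rewrite -[X in _ --> X]subr0; apply: cvgB => //; exact: cvg_cst.
apply: (@nm_fatou _ _ _ m3 pp (fun k x => dif (((m k)%:R * (2 ^+ j k)^-1) *: un a) (sm n f) x)).
- exact: pp0.
- by rewrite lee_fin addr_ge0 ?mulr_ge0// ltW.
- by move=> k; apply: m_dif; exact: m_sm.
- by apply: m_dif; exact: m_sm.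
- apply: aeW => x; apply: cvgB; last exact: cvg_cst.
  exact: (drv_seq (drv_sm n a f x) mr).
- move=> k; rewrite -scalerA.
  apply: le_trans (nm_dif_mul _ _ _ _ (hj k n)) _.
  + exact: ltW pp1.
  + exact: m_sm.
  + exact: sm_periodic.
  rewrite lee_fin mulrA; apply: le_trans (ler_wpM2r _ (mle k)) _; first by rewrite addr_ge0// ltW.
  by rewrite mulrDr lerD2l.
Qed.

Lemma nm_dif_ge0 a r : 0 <= r -> (nm m3 pp (dif (r *: un a) f) <= (r * A)%:E)%E.
Proof.
move=> r0; have [k hk] := sm_cvg_ae (ig_dif (r *: un a) if_ pf).
apply: (nm_fatou pp0 _ _ _ hk).
- by rewrite lee_fin mulr_ge0.
- by move=> n; exact: m_sm.
- exact: m_dif.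
move=> n; rewrite -(funext (fun x => dif_sm (k n) (r *: un a) x if_ pf)).
exact: nm_dif_sm.
Qed.

Lemma nm_difN p h : 0 < p -> nm m3 p (dif (- h) f) = nm m3 p (dif h f).
Proof.
move=> p0; rewrite -(nm_shift h p0 (m_dif (- h) mf) (dif_per (- h) pf)).
by apply: nm_eq => x; rewrite /dif addrK distrC.
Qed.

Lemma nm_dif_axis a r : (nm m3 pp (dif (r *: un a) f) <= (`|r| * A)%:E)%E.
Proof.
have [r0|r0] := leP 0 r; first by rewrite ger0_norm//; exact: nm_dif_ge0.
have -> : r *: un a = - ((- r) *: un a) by rewrite scaleNr opprK.
by rewrite nm_difN ?pp0// ltr0_norm//; apply: nm_dif_ge0; rewrite oppr_ge0 ltW.
Qed.

Lemma periodic_un a x : f (x + un a) = f x.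
Proof. by have [h1 h2 h3] := pf x; case: a. Qed.

Lemma dif_int a r (k : int) : dif ((r + k%:~R) *: un a) f = dif (r *: un a) f.
Proof.
apply/funext => x; rewrite /dif; congr (_ - _).
have H := @periodic_int R (fun r' => f (x + r' *: un a)) _ k r.
by apply: H => r'; rewrite scalerDl scale1r addrA periodic_un.
Qed.

Lemma sn_lb (s : R) : `|s| <= 2^-1 -> `|s| <= `|sn s|.
Proof.
wlog s0 : s / 0 <= s.
  move=> H; have [/H//|s0] := leP 0 s.
  by rewrite -[`|s|]normrN -[`|sn s|]normrN -sinN -mulrN; apply: H; rewrite oppr_ge0 ltW.
rewrite (ger0_norm s0) => s2; have p0 := pi_gt0 R.
have p2 : 2 <= pi :> R by exact: pi_ge2.
have ss0 : 0 <= sn s by apply: sin_ge0_pi; apply/andP; split; nra.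
rewrite ger0_norm//.
have c4 : 2^-1 <= cos (pi / 4) :> R.
  have : cos (pi / 4 + pi / 4) = 0 :> R by rewrite (_ : pi / 4 + pi / 4 = pi / 2) ?cos_pihalf//; field.
  rewrite cosD -!expr2 => h.
  have := cos2Dsin2 (pi / 4 : R).
  have : 0 <= cos (pi / 4) :> R by apply: cos_ge0_pihalf; lra.
  move: h; move: (cos _) (sin _) => c d; nra.
have [s4|s4] := leP s (4^-1).
  have [->|sn0] := eqVneq s 0; first by rewrite mulr0 sin0.
  have s00 : 0 < s by rewrite lt_neqAle eq_sym sn0.
  have [c /[!in_itv]/= /andP[c0 cs_]] := MVT s00 (fun (x : R) _ => @drv_sn R x) (continuous_subspaceT (drv_cont (@drv_sn R))).
  rewrite mulr0 sin0 !subr0 => ->.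
  have hc : 2^-1 <= cos (pi * c).
    apply: le_trans c4 _; rewrite leNgt ltr_cos ?in_itv/= -?leNgt; [nra|apply/andP; split; nra|apply/andP; split; nra].
  rewrite ler_peMl//; nra.
have h : 2^-1 <= sn s.
  have E : cos (pi / 4) = sin (pi / 4) :> R by rewrite -cosBpihalf -cosN; congr cos; field.
  apply: le_trans c4 _; rewrite E leNgt ltr_sin ?in_itv/= -?leNgt; [nra|apply/andP; split; nra|apply/andP; split; nra].
exact: le_trans h.
Qed.

(** A step may be changed by an integer without changing the increment, and close to an integer
    the sine dominates the distance to it. *)
Lemma nm_dif_sn a r : (nm m3 pp (dif (r *: un a) f) <= (`|sn r| * A)%:E)%E.
Proof.
pose k := Num.floor (r + 2^-1); pose t := r - k%:~R.
have tr : r = t + k%:~R by rewrite /t subrK.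
have t2 : `|t| <= 2^-1.
  have /andP[h1 h2] := floor_itv (r + 2^-1).
  rewrite ler_norml /t -/k in h1 h2 *; rewrite intrD in h2; apply/andP; split; lra.
have sE : `|sn r| = `|sn t|.
  rewrite tr (@periodic_int R (fun r => `|sn r|))// => x.
  by rewrite sn1 normrN.
rewrite sE [in dif _]tr dif_int; apply: le_trans (nm_dif_axis _ _) _.
by rewrite lee_fin ler_wpM2r// sn_lb.
Qed.

(** An increment is a sum of increments along the axes, up to translations. *)
Lemma nm_dif_axes (h : X) (c : axis -> R) :
  (forall a, nm m3 pp (dif (co a h *: un a) f) <= (c a * A)%:E)%E ->
  (nm m3 pp (dif h f) <= ((c Ax1 + c Ax2 + c Ax3) * A)%:E)%E.
Proof.
move=> hc; set h1 := co Ax1 h *: un Ax1; set h2 := co Ax2 h *: un Ax2; set h3 := co Ax3 h *: un Ax3.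
have hE : h = h1 + h2 + h3.
  rewrite /h1 /h2 /h3 /= ; case: h {hc h1 h2 h3} => -[x y] z /=.
  apply: (@eq_trans _ _ ((x * 1 + y * 0) + z * 0, (x * 0 + y * 1) + z * 0, (x * 0 + y * 0) + z * 1)) => //.
  by rewrite !mulr0 !mulr1 !addr0 !add0r.
have -> : dif h f = fun x => (dif h1 f (x + (h2 + h3)) + dif h2 f (x + h3)) + dif h3 f x.
  apply/funext => x; rewrite /dif hE.
  have -> : x + (h1 + h2 + h3) = x + (h2 + h3) + h1 by rewrite [RHS]addrAC -!addrA.
  have -> : x + h3 + h2 = x + (h2 + h3) by rewrite -addrA [h3 + _]addrC.
  by ring.
have p1 := ltW pp1.
have md k l : measurable_fun setT (fun x => dif k f (x + l)) by apply: m_shift; exact: m_dif.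
apply: le_trans (@nmD _ _ _ m3 pp (fun x => dif h1 f (x + (h2 + h3)) + dif h2 f (x + h3)) (dif h3 f) _ _ p1) _.
- exact: measurable_funD.
- exact: m_dif.
rewrite !mulrDl !EFinD; apply: leeD; last exact: hc.
apply: le_trans (@nmD _ _ _ m3 pp (fun x => dif h1 f (x + (h2 + h3))) (fun x => dif h2 f (x + h3)) (md _ _) (md _ _) p1) _; apply: leeD.
- rewrite nm_shift ?pp0//; [exact: hc|exact: m_dif|exact: dif_per].
- rewrite nm_shift ?pp0//; [exact: hc|exact: m_dif|exact: dif_per].
Qed.
End estimates.
End static.

(** * The Sobolev embedding *)
Lemma nm_bd d (X : measurableType d) (R : realType) (mu : {measure set X -> \bar R}) p (f : X -> R) (M : R) :
  mu setT = 1%E -> 0 < p -> (forall x, `|f x| <= M) -> (nm mu p f <= M%:E)%E.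
Proof.
move=> m1 p0 fM.
have h : (\int[mu]_x (`|f x| `^ p)%:E <= \int[mu]_x (`|M| `^ p)%:E)%E.
  apply: int_mono => x; first by rewrite lee_fin powR_ge0.
  rewrite lee_fin ge0_ler_powR ?nnegrE// ?(ltW p0)//.
  by apply: le_trans (fM x) _; exact: ler_norm.
have [x0|] := pselect (exists x : X, True); last first.
  move=> /forallNP nX; suff : mu setT = 0%E by rewrite m1 => /eqP; rewrite onee_eq0.
  by rewrite (_ : setT = set0) ?measure0//; apply/seteqP; split => // x; case: (nX x).
have [x _] := x0; have M0 : 0 <= M by exact: le_trans (fM x).
apply: (nm_leP _ _ p0 _).1; first by rewrite lee_fin.
by move: h; rewrite (integral_cst1 _ m1) ger0_norm// -poweR_EFin.
Qed.

Section cauchy_schwarz.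
Context d d' (X : measurableType d) (Y : measurableType d') {R : realType}.
Variables (m : {sigma_finite_measure set X -> \bar R}) (m' : {sigma_finite_measure set Y -> \bar R}).
Hypotheses (m1 : m setT = 1%E) (m1' : m' setT = 1%E).

Let mid := @measurable_id.

Lemma nm_tensor (f : X -> R) (g : Y -> R) : measurable_fun setT f -> measurable_fun setT g ->
  nm (pm m m') 2 (fun z => f z.1 * g z.2) = (nm m 2 f * nm m' 2 g)%E.
Proof.
move=> mf mg; have n2 : (2 : R) != 0 by [].
rewrite (nmE _ _ n2) [nm m _ _](nmE _ _ n2) [nm m' _ _](nmE _ _ n2) -poweRM; first last.
- by apply: integral_ge0 => x _; rewrite lee_fin powR_ge0.
- by apply: integral_ge0 => x _; rewrite lee_fin powR_ge0.
congr poweR; rewrite tonelli1; last 2 first.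
- apply/measurable_EFinP; apply: mpow; apply: measurable_funM.
  + by apply: (mcomp mf); apply: mfst; exact: mid.
  + by apply: (mcomp mg); apply: msnd; exact: mid.
- by move=> z; rewrite lee_fin powR_ge0.
rewrite muleC -ge0_integralZl//; first last.
- by apply: integral_ge0 => x _; rewrite lee_fin powR_ge0.
- by apply/measurable_EFinP; exact: mpow.
apply: eq_integral => x _ /=; rewrite muleC -ge0_integralZl//; first last.
- by apply/measurable_EFinP; exact: mpow.
by apply: eq_integral => y _; rewrite -EFinM normrM powRM.
Qed.

Variable f : X * Y -> R.
Hypotheses (mf : measurable_fun setT f) (bf : bd f).

Definition slice_nm (y : Y) : R := fine (nm m 2 (fun x => f (x, y))).

Lemma slice_nmE y : ((slice_nm y)%:E = nm m 2 (fun x => f (x, y)))%E.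
Proof.
rewrite /slice_nm fineK// ge0_fin_numE ?nm_ge0//.
have [M hM] := bf; apply: (@le_lt_trans _ _ M%:E); last by rewrite ltry.
by apply: nm_bd => // x; exact: hM.
Qed.

Lemma slice_nm_ge0 y : 0 <= slice_nm y.
Proof. by rewrite -lee_fin slice_nmE nm_ge0. Qed.

Let mp : measurable_fun setT (fun z => (`|f z| `^ 2)%:E).
Proof. by apply/measurable_EFinP; exact: mpow. Qed.

Let p0 z : (0 <= (`|f z| `^ 2)%:E)%E. Proof. by rewrite lee_fin powR_ge0. Qed.

Lemma m_slice_nm : measurable_fun setT slice_nm.
Proof.
apply: measurableT_comp => //.
have n2 : (2 : R) != 0 by [].
rewrite (_ : (fun y => _) = fun y => ((\int[m]_x (`|f (x, y)| `^ 2)%:E) `^ 2^-1)%E); last first.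
  by apply/funext => y; rewrite nmE.
apply: (measurableT_comp (measurable_poweR _)) => //.
exact: (mint1 m mp p0).
Qed.

Lemma nm_slice : nm m' 2 slice_nm = nm (pm m m') 2 f.
Proof.
have n2 : (2 : R) != 0 by [].
rewrite (nmE _ _ n2) [RHS](nmE _ _ n2); congr poweR.
rewrite tonelli2//; apply: eq_integral => y _.
rewrite (ger0_norm (slice_nm_ge0 y)) -poweR_EFin slice_nmE nm_pow//.
Qed.
End cauchy_schwarz.

Section loomis_whitney.
Context {R : realType}.
Local Notation X := (R * R * R)%type.
Local Notation nu2 := (pm (@nu R) (@nu R)).
Implicit Types (a : axis) (x : X) (q : R * R).

Let h1 := @nu_setT R.

Definition pr a x : R * R :=
  match a with Ax1 => (x.1.2, x.2) | Ax2 => (x.1.1, x.2) | Ax3 => x.1 end.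
Definition ins a q (r : R) : X :=
  match a with Ax1 => (r, q.1, q.2) | Ax2 => (q.1, r, q.2) | Ax3 => (q, r) end.

Lemma ins_pr a x : ins a (pr a x) (co a x) = x.
Proof. by case: a; case: x => -[]. Qed.

Let mid := @measurable_id.

Lemma m_pr a : measurable_fun setT (pr a).
Proof.
case: a; rewrite /pr; last by apply: mfst; exact: mid.
- by apply: mprod; [apply: msnd; apply: mfst|apply: msnd]; exact: mid.
- by apply: mprod; [apply: mfst; apply: mfst|apply: msnd]; exact: mid.
Qed.

Lemma m_ins a : measurable_fun setT (fun z : (R * R) * R => ins a z.1 z.2).
Proof.
case: a; rewrite /ins.
- apply: mprod; [apply: mprod|]; last by apply: msnd; apply: mfst; exact: mid.
    by apply: msnd; exact: mid.
  by apply: mfst; apply: mfst; exact: mid.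
- apply: mprod; [apply: mprod|]; last by apply: msnd; apply: mfst; exact: mid.
    by apply: mfst; apply: mfst; exact: mid.
  by apply: msnd; exact: mid.
- by apply: mprod; [apply: mfst|apply: msnd]; exact: mid.
Qed.

Lemma int_ins a (H : X -> \bar R) : measurable_fun setT H -> (forall x, 0 <= H x)%E ->
  (\int[nu2]_q \int[nu]_r H (ins a q r) = \int[m3]_x H x)%E.
Proof.
move=> mH H0.
have mc : measurable_fun setT (fun z : R * R * R => (H (ins a z.1 z.2))).
  exact: (mcomp mH (m_ins a)).
have mI : measurable_fun setT (fun q => \int[nu]_r H (ins a q r))%E.
  exact: (@measurable_int2 _ _ _ _ _ nu (fun q r => H (ins a q r))).
case: a mc mI => mc mI; [| |exact: esym (tonelli1 (pm nu nu) nu mH H0)].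
- rewrite tonelli1//; last by move=> q; exact: integral_ge0.
  rewrite [RHS](ge0_m3E mH H0).
  transitivity (\int[nu]_b \int[nu]_a \int[nu]_c H (a, b, c))%E.
    apply: eq_integral => b _; rewrite tonelli_swap//.
    apply: (mcomp mH); apply: mprod; [apply: mprod|] => //.
      by apply: mfst; exact: mid.
  rewrite tonelli_swap//; last by move=> x y; exact: integral_ge0.
  apply: (@measurable_int2 _ _ _ _ _ nu (fun (p : R * R) c => H (p.2, p.1, c))) => //.
  apply: (mcomp mH); apply: mprod; [apply: mprod|].
  + by apply: msnd; apply: mfst; exact: mid.
  + by apply: mfst; apply: mfst; exact: mid.
  + by apply: msnd; exact: mid.
- rewrite tonelli1//; last by move=> q; exact: integral_ge0.
  rewrite [RHS](ge0_m3E mH H0); apply: eq_integral => a _; rewrite tonelli_swap//.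
  apply: (mcomp mH); apply: mprod; [apply: mprod|] => //.
  by apply: mfst; exact: mid.
Qed.

(** On each horizontal plane the first two factors form a tensor product, and Cauchy-Schwarz
    against the third applies; a second Cauchy-Schwarz integrates over the height. *)
Lemma loomis_whitney (f : axis -> R * R -> R) :
  (forall a, measurable_fun setT (f a)) -> (forall a, bd (f a)) ->
  (\int[m3]_x `|f Ax1 (pr Ax1 x) * f Ax2 (pr Ax2 x) * f Ax3 (pr Ax3 x)|%:E <=
   nm nu2 2 (f Ax1) * nm nu2 2 (f Ax2) * nm nu2 2 (f Ax3))%E.
Proof.
move=> mf bf.
have mF a : measurable_fun setT (fun x => f a (pr a x)) by exact: (mcomp (mf a) (m_pr a)).
rewrite /m3 tonelli2//; last first.
  apply/measurable_EFinP; apply: measurableT_comp => //.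
  by apply: measurable_funM => //; exact: measurable_funM.
pose S1 := slice_nm nu (f Ax1); pose S2 := slice_nm nu (f Ax2).
have S10 z : 0 <= S1 z by exact: (slice_nm_ge0 h1 (bf Ax1)).
have S20 z : 0 <= S2 z by exact: (slice_nm_ge0 h1 (bf Ax2)).
have mS1 : measurable_fun setT S1 by exact: (m_slice_nm nu (mf Ax1)).
have mS2 : measurable_fun setT S2 by exact: (m_slice_nm nu (mf Ax2)).
have ms a z : measurable_fun setT (fun r : R => f a (r, z)) by exact: (measurable_fun_pair1 z (mf a)).
apply: (@le_trans _ _ (\int[nu]_z (`|S1 z * S2 z|%:E * nm nu2 2 (f Ax3)))%E).
  apply: int_mono => z; first exact: integral_ge0.
  have e2 : (2^-1 + 2^-1 = 1 :> R) by lra.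
  rewrite (_ : integral _ _ _ = \int[nu2]_q `|f Ax2 (q.1, z) * f Ax1 (q.2, z) * f Ax3 q|%:E)%E; last first.
    by apply: eq_integral => q _; rewrite /= [X in X * _]mulrC.
  apply: le_trans (@hoelder1 _ _ _ nu2 2 2 (fun q => f Ax2 (q.1, z) * f Ax1 (q.2, z)) (f Ax3) _ (mf Ax3) _ _ e2) _ => //.
  - apply: measurable_funM.
      by apply: (mcomp (ms Ax2 z)); apply: mfst; exact: mid.
    by apply: (mcomp (ms Ax1 z)); apply: msnd; exact: mid.
  rewrite le_eqVlt; apply/orP; left; apply/eqP; congr (_ * _)%E.
  have := nm_tensor nu nu (ms Ax2 z) (ms Ax1 z) => ->.
  rewrite ger0_norm ?mulr_ge0// EFinM muleC.
  by rewrite (slice_nmE h1 (bf Ax1)) (slice_nmE h1 (bf Ax2)).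
rewrite ge0_integralZr//; last 2 first.
- by apply/measurable_EFinP; apply: measurableT_comp => //; exact: measurable_funM.
- exact: nm_ge0.
apply: lee_wpmul2r; first exact: nm_ge0.
have e2 : (2^-1 + 2^-1 = 1 :> R) by lra.
apply: le_trans (hoelder1 _ mS1 mS2 _ _ e2) _ => //.
rewrite /S1 /S2 (nm_slice nu h1 (mf Ax1) (bf Ax1)) (nm_slice nu h1 (mf Ax2) (bf Ax2)).
exact: lexx.
Qed.
End loomis_whitney.

Section ae_prod.
Context d d' (X : measurableType d) (Y : measurableType d') {R : realType}.
Variables (m : {sigma_finite_measure set X -> \bar R}) (m' : {sigma_finite_measure set Y -> \bar R}).

Lemma ae_fst (P : X -> Prop) : {ae m, forall x, P x} -> {ae pm m m', forall z, P z.1}.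
Proof.
move=> [N [mN N0 NP]]; exists (N `*` setT); split.
- exact: measurableX.
- by rewrite pmE// N0 mul0e.
- by move=> z /= nP; split => //; exact: NP.
Qed.

Lemma ae_snd (P : Y -> Prop) : {ae m', forall y, P y} -> {ae pm m m', forall z, P z.2}.
Proof.
move=> [N [mN N0 NP]]; exists (setT `*` N); split.
- exact: measurableX.
- by rewrite pmE// N0 mule0.
- by move=> z /= nP; split => //; exact: NP.
Qed.
End ae_prod.

Lemma ae_cube (R : realType) : {ae (m3 : {measure set (R * R * R)%type -> \bar R}), forall x, forall a, 0 <= co a x <= 1}.
Proof.
have h1 := ae_fst nu (ae_fst nu (@ae_nu_in R)).
have h2 := ae_fst nu (ae_snd nu (@ae_nu_in R)).
have h3 := ae_snd (pm nu nu) (@ae_nu_in R).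
by apply: filterS (filterI (filterI h1 h2) h3) => x [[? ?] ?] [].
Qed.

Section sobolev.
Context {R : realType}.
Local Notation X := (R * R * R)%type.
Local Notation nu2 := (pm (@nu R) (@nu R)).
Implicit Types (a : axis) (x : X) (q : R * R) (n : nat).

Let p0 := @pp0 R.
Let h1 := @nu_setT R.

Section smooth_sobolev.
Variables (f : X -> R) (A : R) (n : nat).
Hypothesis sf : stat f A.
Local Notation g := (sm n f).
Local Notation dg a := (dsm n a f).

(** The density whose mean over a line bounds the sixth power of [g] on that line. *)
Definition sobH a x : R := g x ^+ 6 + `|6 * g x ^+ 5 * dg a x|.
Definition sobS a q : R := \int[nu]_r sobH a (ins a q r).

Let g6 x : 0 <= g x ^+ 6. Proof. by rewrite (exprM _ 2 3) exprn_ge0// sqr_ge0. Qed.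

Let H0 a x : 0 <= sobH a x. Proof. by rewrite addr_ge0. Qed.

Let mg := m_sm n f.
Let md a := m_dsm n a f.

Let mH a : measurable_fun setT (sobH a).
Proof.
apply: measurable_funD; first exact: measurable_funX.
apply: measurableT_comp => //; apply: measurable_funM => //.
by apply: measurable_funM => //; exact: measurable_funX.
Qed.

Let bH a : bd (sobH a).
Proof.
have [M hM] : bd (fun x => 6 * g x ^+ 5 * dg a x).
  by apply: bdM; [apply: bdM; [exact: bd_cst|apply: bdX; exact: bd_sm]|exact: bd_dsm].
by apply: bdD; [apply: bdX; exact: bd_sm|exists M => x; rewrite normr_id].
Qed.

Let mHi a q : measurable_fun setT (fun r => sobH a (ins a q r)).
Proof. exact: (measurable_fun_pair2 q (mcomp (mH a) (m_ins a))). Qed.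

Let iH a q : ig nu (fun r => sobH a (ins a q r)).
Proof. by apply: ig_bd => //; exact: bd_comp. Qed.

Let SE a q : ((sobS a q)%:E = \int[nu]_r (sobH a (ins a q r))%:E)%E.
Proof. exact: IE. Qed.

Let S0 a q : 0 <= sobS a q.
Proof. by apply: Rintegral_ge0. Qed.

Let mS a : measurable_fun setT (sobS a).
Proof.
apply: measurableT_comp => //.
apply: (@measurable_int2 _ _ _ _ _ nu (fun q r => (sobH a (ins a q r))%:E)) => //.
  by apply/measurable_EFinP; exact: (mcomp (mH a) (m_ins a)).
by move=> q r; rewrite lee_fin.
Qed.

Let bS a : bd (sobS a).
Proof.
have [M hM] := bH a; exists M => q; apply: I_le0.
apply: (@le_trans _ _ (\int[nu]_r M%:E)%E); last by rewrite (integral_cst1 _ h1).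
by apply: int_mono => r; rewrite lee_fin.
Qed.

Let coins a x r : ins a (pr a x) r = x + (r - co a x) *: un a.
Proof.
case: a; case: x => -[x1 x2] x3.
- apply: (@eq_trans _ _ (x1 + (r - x1) * 1, x2 + (r - x1) * 0, x3 + (r - x1) * 0)) => //=.
  by rewrite mulr1 !mulr0 !addr0 addrC subrK.
- apply: (@eq_trans _ _ (x1 + (r - x2) * 0, x2 + (r - x2) * 1, x3 + (r - x2) * 0)) => //=.
  by rewrite mulr1 !mulr0 !addr0 [x2 + _]addrC subrK.
- apply: (@eq_trans _ _ (x1 + (r - x3) * 0, x2 + (r - x3) * 0, x3 + (r - x3) * 1)) => //=.
  by rewrite mulr1 !mulr0 !addr0 [x3 + _]addrC subrK.
Qed.

Lemma drv_ins a q : drv (fun r => g (ins a q r)) (fun r => dg a (ins a q r)).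
Proof.
have [x <-] : exists x, pr a x = q by exists (ins a q 0); case: a => //=; case: q.
have -> : (fun r => g (ins a (pr a x) r)) = fun r => g (x + (r - co a x) *: un a).
  by apply/funext => r; rewrite coins.
have -> : (fun r => dg a (ins a (pr a x) r)) = fun r => dg a (x + (r - co a x) *: un a).
  by apply/funext => r; rewrite coins.
apply: (drv_ext (drv_comp (drv_sm n a f x) (drvD (drv_id (R := R)) (drv_cst (- co a x))))) => r.
by rewrite addr0 mulr1.
Qed.

Lemma cont_ins a q : continuous (fun r => dg a (ins a q r)).
Proof.
have hb d i (u c : R -> R) : continuous c -> continuous (fun r : R => bsel d n i (c r)).
  by move=> cc r; apply: (cvg_comp _ _ (cc r)); exact: cont_bsel.
have cid : continuous (fun r : R => r) by move=> r; exact: cvg_id.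
have ccst (c : R) : continuous (fun r : R => c) by move=> r; exact: cvg_cst.
have hc (k : 'I_(2 * n).+1 -> R -> R) (I : Type) (rs : seq I) (F : I -> R -> R) : (forall i, continuous (F i)) -> continuous (fun r => \sum_(i <- rs) F i r).
  move=> cF; elim: rs => [|i rs IH].
    by under eq_fun do rewrite big_nil; exact: ccst.
  by under eq_fun do rewrite big_cons; move=> r; apply: cvgD; [exact: cF|exact: IH].
apply: hc => [_ _|J]; first exact: 0.
move=> r; apply: cvgM; first exact: cvg_cst.
rewrite /deb; apply: cvgM; [apply: cvgM|]; apply: hb => //; case: (a) => //=.
Qed.

(** Some value of [g^6] on the line is at most its mean, and the others differ from it by at most
    the variation, which is the mean of the second summand of [sobH]. *)
Lemma sob_pointwise a x : 0 <= co a x <= 1 -> g x ^+ 6 <= sobS a (pr a x).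
Proof.
move=> xa; rewrite -lee_fin SE.
have d6 := drvX 6 (drv_ins a (pr a x)).
have c6 : continuous (fun r => 6%:R * g (ins a (pr a x) r) ^+ 6.-1 * dg a (ins a (pr a x) r)).
  move=> r; apply: cvgM; last exact: cont_ins.
  apply: cvgM; first exact: cvg_cst.
  exact: (drv_cont (drvX 5 (drv_ins a (pr a x)))).
set V := (\int[nu]_r `|6 * g (ins a (pr a x) r) ^+ 5 * dg a (ins a (pr a x) r)|%:E)%E.
have hV r : 0 <= r <= 1 -> ((g x ^+ 6)%:E <= (g (ins a (pr a x) r) ^+ 6)%:E + V)%E.
  move=> r01; have := FTC_le d6 c6 r01 xa; rewrite ins_pr -/V => h.
  apply: le_trans (leeD (lexx _) h); rewrite -EFinD lee_fin -lerBlDl.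
  exact: ler_norm.
have mg6 : measurable_fun setT (fun r => (g (ins a (pr a x) r) ^+ 6)%:E).
  apply/measurable_EFinP; apply: measurable_funX.
  exact: (measurable_fun_pair2 (pr a x) (mcomp mg (m_ins a))).
have mV : measurable_fun setT (fun r => `|6 * g (ins a (pr a x) r) ^+ 5 * dg a (ins a (pr a x) r)|%:E).
  apply/measurable_EFinP; apply: measurableT_comp => //.
  by apply: cont_meas.
under eq_integral do rewrite EFinD.
rewrite ge0_integralD//; last by move=> r _; rewrite lee_fin.
rewrite -/V -(integral_cst1 V h1) -[leLHS](integral_cst1 _ h1) -ge0_integralD//; last 2 first.
- by move=> r _; rewrite lee_fin.
- by move=> r _; apply: integral_ge0.
apply: ae_ge0_le_integral => //.
- by move=> r _; rewrite lee_fin.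
- by move=> r _; apply: adde_ge0; [rewrite lee_fin|apply: integral_ge0].
- by apply: emeasurable_funD.
- by apply: filterS (@ae_nu_in R) => r r01 _; exact: hV.
Qed.

Definition sobY : R := fine (nm m3 9 g).

Lemma sobYE : (sobY%:E = nm m3 9 g)%E.
Proof.
rewrite /sobY fineK// ge0_fin_numE ?nm_ge0//.
have [M hM] := bd_sm n f; apply: (@le_lt_trans _ _ M%:E); last by rewrite ltry.
by apply: nm_bd => //; exact: m3_setT.
Qed.

Lemma sobY0 : 0 <= sobY. Proof. by rewrite -lee_fin sobYE nm_ge0. Qed.

(** Both summands contain [g^5] and one factor in [L^pp]; the conjugate exponent 9/5 turns [g^5]
    into the fifth power of the norm in [L^9]. *)
Lemma sob_int a : (\int[m3]_x (sobH a x)%:E <= (7 * A * sobY ^+ 5)%:E)%E.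
Proof.
have e1 : (9 / 5 : R)^-1 + pp^-1 = 1 by rewrite /pp; lra.
have q0 : 0 < 9 / 5 :> R by lra.
have m5 : measurable_fun setT (fun x => `|g x| `^ 5) by exact: mpow.
have N5 : (nm m3 (9 / 5) (fun x => (`|g x| `^ 5)%R) = (sobY ^+ 5)%:E)%E.
  rewrite nm_powf// (_ : 9 / 5 * 5 = 9 :> R); last by field.
  by rewrite -sobYE poweR_EFin powR_mulrn// sobY0.
have h (F : X -> R) (B : R) : measurable_fun setT F -> (nm m3 pp F <= B%:E)%E ->
    (\int[m3]_x `|g x ^+ 5 * F x|%:E <= (sobY ^+ 5 * B)%:E)%E.
  move=> mF hF; have := hoelder1 m3 m5 mF q0 p0 e1; rewrite N5 => hh.
  rewrite EFinM; apply: le_trans (lee_wpmul2l _ hF); last by rewrite lee_fin exprn_ge0// sobY0.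
  apply: le_trans hh; apply: int_mono => x; rewrite ?lee_fin//.
  by rewrite normrM [leRHS]normrM normrX [X in _ <= X * _]ger0_norm ?powR_ge0// powR_mulrn.
have i1 : (\int[m3]_x (g x ^+ 6)%:E <= (sobY ^+ 5 * A)%:E)%E.
  apply: le_trans (h g A mg _).
    by apply: int_mono => x; rewrite lee_fin// -exprSr ler_norm.
  apply: le_trans (nm_sm n (@pp1 R) (stat_ig sf) (stat_per sf)) _; exact: stat_nm sf.
have i2 : (\int[m3]_x `|6 * g x ^+ 5 * dg a x|%:E <= 6%:E * (sobY ^+ 5 * A)%:E)%E.
  apply: le_trans (lee_wpmul2l _ (h (dg a) A (md a) (nm_dsm sf a n))) => //.
  rewrite -ge0_integralZl//; last first.
    apply/measurable_EFinP; apply: measurableT_comp => //; apply: measurable_funM => //.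
    exact: measurable_funX.
  apply: int_mono => x; rewrite ?lee_fin//.
  by rewrite -mulrA normrM ger0_norm.
under eq_integral do rewrite EFinD.
rewrite ge0_integralD//; first last.
- apply/measurable_EFinP; apply: measurableT_comp => //; apply: measurable_funM => //.
  by apply: measurable_funM => //; exact: measurable_funX.
- by apply/measurable_EFinP; exact: measurable_funX.
- by move=> x _; rewrite lee_fin.
apply: le_trans (leeD i1 i2) _; rewrite -EFinM -EFinD lee_fin.
by rewrite le_eqVlt; apply/orP; left; apply/eqP; ring.
Qed.

(** Loomis-Whitney for the square roots of [sobS] gives [Y^9 <= (7 A Y^5)^(3/2)] for the norm [Y]
    of [g] in [L^9], and [Y] is finite because [g] is bounded. *)
Lemma sobolev_sm : (nm m3 9 g <= (7 * A)%:E)%E.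
Proof.
rewrite -sobYE lee_fin; set Y := sobY.
have Y0 : 0 <= Y by exact: sobY0.
have A0 := stat_ge0 sf.
(* A common bound for the norms of the three factors in the Loomis-Whitney inequality. *)
pose K := Num.sqrt (7 * A * Y ^+ 5).
have K2 : K ^+ 2 = 7 * A * Y ^+ 5 by rewrite sqr_sqrtr// !mulr_ge0// exprn_ge0.
have K0 : 0 <= K by exact: sqrtr_ge0.
pose F a q : R := Num.sqrt (sobS a q).
have F0 a q : 0 <= F a q by exact: sqrtr_ge0.
have mF a : measurable_fun setT (F a).
  exact: (mcomp (cont_meas (@sqrt_continuous R)) (mS a)).
have bF a : bd (F a).
  have [M hM] := bS a; exists (Num.sqrt M) => q; rewrite ger0_norm//.
  by apply: ler_wsqrtr; apply: le_trans (hM q); exact: ler_norm.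
have NF a : (nm nu2 2 (F a) <= K%:E)%E.
  apply: (nm_leP _ _ _ _).1 => //; rewrite poweR_EFin powR_mulrn// K2.
  apply: le_trans (sob_int a); rewrite -(@int_ins _ a (fun x => (sobH a x)%:E)); first last.
  - by move=> x; rewrite lee_fin.
  - by apply/measurable_EFinP.
  rewrite le_eqVlt; apply/orP; left; apply/eqP; apply: eq_integral => q _.
  by rewrite -SE ger0_norm// powR_mulrn// sqr_sqrtr.
have L := loomis_whitney mF bF.
have : ((Y ^+ 9)%:E <= (K ^+ 3)%:E)%E.
  have -> : ((Y ^+ 9)%:E = \int[m3]_x (`|g x| `^ 9)%:E)%E.
    by rewrite -nm_pow// -sobYE poweR_EFin powR_mulrn.
  apply: (@le_trans _ _ (K%:E * K%:E * K%:E)%E); last by rewrite -!EFinM -expr2 -exprSr.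
  apply: (@le_trans _ _ (nm nu2 2 (F Ax1) * nm nu2 2 (F Ax2) * nm nu2 2 (F Ax3))%E); last first.
    apply: lee_pmul => //; [by rewrite mule_ge0 ?nm_ge0|exact: nm_ge0|].
    by apply: lee_pmul => //; exact: nm_ge0.
  apply: le_trans L; apply: ae_ge0_le_integral => //.
  - by apply/measurable_EFinP; exact: mpow.
  - apply/measurable_EFinP; apply: measurableT_comp => //.
    have mFp a : measurable_fun setT (fun x => F a (pr a x)) by exact: (mcomp (mF a) (m_pr a)).
    by apply: measurable_funM => //; exact: measurable_funM.
  apply: filterS (@ae_cube R) => x xc _; rewrite lee_fin powR_mulrn//.
  have FS a q : F a q ^+ 2 = sobS a q by rewrite sqr_sqrtr.
  have -> : `|F Ax1 (pr Ax1 x) * F Ax2 (pr Ax2 x) * F Ax3 (pr Ax3 x)| = F Ax1 (pr Ax1 x) * F Ax2 (pr Ax2 x) * F Ax3 (pr Ax3 x).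
    by rewrite ger0_norm//; apply: mulr_ge0 => //; exact: mulr_ge0.
  rewrite -(@ler_pXn2r _ 2)// ?nnegrE ?exprn_ge0//; last by apply: mulr_ge0 => //; exact: mulr_ge0.
  have -> : (F Ax1 (pr Ax1 x) * F Ax2 (pr Ax2 x) * F Ax3 (pr Ax3 x)) ^+ 2 =
    sobS Ax1 (pr Ax1 x) * sobS Ax2 (pr Ax2 x) * sobS Ax3 (pr Ax3 x) by rewrite -!FS; ring.
  have -> : (`|g x| ^+ 9) ^+ 2 = g x ^+ 6 * g x ^+ 6 * g x ^+ 6.
    by rewrite -exprM -!exprD -normrX ger0_norm// (exprM _ 2 9) exprn_ge0// sqr_ge0.
  have s a := sob_pointwise (xc a).
  exact: (ler_pM (mulr_ge0 (g6 x) (g6 x)) (g6 x) (ler_pM (g6 x) (g6 x) (s Ax1) (s Ax2)) (s Ax3)).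
rewrite lee_fin => h; rewrite leNgt; apply/negP => AY.
have Yp : 0 < Y by apply: le_lt_trans AY; rewrite mulr_ge0.
have : (Y ^+ 9) ^+ 2 <= (K ^+ 3) ^+ 2 by rewrite lerXn2r// ?nnegrE exprn_ge0.
have -> : (K ^+ 3) ^+ 2 = (7 * A) ^+ 3 * Y ^+ 15 by transitivity ((K ^+ 2) ^+ 3); [ring|rewrite K2; ring].
have -> : (Y ^+ 9) ^+ 2 = Y ^+ 3 * Y ^+ 15 by ring.
rewrite ler_pM2r ?exprn_gt0//.
apply/negP; rewrite -ltNge ltr_pXn2r// ?nnegrE ?mulr_ge0//.
Qed.
End smooth_sobolev.

Lemma sobolev (f : X -> R) A : stat f A -> (nm m3 9 f <= (7 * A)%:E)%E.
Proof.
move=> sf; have [k hk] := sm_cvg_ae (stat_ig sf).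
apply: (nm_fatou _ _ _ _ hk) => //.
- by rewrite lee_fin mulr_ge0// (stat_ge0 sf).
- by move=> n; exact: m_sm.
- exact: stat_meas sf.
- by move=> n; exact: sobolev_sm.
Qed.
End sobolev.

(** * The vertical component *)
Section vertical.
Context {R : realType}.
Local Notation X := (R * R * R)%type.
Local Notation nu2 := (pm (@nu R) (@nu R)).
Implicit Types (a : axis) (x : X) (q : R * R) (n : nat).

Let p0 := @pp0 R.
Let p1 := @pp1 R.
Let h1 := @nu_setT R.

Transparent nu leb.
(** A set of full measure meets every neighbourhood of the boundary point 0, where the trace is
    prescribed. *)
Lemma ae_nu_small (P : R -> Prop) (e : R) : {ae (nu : {measure set R -> \bar R}), forall y, P y} -> 0 < e ->
  exists2 x : R, 0 <= x <= 1 /\ x <= e & P x.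
Proof.
move=> [N [mN N0 NP]] e0; apply: contrapT => H.
pose I1 : set R := `[0, Num.min e 1]%classic.
have sub : I1 `<=` N `&` `[0, 1]%classic.
  move=> x; rewrite /I1 /= in_itv/= le_min => /and3P[x0 xe x1]; split; last by rewrite in_itv/= x0.
  apply: NP => /= Px; apply: H; exists x => //; split => //; apply/andP; split => //.
have : (leb I1 <= nu N)%E.
  apply: (@le_measure _ _ _ leb I1 (N `&` `[0, 1]%classic)); rewrite ?inE//; [exact: measurable_itvR|].
  by apply: measurableI => //; exact: measurable_itvR.
rewrite N0 -[leb _]/(lebesgue_measure `[0%R, Num.min e 1]%classic) lebesgue_measure_itv /= lte_fin lt_min e0 ltr01/=.
by rewrite oppr0 adde0 lee_fin leNgt lt_min e0 ltr01.
Qed.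
Opaque nu leb.

Variables (u v w : X -> R) (A B : R).
Hypotheses (su : stat u A) (sv : stat v B).
Hypothesis iw : ig m3 w.
Hypothesis hdiv : forall n (J : idx n),
  \int[m3]_x (u x * deb Ax1 J x + v x * deb Ax2 J x + w x * deb Ax3 J x) = 0.
Hypothesis hcont : {ae (nu2 : {measure set (R * R) -> \bar R}), forall q,
  continuous (fun z => w (q, z)) /\ w (q, 0) = 0}.

Lemma ig_deb n a (J : idx n) (f : X -> R) : ig m3 f -> ig m3 (fun x => f x * deb a J x).
Proof. by move=> hf; apply: igM_bd => //; [exact: m_deb|exact: bd_deb]. Qed.

Lemma dsm_alt n a (f : X -> R) x : ig m3 f ->
  dsm n a f x = - \sum_(J : idx n) eb J x * \int[m3]_y (f y * deb a J y).
Proof.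
move=> hf; rewrite dsmE//.
transitivity (\int[m3]_y (\sum_(J : idx n) (- eb J x) * (f y * deb a J y))).
  apply: I_eq => y; rewrite -sum_eb_deb -sumrN mulr_suml; apply: eq_bigr => J _; ring.
rewrite I_sum; last by move=> J; apply: igZ; exact: ig_deb.
by rewrite -sumrN; apply: eq_bigr => J _; rewrite IZ ?mulNr//; exact: ig_deb.
Qed.

(** The kernel is a finite sum of test functions, so the weak divergence condition passes to the
    smooth functions pointwise. *)
Lemma dsm_div n x : dsm n Ax1 u x + dsm n Ax2 v x + dsm n Ax3 w x = 0.
Proof.
have iu := stat_ig su; have iv := stat_ig sv.
rewrite !dsm_alt// -!opprD -!big_split/= big1 ?oppr0// => J _.
rewrite -!mulrDr -ID; [|exact: ig_deb|exact: ig_deb].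
rewrite -ID ?hdiv ?mulr0//; [by apply: igD; exact: ig_deb|exact: ig_deb].
Qed.

Let C := A + B.

Let C0 : 0 <= C. Proof. by rewrite addr_ge0// ?(stat_ge0 su) ?(stat_ge0 sv). Qed.

(** By incompressibility the vertical derivative of [w] is controlled by the horizontal derivatives
    of [u] and [v]. *)
Lemma nm_dsm_w n : (nm m3 pp (dsm n Ax3 w) <= C%:E)%E.
Proof.
have -> : nm m3 pp (dsm n Ax3 w) = nm m3 pp (fun x => dsm n Ax1 u x + dsm n Ax2 v x)%R.
  apply: nm_eq => x; rewrite -normrN; congr `|_|.
  by apply/eqP; rewrite -subr_eq0 -opprD oppr_eq0 addrC dsm_div.
apply: le_trans (@nmD _ _ _ m3 pp _ _ (m_dsm n Ax1 u) (m_dsm n Ax2 v) (ltW p1)) _.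
by rewrite EFinD leeD// nm_dsm.
Qed.

(** Bounds the difference of the smoothed [w] between any two heights above the point [q]. *)
Definition vvar n q : R := fine (\int[nu]_r `|dsm n Ax3 w (q, r)|%:E)%E.

Let mdq n q : measurable_fun setT (fun r => dsm n Ax3 w (q, r)).
Proof. exact: (measurable_fun_pair2 q (m_dsm n Ax3 w)). Qed.

Lemma vvarE n q : ((vvar n q)%:E = \int[nu]_r `|dsm n Ax3 w (q, r)|%:E)%E.
Proof.
rewrite /vvar fineK// ge0_fin_numE; last exact: integral_ge0.
have [M hM] := bd_dsm n Ax3 w; apply: (@le_lt_trans _ _ (\int[nu]_r M%:E)%E).
  by apply: int_mono => r; rewrite lee_fin.
by rewrite (integral_cst1 _ h1) ltry.
Qed.

Lemma vvar_ge0 n q : 0 <= vvar n q.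
Proof. by rewrite -lee_fin vvarE integral_ge0. Qed.

Lemma nm_vvar n : (nm nu2 pp (vvar n) <= C%:E)%E.
Proof.
have md := m_dsm n Ax3 w; have pn := @ppn0 R.
apply: (nm_leP _ _ p0 _).1; first by rewrite lee_fin.
apply: le_trans (poweR_le (ltW p0) (nm_ge0 _ _ _) (nm_dsm_w n)).
rewrite nm_pow// /m3 [leRHS](tonelli1 (pm nu nu) nu); last 2 first.
- by apply/measurable_EFinP; exact: mpow.
- by move=> x; rewrite lee_fin powR_ge0.
apply: int_mono => q; first by rewrite lee_fin powR_ge0.
rewrite ger0_norm ?vvar_ge0// -poweR_EFin vvarE.
have := @jensen _ _ _ nu pp (fun=> 1) (fun r => dsm n Ax3 w (q, r)) p1 (measurable_cst _) (fun=> ler01) _ (mdq n q).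
rewrite (integral_cst1 _ h1) lexx => /(_ isT).
by under eq_integral do rewrite mul1r; under [X in (_ <= X)%E]eq_integral do rewrite mul1r.
Qed.

Lemma vvar_le n q z z' : 0 <= z <= 1 -> 0 <= z' <= 1 -> `|sm n w (q, z) - sm n w (q, z')| <= vvar n q.
Proof.
move=> hz hz'; rewrite -lee_fin vvarE.
have d : drv (fun r => sm n w (q, r)) (fun r => dsm n Ax3 w (q, r)) by exact: (drv_ins w n Ax3 q).
have c : continuous (fun r => dsm n Ax3 w (q, r)) by exact: (@cont_ins _ w n Ax3 q).
exact: (FTC_le d c hz' hz).
Qed.

Let mwz z : measurable_fun setT (fun q => w (q, z)).
Proof. exact: (measurable_fun_pair1 z (ig_meas iw)). Qed.

(** The difference between two heights is bounded by [vvar] for the smooth functions; Fatou is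
    used first for the smoothing and then for heights tending to 0, where [w] vanishes. The
    heights are chosen so that the smoothing converges on the corresponding planes. *)
Lemma nm_trace : {ae (nu : {measure set R -> \bar R}), forall z, (nm nu2 pp (fun q => w (q, z)) <= C%:E)%E}.
Proof.
have [k hk] := sm_cvg_ae iw.
have good : {ae (nu : {measure set R -> \bar R}), forall z,
    {ae (nu2 : {measure set (R * R) -> \bar R}), forall q, sm (k n) w (q, z) @[n --> \oo] --> w (q, z)}}.
  apply: (@ae_pm2 _ _ _ _ _ nu2 nu (fun q z => sm (k n) w (q, z) @[n --> \oo] --> w (q, z))).
  by apply: filterS hk => -[].
have msz n z : measurable_fun setT (fun q => sm n w (q, z)).
  exact: (measurable_fun_pair1 z (m_sm n w)).
have step z z' : 0 <= z <= 1 -> 0 <= z' <= 1 ->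
    {ae (nu2 : {measure set (R * R) -> \bar R}), forall q, sm (k n) w (q, z) @[n --> \oo] --> w (q, z)} ->
    {ae (nu2 : {measure set (R * R) -> \bar R}), forall q, sm (k n) w (q, z') @[n --> \oo] --> w (q, z')} ->
    (nm nu2 pp (fun q => w (q, z) - w (q, z'))%R <= C%:E)%E.
  move=> hz hz' cz cz'.
  apply: (@nm_fatou _ _ _ nu2 pp (fun n q => sm (k n) w (q, z) - sm (k n) w (q, z'))) => //.
  - by move=> n; exact: measurable_funB.
  - exact: measurable_funB.
  - by apply: filterS (filterI cz cz') => q [c c']; exact: cvgB.
  - move=> n; apply: le_trans (nm_vvar (k n)); apply: nm_mono => // q.
    by rewrite [leRHS]ger0_norm ?vvar_ge0// vvar_le.
have H (j : nat) : exists z : R, (0 <= z <= 1 /\ z <= j.+1%:R^-1) /\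
    {ae (nu2 : {measure set (R * R) -> \bar R}), forall q, sm (k n) w (q, z) @[n --> \oo] --> w (q, z)}.
  have j0 : 0 < j.+1%:R^-1 :> R by rewrite invr_gt0.
  by have [x x1 x2] := ae_nu_small good j0; exists x.
have [zz hzz] := boolp.choice H.
have zz0 : zz j @[j --> \oo] --> 0.
  by apply: cvg_harm => j; have [[/andP[-> _] ->] _] := hzz j.
apply: filterS (filterI good (@ae_nu_in R)) => z [cz hz].
apply: (@nm_fatou _ _ _ nu2 pp (fun j q => w (q, z) - w (q, zz j))) => //.
- by move=> n; exact: measurable_funB.
- apply: filterS hcont => q [cq q0].
  rewrite -[X in _ --> X]subr0; apply: cvgB; first exact: cvg_cst.
  by rewrite -q0; exact: (cvg_comp _ _ zz0 (cq 0)).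
- by move=> j; have [[h _] h'] := hzz j; exact: step.
Qed.

(** The bound at almost every height is integrated over the heights. *)
Lemma nm_w : (nm m3 pp w <= C%:E)%E.
Proof.
apply: (nm_leP _ _ p0 _).1; first by rewrite lee_fin.
have mw := ig_meas iw.
rewrite /m3 tonelli2; last 2 first.
- by apply/measurable_EFinP; exact: mpow.
- by move=> x; rewrite lee_fin powR_ge0.
rewrite -(integral_cst1 (C%:E `^ pp)%E h1).
apply: ae_ge0_le_integral => //.
- by move=> z _; apply: integral_ge0 => q _; rewrite lee_fin powR_ge0.
- apply: (@mint1 _ _ _ _ _ nu2 (fun x => (`|w x| `^ pp)%:E)).
    by apply/measurable_EFinP; exact: mpow.
  by move=> x; rewrite lee_fin powR_ge0.
- by move=> z _; exact: poweR_ge0.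
apply: filterS nm_trace => z hz _.
by apply/(nm_leP _ _ p0 _) => //; rewrite lee_fin.
Qed.
End vertical.

(** * From higher differences to first differences *)
Section marchaud.
Context {R : realType}.
Local Notation X := (R * R * R)%type.
Implicit Types (a : axis) (x h : X) (n j k : nat) (f g : X -> R).

Let p0 := @pp0 R.
Let p1 := ltW (@pp1 R).
Let N f := nm m3 pp f.

Local Notation D k h := (iter k (dif h)).

(** The class of functions on which translations act without changing norms. *)
Definition torus f := measurable_fun setT f /\ torus_periodic f.

Lemma torus_dif h f : torus f -> torus (dif h f).
Proof. by move=> [mf pf]; split; [exact: m_dif|exact: dif_per]. Qed.

Lemma torus_iter k h f : torus f -> torus (D k h f).
Proof. by move=> tf; elim: k => //= k; exact: torus_dif. Qed.

Lemma torus_lin (c : R) f g : torus f -> torus g -> torus (fun x => c * f x + g x).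
Proof.
move=> [mf pf] [mg pg]; split; first by apply: measurable_funD => //; exact: measurable_funM.
by move=> x; have [h1 h2 h3] := pf x; have [k1 k2 k3] := pg x; rewrite h1 h2 h3 k1 k2 k3.
Qed.

Lemma dif_lin h (c : R) f g : dif h (fun x => c * f x + g x) = fun x => c * dif h f x + dif h g x.
Proof. by apply/funext => x; rewrite /dif; ring. Qed.

Lemma iter_lin k h (c : R) f g : D k h (fun x => c * f x + g x) = fun x => c * D k h f x + D k h g x.
Proof. by elim: k => //= k ->; rewrite dif_lin. Qed.

Lemma dif_double h f : dif (h + h) f = fun x => 2 * dif h f x + dif h (dif h f) x.
Proof. by apply/funext => x; rewrite /dif addrA; ring. Qed.

Lemma N_lin (c : R) f g : torus f -> torus g ->
  (N (fun x => c * f x + g x)%R <= `|c|%:E * N f + N g)%E.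
Proof.
move=> [mf _] [mg _]; apply: le_trans (@nmD _ _ _ m3 pp (fun x => c * f x) g _ mg p1) _.
  exact: measurable_funM.
by rewrite nmZ.
Qed.

Lemma N_dif h f : torus f -> (N (dif h f) <= 2%:E * N f)%E.
Proof.
move=> [mf pf]; apply: le_trans (@nmB _ _ _ m3 pp (fun x => f (x + h)) f (m_shift h mf) mf p1) _.
by rewrite nm_shift// -mule2n -mule_natl.
Qed.

Lemma N_iter k h f : torus f -> (N (D k h f) <= (2 ^+ k)%:E * N f)%E.
Proof.
move=> tf; elim: k => [|k IH]; first by rewrite expr0 mul1e.
rewrite iterS; apply: le_trans (N_dif h (torus_iter k h tf)) _.
by rewrite exprS EFinM -muleA; apply: lee_wpmul2l.
Qed.

(** The operator identity [E^2 - 1 = 2 (E - 1) + (E - 1)^2] for a translation [E], raised to the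
    power [k]. *)
Lemma doubling k : exists2 c : R, 0 <= c & forall h g, torus g ->
  (N (fun x => (- (2 ^+ k)) * D k h g x + D k (h + h) g x)%R <= c%:E * N (D k.+1 h g))%E.
Proof.
elim: k => [|k [c c0 IH]].
  exists 0 => // h g tg; rewrite mul0e (_ : (fun x => _) = fun=> 0); last first.
    by apply/funext => x /=; rewrite expr0 mulN1r addNr.
  apply: (nm_leP _ _ p0 (lexx _)).1; rewrite integral0_eq ?poweR_ge0// => x _.
  by rewrite normr0 powR0// ppn0.
exists (c * 4 + 2 ^+ k); first by rewrite addr_ge0// ?mulr_ge0// exprn_ge0.
move=> h g tg.
have tdd := torus_dif (h + h) tg.
have E : (fun x => - 2 ^+ k.+1 * D k.+1 h g x + D k.+1 (h + h) g x) =
    fun x => 2 ^+ k * D k.+2 h g x + (- 2 ^+ k * D k h (dif (h + h) g) x + D k (h + h) (dif (h + h) g) x).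
  have E1 : D k.+1 (h + h) g = D k (h + h) (dif (h + h) g) by exact: iterSr.
  have E2 : D k h (dif (h + h) g) = fun x => 2 * D k.+1 h g x + D k.+2 h g x.
    by rewrite dif_double iter_lin -!iterSr.
  by apply/funext => x; rewrite E1 E2 exprS; ring.
rewrite E; apply: le_trans (N_lin _ _ _) _.
- exact: torus_iter.
- by apply: torus_lin; exact: torus_iter.
rewrite ger0_norm ?exprn_ge0// addrC EFinD ge0_muleDl ?lee_fin ?mulr_ge0 ?exprn_ge0//.
apply: leeD => //; apply: le_trans (IH h _ tdd) _.
rewrite EFinM -muleA; apply: lee_wpmul2l; first by rewrite lee_fin.
have -> : D k.+1 h (dif (h + h) g) = fun x => 2 * D k.+2 h g x + D k.+3 h g x.
  by rewrite dif_double iter_lin -!iterSr.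
apply: le_trans (N_lin _ _ _) _; [exact: torus_iter|exact: torus_iter|].
have h3 := N_dif h (torus_iter k.+2 h tg).
apply: le_trans (leeD (lexx _) h3) _.
rewrite ger0_norm// -ge0_muleDl ?lee_fin// -EFinD.
by apply: lee_wpmul2r; [exact: nm_ge0|rewrite lee_fin; lra].
Qed.

Lemma doubling_le k : exists2 c : R, 0 <= c & forall h g, torus g ->
  ((2 ^+ k)%:E * N (D k h g) <= N (D k (h + h)%R g) + c%:E * N (D k.+1 h g))%E.
Proof.
have [c c0 H] := doubling k; exists c => // h g tg.
rewrite -[X in (X%:E * _)%E]ger0_norm ?exprn_ge0// -nmZ//; last by have [] := torus_iter k h tg.
have E x : 2 ^+ k * D k h g x = D k (h + h) g x - (- 2 ^+ k * D k h g x + D k (h + h) g x) by ring.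
rewrite (_ : (fun x => _) = fun x => D k (h + h) g x - (- 2 ^+ k * D k h g x + D k (h + h) g x)); last first.
  by apply/funext => x; exact: E.
have [m1 _] := torus_iter k (h + h) tg.
have [m2 _] := torus_lin (- 2 ^+ k) (torus_iter k h tg) (torus_iter k (h + h) tg).
apply: le_trans (@nmB _ _ _ m3 pp _ _ m1 m2 p1) _.
by apply: leeD => //; exact: H.
Qed.

Local Notation hj a j := ((2 ^+ j)^-1 *: un a).

Lemma hj_double a j : hj a j.+1 + hj a j.+1 = hj a j :> X.
Proof.
rewrite -scalerDl; congr (_ *: _); rewrite exprS; field.
by rewrite expf_neq0.
Qed.

(** Geometric decay, with ratio [q], of the differences of order [m] along dyadic steps; the ratio
    [2^(-s)] is that of a Besov norm of order [s]. *)
Definition has_decay (q b : R) m a f := torus f /\ (N f <= b%:E)%E /\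
  forall j, (N (D m (hj a j) f) <= (b * q ^+ j)%:E)%E.

(** The order is lowered by one with the same ratio. Halving the step gains a factor [2^k], at
    least 4, which beats the ratio because [q] is at least 3/8. *)
Lemma decay_step (q : R) m k : 3 / 8 <= q -> q <= 1 / 2 -> (2 <= k)%N ->
  (exists2 C : R, 0 <= C & forall a f b, has_decay q b m a f -> forall j,
     (N (D k.+1 (hj a j) f) <= (C * b * q ^+ j)%:E)%E) ->
  exists2 C : R, 0 <= C & forall a f b, has_decay q b m a f -> forall j,
     (N (D k (hj a j) f) <= (C * b * q ^+ j)%:E)%E.
Proof.
move=> q1 q2 k2 [C C0 HC]; have [c c0 Hc] := doubling_le k.
exists (2 ^+ k + c * C); first by rewrite addr_ge0 ?exprn_ge0 ?mulr_ge0.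
move=> a f b hf; have [tf [fb _]] := hf.
have b0 : 0 <= b by rewrite -lee_fin; apply: le_trans fb; exact: nm_ge0.
have k4 : 4 <= 2 ^+ k :> R.
  by rewrite (_ : 4 = 2 ^+ 2 :> R) ?ler_eXn2l//; [rewrite ltr1n|rewrite expr2; lra].
elim => [|j IH].
  rewrite expr0 mulr1; apply: le_trans (N_iter k _ tf) _.
  apply: le_trans (lee_wpmul2l _ fb) _; first by rewrite lee_fin exprn_ge0.
  by rewrite -EFinM lee_fin ler_wpM2r// lerDl mulr_ge0.
have := Hc (hj a j.+1) f tf; rewrite hj_double => /le_trans h.
have {h} := h _ (leeD IH (lee_wpmul2l _ (HC a f b hf j.+1))).
rewrite lee_fin => /(_ c0); rewrite muleC -lee_pdivlMr ?exprn_gt0// => h.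
apply: le_trans h _; rewrite -[(c%:E * _)%E]EFinM -EFinD -EFinM lee_fin.
rewrite ler_pdivrMr ?exprn_gt0// exprS.
have := exprn_ge0 j (le_trans (_ : 0 <= 3 / 8 :> R) q1).
move=> /(_ ltac:(lra)) qj0.
rewrite [leLHS](_ : _ = (b * q ^+ j) * ((2 ^+ k + c * C) + c * C * q)); last by ring.
rewrite [leRHS](_ : _ = (b * q ^+ j) * ((2 ^+ k + c * C) * q * 2 ^+ k)); last by ring.
apply: ler_wpM2l; first by rewrite mulr_ge0.
move: (mulr_ge0 c0 C0) k4; move: (c * C) (2 ^+ k) => K t K0 t4.
have qt : 3 / 2 <= q * t by nra.
rewrite -mulrA; apply: (@le_trans _ _ ((t + K) * (3 / 2))); last by apply: ler_wpM2l => //; lra.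
nra.
Qed.

Lemma decay_two (q : R) m : 3 / 8 <= q -> q <= 1 / 2 ->
  exists2 C : R, 0 <= C & forall a f b, has_decay q b m.+2 a f -> forall j,
     (N (D 2 (hj a j) f) <= (C * b * q ^+ j)%:E)%E.
Proof.
move=> q1 q2.
suff H d : (d <= m)%N -> exists2 C : R, 0 <= C & forall a f b, has_decay q b m.+2 a f -> forall j,
     (N (D (m.+2 - d) (hj a j) f) <= (C * b * q ^+ j)%:E)%E.
  by have := H m (leqnn m); rewrite -[m.+2]addn2 addnC addnK.
elim: d => [_|d IH dm].
  exists 1 => // a f b [_ [_ h]] j; rewrite subn0 mul1r; exact: h.
apply: decay_step => //; first by rewrite -[m.+2]addn2 -addnBAC// leq_addl.
rewrite -subSn; last by rewrite (leq_trans dm)// (leq_trans (leqnSn _)).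
by rewrite subSS; exact: IH (ltnW dm).
Qed.

(** For first differences the gain 2 is only just enough: the error terms form a geometric
    series with ratio [2 q < 1], and the difference quotients stay bounded. *)
Lemma decay_one (q : R) m : 3 / 8 <= q -> q < 1 / 2 ->
  exists2 C : R, 0 <= C & forall a f b, has_decay q b m.+2 a f -> forall j, (dq a f j <= (C * b)%:E)%E.
Proof.
move=> q1 q2; have [C C0 HC] := decay_two m q1 (ltW q2).
have [c c0 Hc] := doubling_le 1.
(* The sum of the geometric series of errors; the induction carries its partial sums. *)
pose E := c * C / 2 * (2 * q) / (1 - 2 * q).
have q0 : 0 <= q by lra.
have q3 : 0 < 1 - 2 * q by lra.
have E0 : 0 <= E by rewrite /E !mulr_ge0// invr_ge0 ltW.
exists (2 + E); first by rewrite addr_ge0.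
move=> a f b hf; have [tf [fb _]] := hf.
have b0 : 0 <= b by rewrite -lee_fin; apply: le_trans fb; exact: nm_ge0.
suff H j : (dq a f j <= (b * (2 + E - E * (2 * q) ^+ j))%:E)%E.
  move=> j; apply: le_trans (H j) _; rewrite lee_fin mulrC ler_wpM2r//.
  by rewrite lerBlDr lerDl mulr_ge0// exprn_ge0// mulr_ge0.
elim: j => [|j IH].
  rewrite /dq expr0 mul1e invr1 expr0 mulr1 addrK; apply: le_trans (N_dif _ tf) _.
  apply: le_trans (lee_wpmul2l _ fb) _ => //.
  by rewrite -EFinM lee_fin mulrC.
have := Hc (hj a j.+1) f tf; rewrite hj_double expr1 => h1.
have W (r : R) (x y : \bar R) : 0 <= r -> (x <= y -> r%:E * x <= r%:E * y)%E.
  by move=> r0; apply: lee_wpmul2l; rewrite lee_fin.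
have j0 : 0 <= 2 ^+ j :> R by rewrite exprn_ge0.
have h2 := W _ _ _ j0 h1.
have -> : dq a f j.+1 = ((2 ^+ j)%:E * (2%:E * N (D 1 (hj a j.+1) f)))%E.
  by rewrite /dq muleA -EFinM -exprSr.
apply: le_trans h2 _; rewrite ge0_muleDr ?mule_ge0 ?nm_ge0 ?lee_fin//.
have h4 := W _ _ _ j0 (W _ _ _ c0 (HC a f b hf j.+1)).
apply: le_trans (leeD IH h4) _; rewrite -!EFinM -EFinD lee_fin.
rewrite -[leRHS](_ : b * (2 + E - E * (2 * q) ^+ j) + b * (E * (1 - 2 * q) * (2 * q) ^+ j) = _); last first.
  by rewrite exprS; ring.
rewrite lerD2l /E divfK ?gt_eqF// !exprMn exprS le_eqVlt; apply/orP; left; apply/eqP; by field.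
Qed.

(** A measurable substitute for the Besov norm: the constant of the statement [stat]. *)
Definition AA f : \bar R :=
  (nm m3 pp f + (limn_einf (dq Ax1 f) + (limn_einf (dq Ax2 f) + limn_einf (dq Ax3 f))))%E.

Lemma limn_einf_le (x : nat -> \bar R) (c : \bar R) : (forall n, x n <= c)%E -> (limn_einf x <= c)%E.
Proof.
move=> h; rewrite limn_einf_lim; apply: lime_le; first exact: is_cvg_einfs.
apply: nearW => n; apply: le_trans (h n); apply: ereal_inf_lbound; exists n => //=.
Qed.

Lemma limn_einf_ge0 (x : nat -> \bar R) : (forall n, 0 <= x n)%E -> (0 <= limn_einf x)%E.
Proof.
move=> h; rewrite limn_einf_lim; apply: lime_ge; first exact: is_cvg_einfs.
by apply: nearW => n; apply: le_ereal_inf_tmp => _ [i _ <-].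
Qed.

Lemma dq_ge0 a f j : (0 <= dq a f j)%E.
Proof. by rewrite mule_ge0 ?nm_ge0// lee_fin exprn_ge0. Qed.

Lemma AA_ge0 f : (0 <= AA f)%E.
Proof. by rewrite !adde_ge0 ?nm_ge0// limn_einf_ge0// => n; exact: dq_ge0. Qed.

Lemma AA_stat f : torus f -> (AA f < +oo)%E -> stat f (fine (AA f)).
Proof.
move=> [mf pf] fin.
have E : ((fine (AA f))%:E = AA f)%E by rewrite fineK// ge0_fin_numE ?AA_ge0.
have l0 a : (0 <= limn_einf (dq a f))%E by apply: limn_einf_ge0 => n; exact: dq_ge0.
have n0 : (0 <= nm m3 pp f)%E by exact: nm_ge0.
split => //; rewrite E /AA; first by rewrite leeDl// !adde_ge0.
move=> a; rewrite (@le_trans _ _ (limn_einf (dq Ax1 f) + (limn_einf (dq Ax2 f) + limn_einf (dq Ax3 f)))%E)//; last first.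
  by rewrite leeDr.
case: a; first by rewrite leeDl// adde_ge0.
- by rewrite (@le_trans _ _ (limn_einf (dq Ax2 f) + limn_einf (dq Ax3 f))%E)// ?leeDl// leeDr.
- by rewrite (@le_trans _ _ (limn_einf (dq Ax2 f) + limn_einf (dq Ax3 f))%E)// leeDr.
Qed.

Lemma torus_norm_nm (r : R) f : r != 0 -> measurable_fun setT f -> torus_norm r%:E f = nm m3 r f.
Proof.
move=> r0 mf; rewrite (nmE _ _ r0) -[LHS](poweRK r0 (Lnorm_ge0 _ _ _)) powR_Lnorm//; congr poweR.
rewrite -ge0_cubeE; last 2 first.
- by apply/measurable_EFinP; exact: mpow.
- by move=> x; rewrite lee_fin powR_ge0.
rewrite [RHS]integral_mkcond; apply: eq_integral => x _.
rewrite /= !patchE; case: ifP => // _.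
by rewrite normr0 powR0.
Qed.

Lemma torus_normE f : measurable_fun setT f -> torus_norm pp%:E f = nm m3 pp f.
Proof. exact: torus_norm_nm ppn0. Qed.

Lemma enorm_un a (r : R) : 0 <= r -> enorm (r *: un a) = r.
Proof.
move=> r0; have E : enorm (r *: un a) = Num.sqrt ((r * (un a).1.1) ^+ 2 + (r * (un a).1.2) ^+ 2 + (r * (un a).2) ^+ 2) by [].
by rewrite E; case: a {E} => /=; rewrite !mulr0 !mulr1 expr0n /= ?addr0 ?add0r sqrtr_sqr ger0_norm.
Qed.

(** The Besov norm gives decay with ratio [2^(-s)] for differences of order one more than the
    integral part of [s]; when [s] is large the ratio is first weakened to 3/8. *)
Lemma AA_besov (s : R) : 1 < s -> exists2 C : R, 0 < C & forall f, torus f ->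
  (AA f <= C%:E * besov_norm s pp%:E f)%E.
Proof.
move=> s1; have s0 : 0 < s by lra.
have [m mE] : exists m, (Num.truncn s).+1 = m.+2.
  exists (Num.truncn s).-1; congr (_.+1); rewrite prednK//.
  by rewrite truncn_gt0 ltW.
pose q := Num.max (2 `^ (- s)) (3 / 8) : R.
have q1 : 3 / 8 <= q by rewrite le_max lexx orbT.
have q2 : q < 1 / 2.
  rewrite gt_max; apply/andP; split; last by lra.
  rewrite powRN div1r ltf_pV2 ?posrE ?powR_gt0//.
  have l2 : 0 < ln (2 : R) by apply: ln_gt0; lra.
  rewrite /powR (_ : (2 == 0 :> R) = false); last by rewrite gt_eqF.
  by rewrite -[ltLHS]lnK ?posrE// ltr_expR ltr_pMl.
have [C C0 HC] := decay_one m q1 q2.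
exists (1 + 3 * C); first by rewrite ltr_wpDr// mulr_ge0.
move=> f tf; have [mf pf] := tf.
set b := besov_norm _ _ _.
have sup0 h : (h != 0)%R -> ((enorm h `^ (- s))%:E * nm m3 pp (D m.+2 h f) <= b)%E.
  move=> h0; have [mD _] := torus_iter m.+2 h tf.
  rewrite -torus_normE// /b /besov_norm mE; apply: le_trans (leeDr _ _); last first.
    by rewrite torus_normE// nm_ge0.
  by apply: ereal_sup_ubound; exists h.
have nb : (nm m3 pp f <= b)%E.
  rewrite -torus_normE// /b /besov_norm leeDl//.
  apply: le_trans (ereal_sup_ubound _); last by exists (un Ax1) => //; apply/eqP => -[] /eqP; rewrite oner_eq0.
  by rewrite mule_ge0 ?lee_fin ?powR_ge0// /torus_norm Lnorm_ge0.
have b0 : (0 <= b)%E by apply: le_trans nb; exact: nm_ge0.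
have [boo|] := ltP b +oo%E; last first.
  rewrite leye_eq => /eqP ->; rewrite gt0_muley ?leey// lte_fin ltr_wpDr// mulr_ge0//.
have fb : b \is a fin_num by rewrite ge0_fin_numE.
have H a : has_decay q (fine b) m.+2 a f.
  split => //; split; first by rewrite fineK.
  move=> j; set h := hj a j.
  have hE : enorm h = (2 ^+ j)^-1 by rewrite enorm_un// invr_ge0 exprn_ge0.
  have h0 : (h != 0)%R.
    apply/eqP => h0; have : enorm h = 0 by rewrite h0 /enorm /= expr0n /= !addr0 sqrtr0.
    by rewrite hE => /eqP; rewrite invr_eq0 expf_eq0 pnatr_eq0 andbF.
  have := sup0 h h0; rewrite -[X in (_ <= X)%E](fineK fb) muleC -lee_pdivlMr; last first.
    by rewrite powR_gt0// hE invr_gt0 exprn_gt0.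
  move=> /le_trans; apply; rewrite -EFinM lee_fin ler_wpM2l ?fine_ge0//.
  rewrite hE powRN invrK.
  have -> : (2 ^+ j)^-1 `^ s = (2 `^ (- s)) ^+ j :> R.
    rewrite -powR_invn// -powRrM -[RHS]powR_mulrn ?powR_ge0// -powRrM; congr (_ `^ _); ring.
  by rewrite lerXn2r ?nnegrE ?powR_ge0//; [lra|rewrite le_max lexx].
have dqb a : (limn_einf (dq a f) <= (C * fine b)%:E)%E.
  by apply: limn_einf_le => j; exact: HC (H a) j.
rewrite /AA; apply: le_trans (leeD nb (leeD (dqb Ax1) (leeD (dqb Ax2) (dqb Ax3)))) _.
rewrite -(fineK fb) -!EFinD -EFinM lee_fin; nra.
Qed.
End marchaud.

(** * Smooth functions *)
Section Cn.
Context {R : realType}.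
Implicit Types (F G f g : R -> R) (k : nat) (x : R).

(** Derivatives are again required to be continuous; what is asked is the existence of a
    chain of derivatives, none of which has to be named. *)
Fixpoint Cn k F : Prop :=
  if k is k'.+1 then exists2 f, drv F f & Cn k' f else continuous F.

Definition Cinf F := forall k, Cn k F.

Lemma CnS k F : Cn k.+1 F -> Cn k F.
Proof.
elim: k F => [|k IH] F [f dF cf]; first exact: (drv_cont dF).
by exists f => //; exact: IH.
Qed.

Lemma Cn_cont k F : Cn k F -> continuous F.
Proof. by elim: k F => // k IH F /CnS; exact: IH. Qed.

Lemma Cn_cst k (c : R) : Cn k (fun=> c).
Proof.
elim: k c => [|k IH] c; first by move=> x; exact: cvg_cst.
by exists (fun=> 0); [exact: drv_cst|exact: IH].
Qed.

Lemma CnD k F G : Cn k F -> Cn k G -> Cn k (fun x => F x + G x).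
Proof.
elim: k F G => [|k IH] F G; first by move=> cF cG x; apply: cvgD; [exact: cF|exact: cG].
move=> [f dF cf] [g dG cg]; exists (fun x => f x + g x); [exact: drvD|exact: IH].
Qed.

Lemma CnM k F G : Cn k F -> Cn k G -> Cn k (fun x => F x * G x).
Proof.
elim: k F G => [|k IH] F G; first by move=> cF cG x; apply: cvgM; [exact: cF|exact: cG].
move=> hF hG; have cF := CnS hF; have cG := CnS hG.
move: hF hG => [f dF cf] [g dG cg]; exists (fun x => f x * G x + F x * g x); first exact: drvM.
by apply: CnD; exact: IH.
Qed.

Lemma CnX k F n : Cn k F -> Cn k (fun x => F x ^+ n).
Proof.
move=> hF; elim: n => [|n IH]; first exact: Cn_cst.
by under eq_fun do rewrite exprS; exact: CnM.
Qed.

Lemma Cn_affine k F (a b : R) : Cn k F -> Cn k (fun x => F (a * x + b)).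
Proof.
elim: k F => [|k IH] F.
  move=> cF x; apply: (@cvg_comp _ _ _ (fun x => a * x + b) F); last exact: cF.
  by apply: cvgD; [apply: cvgM; [exact: cvg_cst|exact: cvg_id]|exact: cvg_cst].
move=> [f dF cf]; exists (fun x => f (a * x + b) * a); last first.
  by apply: CnM; [exact: IH|exact: Cn_cst].
apply: (drv_ext (drv_comp dF (drvD (drvZ a (drv_id (R := R))) (drv_cst b)))) => x.
by rewrite mulr1 addr0.
Qed.

Lemma drvV F f : drv F f -> (forall x, F x != 0) -> drv (fun x => (F x)^-1) (fun x => - f x * ((F x)^-1 * (F x)^-1)).
Proof.
move=> dF F0 x; have := @is_deriveV R F x (f x) 1 (F0 x) (dF x).
move=> /@is_derive_eq; apply.
by rewrite /= -[_ *: _]/(_ * _) -exprVn expr2; ring.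
Qed.

Lemma CnV k F : Cn k F -> (forall x, F x != 0) -> Cn k (fun x => (F x)^-1).
Proof.
move=> hF F0; elim: k hF => [|k IH]; first by move=> cF x; apply: cvgV => //; exact: cF.
move=> hF; have cV := IH (CnS hF); move: hF => [f dF cf].
exists (fun x => - f x * ((F x)^-1 * (F x)^-1)); first exact: drvV.
apply: CnM; last exact: CnM.
by under eq_fun do rewrite -mulN1r; apply: CnM => //; exact: Cn_cst.
Qed.

Lemma drv_uniq F f g : drv F f -> drv F g -> f = g.
Proof. by move=> df dg; apply/funext => x; have [_ <-] := df x; have [_ <-] := dg x. Qed.

Lemma Cinf_drv F f : Cinf F -> drv F f -> Cinf f.
Proof. by move=> hF df k; have [g dg cg] := hF k.+1; rewrite (drv_uniq df dg). Qed.

Lemma Cn_cs_sn k : Cn k (fun x => cos (pi * x)) /\ Cn k (fun x => sin (pi * x)).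
Proof.
elim: k => [|k [hc hs]]; first by split; [exact: (drv_cont drv_cs)|exact: (drv_cont drv_sn)].
split.
  exists (fun x => - (pi * sin (pi * x))); first exact: drv_cs.
  by under eq_fun do rewrite -mulN1r; apply: CnM; [exact: Cn_cst|apply: CnM => //; exact: Cn_cst].
exists (fun x => pi * cos (pi * x)); first exact: drv_sn.
by apply: CnM => //; exact: Cn_cst.
Qed.

Lemma Cinf_bas n i : Cinf (bas n i).
Proof.
move=> k; have [hc hs] := Cn_cs_sn k.
by apply: CnM; [exact: Cn_cst|apply: CnM; exact: CnX].
Qed.

(** The derivative of [flat k] is a combination of [flat k.+1] and [flat k.+2], so the whole family
    is smooth by induction. *)
Definition flat (k : nat) x : R := if 0 < x then x^-1 ^+ k * expR (- x^-1) else 0.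

Lemma flat_le k x : 0 <= flat k x /\ flat k x <= k.+2%:R ^+ k.+2 * x ^+ 2.
Proof.
rewrite /flat; case: ifP => x0; last by split => //; apply: mulr_ge0; [exact: exprn_ge0|exact: sqr_ge0].
have y0 : 0 < x^-1 by rewrite invr_gt0.
split; first by rewrite mulr_ge0 ?exprn_ge0 ?expR_ge0// ltW.
set y := x^-1 in y0 *; have xE : x = y^-1 by rewrite invrK.
have n0 : 0 < k.+2%:R :> R by rewrite ltr0n.
have h : (y / k.+2%:R) ^+ k.+2 <= expR y.
  have -> : expR y = expR (y / k.+2%:R) ^+ k.+2.
    by rewrite -expRM_natr divfK ?gt_eqF.
  rewrite lerXn2r ?nnegrE ?expR_ge0 ?divr_ge0 ?(ltW y0)//.
  by apply: le_trans (expR_ge1Dx _); rewrite lerDr.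
rewrite expRN ler_pdivrMr ?expR_gt0//.
apply: le_trans (ler_wpM2l _ h); last by rewrite mulr_ge0 ?exprn_ge0// xE invr_ge0 ltW.
have Q0 : k.+2%:R ^+ k.+2 != 0 :> R by rewrite expf_neq0// gt_eqF.
rewrite expr_div_n -[in y ^+ k.+2]addn2 exprD xE le_eqVlt; apply/orP; left; apply/eqP.
by move: Q0; move: (k.+2%:R ^+ k.+2) => Q Q0; field; rewrite Q0 gt_eqF.
Qed.

Lemma drv_flat k : drv (flat k) (fun x => - k%:R * flat k.+1 x + flat k.+2 x).
Proof.
move=> x; have [x0|x0|x0] := ltgtP 0 x.
- have xn0 : x != 0 by rewrite gt_eqF.
  have dV : is_derive x 1 (fun y : R => y^-1) (- x ^- 2).
    have := @is_deriveV R id x 1 1 xn0 (is_derive_id _ _).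
    by move=> /@is_derive_eq; apply; rewrite /= -[_ *: _]/(_ * _) mulr1.
  have d1 := is_deriveX k dV.
  have dN := is_deriveN dV.
  have d2 := @is_derive1_comp _ expR (fun y : R => - y^-1) x _ _ (is_derive_expR _) dN.
  have d3 := is_deriveM d1 d2.
  have E : \near x, ((fun y : R => y^-1) ^+ k * (expR \o (fun y : R => - y^-1))) x = flat k x.
    near=> y; have y0 : 0 < y by near: y; exact: lt_nbhsr.
    by rewrite /flat y0 /= fctE exprfctE.
  apply: (near_eq_is_derive E); apply: (is_derive_eq d3).
  rewrite /flat x0 /= -![_ *: _]/(_ * _) exprfctE /=.
  by case: k {d1 d3 E} => [|k] /=; rewrite ?mul0r ?oppr0 !exprS ?expr0; field.
- have E : \near x, cst 0 x = flat k x.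
    near=> y; have y0 : y < 0 by near: y; exact: lt_nbhsl.
    by rewrite /flat ltNge ltW.
  apply: (near_eq_is_derive E); apply: (is_derive_eq (is_derive_cst 0 x 1)).
  by rewrite /flat (_ : (0 < x) = false) ?mulr0 ?addr0// ltNge ltW.
rewrite -x0 {x0}.
have H : (fun h : R => h^-1 *: (flat k (h *: 1 + 0) - flat k 0)) @ 0^' --> (0 : R).
  have f0 : flat k 0 = 0 by rewrite /flat ltxx.
  apply/cvgrPdist_le => e e0; set C : R := k.+2%:R ^+ k.+2.
  have C0 : 0 < C by rewrite exprn_gt0.
  near=> h; rewrite f0 subr0 addr0 sub0r normrN -[h *: 1]/(h * 1) mulr1.
  have hn0 : h != 0 by near: h; exact: nbhs_dnbhs_neq.
  have [a1 a2] := flat_le k h.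
  rewrite -[_ *: _]/(_ * _) normrM normfV ger0_norm// mulrC ler_pdivrMr ?normr_gt0//.
  apply: le_trans a2 _; rewrite -/C -real_normK ?num_real// expr2 mulrA ler_wpM2r//.
  rewrite -ler_pdivlMl//; near: h; apply: dnbhs0_le; by rewrite mulr_gt0// invr_gt0.
split; first by apply/cvg_ex; exists 0.
have -> : 'D_1 (flat k) 0 = 0 by apply: (cvg_lim _ H).
by rewrite /flat ltxx mulr0 addr0.
Unshelve. all: by end_near. Qed.

Lemma Cinf_flat k : Cinf (flat k).
Proof.
move=> n; elim: n k => [|n IH] k; first exact: (drv_cont (drv_flat k)).
exists (fun x => - k%:R * flat k.+1 x + flat k.+2 x); first exact: drv_flat.
by apply: CnD => //; apply: CnM => //; exact: Cn_cst.
Qed.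

(** A partition of unity quotient of the functions [exp (- 1 / x)] at [x] and at [1 - x]. *)
Definition step x : R := flat 0 x * (flat 0 x + flat 0 (- 1 * x + 1))^-1.

Let flat_gt0 x : 0 < x -> 0 < flat 0 x.
Proof. by move=> x0; rewrite /flat x0 expr0 mul1r expR_gt0. Qed.

Let flat_ge0 x : 0 <= flat 0 x. Proof. by have [] := flat_le 0 x. Qed.

Let den_gt0 x : 0 < flat 0 x + flat 0 (- 1 * x + 1).
Proof.
have [x0|x0] := ltP 0 x; first by rewrite ltr_pwDl// flat_gt0.
by rewrite ltr_wpDl// flat_gt0; lra.
Qed.

Lemma Cinf_step : Cinf step.
Proof.
move=> k; apply: CnM; first exact: Cinf_flat.
apply: CnV; last by move=> x; rewrite gt_eqF.
by apply: CnD; [|apply: Cn_affine]; exact: Cinf_flat.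
Qed.

Lemma step0 x : x <= 0 -> step x = 0.
Proof. by move=> x0; rewrite /step {1}/flat ltNge x0 mul0r. Qed.

Lemma step1 x : 1 <= x -> step x = 1.
Proof.
move=> x1; have h := den_gt0 x; move: h; rewrite /step.
have -> : flat 0 (- 1 * x + 1) = 0 by rewrite /flat ltNge (_ : _ <= 0)//; lra.
by rewrite addr0 => h; rewrite mulfV// gt_eqF.
Qed.

Lemma step_01 x : 0 <= step x <= 1.
Proof.
rewrite /step; apply/andP; split; first by rewrite mulr_ge0// invr_ge0 ltW.
by rewrite ler_pdivrMr// mul1r lerDl.
Qed.

(** The derivative of the step: smooth, supported in the unit interval, of integral 1. *)
Definition rho : R -> R := xget (fun=> 0) [set f | drv step f].

Lemma drv_step : drv step rho.
Proof.
have [f df _] := Cinf_step 1.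
exact: (@xgetPex _ (fun=> 0) [set f | drv step f] (ex_intro _ f df)).
Qed.

Lemma Cinf_rho : Cinf rho. Proof. exact: (Cinf_drv Cinf_step drv_step). Qed.

Lemma rho0 x : ~~ (0 <= x <= 1) -> rho x = 0.
Proof.
move=> h; have [c E] : exists c : R, \near x, cst c x = step x.
  have [x0|x0] := ltP x 0.
    exists 0; near=> y; rewrite step0// ltW//; near: y; exact: lt_nbhsl.
  move: h; rewrite x0 /= -ltNge => x1.
  exists 1; near=> y; rewrite step1// ltW//; near: y; exact: lt_nbhsr.
have [_ <-] := drv_step x; rewrite -(near_eq_derive _ E).
by have [_ ->] := is_derive_cst c x 1.
Unshelve. all: by end_near. Qed.

Lemma rho_bd : exists2 C : R, 0 < C & forall x, `|rho x| <= C.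
Proof.
have cr : continuous (fun x => `|rho x|).
  by move=> x; apply: cvg_norm; exact: (Cn_cont (Cinf_rho 0)).
have [c _ hc] := EVT_max ler01 (continuous_subspaceT cr).
exists (`|rho c| + 1); first by rewrite ltr_wpDl.
move=> x; have [x01|/rho0 ->] := boolP (0 <= x <= 1).
  by apply: le_trans (hc x _) _; rewrite ?in_itv// lerDl.
by rewrite normr0 addr_ge0.
Qed.
End Cn.

Section smooth4.
Context {R : realType}.
Local Notation X := (R * R * R)%type.
Local Notation V := (R * R * R * R)%type.
Implicit Types (f g : V -> R).

(** Derivatives in all directions of the vector space at once, as in the definition of test functions. *)
Fixpoint Sn (k : nat) f : Prop :=
  if k is k'.+1 then continuous f /\ forall v, exists2 g, (forall x, is_derive x v f (g x)) & Sn k' g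
  else continuous f.

Lemma Sn_cont k f : Sn k f -> continuous f. Proof. by case: k => // k []. Qed.

Lemma SnS k f : Sn k.+1 f -> Sn k f.
Proof.
elim: k f => [|k IH] f [cf H] //; split=> // v.
by have [g dg hg] := H v; exists g => //; exact: IH.
Qed.

Lemma Sn_smooth f : (forall k, Sn k f) -> smooth f.
Proof.
move=> hf l g.
have H k : Sn k g.
  rewrite /g; elim: l {g} k => [|v l IH] k /=; first exact: hf.
  have [_ /(_ v)[g dg hg]] := IH k.+1.
  by rewrite (_ : 'D_v _ = g)//; apply/funext => x; have [_ ->] := dg x.
split; first exact: (H 0%N).
by move=> x v; have [_ /(_ v)[g' dg _]] := H 1%N; have [] := dg x.
Qed.

Lemma SnM k f g : Sn k f -> Sn k g -> Sn k (fun x => f x * g x).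
Proof.
have SnD n f1 f2 : Sn n f1 -> Sn n f2 -> Sn n (fun x => f1 x + f2 x).
  elim: n f1 f2 => [|n IH] f1 f2 h1 h2; first by move=> x; apply: cvgD; [exact: h1|exact: h2].
  split; first by move=> x; apply: cvgD; [exact: (Sn_cont h1)|exact: (Sn_cont h2)].
  move=> v; have [g1 d1 hg1] := h1.2 v; have [g2 d2 hg2] := h2.2 v.
  by exists (fun x => g1 x + g2 x); [move=> x; exact: is_deriveD|exact: IH].
elim: k f g => [|k IH] f g h1 h2; first by move=> x; apply: cvgM; [exact: h1|exact: h2].
split; first by move=> x; apply: cvgM; [exact: (Sn_cont h1)|exact: (Sn_cont h2)].
move=> v; have [g1 d1 hg1] := h1.2 v; have [g2 d2 hg2] := h2.2 v.
exists (fun x => f x * g2 x + g x * g1 x); first by move=> x; exact: is_deriveM.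
by apply: SnD; apply: IH => //; exact: SnS.
Qed.

Lemma is_derive_dir (F f : R -> R) (x c : R) : drv F f -> is_derive x c F (f x * c).
Proof.
move=> dF; have [dv vd] := dF x.
have df : differentiable F x by exact/derivable1_diffP.
split; first exact: diff_derivable.
rewrite deriveE// -vd deriveE// -[c in LHS]mulr1 -[c * 1]/(c *: (1 : R)) linearZ /=.
by rewrite mulrC.
Qed.

Lemma Sn_coord (pj : V -> R) k (F : R -> R) : continuous pj ->
  (forall (h : R) v x, pj (h *: v + x) = h * pj v + pj x) -> Cn k F -> Sn k (fun q => F (pj q)).
Proof.
move=> cp lp; elim: k F => [|k IH] F hF.
  by move=> x; apply: (cvg_comp _ _ (cp x)); exact: hF.
split; first by move=> x; apply: (cvg_comp _ _ (cp x)); exact: (Cn_cont hF).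
move=> v; move: hF => [f dF hf]; exists (fun q => f (pj q) * pj v).
  move=> x; have [dd vd] := is_derive_dir (pj x) (pj v) dF.
  have E : (fun h : R => h^-1 *: (((fun q => F (pj q)) \o shift x) (h *: v) - F (pj x))) =
           (fun h : R => h^-1 *: ((F \o shift (pj x)) (h *: pj v) - F (pj x))).
    by apply/funext => h /=; rewrite lp.
  by split; [rewrite /derivable E|rewrite /derive E].
have := IH f hf => h; apply: SnM => //.
elim: k {IH hf h dF f} (pj v) => [|k IH] c; first by move=> x; exact: cvg_cst.
split; first by move=> x; exact: cvg_cst.
by move=> v'; exists (fun=> 0) => // x; exact: is_derive_cst.
Qed.

Lemma cont_coord : [/\ continuous (fun q : V => q.2), continuous (fun q : V => q.1.1.1),
  continuous (fun q : V => q.1.1.2) & continuous (fun q : V => q.1.2)].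
Proof.
have c1 (A B : topologicalType) : continuous (@fst A B) by move=> x; exact: cvg_fst.
have c2 (A B : topologicalType) : continuous (@snd A B) by move=> x; exact: cvg_snd.
have d1 (A B : topologicalType) (g : V -> A * B) : continuous g -> continuous (fun q => (g q).1).
  by move=> cg x; exact: (cvg_comp _ _ (cg x) (c1 A B (g x))).
have d2 (A B : topologicalType) (g : V -> A * B) : continuous g -> continuous (fun q => (g q).2).
  by move=> cg x; exact: (cvg_comp _ _ (cg x) (c2 A B (g x))).
split.
- exact: c2.
- exact: (d1 _ _ _ (d1 _ _ _ (c1 _ _))).
- exact: (d2 _ _ _ (d1 _ _ _ (c1 _ _))).
- exact: (d2 _ _ _ (c1 _ _)).
Qed.

(** Products of a function of time with a basis function; these are the only test functions that
    the proof inserts in the weak formulation. *)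
Definition tphi n (chi : R -> R) (J : idx n) (q : V) : R := chi q.2 * eb J q.1.

Lemma tphi_test T n chi (J : idx n) a b : Cinf chi -> 0 < a -> b < T ->
  (forall t, ~~ (a <= t <= b) -> chi t = 0) -> test_fun T (tphi chi J).
Proof.
move=> hc a0 bT sup; have [k0 k1 k2 k3] := cont_coord; split.
- apply: Sn_smooth => k; rewrite /tphi /eb.
  apply: SnM; first by apply: Sn_coord.
  apply: SnM; [apply: SnM|].
  + exact: (@Sn_coord (fun q => q.1.1.1) k _ k1 (fun _ _ _ => erefl) (Cinf_bas n J.1.1 k)).
  + exact: (@Sn_coord (fun q => q.1.1.2) k _ k2 (fun _ _ _ => erefl) (Cinf_bas n J.1.2 k)).
  + exact: (@Sn_coord (fun q => q.1.2) k _ k3 (fun _ _ _ => erefl) (Cinf_bas n J.2 k)).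
- by move=> t x; rewrite /slice /tphi /=; have [h1 h2 h3] := eb_periodic J x; rewrite h1 h2 h3.
- by exists a, b; split => // x t h; rewrite /tphi /= sup// mul0r.
Qed.

(** A directional derivative only sees the restriction to a line. *)
Lemma line_derive (W : normedModType R) (f : W -> R) (q v : W) (g : R -> R) :
  drv (fun r => f (q + r *: v)) g -> 'D_v f q = g 0.
Proof.
move=> /(_ 0)[_ <-]; rewrite /derive.
have -> : (fun h : R => h^-1 *: ((f \o shift q) (h *: v) - f q)) =
  (fun h : R => h^-1 *: (((fun r : R => f (q + r *: v)) \o shift 0) (h *: 1) - f (q + 0 *: v))) => //.
apply/funext => h /=.
have -> : h%:A + 0 = h :> R by rewrite addr0 -[h%:A]/(h * 1) mulr1.
by rewrite scale0r addr0 [h *: v + q]addrC.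
Qed.

Lemma tphi_dx n chi (J : idx n) ax q :
  'D_((un ax, 0) : V) (tphi chi J) q = chi q.2 * deb ax J q.1.
Proof.
have E r : (q + r *: ((un ax, 0) : V)) = (q.1 + r *: un ax, q.2).
  by apply: (@eq_trans _ _ (q.1 + r *: un ax, q.2 + r * 0)) => //; rewrite mulr0 addr0.
have d : drv (fun r => tphi chi J (q + r *: ((un ax, 0) : V))) (fun r => chi q.2 * deb ax J (q.1 + r *: un ax)).
  have -> : (fun r => tphi chi J (q + r *: ((un ax, 0) : V))) = fun r => chi q.2 * eb J (q.1 + r *: un ax).
    by apply/funext => r; rewrite E.
  by apply: drvZ; exact: drv_eb.
by rewrite (line_derive d) scale0r addr0.
Qed.

Lemma tphi_dt n chi chi' (J : idx n) q : drv chi chi' ->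
  'D_(e_t : V) (tphi chi J) q = chi' q.2 * eb J q.1.
Proof.
move=> dc; have E r : (q + r *: (e_t : V)) = (q.1, q.2 + r).
  apply: (@eq_trans _ _ (q.1 + r *: (0 : X), q.2 + r * 1)) => //.
  by rewrite scaler0 addr0 mulr1.
have d : drv (fun r => tphi chi J (q + r *: (e_t : V))) (fun r => chi' (q.2 + r) * eb J q.1).
  under eq_fun do rewrite E.
  apply: (drv_ext (drvM (drv_comp dc (drvD (drv_cst q.2) (drv_id (R := R)))) (drv_cst (eb J q.1)))) => r.
  by rewrite add0r mulr1 mulr0 addr0.
by rewrite (line_derive d) addr0.
Qed.
End smooth4.

(** * Weak derivatives in time *)
Section more_integrals.
Context d (X : measurableType d) {R : realType} (mu : {measure set X -> \bar R}).

Lemma I_dct_ae (F : nat -> X -> R) (f g : X -> R) : (forall n, measurable_fun setT (F n)) ->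
  measurable_fun setT f -> ig mu g ->
  {ae mu, forall x, (forall n, `|F n x| <= g x) /\ F n x @[n --> \oo] --> f x} ->
  \int[mu]_x F n x @[n --> \oo] --> \int[mu]_x f x.
Proof.
move=> mF mf ig_ H.
have mFE n : measurable_fun setT (EFin \o F n) by exact/measurable_EFinP.
have mfE : measurable_fun setT (EFin \o f) by exact/measurable_EFinP.
have cvE : {ae mu, forall x, [set: X] x -> (EFin \o F n) x @[n --> \oo] --> (EFin \o f) x}.
  by apply: filterS H => x [_ cv] _; apply: cvg_EFin; [exact: nearW|exact: cv].
have bd : {ae mu, forall x n, [set: X] x -> (`|(EFin \o F n) x| <= (EFin \o g) x)%E}.
  by apply: filterS H => x [Fg _] n _; rewrite /= lee_fin.
have [if_ _ h] := dominated_convergence measurableT mFE mfE cvE ig_ bd.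
apply: fine_cvg; rewrite -/(Rintegral mu setT f) IE //; exact: h.
Qed.

Lemma I_dct (F : nat -> X -> R) (f g : X -> R) : (forall n, measurable_fun setT (F n)) ->
  measurable_fun setT f -> ig mu g -> (forall n x, `|F n x| <= g x) ->
  (forall x, F n x @[n --> \oo] --> f x) ->
  \int[mu]_x F n x @[n --> \oo] --> \int[mu]_x f x.
Proof. by move=> mF mf ig_ Fg cv; apply: I_dct_ae (aeW _ _) => //; exact: ig_. Qed.
(** Integrability depends only on the class modulo null sets, once measurability is known. *)
Lemma ig_ae (f g : X -> R) : ig mu f -> measurable_fun setT g ->
  {ae mu, forall x, g x = f x} -> ig mu g.
Proof.
move=> if_ mg H; have mf := ig_meas if_; have /igP[_ fy] := if_.
have mn (k : X -> R) : measurable_fun setT k -> measurable_fun setT (fun x => (`|k x|%:E : \bar R)).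
  by move=> mk; apply/measurable_EFinP; exact: measurableT_comp.
apply/igP; split => //; apply: le_lt_trans fy; apply: ae_ge0_le_integral => //; [exact: mn|exact: mn|].
by apply: filterS H => x -> _.
Qed.
End more_integrals.

Section fubini1.
Context d d' (X : measurableType d) (Y : measurableType d') {R : realType}.
Variables (m : {sigma_finite_measure set X -> \bar R}) (m' : {sigma_finite_measure set Y -> \bar R}).
Variable f : X * Y -> R.
Hypothesis hf : ig (pm m m') f.

Lemma fubini_ae1 : {ae m, forall x, ig m' (fun y => f (x, y))}.
Proof.
have [mf h] := (igP _ _).1 hf.
have mnf : measurable_fun setT (fun z => `|f z|%:E : \bar R).
  by apply/measurable_EFinP; exact: measurableT_comp.
rewrite tonelli1 in h => //.
have mI := mint2 m' mnf (fun z => normr_ge0 (f z)).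
have I0 x : (0 <= \int[m']_y `|f (x, y)|%:E)%E by exact: integral_ge0.
apply: filterS (int_lty_ae mI I0 h).
by move=> x Hx; apply/igP; split => //; exact: (measurable_fun_pair2 x mf).
Qed.

Lemma fubini_ig1 : ig m (fun x => \int[m']_y f (x, y)).
Proof.
apply/integrableP; split.
  apply/measurable_EFinP; apply: measurableT_comp => //.
  exact: (measurable_fubini_F hf).
have [mf h] := (igP _ _).1 hf; rewrite tonelli1 in h => //; last first.
  by apply/measurable_EFinP; exact: measurableT_comp.
by apply: le_lt_trans h; apply: int_mono => // x; exact: I_abs.
Qed.

Lemma fubini1 : \int[pm m m']_z f z = \int[m]_x \int[m']_y f (x, y).
Proof.
rewrite [LHS]/Rintegral [RHS]/Rintegral; congr fine.
rewrite -[LHS](integral12_prod_meas1 hf).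
apply: ae_eq_integral => //.
- exact: (measurable_fubini_F hf).
- by apply/measurable_EFinP; exact: ig_meas fubini_ig1.
apply: filterS fubini_ae1 => x hx _ /=; rewrite -/(EFin _).
by rewrite [RHS](IE hx).
Qed.
End fubini1.

Section ig_tensor.
Context d d' (X : measurableType d) (Y : measurableType d') {R : realType}.
Variables (m : {sigma_finite_measure set X -> \bar R}) (m' : {sigma_finite_measure set Y -> \bar R}).

Lemma ig_tensor (f : X -> R) (g : Y -> R) : ig m f -> ig m' g -> ig (pm m m') (fun z => f z.1 * g z.2).
Proof.
move=> /igP[mf hf] /igP[mg hg]; apply/igP; split.
  apply: measurable_funM; first by apply: (mcomp mf); apply: mfst; exact: measurable_id.
  by apply: (mcomp mg); apply: msnd; exact: measurable_id.
rewrite tonelli1//; last first.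
  apply/measurable_EFinP; apply: measurableT_comp => //.
  apply: measurable_funM; first by apply: (mcomp mf); apply: mfst; exact: measurable_id.
  by apply: (mcomp mg); apply: msnd; exact: measurable_id.
have mgE : measurable_fun setT (fun y => `|g y|%:E) by apply/measurable_EFinP; exact: measurableT_comp.
rewrite (_ : integral _ _ _ = \int[m]_x (`|f x|%:E * \int[m']_y `|g y|%:E))%E; last first.
  apply: eq_integral => x _; rewrite /= -ge0_integralZl//.
  by apply: eq_integral => y _; rewrite -EFinM normrM.
rewrite ge0_integralZr//; [|by apply/measurable_EFinP; exact: measurableT_comp|exact: integral_ge0].
by rewrite lte_mul_pinfty//; [exact: integral_ge0|rewrite ge0_fin_numE//; exact: integral_ge0].
Qed.
End ig_tensor.

Section time.
Context {R : realType}.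
Local Notation mu1 := (@lebesgue_measure R).
Variable T : R.
Hypothesis T0 : 0 < T.
Implicit Types (h a f : R -> R) (s t : R) (n : nat).
Local Notation ta := (tau T).

Transparent tau leb.
Lemma tau_le (A : set R) : measurable A -> (ta A <= leb A)%E.
Proof.
move=> mA; apply: (@le_measure _ _ _ leb (A `&` `]0, T[%classic) A); rewrite ?inE//.
by apply: measurableI => //; exact: measurable_itvR.
Qed.

Lemma ae_tau (P : R -> Prop) : {ae mu1, forall x, P x} -> {ae (ta : {measure set R -> \bar R}), forall x, P x}.
Proof.
move=> [N [mN N0 NP]]; exists N; split => //; apply/eqP; rewrite eq_le measure_ge0 andbT.
apply: le_trans (tau_le mN) _.
by rewrite -[leb N]/(mu1 N) N0.
Qed.

Lemma ae_tau_in : {ae (ta : {measure set R -> \bar R}), forall t, 0 < t < T}.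
Proof.
exists (~` `]0, T[%classic); split.
- by apply: measurableC; exact: measurable_itvR.
- by rewrite -[LHS]/(leb (~` `]0, T[ `&` `]0, T[)%classic) setICl measure0.
- by move=> x /= h; rewrite in_itv.
Qed.

Lemma ae_tau_neq c : {ae (ta : {measure set R -> \bar R}), forall t, t <> c}.
Proof.
apply: ae_tau; exists [set c]; split; [exact: measurable_set1|exact: lebesgue_measure_set1|].
by move=> x /= /contrapT.
Qed.

Lemma integral_tau (f : R -> \bar R) : measurable_fun setT f ->
  (\int[ta]_t f t = \int[mu1]_(t in `]0%R, T[) f t)%E.
Proof.
move=> mf; rewrite [LHS](@integral_mfrestr _ _ _ leb _ (measurable_itvR `]0%R, T[) (I0T_lty T))//.
rewrite integral_mkcond [RHS]integral_mkcond; apply: integral_leb.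
by apply/(measurable_restrictT _ (measurable_itvR `]0, T[)); exact: measurable_funTS.
Qed.
Opaque tau leb.

(** Lebesgue points are taken on the whole line, so functions of time are extended by zero. *)
Definition tex h t : R := if 0 < t < T then h t else 0.

Lemma tex_patch h : tex h = h \_ `]0, T[%classic.
Proof. by apply/funext => t; rewrite /tex patchE mem_setE in_itv. Qed.

Lemma m_tex h : measurable_fun setT h -> measurable_fun setT (tex h).
Proof.
move=> mh; rewrite tex_patch; apply/(measurable_restrictT _ (measurable_itvR `]0, T[)).
exact: measurable_funTS.
Qed.

Lemma int_tex h : measurable_fun setT h ->
  (\int[mu1]_t `|tex h t|%:E = \int[ta]_t `|h t|%:E)%E.
Proof.
move=> mh; rewrite integral_tau; last by apply/measurable_EFinP; exact: measurableT_comp.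
rewrite [RHS]integral_mkcond; apply: eq_integral => t _.
by rewrite tex_patch !patchE; case: ifP => // _; rewrite normr0.
Qed.

Lemma locint_tex h : ig ta h -> locally_integrable setT (tex h).
Proof.
move=> /igP[mh ih]; split; [exact: m_tex|exact: openT|].
move=> K _ _; apply: le_lt_trans ih; rewrite -int_tex//.
rewrite integral_mkcond; apply: int_mono => t; rewrite patchE; case: ifP => // _; exact: (normr_ge0 (tex h t)).
Qed.

Definition bump n s t : R := n.+1%:R * rho (n.+1%:R * t + - (n.+1%:R * s)).
Definition stepn n s t : R := step (n.+1%:R * t + - (n.+1%:R * s)).

Lemma drv_stepn n s : drv (stepn n s) (bump n s).
Proof.
apply: (drv_ext (drv_comp (@drv_step R) (drvD (drvZ n.+1%:R (drv_id (R := R))) (drv_cst (- (n.+1%:R * s)))))) => t.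
by rewrite /bump mulr1 addr0 mulrC.
Qed.

Lemma Cinf_stepn n s : Cinf (stepn n s).
Proof. by move=> k; apply: Cn_affine; exact: Cinf_step. Qed.

Lemma Cinf_bump n s : Cinf (bump n s).
Proof. exact: (Cinf_drv (Cinf_stepn n s) (drv_stepn n s)). Qed.

Lemma cont_bump n s : continuous (bump n s).
Proof. exact: (Cn_cont (Cinf_bump n s 0)). Qed.

Lemma bump0 n s t : ~~ (s <= t <= s + n.+1%:R^-1) -> bump n s t = 0.
Proof.
move=> h; rewrite /bump rho0 ?mulr0//; apply: contra h.
have n0 : 0 < n.+1%:R :> R by [].
rewrite -mulrBr => /andP[h1 h2]; rewrite pmulr_rge0// subr_ge0 in h1.
by rewrite h1 /= -lerBlDl -[leRHS]mul1r ler_pdivlMr// mulrC.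
Qed.

Lemma stepn0 n s t : t <= s -> stepn n s t = 0.
Proof. by move=> ts; rewrite /stepn -mulrBr step0// pmulr_rle0// subr_le0. Qed.

Lemma stepn1 n s t : s + n.+1%:R^-1 <= t -> stepn n s t = 1.
Proof.
move=> ts; rewrite /stepn -mulrBr step1// mulrC -ler_pdivrMr// mul1r.
by rewrite lerBrDl.
Qed.

Lemma int_bump n s : 0 < s -> s + n.+1%:R^-1 <= T -> \int[ta]_t bump n s t = 1.
Proof.
move=> s0 sT; rewrite /Rintegral integral_tau; last first.
  by apply/measurable_EFinP; apply: cont_meas; exact: cont_bump.
have mb (A : set R) : measurable_fun A (EFin \o bump n s).
  by apply: measurable_funTS; apply/measurable_EFinP; apply: cont_meas; exact: cont_bump.
rewrite integral_itv_bndo_bndc// integral_itv_obnd_cbnd//.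
rewrite (FTC_itv (drv_stepn n s) (@cont_bump n s) (ltW T0)) /=.
by rewrite stepn1// stepn0 ?subr0// ltW.
Qed.

Let harm : n.+1%:R^-1 @[n --> \oo] --> (0 : R).
Proof. exact: cvg_harmonic. Qed.

Lemma harm_lt (e : R) : 0 < e -> \forall n \near \oo, n.+1%:R^-1 < e.
Proof.
move=> e0; have /cvgrPdist_lt/(_ e e0) := harm.
by apply: filterS => n; rewrite sub0r normrN ger0_norm// invr_ge0.
Qed.

(** The bumps are bounded by a multiple of the indicator of the ball over its measure, so the error
    is a multiple of the mean oscillation at the Lebesgue point. *)
Lemma bump_cvg h s : ig ta h -> lebesgue_pt (tex h) s -> 0 < s < T ->
  \int[ta]_t (h t * bump n s t) @[n --> \oo] --> h s.
Proof.
move=> ih ls /andP[s0 sT]; have mh := ig_meas ih.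
have [C C0 hC] := @rho_bd R.
have hs : tex h s = h s by rewrite /tex s0 sT.
have mbump n : measurable_fun setT (bump n s) by apply: cont_meas; exact: cont_bump.
have bb n t : `|bump n s t| <= n.+1%:R * C by rewrite normrM ger0_norm// ler_wpM2l.
have ihb n : ig ta (fun t => h t * bump n s t).
  by apply: (igM_bd ih) => //; exists (n.+1%:R * C).
have tlty : (ta setT < +oo)%E by exact: fin_num_fun_lty.
have ib n : ig ta (bump n s).
  apply/igP; split => //; apply: (@le_lt_trans _ _ (\int[ta]_t (n.+1%:R * C)%:E)%E).
    by apply: int_mono => t; rewrite lee_fin.
  by rewrite integral_cst// lte_mul_pinfty// lee_fin mulr_ge0// ltW.
apply/cvgrPdist_le => e e0.
have hd : davg (tex h) s (2 * n.+1%:R^-1) @[n --> \oo] --> 0%E.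
  apply: (cvg_comp _ _ _ ls) => A hA.
  have [d /= d0 hd] := hA; have d2 : 0 < d / 2 by rewrite divr_gt0.
  near=> n; apply: hd; last by rewrite mulr_gt0// invr_gt0.
  rewrite /= sub0r normrN gtr0_norm ?mulr_gt0 ?invr_gt0//.
  rewrite mulrC -ltr_pdivlMr//; near: n; exact: harm_lt.
have eC : 0 < e / (4 * C) by rewrite divr_gt0// mulr_gt0.
have [N1 hN1] := cvg_tozero hd eC.
near=> n; pose r : R := 2 * n.+1%:R^-1.
have n0 : 0 < n.+1%:R :> R by [].
have r0 : 0 < r by rewrite mulr_gt0// invr_gt0.
have hr : (davg (tex h) s r <= (e / (4 * C))%:E)%E.
  by apply: hN1; near: n; exists N1.
have -> : h s - \int[ta]_t (h t * bump n s t) = - \int[ta]_t ((h t - h s) * bump n s t).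
  have -> : \int[ta]_t ((h t - h s) * bump n s t) = \int[ta]_t (h t * bump n s t - h s * bump n s t).
    by apply: I_eq => t; rewrite mulrBl.
  rewrite IB//; last exact: igZ.
  rewrite IZ// int_bump ?mulr1 ?opprB//.
  by rewrite -lerBrDl; near: n; apply: filterS (harm_lt (_ : 0 < T - s)) => [k|]; [exact: ltW|rewrite subr_gt0].
rewrite normrN; apply: I_le0.
apply: (@le_trans _ _ ((n.+1%:R * C)%:E * \int[mu1]_(t in ball s r) `|tex h t - tex h s|%:E)%E).
  have mg : measurable_fun setT (fun t => (`|tex h t - tex h s|%:E : \bar R)).
    apply/measurable_EFinP; apply: measurableT_comp => //; apply: measurable_funB => //; exact: m_tex.
  rewrite integral_tau; last first.
    by apply/measurable_EFinP; apply: measurableT_comp => //; apply: measurable_funM => //; exact: measurable_funB.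
  have -> : ((n.+1%:R * C)%:E * \int[mu1]_(t in ball s r) `|tex h t - tex h s|%:E = \int[mu1]_(t in ball s r) ((n.+1%:R * C)%:E * `|tex h t - tex h s|%:E))%E.
    rewrite ge0_integralZl//; last 3 first.
    - exact: measurable_ball.
    - exact: measurable_funTS.
    - by rewrite lee_fin mulr_ge0// ltW.
  rewrite integral_mkcond [leRHS]integral_mkcond; apply: int_mono => t.
    by rewrite patchE; case: ifP.
  rewrite !patchE; case: ifP => [|_]; last first.
    by case: ifP => // _; rewrite -EFinM lee_fin !mulr_ge0// ltW.
  rewrite mem_setE in_itv /= => t0T.
  have E : tex h t = h t by rewrite /tex t0T.
  case: ifP => [_|/negbT]; first by rewrite hs E -EFinM lee_fin normrM mulrC ler_wpM2r.
  rewrite notin_setE /ball /= => hb; rewrite lee_fin bump0 ?mulr0 ?normr0//.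
  apply/negP => /andP[st ts]; apply: hb; rewrite distrC ger0_norm ?subr_ge0//.
  rewrite ltrBlDl; apply: le_lt_trans ts _; rewrite ltrD2l /r ltr_pMl ?invr_gt0//.
  by rewrite ltr1n.
have mB : mu1 (ball s r) = (2 * r)%:E.
  by rewrite lebesgue_measure_ball ?ltW// mulr_natl.
have -> : (\int[mu1]_(t in ball s r) `|tex h t - tex h s|%:E = (2 * r)%:E * davg (tex h) s r)%E.
  have r2 : 2 * r != 0 by rewrite gt_eqF// mulr_gt0.
  by rewrite /davg /iavg mB inver (negbTE r2) muleA -EFinM divff// mul1e.
rewrite muleA -EFinM.
apply: le_trans (lee_wpmul2l _ hr) _; first by rewrite lee_fin !mulr_ge0// ltW.
rewrite -EFinM lee_fin le_eqVlt; apply/orP; left; apply/eqP; rewrite /r; field.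
by rewrite gt_eqF//= nat1r pnatr_eq0.
Unshelve. all: by end_near. Qed.

Definition tsupp (chi : R -> R) := exists a b : R, [/\ 0 < a, b < T & forall t, ~~ (a <= t <= b) -> chi t = 0].

Lemma ae_lebpt h : ig ta h -> {ae (ta : {measure set R -> \bar R}), forall t, lebesgue_pt (tex h) t /\ 0 < t < T}.
Proof.
move=> ih; have := ae_tau (lebesgue_differentiation (locint_tex ih)).
by move=> H; apply: filterS (filterI H ae_tau_in).
Qed.

(** Testing with bumps at a Lebesgue point recovers the value there. *)
Lemma weak_zero h : ig ta h ->
  (forall chi, Cinf chi -> tsupp chi -> \int[ta]_t (h t * chi t) = 0) ->
  {ae (ta : {measure set R -> \bar R}), forall t, h t = 0}.
Proof.
move=> ih H; apply: filterS (ae_lebpt ih) => s [ls s0T].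
have cv := bump_cvg ih ls s0T; have /andP[s0 sT] := s0T.
have : (fun=> 0 : R) @ \oo --> h s.
  apply: cvg_trans cv; apply: near_eq_cvg; near=> n.
  apply: H; first exact: Cinf_bump.
  exists s, (s + n.+1%:R^-1); split => //; last by move=> t; exact: bump0.
  by rewrite -ltrBrDl; near: n; apply: harm_lt; rewrite subr_gt0.
by move=> /(cvg_lim (@norm_hausdorff _ _)) <-; rewrite lim_cst.
Unshelve. all: by end_near. Qed.

Definition win t1 t2 t : R := (t1 < t <= t2)%R%:R.

Lemma m_win t1 t2 : measurable_fun setT (win t1 t2).
Proof.
rewrite (_ : win t1 t2 = \1_(`]t1, t2]%classic)); first by apply: measurable_indic; exact: measurable_itvR.
by apply/funext => t; rewrite indicE mem_setE in_itv.
Qed.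

Lemma win_bd t1 t2 : bd (win t1 t2).
Proof. by exists 1 => t; rewrite /win; case: (_ && _); rewrite ?normr0 ?normr1. Qed.

(** The test function is the difference of two smooth steps: its derivative is a difference of two
    bumps, which recover the two values, and it converges to the indicator of the interval. *)
Lemma weak_primitive a f : ig ta a -> ig ta f ->
  (forall chi chi', Cinf chi -> drv chi chi' -> tsupp chi -> \int[ta]_t (a t * chi' t + f t * chi t) = 0) ->
  forall t1 t2, lebesgue_pt (tex a) t1 -> lebesgue_pt (tex a) t2 -> 0 < t1 -> t1 < t2 -> t2 < T ->
  a t2 - a t1 = \int[ta]_t (f t * win t1 t2 t).
Proof.
move=> ia if_ H t1 t2 l1 l2 t10 t12 t2T.
have t1T : t1 < T by exact: lt_trans t2T.
have t20 : 0 < t2 by exact: lt_trans t12.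
pose chi n t := stepn n t1 t - stepn n t2 t.
pose chi' n t := bump n t1 t - bump n t2 t.
have mst n s : measurable_fun setT (stepn n s).
  by apply: cont_meas; exact: (drv_cont (drv_stepn n s)).
have mbu n s : measurable_fun setT (bump n s) by apply: cont_meas; exact: cont_bump.
have bst n s : bd (stepn n s).
  by exists 1 => t; have /andP[h1 h2] := step_01 (n.+1%:R * t + - (n.+1%:R * s)); rewrite ger0_norm.
have bbu n s : bd (bump n s).
  have [C C0 hC] := @rho_bd R; exists (n.+1%:R * C) => t.
  by rewrite normrM ger0_norm// ler_wpM2l.
have c1 : \int[ta]_t (f t * chi n t) @[n --> \oo] --> \int[ta]_t (f t * win t1 t2 t).
  have i2 : ig ta (fun t => 2 * `|f t|) by apply: igZ; exact: ig_norm.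
  apply: (I_dct _ _ i2).
  - by move=> n; apply: measurable_funM; [exact: ig_meas if_|exact: measurable_funB].
  - by apply: measurable_funM; [exact: ig_meas if_|exact: m_win].
  - move=> n t; rewrite normrM mulrC ler_wpM2r//.
    have /andP[h1 h2] := step_01 (n.+1%:R * t + - (n.+1%:R * t1)).
    have /andP[h3 h4] := step_01 (n.+1%:R * t + - (n.+1%:R * t2)).
    apply: le_trans (ler_normB _ _) _; rewrite !ger0_norm ?/stepn//; lra.
  - move=> t; apply: cvgM; first exact: cvg_cst.
    have st s : stepn n s t @[n --> \oo] --> ((s < t)%R%:R : R).
      have [ts|st] := leP t s.
        by under eq_fun do rewrite stepn0//; exact: cvg_cst.
      apply: (@cvg_trans _ ((fun=> 1 : R) @ \oo)); last exact: cvg_cst.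
      apply: near_eq_cvg; near=> n; rewrite stepn1// -lerBrDl ltW//.
      by near: n; apply: harm_lt; rewrite subr_gt0.
    have -> : win t1 t2 t = (t1 < t)%R%:R - (t2 < t)%R%:R.
      rewrite /win; have [tt2|t2t] := leP t t2; first by rewrite andbT subr0.
      by rewrite (lt_trans t12 t2t) subrr.
    by apply: cvgB.
have c2 : \int[ta]_t (a t * chi' n t) @[n --> \oo] --> a t1 - a t2.
  have E n : \int[ta]_t (a t * chi' n t) = \int[ta]_t (a t * bump n t1 t) - \int[ta]_t (a t * bump n t2 t).
    rewrite -IB; [|by apply: igM_bd|by apply: igM_bd].
    by apply: I_eq => t; rewrite mulrBr.
  rewrite (funext E); apply: cvgB; apply: bump_cvg => //.
    by rewrite t10 t1T.
  by rewrite t20 t2T.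
have c3 : (fun n => \int[ta]_t (a t * chi' n t) + \int[ta]_t (f t * chi n t)) @ \oo --> a t1 - a t2 + \int[ta]_t (f t * win t1 t2 t).
  exact: cvgD c2 c1.
have : (fun=> 0 : R) @ \oo --> a t1 - a t2 + \int[ta]_t (f t * win t1 t2 t).
  apply: cvg_trans c3; apply: near_eq_cvg; near=> n.
  rewrite -ID.
  - apply: (H (chi n) (chi' n)).
    + have cn k : Cn k (fun t : R => - stepn n t2 t).
        by under eq_fun do rewrite -mulN1r; apply: CnM; [exact: Cn_cst|exact: Cinf_stepn].
      by move=> k; apply: CnD; [exact: Cinf_stepn|exact: cn].
    + by apply: drvD; [exact: drv_stepn|apply: drvN; exact: drv_stepn].
    + exists t1, (t2 + n.+1%:R^-1); split => //.
        by rewrite -ltrBrDl; near: n; apply: harm_lt; rewrite subr_gt0.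
      move=> t; rewrite negb_and -!ltNge => /orP[h|h].
        by rewrite /chi !stepn0 ?subrr// ltW// (lt_trans h).
      rewrite /chi !stepn1 ?subrr// ltW// (le_lt_trans _ h)// lerD2r ltW//.
  - by apply: igM_bd => //; [exact: measurable_funB|apply: bdD => //; exact: bdN].
  - by apply: igM_bd => //; [exact: measurable_funB|apply: bdD => //; exact: bdN].
move=> /(cvg_lim (@norm_hausdorff _ _)); rewrite lim_cst// => h.
by apply/eqP; rewrite eq_sym -subr_eq0 opprB addrC h.
Unshelve. all: by end_near. Qed.

Let m1 : measurable_fun setT (fun z : R * R => z.1). Proof. by apply: mfst; exact: measurable_id. Qed.
Let m2 : measurable_fun setT (fun z : R * R => z.2). Proof. by apply: msnd; exact: measurable_id. Qed.

Let mle : measurable_fun setT (fun z : R * R => ((z.1 <= z.2)%R%:R : R)).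
Proof.
rewrite (_ : (fun z => _) = (\1_[set z : R * R | z.1 <= z.2] : R * R -> R)); last first.
  by apply/funext => z; rewrite indicE; case: (boolP (_ <= _)) => h; [rewrite mem_set|rewrite memNset//; exact/negP].
apply: measurable_indic; rewrite -[X in measurable X]setTI.
by have := measurable_fun_ler m1 m2 => /(_ measurableT [set true]); apply.
Qed.

Let meq : measurable_fun setT (fun z : R * R => ((z.1 == z.2)%R%:R : R)).
Proof.
rewrite (_ : (fun z => _) = (\1_[set z : R * R | z.1 == z.2] : R * R -> R)); last first.
  by apply/funext => z; rewrite indicE; case: (boolP (_ == _)) => h; [rewrite mem_set|rewrite memNset//; exact/negP].
apply: measurable_indic; rewrite -[X in measurable X]setTI.
by have := measurable_fun_eqr m1 m2 => /(_ measurableT [set true]); apply.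
Qed.

Let b1 (b : bool) : `|(b%:R : R)| <= 1. Proof. by case: b; rewrite ?normr0 ?normr1. Qed.

Lemma ig_order (g : R -> R) : ig ta g -> ig (pm ta ta) (fun z => g z.1 * g z.2 * (z.1 <= z.2)%R%:R).
Proof. by move=> hg; apply: (igM_bd (ig_tensor hg hg)); [exact: mle|exists 1]. Qed.

Lemma ig_prim (g : R -> R) : ig ta g -> ig ta (fun t => g t * \int[ta]_s (g s * (s <= t)%R%:R)).
Proof.
move=> hg; have := fubini_ig2 (ig_order hg); congr ig; apply/funext => t /=.
rewrite -IZ; first by apply: I_eq => s; ring.
by apply: (igM_bd hg) => //; [exact: (measurable_fun_pair1 t mle)|exists 1].
Qed.

(** The square is an integral over the product, split along the diagonal, which is a null set. *)
Lemma int_prim_sq (g : R -> R) : ig ta g ->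
  2 * \int[ta]_t (g t * \int[ta]_s (g s * (s <= t)%R%:R)) = (\int[ta]_t g t) ^+ 2.
Proof.
move=> hg; have mg := ig_meas hg.
have hgg := ig_tensor hg hg.
have i1 := ig_order hg.
have E1 : \int[pm ta ta]_z (g z.1 * g z.2 * (z.1 <= z.2)%R%:R) = \int[ta]_t (g t * \int[ta]_s (g s * (s <= t)%R%:R)).
  rewrite fubini2//; apply: I_eq => t /=.
  rewrite -IZ; first by apply: I_eq => s; ring.
  by apply: (igM_bd hg) => //; [exact: (measurable_fun_pair1 t mle)|exists 1].
have E2 : \int[pm ta ta]_z (g z.1 * g z.2 * (z.1 <= z.2)%R%:R) =
    \int[ta]_t (g t * \int[ta]_s (g s * (1 - (s <= t)%R%:R + (s == t)%R%:R))).
  rewrite fubini1//; apply: I_eq => t /=.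
  rewrite -IZ; last first.
    apply: (igM_bd hg).
      apply: measurable_funD; last exact: (measurable_fun_pair1 t meq).
      by apply: measurable_funB => //; exact: (measurable_fun_pair1 t mle).
    by apply: bdD; [apply: bdD; [exact: bd_cst|apply: bdN; exists 1]|exists 1].
  apply: I_eq => s; rewrite mulrA; congr (_ * _).
  by case: (ltgtP s t) => h /=; rewrite ?subrr ?subr0 ?add0r ?addr0.
have E3 t : \int[ta]_s (g s * (1 - (s <= t)%R%:R + (s == t)%R%:R)) =
    \int[ta]_s g s - \int[ta]_s (g s * (s <= t)%R%:R).
  rewrite -IB//; last by apply: (igM_bd hg) => //; [exact: (measurable_fun_pair1 t mle)|exists 1].
  apply: ae_eqI.
  - apply: measurable_funM => //; apply: measurable_funD; last exact: (measurable_fun_pair1 t meq).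
    by apply: measurable_funB => //; exact: (measurable_fun_pair1 t mle).
  - by apply: measurable_funB => //; apply: measurable_funM => //; exact: (measurable_fun_pair1 t mle).
  apply: filterS (ae_tau_neq t) => s /eqP/negbTE ->; rewrite addr0; ring.
have i3 := ig_prim hg.
have : \int[ta]_t (g t * \int[ta]_s (g s * (1 - (s <= t)%R%:R + (s == t)%R%:R))) =
   (\int[ta]_t g t) ^+ 2 - \int[ta]_t (g t * \int[ta]_s (g s * (s <= t)%R%:R)).
  rewrite -[(\int[ta]_t g t) ^+ 2]IZr// -IB//; last first.
    by under eq_fun do rewrite mulrC; exact: igZ.
  by apply: I_eq => t; rewrite E3 mulrBr.
rewrite -E2 E1 => h; rewrite [LHS]mulr_natl mulr2n {1}h; ring.
Qed.

(** The product of the function and its weak derivative is not known to be integrable beforehand: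
    the function is replaced by its value at the left end plus a primitive, after which the
    integral of a primitive times its density is [int_prim_sq]. *)
Lemma weak_square a f : ig ta a -> ig ta f ->
  (forall chi chi', Cinf chi -> drv chi chi' -> tsupp chi -> \int[ta]_t (a t * chi' t + f t * chi t) = 0) ->
  forall t1 t2, lebesgue_pt (tex a) t1 -> lebesgue_pt (tex a) t2 -> 0 < t1 -> t1 < t2 -> t2 < T ->
  ig ta (fun t => 2 * a t * f t * win t1 t2 t) /\
  a t2 ^+ 2 - a t1 ^+ 2 = \int[ta]_t (2 * a t * f t * win t1 t2 t).
Proof.
move=> ia if_ H t1 t2 l1 l2 t10 t12 t2T.
have P := weak_primitive ia if_ H.
pose g t := f t * win t1 t2 t.
have hg : ig ta g by apply: (igM_bd if_); [exact: m_win|exact: win_bd].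
have G12 := P t1 t2 l1 l2 t10 t12 t2T.
have i3 := ig_prim hg.
have mF : measurable_fun setT (fun t => 2 * a t * f t * win t1 t2 t).
  apply: measurable_funM; last exact: m_win.
  apply: measurable_funM; last exact: ig_meas if_.
  by apply: measurable_funM => //; exact: ig_meas ia.
have iG : ig ta (fun t => 2 * a t1 * g t + 2 * (g t * \int[ta]_s (g s * (s <= t)%R%:R))).
  by apply: igD; exact: igZ.
have EA : {ae (ta : {measure set R -> \bar R}), forall t, 2 * a t * f t * win t1 t2 t =
    2 * a t1 * g t + 2 * (g t * \int[ta]_s (g s * (s <= t)%R%:R))}.
  apply: filterS (ae_lebpt ia) => t [lt /andP[t0 tT]].
  rewrite /g /win; case: (boolP (t1 < t <= t2)) => [/andP[h1 h2]|_]; last by rewrite !(mulr0, mul0r, addr0).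
  rewrite /= !mulr1; have := P t1 t l1 lt t10 h1 tT.
  have -> : \int[ta]_t0 (f t0 * win t1 t t0) = \int[ta]_s (f s * (t1 < s <= t2)%R%:R * (s <= t)%R%:R).
    apply: I_eq => s; rewrite -mulrA -natrM mulnb; congr (_ * _%:R).
    rewrite /win; congr nat_of_bool; case: (ltP t1 s) => //= _.
    by case: (leP s t) => //= st; rewrite ?andbF// (le_trans st h2).
  move=> <-; ring.
split; first exact: ig_ae iG mF EA.
rewrite (ae_eqI mF (ig_meas iG) EA) ID; [|exact: igZ|exact: igZ].
rewrite !IZ// int_prim_sq// -/g -[\int[ta]_t g t]G12; ring.
Qed.
End time.

(** * Slices at almost every time *)
Section slices.
Context {R : realType}.
Local Notation X := (R * R * R)%type.
Local Notation V := (R * R * R * R)%type.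
Local Notation mu1 := (@lebesgue_measure R).
Local Notation mu3 := (mu1 \x mu1 \x mu1)%E.
Local Notation mu4 := (mu3 \x mu1)%E.
Variable T : R.
Implicit Types (F G : V -> R) (t : R).
Local Notation ta := (tau T).
Let p0 := @pp0 R.
Let p1 := @pp1 R.

Lemma int_ae_le d (Y : measurableType d) (mu : {measure set Y -> \bar R}) (f g : Y -> \bar R) :
  measurable_fun setT f -> measurable_fun setT g ->
  (forall y, 0 <= f y)%E -> (forall y, 0 <= g y)%E ->
  {ae mu, forall y, (f y <= g y)%E} -> (\int[mu]_y f y <= \int[mu]_y g y)%E.
Proof.
move=> mf mg f0 g0 fg; apply: ae_ge0_le_integral => //.
by apply: filterS fg => y h _.
Qed.

Lemma m_slice F t : measurable_fun setT F -> measurable_fun setT (slice F t).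
Proof. by move=> mF; exact: (measurable_fun_pair1 t mF). Qed.

Lemma m_nm_slice p F : p != 0 -> measurable_fun setT F ->
  measurable_fun setT (fun t => nm m3 p (slice F t)).
Proof.
move=> p0' mF; rewrite (funext (fun t => nmE m3 (slice F t) p0')).
apply: (measurableT_comp (measurable_poweR _)).
apply: (mint1 m3 (f := fun z => (`|F z| `^ p)%:E)).
  by apply/measurable_EFinP; exact: mpow.
by move=> z; rewrite lee_fin powR_ge0.
Qed.

Lemma m_dif_slice F (h : X) : measurable_fun setT F ->
  measurable_fun setT (fun q : V => F (q.1 + h, q.2) - F q).
Proof.
move=> mF; apply: measurable_funB => //; apply: (mcomp mF).
by apply: mprod; [apply: madd => //; exact: mfst|exact: msnd].
Qed.

Lemma m_AA_slice F : measurable_fun setT F -> measurable_fun setT (fun t => AA (slice F t)).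
Proof.
move=> mF.
have md a : measurable_fun setT (fun t => limn_einf (dq a (slice F t))).
  apply: (@measurable_limn_einf _ _ _ (fun j t => dq a (slice F t) j)) => j.
  apply: emeasurable_funM => //.
  by apply: (m_nm_slice (lt0r_neq0 p0) (m_dif_slice ((2 ^+ j)^-1 *: un a) mF)).
apply: emeasurable_funD; first exact: (m_nm_slice (lt0r_neq0 p0) mF).
by apply: emeasurable_funD => //; exact: emeasurable_funD.
Qed.

(** Tonelli; products of velocities are seen to be integrable in space-time this way. *)
Lemma ig_slices F (b : R -> R) : measurable_fun setT F -> ig ta b ->
  {ae (ta : {measure set R -> \bar R}), forall t, (\int[m3]_x `|F (x, t)|%:E <= (b t)%:E)%E} ->
  ig (m4 T) F.
Proof.
move=> mF ib H; apply/igP; split => //.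
have mFE : measurable_fun setT (fun z => (`|F z|%:E : \bar R)).
  by apply/measurable_EFinP; exact: measurableT_comp.
rewrite (tonelli2 m3 ta mFE)//; have /igP[mb] := ib; apply: le_lt_trans.
apply: int_ae_le.
- by apply: (mint1 m3 mFE) => z; rewrite lee_fin.
- by apply/measurable_EFinP; exact: measurableT_comp.
- by move=> t; apply: integral_ge0 => x _; rewrite lee_fin.
- by move=> t; rewrite lee_fin.
by apply: filterS H => t /le_trans -> //; rewrite lee_fin ler_norm.
Qed.

Lemma int_nu_le (f : R -> \bar R) : measurable_fun setT f -> (forall x, (0 <= f x)%E) ->
  (\int[nu]_x f x <= \int[leb]_x f x)%E.
Proof.
move=> mf f0; rewrite ge0_nuE// ge0_integral_leb//; apply: int_mono => x.
  by rewrite patchE; case: ifP.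
by rewrite patchE; case: ifP.
Qed.

Lemma int_tau_le (f : R -> \bar R) : measurable_fun setT f -> (forall x, (0 <= f x)%E) ->
  (\int[ta]_x f x <= \int[leb]_x f x)%E.
Proof.
move=> mf f0; rewrite ge0_tauE// ge0_integral_leb//; apply: int_mono => x.
  by rewrite patchE; case: ifP.
by rewrite patchE; case: ifP.
Qed.

(** The trace condition is given up to null sets for Lebesgue measure on all of space; the measure
    of the box is smaller. *)
Lemma ae_box (P : X -> Prop) : {ae mu3, forall q, P q} ->
  {ae (ta : {measure set R -> \bar R}), forall t,
    {ae (pm nu nu : {measure set (R * R) -> \bar R}), forall q, P (q, t)}}.
Proof.
move=> H; apply: (@ae_pm2 _ _ _ _ _ (pm nu nu) ta (fun q t => P (q, t))).
have [N [mN N0 NP]] := H; exists N; split => //; last by move=> [q t]; exact: NP.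
apply/eqP; rewrite eq_le measure_ge0 andbT.
have mI : measurable_fun setT (fun x : X => (\1_N x)%:E : \bar R).
  by apply/measurable_EFinP; exact: measurable_indic.
have I0 x : (0 <= (\1_N x)%:E :> \bar R)%E by rewrite lee_fin.
have <- : (\int[leb3]_x (\1_N x)%:E = 0)%E.
  by rewrite -ge0_leb3E// integral_indic// setIT.
have -> : pm (pm nu nu) ta N = (\int[pm (pm nu nu) ta]_x (\1_N x)%:E)%E.
  by rewrite integral_indic// setIT.
rewrite (tonelli2 (pm nu nu) ta mI I0).
have -> := tonelli2 (pm leb leb) leb mI I0.
have ms t : measurable_fun setT (fun q : R * R => (\1_N (q, t))%:E : \bar R).
  exact: (measurable_fun_pair1 t mI).
have mss t b : measurable_fun setT (fun a : R => (\1_N (a, b, t))%:E : \bar R).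
  exact: (measurable_fun_pair1 b (ms t)).
have le2 t : (\int[pm nu nu]_q (\1_N (q, t))%:E <= \int[pm leb leb]_q (\1_N (q, t))%:E)%E.
  rewrite (tonelli2 nu nu (ms t))// (tonelli2 leb leb (ms t))//.
  apply: (@le_trans _ _ (\int[nu]_b \int[leb]_a (\1_N (a, b, t))%:E)%E).
    apply: int_mono => b; first by apply: integral_ge0 => a _.
    by apply: int_nu_le.
  apply: int_nu_le; first by apply: (mint1 leb (ms t)).
  by move=> b; apply: integral_ge0 => a _.
apply: (@le_trans _ _ (\int[ta]_t \int[pm leb leb]_q (\1_N (q, t))%:E)%E).
  apply: int_mono => t; first by apply: integral_ge0 => a _.
  exact: le2.
apply: int_tau_le; first by apply: (mint1 (pm leb leb) mI).
by move=> b; apply: integral_ge0 => a _.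
Qed.

(** On a probability space the exponent 9/4 is larger than its conjugate exponent. *)
Lemma int_mul_le (f g : X -> R) (a b : R) : measurable_fun setT f -> measurable_fun setT g ->
  (nm m3 pp f <= a%:E)%E -> (nm m3 pp g <= b%:E)%E -> (\int[m3]_x `|f x * g x|%:E <= (a * b)%:E)%E.
Proof.
move=> mf mg fa gb.
have h95 : (9 / 5 : R)^-1 + pp^-1 = 1 by rewrite /pp; field.
have q0 : 0 < 9 / 5 :> R by rewrite divr_gt0.
apply: (le_trans (hoelder1 m3 mf mg q0 p0 h95)).
rewrite EFinM; apply: lee_pmul; [exact: nm_ge0|exact: nm_ge0| |exact: gb].
apply: le_trans fa; apply: nm_incr => //; first exact: m3_setT.
by rewrite /pp; lra.
Qed.

End slices.

(** * The equations at almost every time *)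
Section cut.
Context {R : realType}.
Local Notation X := (R * R * R)%type.
Local Notation V := (R * R * R * R)%type.
Local Notation mu1 := (@lebesgue_measure R).
Local Notation mu3 := (mu1 \x mu1 \x mu1)%E.
Local Notation mu4 := (mu3 \x mu1)%E.
Variable T : R.
Implicit Types (F G f : V -> R) (t : R).
Local Notation ta := (tau T).

(** Times outside the interval are irrelevant to every hypothesis, and killing them makes
    the functions measurable on the whole space. *)
Definition cut f (q : V) : R := if 0 < q.2 < T then f q else 0.

Lemma cut_in f q : 0 < q.2 < T -> cut f q = f q.
Proof. by rewrite /cut => ->. Qed.

Lemma slice_cut f t : 0 < t < T -> slice (cut f) t = slice f t.
Proof. by move=> t0; apply/funext => x; rewrite /slice cut_in. Qed.

Lemma m_cut f : torus_fun T f -> measurable_fun setT (cut f).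
Proof.
move=> [mf _]; rewrite (_ : cut f = f \_ (slab T)).
  by apply/(measurable_restrictT _ (measurable_slab T)).
by apply/funext => q; rewrite patchE mem_setE.
Qed.

Lemma torus_cut f t : torus_fun T f -> torus (slice (cut f) t).
Proof.
move=> tf; split; first exact: m_slice (m_cut tf).
case: (boolP (0 < t < T)) => h x; last by rewrite /slice /cut /= (negbTE h).
by rewrite slice_cut//; exact: tf.2.
Qed.

Lemma cyl_in q : cylinder T q -> 0 < q.2 < T.
Proof. by move=> [_] /=; rewrite in_itv. Qed.

Lemma ig_cut f : L1_torus T f -> ig (m4 T) (cut f).
Proof.
move=> [tf /integrableP[_ h]]; apply/igP; split; first exact: m_cut.
rewrite -ge0_cylinderE; [|by apply/measurable_EFinP; apply: measurableT_comp => //; exact: m_cut|by []].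
apply: le_lt_trans h; rewrite le_eqVlt; apply/orP; left; apply/eqP.
by apply: eq_integral => q; rewrite inE => /cyl_in q0 /=; rewrite cut_in.
Qed.

Lemma int_cyl F G : measurable_fun setT G -> (forall q, 0 < q.2 < T -> F q = G q) ->
  \int[mu4]_(q in cylinder T) F q = \int[m4 T]_q G q.
Proof.
move=> mG FG; rewrite /Rintegral -cylinderE; last exact/measurable_EFinP.
by congr fine; apply: eq_integral => q; rewrite inE => /cyl_in q0; rewrite /= FG.
Qed.

End cut.

Section bochner.
Context {R : realType}.
Local Notation V := (R * R * R * R)%type.
Local Notation mu1 := (@lebesgue_measure R).
Variable T : R.
Local Notation ta := (tau T).

(** The Besov norm of a slice is not known to be measurable in time, so the constant is moved
    to the measurable side before the integrals are compared. *)
Lemma AA_cube_int (s : R) (f : V -> R) : 1 < s -> bochner_besov T 3 s (9 / 4)%:E f ->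
  (\int[ta]_t (AA (slice (cut T f) t) `^ 3) < +oo)%E.
Proof.
move=> s1 [tf _ h]; have [C C0 hC] := @AA_besov R s s1.
have mA := m_AA_slice (m_cut tf).
pose g t : \bar R := ((C^-1)%:E * AA (slice (cut T f) t))%E.
have mg : measurable_fun setT g by exact: emeasurable_funM.
have g0 t : (0 <= g t)%E by rewrite mule_ge0 ?AA_ge0// lee_fin invr_ge0 ltW.
have mg3 : measurable_fun setT (fun t => (g t `^ 3)%E).
  by apply: (measurableT_comp (measurable_poweR _)).
have fi : (\int[ta]_t (g t `^ 3) < +oo)%E.
  rewrite ge0_tauE//; last by move=> t; exact: poweR_ge0.
  apply: le_lt_trans h; rewrite [leRHS]integral_mkcond; apply: int_mono => t.
    by rewrite patchE; case: ifP => // _; exact: poweR_ge0.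
  rewrite !patchE; case: ifP => //; rewrite mem_setE in_itv/= => t0.
  apply: poweR_le => //.
  have ht : torus (slice f t) by rewrite -(slice_cut f t0); exact: torus_cut.
  have C1 : (0 <= (C^-1)%:E :> \bar R)%E by rewrite lee_fin invr_ge0 ltW.
  have := lee_wpmul2l C1 (hC _ ht); rewrite muleA -EFinM mulVf ?gt_eqF// mul1e.
  by rewrite /g slice_cut.
have -> : (\int[ta]_t (AA (slice (cut T f) t) `^ 3) = (C ^+ 3)%:E * \int[ta]_t (g t `^ 3))%E.
  rewrite -ge0_integralZl//; [|by move=> t _; exact: poweR_ge0|by rewrite lee_fin exprn_ge0// ltW].
  apply: eq_integral => t _.
  have -> : AA (slice (cut T f) t) = (C%:E * g t)%E.
    by rewrite /g muleA -EFinM divff ?mul1e// gt_eqF.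
  rewrite poweRM//; last by rewrite lee_fin ltW.
  by rewrite poweR_EFin powR_mulrn// ltW.
by rewrite lte_mul_pinfty// lee_fin exprn_ge0// ltW.
Qed.

End bochner.

Section time_integrals.
Context {R : realType}.
Local Notation X := (R * R * R)%type.
Local Notation V := (R * R * R * R)%type.
Variable T : R.
Local Notation ta := (tau T).

(** Fubini for a test function whose time factor splits off. *)
Lemma weak_time (A : V -> R) (h : R -> R) : ig (m4 T) A -> measurable_fun setT h -> bd h ->
  ig (m4 T) (fun q => A q * h q.2) /\
  \int[m4 T]_q (A q * h q.2) = \int[ta]_t ((\int[m3]_x A (x, t)) * h t).
Proof.
move=> iA mh bh.
have iAh : ig (m4 T) (fun q => A q * h q.2).
  by apply: igM_bd => //; [apply: (mcomp mh); exact: msnd|exact: bd_comp].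
split => //; rewrite fubini2//; apply: ae_eqI.
- exact: ig_meas (fubini_ig2 iAh).
- by apply: measurable_funM => //; exact: ig_meas (fubini_ig2 iA).
by apply: filterS (fubini_ae2 iA) => t it /=; rewrite IZr.
Qed.

Lemma ig_lower_powers (a : R -> R) k : measurable_fun setT a -> (forall t, 0 <= a t) ->
  ig ta (fun t => a t ^+ 3) -> (k <= 3)%N -> ig ta (fun t => a t ^+ k).
Proof.
move=> ma a0 ia k3; apply: (@ig_le _ _ _ _ _ (fun t => 1 + a t ^+ 3)).
- exact: measurable_funX.
- move=> t; have at0 := a0 t; have a30 := exprn_ge0 3 at0; have ak0 := exprn_ge0 k at0.
  rewrite !ger0_norm//; last exact: addr_ge0.
  have [a1|a1] := leP (a t) 1.
    by apply: (@le_trans _ _ 1); [exact: exprn_ile1|rewrite lerDl].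
  by apply: (@le_trans _ _ (a t ^+ 3)); [rewrite ler_eXn2l|rewrite lerDr].
- apply: igD => //.
  by apply/igP; split => //; rewrite normr1 integral_cst// mul1e; exact: fin_num_fun_lty.
Qed.

(** There are countably many basis functions. *)
Lemma ae_idx (P : forall n, idx n -> R -> Prop) :
  (forall n (J : idx n), {ae (ta : {measure set R -> \bar R}), forall t, P n J t}) ->
  {ae (ta : {measure set R -> \bar R}), forall t, forall n (J : idx n), P n J t}.
Proof.
move=> H; have : {ae (ta : {measure set R -> \bar R}), forall t, forall n m : nat,
    if unpickle m is Some J then P n J t else True}.
  apply: ae_foralln => n; apply: ae_foralln => m.
  by case: (unpickle m) => [J|]; [exact: H|exact: aeW].
by apply: filterS => t h n J; have := h n (pickle J); rewrite pickleK.
Qed.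

Lemma tsupp_bd (chi : R -> R) : continuous chi -> tsupp T chi -> bd chi.
Proof.
move=> cchi [a [b [a0 bT h]]].
have [ab|ba] := leP a b; last first.
  exists 0 => t; rewrite h ?normr0//; apply/negP => /andP[h1 h2].
  by have := le_trans h1 h2; rewrite leNgt ba.
have cn : {within `[a, b], continuous (fun t => `|chi t|)}.
  by apply: continuous_subspaceT => t; apply: continuous_comp; [exact: cchi|exact: norm_continuous].
have [c _ hc] := EVT_max ab cn; exists `|chi c| => t.
case: (boolP (a <= t <= b)) => ht; first by apply: hc; rewrite in_itv.
by rewrite h// normr0.
Qed.

Lemma tsupp_drv (chi chi' : R -> R) : drv chi chi' -> tsupp T chi -> tsupp T chi'.
Proof.
move=> D [a [b [a0 bT h]]]; exists a, b; split => // t; rewrite negb_and -!ltNge => ht.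
have [e e0 he] : exists2 e : R, 0 < e & forall s, `|t - s| < e -> chi s = 0.
  case/orP: ht => ht.
    exists (a - t); first by rewrite subr_gt0.
    move=> s hs; apply: h; rewrite negb_and -!ltNge; apply/orP; left.
    by have := ler_norm (s - t); rewrite distrC; lra.
  exists (t - b); first by rewrite subr_gt0.
  move=> s hs; apply: h; rewrite negb_and -!ltNge; apply/orP; right.
  by have := ler_norm (t - s); lra.
have D0 : is_derive t (1 : R) chi 0.
  have E : \forall s \near t, cst 0 s = chi s.
    by near=> s; rewrite he//; near: s; apply/nbhs_ballP; exists e.
  by apply: (near_eq_is_derive E); apply: (is_derive_eq (is_derive_cst 0 t 1)).
by have [_ <-] := D t; have [_ <-] := D0.
Unshelve. all: by end_near. Qed.

End time_integrals.

Section flow.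
Context {R : realType}.
Local Notation X := (R * R * R)%type.
Local Notation V := (R * R * R * R)%type.
Implicit Types (u v w p f g : V -> R) (c : R) (ax : axis) (chi : R -> R).

(** The right-hand side of the ordinary differential equation solved by the coefficient
    of [f] on [eb J]. *)
Definition mom u v w p f g c ax n (J : idx n) (q : V) : R :=
  f q * (u q * deb Ax1 J q.1 + v q * deb Ax2 J q.1 + w q * deb Ax3 J q.1)
  + c * g q * eb J q.1 + p q * deb ax J q.1.

Definition momentum (T : R) u v w p f g c ax := forall n (J : idx n),
  [/\ ig (tau T) (fun t => coef (slice f t) J),
      ig (tau T) (fun t => \int[m3]_x mom u v w p f g c ax J (x, t)) &
      forall chi chi', Cinf chi -> drv chi chi' -> tsupp T chi ->
        \int[tau T]_t (coef (slice f t) J * chi' t +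
          (\int[m3]_x mom u v w p f g c ax J (x, t)) * chi t) = 0].

(** What the hypotheses say at almost every time, in terms of the finite families of test
    functions only. Both horizontal components are instances of one momentum equation. *)
Record flow (T : R) u v w p (Omega : R) (al : R -> R) : Prop := Flow {
  flow_mu : measurable_fun setT u ;
  flow_mv : measurable_fun setT v ;
  flow_mw : measurable_fun setT w ;
  flow_mp : measurable_fun setT p ;
  flow_al0 : forall t, 0 <= al t ;
  flow_ial : ig (tau T) (fun t => al t ^+ 3) ;
  flow_mal : measurable_fun setT al ;
  flow_u : {ae (tau T : {measure set R -> \bar R}), forall t, stat (slice u t) (al t)} ;
  flow_v : {ae (tau T : {measure set R -> \bar R}), forall t, stat (slice v t) (al t)} ;
  flow_w : {ae (tau T : {measure set R -> \bar R}), forall t,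
    torus (slice w t) /\ (nm m3 pp (slice w t) <= (2 * al t)%:E)%E} ;
  flow_p : {ae (tau T : {measure set R -> \bar R}), forall t, ig m3 (slice p t)} ;
  flow_div : {ae (tau T : {measure set R -> \bar R}), forall t, forall n (J : idx n),
    \int[m3]_x (u (x, t) * deb Ax1 J x + v (x, t) * deb Ax2 J x + w (x, t) * deb Ax3 J x) = 0} ;
  flow_pz : {ae (tau T : {measure set R -> \bar R}), forall t, forall n (J : idx n),
    \int[m3]_x (p (x, t) * deb Ax3 J x) = 0} ;
  flow_momu : momentum T u v w p u v Omega Ax1 ;
  flow_momv : momentum T u v w p v u (- Omega) Ax2 }.

End flow.

Section reduction.
Context {R : realType}.
Local Notation X := (R * R * R)%type.
Local Notation V := (R * R * R * R)%type.
Local Notation mu1 := (@lebesgue_measure R).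
Local Notation mu3 := (mu1 \x mu1 \x mu1)%E.
Local Notation mu4 := (mu3 \x mu1)%E.
Variables (T Omega s : R) (u v w p : V -> R).
Hypotheses (hT : 0 < T) (hs : 1 < s).
Hypotheses (hu : bochner_besov T 3 s (9 / 4)%:E u) (hv : bochner_besov T 3 s (9 / 4)%:E v).
Hypotheses (hw : vertical_velocity T u v w) (hp : L1_torus T p).
Hypothesis hweak : hydrostatic_euler_weak T Omega u v w p.
Local Notation ta := (tau T).
Local Notation U := (cut T u).
Local Notation V' := (cut T v).
Local Notation W := (cut T w).
Local Notation P := (cut T p).

(** The amplitude [A(t)] that governs all spatial norms. *)
Definition amp (t : R) : R := fine (AA (slice U t)) + fine (AA (slice V' t)).

Lemma amp_ge0 t : 0 <= amp t.
Proof. by rewrite addr_ge0// fine_ge0// AA_ge0. Qed.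

Let mU := let: And3 tu _ _ := hu in m_cut tu.
Let mV := let: And3 tv _ _ := hv in m_cut tv.

Lemma m_amp : measurable_fun setT amp.
Proof. by apply: measurable_funD; apply: measurableT_comp => //; exact: m_AA_slice. Qed.

Let m_AA3 (F : V -> R) : measurable_fun setT F -> measurable_fun setT (fun t => (AA (slice F t) `^ 3)%E).
Proof. by move=> mF; apply: (measurableT_comp (measurable_poweR _)); exact: m_AA_slice. Qed.

Lemma ig_AA3 (f : V -> R) : bochner_besov T 3 s (9 / 4)%:E f ->
  ig ta (fun t => fine (AA (slice (cut T f) t)) ^+ 3).
Proof.
move=> hf; have [tf _ _] := hf; have mA := m_AA_slice (m_cut tf).
apply/igP; split; first by apply: measurable_funX; exact: measurableT_comp.
apply: le_lt_trans (AA_cube_int hs hf); apply: int_mono => t; first by rewrite lee_fin.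
have := AA_ge0 (slice (cut T f) t); case: (AA _) => [r| |//] r0.
  by rewrite /= lee_fin in r0 *; rewrite powR_mulrn// ger0_norm// exprn_ge0.
by rewrite poweRyr ?leey// pnatr_eq0.
Qed.

Lemma ig_amp3 : ig ta (fun t => amp t ^+ 3).
Proof.
apply: (@ig_le _ _ _ _ _ (fun t => 8 * (fine (AA (slice U t)) ^+ 3 + fine (AA (slice V' t)) ^+ 3))).
- by apply: measurable_funX; exact: m_amp.
- move=> t; rewrite /amp.
  have := fine_ge0 (AA_ge0 (slice U t)); have := fine_ge0 (AA_ge0 (slice V' t)).
  move: (fine _) (fine _) => a b a0 b0.
  have a3 := exprn_ge0 3 a0; have b3 := exprn_ge0 3 b0.
  rewrite !ger0_norm ?exprn_ge0 ?mulr_ge0 ?addr_ge0//.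
  have := mulr_ge0 (addr_ge0 a0 b0) (sqr_ge0 (a - b)); nra.
- by apply: igZ; apply: igD; exact: ig_AA3.
Qed.

Lemma ig_ampX k : (k <= 3)%N -> ig ta (fun t => amp t ^+ k).
Proof. exact: ig_lower_powers m_amp amp_ge0 ig_amp3. Qed.

Lemma ae_AA_fin (f : V -> R) : bochner_besov T 3 s (9 / 4)%:E f ->
  {ae (ta : {measure set R -> \bar R}), forall t, stat (slice (cut T f) t) (fine (AA (slice (cut T f) t)))}.
Proof.
move=> hf; have [tf _ _] := hf.
have := int_lty_ae (m_AA3 (m_cut tf)) (fun t => poweR_ge0 _ _) (AA_cube_int hs hf).
apply: filterS => t h; apply: AA_stat; first exact: torus_cut.
rewrite ltNge leye_eq; apply/negP => /eqP E; move: h; rewrite E poweRyr// pnatr_eq0//.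
Qed.

Lemma stat_le (f : X -> R) (A B : R) : stat f A -> A <= B -> stat f B.
Proof.
move=> [mf pf nf df] AB; split => //; first by apply: le_trans nf _; rewrite lee_fin.
by move=> a; apply: le_trans (df a) _; rewrite lee_fin.
Qed.

Lemma ae_stat_u : {ae (ta : {measure set R -> \bar R}), forall t, stat (slice U t) (amp t)}.
Proof.
by apply: filterS (ae_AA_fin hu) => t /stat_le; apply; rewrite lerDl fine_ge0// AA_ge0.
Qed.

Lemma ae_stat_v : {ae (ta : {measure set R -> \bar R}), forall t, stat (slice V' t) (amp t)}.
Proof.
by apply: filterS (ae_AA_fin hv) => t /stat_le; apply; rewrite lerDr fine_ge0// AA_ge0.
Qed.

Lemma ig_of_stat (f : V -> R) : measurable_fun setT f ->
  {ae (ta : {measure set R -> \bar R}), forall t, stat (slice f t) (amp t)} -> ig (m4 T) f.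
Proof.
move=> mf H; apply: (ig_slices mf (ig_ampX (k := 1) isT)); apply: filterS H => t [ms _ sn _].
pose o : X -> R := fun=> 1.
rewrite expr1; have := @int_mul_le R o (slice f t) 1 (amp t) (measurable_cst _) ms.
have n1 : (nm m3 pp o <= 1%:E)%E.
  by apply: nm_bd; [exact: m3_setT|exact: pp0|move=> x; rewrite normr1].
move=> /(_ n1 sn); rewrite mul1r; apply: le_trans; apply: int_mono => x; rewrite lee_fin//.
by rewrite mul1r.
Qed.

Let iU := ig_of_stat mU ae_stat_u.
Let iV := ig_of_stat mV ae_stat_v.

Let iW : ig (m4 T) W.
Proof. by have [[d [_ [hw1 _ _]]] _] := hw; exact: ig_cut. Qed.

Let iP := ig_cut hp.

Let m_q1 (h : X -> R) : measurable_fun setT h -> measurable_fun setT (fun q : V => h q.1).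
Proof. by move=> mh; apply: (mcomp mh); exact: mfst. Qed.

Let m_q2 (h : R -> R) : measurable_fun setT h -> measurable_fun setT (fun q : V => h q.2).
Proof. by move=> mh; apply: (mcomp mh); exact: msnd. Qed.

Let igm (F : V -> R) (h : X -> R) : ig (m4 T) F -> measurable_fun setT h -> bd h ->
  ig (m4 T) (fun q => F q * h q.1).
Proof. by move=> iF mh bh; apply: igM_bd => //; [exact: m_q1|exact: bd_comp]. Qed.

Lemma partial_weak e ax (f g : V -> R) n (J : idx n) chi : e = un ax :> X -> weak_partial T e f g ->
  Cinf chi -> tsupp T chi ->
  \int[m4 T]_q (cut T f q * deb ax J q.1 * chi q.2) = - \int[m4 T]_q (cut T g q * eb J q.1 * chi q.2).
Proof.
move=> -> [[tf _] [tg _] H] cchi sc; have [a [b [a0 bT hab]]] := sc.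
have mchi := cont_meas (Cn_cont (cchi 0)).
have te := tphi_test J cchi a0 bT hab.
have := H _ te.
rewrite (int_cyl (G := fun q => cut T f q * deb ax J q.1 * chi q.2)); last 2 first.
- by apply: measurable_funM; [apply: measurable_funM; [exact: m_cut|exact: m_q1 (m_deb ax J)]|exact: m_q2].
- by move=> q q0; rewrite tphi_dx cut_in//; ring.
move=> ->; congr (- _); apply: int_cyl.
  by apply: measurable_funM; [apply: measurable_funM; [exact: m_cut|exact: m_q1 (m_eb J)]|exact: m_q2].
by move=> q q0; rewrite cut_in// /tphi; ring.
Qed.

Let divf n (J : idx n) (q : V) : R := U q * deb Ax1 J q.1 + V' q * deb Ax2 J q.1 + W q * deb Ax3 J q.1.

Let ig_divf n (J : idx n) : ig (m4 T) (divf J).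
Proof. by apply: igD; [apply: igD|]; apply: igm => //; [exact: m_deb|exact: bd_deb|exact: m_deb|exact: bd_deb|exact: m_deb|exact: bd_deb]. Qed.

(** Both weak derivatives entering the divergence are integrated back against the same test
    function, where they cancel. *)
Lemma ae_div : {ae (ta : {measure set R -> \bar R}), forall t, forall n (J : idx n),
  \int[m3]_x (U (x, t) * deb Ax1 J x + V' (x, t) * deb Ax2 J x + W (x, t) * deb Ax3 J x) = 0}.
Proof.
apply: (ae_idx (P := fun n J t => \int[m3]_x divf J (x, t) = 0)) => n J.
have iD := ig_divf J; apply: (weak_zero hT (fubini_ig2 iD)) => chi cchi sc.
have mchi := cont_meas (Cn_cont (cchi 0)); have bchi := tsupp_bd (Cn_cont (cchi 0)) sc.
have [_ <-] := weak_time iD mchi bchi.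
have [[d [[ux [vy [hx hy ->]]] hz]] _] := hw.
have iUX : ig (m4 T) (cut T ux) by have [_ h _] := hx; exact: ig_cut.
have iVY : ig (m4 T) (cut T vy) by have [_ h _] := hy; exact: ig_cut.
have igc (F : V -> R) (h : X -> R) : ig (m4 T) F -> measurable_fun setT h -> bd h ->
    ig (m4 T) (fun q => F q * h q.1 * chi q.2).
  by move=> iF mh bh; apply: igM_bd; [exact: igm|exact: m_q2|exact: bd_comp].
have E1 := partial_weak J (ax := Ax1) (erefl _) hx cchi sc.
have E2 := partial_weak J (ax := Ax2) (erefl _) hy cchi sc.
have E3 := partial_weak J (ax := Ax3) (erefl _) hz cchi sc.
have md a := @m_deb R n a J; have bdd a := @bd_deb R n a J.
have iA1 := igc U (deb Ax1 J) iU (md _) (bdd _).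
have iA2 := igc V' (deb Ax2 J) iV (md _) (bdd _).
have iA3 := igc W (deb Ax3 J) iW (md _) (bdd _).
have iB1 := igc _ _ iUX (m_eb J) (bd_eb J).
have iB2 := igc _ _ iVY (m_eb J) (bd_eb J).
have -> : \int[m4 T]_q (divf J q * chi q.2) = \int[m4 T]_q (U q * deb Ax1 J q.1 * chi q.2)
    + \int[m4 T]_q (V' q * deb Ax2 J q.1 * chi q.2) + \int[m4 T]_q (W q * deb Ax3 J q.1 * chi q.2).
  rewrite -ID// -ID//; last exact: igD.
  by apply: I_eq => q; rewrite /divf; ring.
have E4 : \int[m4 T]_q (cut T (\- (ux \+ vy)) q * eb J q.1 * chi q.2) =
    - (\int[m4 T]_q (cut T ux q * eb J q.1 * chi q.2)) - (\int[m4 T]_q (cut T vy q * eb J q.1 * chi q.2)).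
  rewrite -opprD -ID// -mulN1r -IZ; last exact: igD.
  by apply: I_eq => q; rewrite /cut; case: ifP => _ /=; ring.
rewrite E1 E2 E3 E4; ring.
Qed.

Lemma ae_pz : {ae (ta : {measure set R -> \bar R}), forall t, forall n (J : idx n),
  \int[m3]_x (P (x, t) * deb Ax3 J x) = 0}.
Proof.
apply: (ae_idx (P := fun n J t => \int[m3]_x (P (x, t) * deb Ax3 J x) = 0)) => n J.
have iD := igm iP (m_deb Ax3 J) (bd_deb Ax3 J).
apply: (weak_zero hT (fubini_ig2 iD)) => chi cchi sc.
have mchi := cont_meas (Cn_cont (cchi 0)); have bchi := tsupp_bd (Cn_cont (cchi 0)) sc.
have [iDc <-] := weak_time iD mchi bchi; have [a [b [a0 bT hab]]] := sc.
have te := tphi_test J cchi a0 bT hab.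
have [_ _ <-] := hweak te te te; symmetry; apply: int_cyl; first exact: ig_meas iDc.
by move=> q q0; rewrite (tphi_dx chi J Ax3) cut_in//=; ring.
Qed.

Lemma ae_w : {ae (ta : {measure set R -> \bar R}), forall t,
  torus (slice W t) /\ (nm m3 pp (slice W t) <= (2 * amp t)%:E)%E}.
Proof.
have [[d [_ [[tw _] _ _]]] hc] := hw.
apply: filterS (filterI (filterI ae_stat_u ae_stat_v) (filterI ae_div (filterI (fubini_ae2 iW) (filterI (ae_box T hc) (ae_tau_in T))))).
move=> t [[su sv] [hd [iw [hb t0]]]].
have tW := torus_cut t tw; split => //.
rewrite mulr_natl mulr2n; apply: (nm_w su sv iw) => //.
apply: filterS hb => q /(_ t0)[h1 h2]; split; last by rewrite cut_in.
rewrite (_ : (fun z => W (q, z, t)) = (fun z => w (q, z, t)))//.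
by apply/funext => z; rewrite cut_in.
Qed.

Lemma ig_mulU (f g : V -> R) : measurable_fun setT f -> measurable_fun setT g ->
  {ae (ta : {measure set R -> \bar R}), forall t, stat (slice f t) (amp t)} ->
  {ae (ta : {measure set R -> \bar R}), forall t, (nm m3 pp (slice g t) <= (2 * amp t)%:E)%E} ->
  ig (m4 T) (fun q => f q * g q).
Proof.
move=> mf mg sf sg; apply: (ig_slices (b := fun t => 2 * amp t ^+ 2)); first exact: measurable_funM.
  by apply: igZ; exact: ig_ampX.
apply: filterS (filterI sf sg) => t [[ms _ sn _] sgt].
apply: le_trans (int_mul_le ms (m_slice t mg) sn sgt) _.
by rewrite lee_fin le_eqVlt; apply/orP; left; apply/eqP; ring.
Qed.

(** The products of velocities are integrable by [int_mul_le], so the weak formulation can be split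
    into a part with the derivative of the time factor and a part with the time factor itself. *)
Lemma momentum_of (f g : V -> R) c ax : torus_fun T f ->
  {ae (ta : {measure set R -> \bar R}), forall t, stat (slice (cut T f) t) (amp t)} ->
  ig (m4 T) (cut T g) ->
  (forall phi, test_fun T phi -> \int[mu4]_(q in cylinder T)
     (f q * 'D_e_t phi q + f q * advect u v w phi q + c * g q * phi q + p q * 'D_((un ax, 0) : V) phi q) = 0) ->
  momentum T U V' W P (cut T f) (cut T g) c ax.
Proof.
move=> tf sf ig_ H n J; have mf := m_cut tf.
have if_ := ig_of_stat mf sf.
have le2 F : {ae (ta : {measure set R -> \bar R}), forall t, stat (slice F t) (amp t)} ->
    {ae (ta : {measure set R -> \bar R}), forall t, (nm m3 pp (slice F t) <= (2 * amp t)%:E)%E}.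
  apply: filterS => t [_ _ h _]; apply: le_trans h _; rewrite lee_fin.
  by have := amp_ge0 t; lra.
have ifU := ig_mulU mf mU sf (le2 _ ae_stat_u).
have ifV := ig_mulU mf mV sf (le2 _ ae_stat_v).
have ifW : ig (m4 T) (fun q => cut T f q * W q).
  by apply: ig_mulU => //; [exact: ig_meas iW|apply: filterS ae_w => t []].
have md a := @m_deb R n a J; have bdd a := @bd_deb R n a J.
have iA := igm if_ (m_eb J) (bd_eb J).
have iM : ig (m4 T) (mom U V' W P (cut T f) (cut T g) c ax J).
  have E q : mom U V' W P (cut T f) (cut T g) c ax J q =
     cut T f q * U q * deb Ax1 J q.1 + cut T f q * V' q * deb Ax2 J q.1 + cut T f q * W q * deb Ax3 J q.1
     + c * (cut T g q * eb J q.1) + P q * deb ax J q.1 by rewrite /mom; ring.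
  rewrite (funext E); apply: igD; last exact: igm.
  apply: igD; last by apply: igZ; apply: igm => //; [exact: m_eb|exact: bd_eb].
  exact: igD (igD (igm ifU (md _) (bdd _)) (igm ifV (md _) (bdd _))) (igm ifW (md _) (bdd _)).
split; [exact: fubini_ig2 iA|exact: fubini_ig2 iM|move=> chi chi' cchi D sc].
have cc := Cn_cont (cchi 0); have bchi := tsupp_bd cc sc.
have cc' := Cn_cont (Cinf_drv cchi D 0); have sc' := tsupp_drv D sc; have bchi' := tsupp_bd cc' sc'.
have [iA' EA] := weak_time iA (cont_meas cc') bchi'.
have [iM' EM] := weak_time iM (cont_meas cc) bchi.
have igc F h h' : ig (m4 T) F -> continuous h -> bd h ->
   (forall t, h' t = (\int[m3]_x F (x, t)) * h t) -> ig ta h'.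
  move=> iF ch bh E; rewrite (funext E); apply: igM_bd => //; [exact: fubini_ig2|exact: cont_meas].
rewrite ID; last 2 first.
- exact: (igc _ _ _ iA cc' bchi').
- exact: (igc _ _ _ iM cc bchi).
rewrite -[X in X + _]EA -[X in _ + X]EM -ID//.
have [a [b [a0 bT hab]]] := sc; rewrite -(H _ (tphi_test J cchi a0 bT hab)).
symmetry; apply: int_cyl; first exact: measurable_funD (ig_meas iA') (ig_meas iM').
move=> q q0; rewrite /advect (tphi_dx chi J Ax1) (tphi_dx chi J Ax2) (tphi_dx chi J Ax3).
by rewrite tphi_dx (tphi_dt J q D) /mom !cut_in// /tphi; ring.
Qed.

Theorem reduction : flow T U V' W P Omega amp.
Proof.
have [tu _ _] := hu; have [tv _ _] := hv.
split => //.
- exact: ig_meas iW.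
- exact: ig_meas iP.
- exact: amp_ge0.
- exact: ig_amp3.
- exact: m_amp.
- exact: ae_stat_u.
- exact: ae_stat_v.
- exact: ae_w.
- exact: fubini_ae2 iP.
- exact: ae_div.
- exact: ae_pz.
- apply: momentum_of => //; first exact: ae_stat_u.
  by move=> phi tp; have [h _ _] := hweak tp tp tp.
- apply: momentum_of => //; first exact: ae_stat_v.
  move=> phi tp; have [_ h _] := hweak tp tp tp; rewrite -[RHS]h.
  by congr fine; apply: eq_integral => q _; rewrite !mulNr.
Qed.

End reduction.

(** * The cubic increment functional *)
Section truncation.
Context {R : realType}.
Local Notation X := (R * R * R)%type.
Implicit Types (M s : R) (f g h : X -> R).
Let p0 := @pp0 R.

(** The truncation of [s] to the interval from [- M] to [M], written so that its Lipschitz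
    property is visible. *)
Definition clamp M s : R := (`|s + M| - `|s - M|) / 2.
Definition excess M s : R := s - clamp M s.

Lemma clamp_le M s : 0 <= M -> `|clamp M s| <= M.
Proof.
move=> M0; rewrite normrM [`|2^-1|]gtr0_norm ?invr_gt0// ler_pdivrMr//.
apply: le_trans (ler_dist_dist _ _) _.
by have -> : s + M - (s - M) = M * 2 by [ring]; rewrite ger0_norm// mulr_ge0.
Qed.

Lemma clamp_lip M s s' : `|clamp M s - clamp M s'| <= `|s - s'|.
Proof.
rewrite /clamp -mulrBl normrM [`|2^-1|]gtr0_norm ?invr_gt0// ler_pdivrMr//.
have -> : `|s + M| - `|s - M| - (`|s' + M| - `|s' - M|) =
  (`|s + M| - `|s' + M|) - (`|s - M| - `|s' - M|) by ring.
apply: le_trans (ler_normB _ _) _.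
have h1 := ler_dist_dist (s + M) (s' + M); have h2 := ler_dist_dist (s - M) (s' - M).
have E1 : s + M - (s' + M) = s - s' by ring.
have E2 : s - M - (s' - M) = s - s' by ring.
by rewrite E1 in h1; rewrite E2 in h2; lra.
Qed.

Lemma clamp_id M s : `|s| <= M -> clamp M s = s.
Proof.
move=> sM; have /ler_normlP[h1 h2] := sM; rewrite /clamp ger0_norm; last by lra.
by rewrite ler0_norm; [field|lra].
Qed.

Lemma excess_le M s : 0 <= M -> `|excess M s| <= `|s|.
Proof.
move=> M0; rewrite /excess /clamp.
by case: (ger0P (s + M)) => h1; case: (ger0P (s - M)) => h2; case: (ger0P s) => h3;
   rewrite ler_norml; apply/andP; split; lra.
Qed.

Lemma m_clamp M : measurable_fun setT (clamp M).
Proof.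
apply: measurable_funM => //; apply: measurable_funB; apply: measurableT_comp => //.
  exact: measurable_funD.
exact: measurable_funB.
Qed.

Lemma m_excess M : measurable_fun setT (excess M).
Proof. by apply: measurable_funB => //; exact: m_clamp. Qed.

(** Interpolation between the bound [A] and the norm in [L^pp], followed by Young's inequality with
    weights [eta] and [eta^(-3)]. *)
Lemma nm_interp g h (A B eta : R) : measurable_fun setT h -> 0 < A -> 0 <= B -> 0 < eta ->
  (forall x, `|g x| <= A) -> (forall x, `|g x| <= `|h x|) -> (nm m3 pp h <= B%:E)%E ->
  (nm m3 9 g <= (A * eta + eta ^- 3 * B)%:E)%E.
Proof.
move=> mh A0 B0 e0 gA gh hB; set C := _ + _.
have e30 : 0 < eta ^- 3 by rewrite invr_gt0 exprn_gt0.
have C0 : 0 < C by rewrite ltr_pwDl// ?mulr_gt0// mulr_ge0// ltW.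
apply/nm_leP => //; first by rewrite lee_fin ltW.
(* The exponent 9 is split as 27/4 + 9/4. *)
pose q : R := 27 / 4.
have q0 : 0 <= q by rewrite /q divr_ge0.
have pw x : `|g x| `^ 9 <= A `^ q * `|h x| `^ pp.
  have -> : 9 = q + pp :> R by rewrite /q /pp; field.
  rewrite powRD; last first.
    by apply/implyP => /eqP; rewrite /q /pp => E; exfalso; lra.
  by apply: ler_pM; rewrite ?powR_ge0//; apply: ge0_ler_powR; rewrite ?nnegrE// ltW.
apply: (@le_trans _ _ ((A `^ q)%:E * \int[m3]_x (`|h x| `^ pp)%:E)%E).
  rewrite -ge0_integralZl//; last 2 first.
  - by apply/measurable_EFinP; exact: mpow.
  - by rewrite lee_fin powR_ge0.
  by apply: int_mono => x; rewrite ?lee_fin ?powR_ge0// -EFinM lee_fin.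
apply: (@le_trans _ _ ((A `^ q)%:E * (B%:E `^ pp))%E).
  apply: lee_wpmul2l; first by rewrite lee_fin powR_ge0.
  by apply/nm_leP => //; rewrite lee_fin.
rewrite !poweR_EFin -EFinM lee_fin.
have AC : A <= C / eta.
  by rewrite ler_pdivlMr// lerDl mulr_ge0// ltW.
have BC : B <= eta ^+ 3 * C.
  rewrite -ler_pdivrMl ?exprn_gt0//; rewrite lerDr; exact: mulr_ge0 (ltW A0) (ltW e0).
have C1 : 0 <= C / eta by rewrite divr_ge0// ltW.
have C2 : 0 <= eta ^+ 3 * C by rewrite mulr_ge0 ?exprn_ge0// ltW.
apply: (@le_trans _ _ ((C / eta) `^ q * (eta ^+ 3 * C) `^ pp)).
  by apply: ler_pM; rewrite ?powR_ge0//; apply: ge0_ler_powR; rewrite ?nnegrE// ltW.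
have e1 : 0 <= eta^-1 by rewrite invr_ge0 ltW.
have e3 : 0 <= eta ^+ 3 by rewrite exprn_ge0 ?ltW.
rewrite (powRM _ (ltW C0) e1) (powRM _ e3 (ltW C0)).
have -> : (eta ^+ 3) `^ pp = eta `^ q.
  by rewrite -powR_mulrn ?ltW// -powRrM; congr (_ `^ _); rewrite /q /pp; field.
have -> : C `^ q * eta^-1 `^ q * (eta `^ q * C `^ pp) = (eta^-1 `^ q * eta `^ q) * (C `^ q * C `^ pp) by ring.
rewrite -powRM ?(ltW e0)// mulVf ?gt_eqF// powR1 mul1r -powRD; last by rewrite (gt_eqF C0) implybT.
by rewrite (_ : q + pp = 9)// /q /pp; field.
Qed.

(** Dominated convergence: the excess over a level is dominated by the function itself and
    eventually vanishes at each point. *)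
Lemma nm_excess_cvg f : measurable_fun setT f -> (nm m3 9 f < +oo)%E ->
  tozero (fun k => nm m3 9 (fun x => excess k%:R (f x))).
Proof.
move=> mf fy; have n9 : 9 != 0 :> R by [].
have mR (M : R) : measurable_fun setT (fun x => excess M (f x)) by apply: (mcomp (m_excess M)).
have i9 : ig m3 (fun x => `|f x| `^ 9).
  apply/igP; split; first exact: mpow.
  under eq_integral => x _ do rewrite (ger0_norm (powR_ge0 _ _)).
  by rewrite -nm_pow//; exact: poweR_lty.
have cv : \int[m3]_x (`|excess M%:R (f x)| `^ 9) @[M --> \oo] --> \int[m3]_x (0 : R).
  apply: (I_dct _ _ i9) => [M|//|M x|x]; first exact: mpow.
    rewrite ger0_norm ?powR_ge0//; apply: ge0_ler_powR; rewrite ?nnegrE//; exact: excess_le.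
  apply: (@cvg_trans _ ((fun=> 0 : R) @ \oo)); last exact: cvg_cst.
  apply: near_eq_cvg; near=> M; rewrite /excess clamp_id ?subrr ?normr0 ?powR0//.
  by near: M; exact: nbhs_infty_ger.
rewrite I0 in cv; move=> e e0.
have e9 : 0 < e `^ 9 by exact: powR_gt0.
move/cvgrPdist_le : cv => /(_ _ e9)[N _ hN]; exists N => n Nn.
apply/nm_leP; [by []|by rewrite lee_fin ltW|].
have ie : ig m3 (fun x => `|excess n%:R (f x)| `^ 9).
  apply: (ig_le _ _ i9); first exact: mpow.
  move=> x; rewrite (ger0_norm (powR_ge0 _ _)) (ger0_norm (powR_ge0 _ _)); apply: ge0_ler_powR; rewrite ?nnegrE//; exact: excess_le.
rewrite -IE// poweR_EFin lee_fin; have := hN n Nn; rewrite /= sub0r normrN.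
exact: le_trans (ler_norm _).
Unshelve. all: by end_near. Qed.

End truncation.

Section cubic.
Context {R : realType}.
Local Notation X := (R * R * R)%type.
Local Notation V := (R * R * R * R)%type.
Variables (T Om : R) (u v w p : V -> R) (al : R -> R).
Hypothesis fl : flow T u v w p Om al.
Implicit Types (xi : X) (t r : R) (f : V -> R).
Local Notation ta := (tau T).
Local Notation "'aet' t , P" := {ae (tau T : {measure set R -> \bar R}), forall t, P}
  (at level 200, t name).
Let p0 := @pp0 R.
Let p1 := @pp1 R.
Let mu := flow_mu fl.
Let mv := flow_mv fl.
Let mw := flow_mw fl.
Let al0 := flow_al0 fl.
Let mal := flow_mal fl.

Definition incr xi f (q : V) : R := f (q.1 + xi, q.2) - f q.

Definition totinc xi (q : V) : R := `|incr xi u q| + `|incr xi v q| + `|incr xi w q|.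

(** The spatial part of the cubic functional, at one time and for one increment. *)
Definition cub xi t : \bar R :=
  (\int[m3]_x (totinc xi (x, t) * (incr xi u (x, t) ^+ 2 + incr xi v (x, t) ^+ 2))%:E)%E.

(** The increment [xi] behaves like a displacement of length [r]. Two lengths are used: the size of
    a box for the defect, and a sum of sines for the energy. *)
Definition small xi r := aet t, (nm m3 pp (dif xi (slice u t)) <= (r * al t)%:E)%E /\
  (nm m3 pp (dif xi (slice v t)) <= (r * al t)%:E)%E.

Lemma igalX k : (k <= 3)%N -> ig ta (fun t => al t ^+ k).
Proof. exact: ig_lower_powers mal al0 (flow_ial fl). Qed.

Lemma m_incr xi f : measurable_fun setT f -> measurable_fun setT (incr xi f).
Proof. exact: m_dif_slice. Qed.

Let mnorm (f : V -> R) : measurable_fun setT f -> measurable_fun setT (fun q => `|f q|).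
Proof. by move=> mf; exact: measurableT_comp. Qed.

Lemma m_totinc xi : measurable_fun setT (totinc xi).
Proof. by apply: measurable_funD; [apply: measurable_funD|]; apply: mnorm; exact: m_incr. Qed.

Lemma totinc_ge0 xi q : 0 <= totinc xi q.
Proof. by rewrite !addr_ge0. Qed.

Definition exn (M : nat) f t : R := fine (nm m3 9 (fun x => excess M%:R (f (x, t)))).

Let mex (M : nat) f : measurable_fun setT f -> measurable_fun setT (fun q => excess M%:R (f q)).
Proof. by move=> mf; apply: (mcomp (m_excess M%:R)). Qed.

Lemma m_exn M f : measurable_fun setT f -> measurable_fun setT (exn M f).
Proof. move=> mf; have n9 : 9 != 0 :> R by [].
apply: measurableT_comp => //.
exact: (m_nm_slice n9 (mex M mf)). Qed.

Lemma exn_ge0 M f t : 0 <= exn M f t.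
Proof. by apply: fine_ge0; exact: nm_ge0. Qed.

Section component.
Variable f : V -> R.
Hypotheses (mf : measurable_fun setT f) (sf : aet t, stat (slice f t) (al t)).

Lemma exnE : aet t, forall M, (nm m3 9 (fun x => excess M%:R (f (x, t))) = (exn M f t)%:E)%E /\
  exn M f t <= 7 * al t.
Proof.
apply: filterS sf => t st M.
have h : (nm m3 9 (fun x => excess M%:R (f (x, t))) <= (7 * al t)%:E)%E.
  apply: le_trans (sobolev st); apply: nm_mono => // x; exact: excess_le.
have E : (nm m3 9 (fun x => excess M%:R (f (x, t))) = (exn M f t)%:E)%E.
  rewrite /exn fineK// ge0_fin_numE; last exact: nm_ge0.
  by apply: le_lt_trans h _; rewrite ltry.
by split => //; rewrite -lee_fin -E.
Qed.

(** The excess is dominated by seven times the amplitude, by [sobolev], and tends to 0 at almost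
    every time. *)
Lemma exn_small (k : R) : 0 < k -> exists2 M : nat, (0 < M)%N & \int[ta]_t (al t ^+ 2 * exn M f t) <= k.
Proof.
move=> k0.
have cv : \int[ta]_t (al t ^+ 2 * exn M f t) @[M --> \oo] --> \int[ta]_t (0 : R).
  apply: (@I_dct_ae _ _ _ _ _ _ (fun t => 7 * al t ^+ 3)) => [M|//||].
  - by apply: measurable_funM; [exact: measurable_funX|exact: m_exn].
  - by apply: igZ; exact: igalX.
  apply: filterS (filterI exnE sf) => t [Et st]; split => [M|].
    have [_ h] := Et M; have a0 := al0 t; rewrite ger0_norm ?mulr_ge0 ?exprn_ge0 ?exn_ge0//.
    have -> : 7 * al t ^+ 3 = al t ^+ 2 * (7 * al t) by ring.
    by rewrite ler_wpM2l// exprn_ge0.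
  rewrite -[X in _ --> X](mulr0 (al t ^+ 2)); apply: cvgM; first exact: cvg_cst.
  have fy : (nm m3 9 (slice f t) < +oo)%E by apply: le_lt_trans (sobolev st) _; rewrite ltry.
  have tz := nm_excess_cvg (m_slice t mf) fy.
  apply/cvgrPdist_le => e e0; have [N hN] := tz e e0; exists N => // n Nn.
  rewrite /= sub0r normrN ger0_norm ?exn_ge0//.
  by have := hN n Nn; rewrite /slice (Et n).1.
rewrite I0 in cv; move/cvgrPdist_le : cv => /(_ _ k0)[N _ hN]; exists N.+1 => //.
by have := hN N.+1 (leqnSn N); rewrite /= sub0r normrN; exact: le_trans (ler_norm _).
Qed.

Lemma ig_exn M : ig ta (fun t => al t ^+ 2 * exn M f t).
Proof.
have mF : measurable_fun setT (fun t => al t ^+ 2 * exn M f t).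
  by apply: measurable_funM; [exact: measurable_funX|exact: m_exn].
have /igP[m3 h3] := igZ 7 (igalX (k := 3) isT).
apply/igP; split => //; apply: le_lt_trans h3; apply: int_ae_le => //.
- by apply/measurable_EFinP; exact: measurableT_comp.
- by apply/measurable_EFinP; exact: measurableT_comp.
apply: filterS exnE => t Et; have [_ h] := Et M; have a0 := al0 t; rewrite lee_fin.
rewrite !ger0_norm ?mulr_ge0 ?exprn_ge0 ?exn_ge0//.
have -> : 7 * al t ^+ 3 = al t ^+ 2 * (7 * al t) by ring.
by rewrite ler_wpM2l// exprn_ge0.
Qed.

Lemma nm9_incr (xi : X) (r eta : R) (M : nat) : (0 < M)%N -> 0 < eta -> 0 <= r ->
  (aet t, nm m3 pp (dif xi (slice f t)) <= (r * al t)%:E)%E ->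
  aet t, (nm m3 9 (dif xi (slice f t)) <=
    (2 * exn M f t + (2 * M%:R * eta + eta ^- 3 * (r * al t)))%:E)%E.
Proof.
move=> M0 e0 r0 H; apply: filterS (filterI (filterI H exnE) sf) => t [[Ht Et] st].
have [ms ps _ _] := st; have [EM _] := Et M.
pose ex x := excess M%:R (slice f t x); pose cl x := clamp M%:R (slice f t x).
have mexs : measurable_fun setT ex by apply: (mcomp (m_excess M%:R)).
have mcl : measurable_fun setT cl by apply: (mcomp (m_clamp M%:R)).
have pex : torus_periodic ex.
  by move=> x; have [h1 h2 h3] := ps x; rewrite /ex h1 h2 h3.
have -> : dif xi (slice f t) = (fun x => dif xi ex x + dif xi cl x).
  by apply/funext => x; rewrite /dif /ex /cl /excess; ring.
have p9 : 1 <= 9 :> R by rewrite ler1n.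
apply: le_trans (@nmD _ _ _ m3 9 _ _ (m_dif xi mexs) (m_dif xi mcl) p9) _.
rewrite EFinD; apply: leeD.
  apply: le_trans (nmB m3 (m_shift xi mexs) mexs p9) _.
  by rewrite nm_shift// /ex /slice EM -EFinD lee_fin mulr_natl mulr2n.
have M1 : 0 < 2 * M%:R :> R by rewrite mulr_gt0// ltr0n.
apply: (nm_interp (m_dif xi ms) M1 _ e0 _ _ Ht).
- by rewrite mulr_ge0.
- move=> x; apply: le_trans (ler_normB _ _) _.
  by rewrite mulr_natl mulr2n lerD// clamp_le.
- by move=> x; exact: clamp_lip.
Qed.

End component.

Lemma m_cub_int xi : measurable_fun setT (fun q => totinc xi q * (incr xi u q ^+ 2 + incr xi v q ^+ 2)).
Proof.
apply: measurable_funM; first exact: m_totinc.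
by apply: measurable_funD; apply: measurable_funX; exact: m_incr.
Qed.

Lemma cub_int_ge0 xi q : 0 <= totinc xi q * (incr xi u q ^+ 2 + incr xi v q ^+ 2).
Proof. by rewrite mulr_ge0 ?totinc_ge0// addr_ge0// sqr_ge0. Qed.

Lemma m_cub xi : measurable_fun setT (cub xi).
Proof.
apply: (mint1 m3 (f := fun q : V => (totinc xi q * (incr xi u q ^+ 2 + incr xi v q ^+ 2))%:E)).
  by apply/measurable_EFinP; exact: m_cub_int.
by move=> q; rewrite lee_fin; exact: cub_int_ge0.
Qed.

Lemma cub_ge0 xi t : (0 <= cub xi t)%E.
Proof. by apply: integral_ge0 => x _; rewrite lee_fin; exact: cub_int_ge0. Qed.

(** The increments of [w] carry no factor [r]: only boundedness is available in all directions. *)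
Lemma nm_totinc xi : aet t, (nm m3 pp (slice (totinc xi) t) <= (8 * al t)%:E)%E.
Proof.
apply: filterS (filterI (filterI (flow_u fl) (flow_v fl)) (flow_w fl)) => t [[su sv] [[mwt pwt] wt]].
have [mut put ut _] := su; have [mvt pvt vt _] := sv.
have p1' := ltW p1.
have two (g : X -> R) (c : R) : measurable_fun setT g -> torus_periodic g -> (nm m3 pp g <= c%:E)%E ->
    (nm m3 pp (fun x => `|dif xi g x|)%R <= (2 * c)%:E)%E.
  move=> mg pg gc; rewrite (nm_eq _ _ (g := dif xi g)); last by move=> x; rewrite normr_id.
  apply: le_trans (nmB m3 (m_shift xi mg) mg p1') _.
  by rewrite nm_shift// mulr_natl mulr2n EFinD leeD.
have ma (g : X -> R) : measurable_fun setT g -> measurable_fun setT (fun x => `|dif xi g x|).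
  by move=> mg; apply: measurableT_comp => //; exact: m_dif.
have E : 8 * al t = 2 * al t + 2 * al t + 2 * (2 * al t) by ring.
rewrite E !EFinD.
apply: le_trans (@nmD _ _ _ m3 pp (fun x => `|dif xi (slice u t) x| + `|dif xi (slice v t) x|)%R (fun x => `|dif xi (slice w t) x|)%R _ _ p1') _.
- by apply: measurable_funD; exact: ma.
- exact: ma.
apply: leeD; last exact: two.
apply: le_trans (@nmD _ _ _ m3 pp (fun x => `|dif xi (slice u t) x|)%R (fun x => `|dif xi (slice v t) x|)%R _ _ p1') _.
- exact: ma.
- exact: ma.
by apply: leeD; exact: two.
Qed.

(** Hoelder with exponents 9/4, 9/4 and 9. The level [M] is chosen first, to make the excess
    small, then [eta], to make the bounded part small; the term linear in [r] that remains is
    absorbed in the constant and in the square. *)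
Lemma cub_le (k : R) : 0 < k -> exists2 C : R, 0 <= C & forall xi r, 0 <= r -> small xi r ->
  (\int[ta]_t cub xi t <= (r * (k + C * r ^+ 2))%:E)%E.
Proof.
move=> k0; pose I2 := \int[ta]_t (al t ^+ 2); pose I3 := \int[ta]_t (al t ^+ 3).
have ial2 := igalX (k := 2) isT; have ial3 := igalX (k := 3) isT.
have I20 : 0 <= I2 by apply: Rintegral_ge0 => t _; rewrite sqr_ge0.
have I30 : 0 <= I3 by apply: Rintegral_ge0 => t _; rewrite exprn_ge0.
(* Each of the two excess terms enters with the factor 16; together they use a third of k. *)
have k48 : 0 < k / 96 by rewrite divr_gt0.
have [Mu Mu0 hMu] := exn_small mu (flow_u fl) k48; have [Mv Mv0 hMv] := exn_small mv (flow_v fl) k48.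
pose L : R := Mu%:R + Mv%:R; have L0 : 0 <= L by rewrite addr_ge0.
pose eta : R := k / (48 * (L * I2 + 1)).
have LI : 0 < L * I2 + 1 by rewrite ltr_wpDl// mulr_ge0.
have e0 : 0 < eta by rewrite divr_gt0// mulr_gt0.
have e30 : 0 <= eta ^- 3 by rewrite invr_ge0 exprn_ge0// ltW.
pose D := 16 * eta ^- 3 * I3; have D0 : 0 <= D by rewrite !mulr_ge0.
(* By the inequality between the means, D r <= k/3 + 3 D^2 r^2 / k. *)
exists (3 * D ^+ 2 / k) => [|xi r r0 sm].
  by rewrite divr_ge0 ?mulr_ge0 ?sqr_ge0// ltW.
pose g t := r * (16 * (al t ^+ 2 * exn Mu u t) + 16 * (al t ^+ 2 * exn Mv v t)
   + 16 * L * eta * al t ^+ 2 + 16 * eta ^- 3 * r * al t ^+ 3).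
have g0 t : 0 <= g t.
  have a0 := al0 t; have h1 := exn_ge0 Mu u t; have h2 := exn_ge0 Mv v t; have e0' := ltW e0.
  have a2 := exprn_ge0 2 a0; have a3 := exprn_ge0 3 a0.
  have c1 := mulr_ge0 a2 h1; have c2 := mulr_ge0 a2 h2.
  have c3 := mulr_ge0 (mulr_ge0 L0 e0') a2; have c4 := mulr_ge0 (mulr_ge0 e30 r0) a3.
  by apply: mulr_ge0 => //; lra.
have iu := ig_exn mu (flow_u fl) Mu; have iv := ig_exn mv (flow_v fl) Mv.
have ig_ : ig ta g.
  by apply: igZ; apply: igD; [apply: igD; [apply: igD|]|]; apply: igZ.
apply: (@le_trans _ _ (\int[ta]_t (g t)%:E)%E); last first.
  rewrite -IE// lee_fin /g IZ; last first.
    by apply: igD; [apply: igD; [apply: igD|]|]; apply: igZ.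
  rewrite ler_wpM2l// ID; [|by apply: igD; [apply: igD|]; apply: igZ|exact: igZ].
  rewrite ID; [|by apply: igD; apply: igZ|exact: igZ].
  rewrite ID; [|exact: igZ|exact: igZ].
  rewrite !IZ// -/I2 -/I3.
  have h1 : 16 * L * eta * I2 <= k / 3.
    have -> : 16 * L * eta * I2 = (L * I2) / (L * I2 + 1) * (k / 3).
      by rewrite /eta; field; rewrite gt_eqF.
    rewrite -[leRHS]mul1r ler_wpM2r ?divr_ge0 ?(ltW k0)// ler_pdivrMr// mul1r lerDl//.
  have -> : 16 * eta ^- 3 * r * I3 = D * r by rewrite /D; ring.
  have h2 : D * r <= k / 3 + 3 * D ^+ 2 / k * r ^+ 2.
    have -> : 3 * D ^+ 2 / k * r ^+ 2 = 3 * (D * r) ^+ 2 / k by field; rewrite gt_eqF.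
    have x0 : 0 <= D * r by exact: mulr_ge0.
    have q0 : 0 <= 3 * (D * r) ^+ 2 / k by rewrite divr_ge0 ?mulr_ge0 ?sqr_ge0// ltW.
    have [xk|kx] := leP (D * r) (k / 3); first by rewrite (le_trans xk)// lerDl.
    apply: (@le_trans _ _ (3 * (D * r) ^+ 2 / k)); last by rewrite lerDr divr_ge0// ltW.
    rewrite ler_pdivlMr// expr2 mulrA [leRHS]mulrC ler_wpM2l//; lra.
  lra.
apply: int_ae_le.
- exact: m_cub.
- by apply/measurable_EFinP; exact: ig_meas ig_.
- exact: cub_ge0.
- by move=> t; rewrite lee_fin.
have smu : aet t, (nm m3 pp (dif xi (slice u t)) <= (r * al t)%:E)%E by apply: filterS sm => t [].
have smv : aet t, (nm m3 pp (dif xi (slice v t)) <= (r * al t)%:E)%E by apply: filterS sm => t [].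
have H9u := nm9_incr (flow_u fl) Mu0 e0 r0 smu.
have H9v := nm9_incr (flow_v fl) Mv0 e0 r0 smv.
apply: filterS (filterI sm (filterI (nm_totinc xi) (filterI H9u H9v))) => t [[su sv] [tt [nu9 nv9]]].
have hh : pp^-1 + pp^-1 + 9^-1 = 1 :> R by rewrite /pp; field.
have mtt : measurable_fun setT (slice (totinc xi) t) by exact: m_slice (m_totinc xi).
have H (f : V -> R) (b : R) : measurable_fun setT f -> (nm m3 pp (dif xi (slice f t)) <= (r * al t)%:E)%E ->
    (nm m3 9 (dif xi (slice f t)) <= b%:E)%E ->
    (\int[m3]_x (totinc xi (x, t) * incr xi f (x, t) ^+ 2)%:E <= (8 * al t * (r * al t) * b)%:E)%E.
  move=> mf h1 h2; have md : measurable_fun setT (dif xi (slice f t)) by exact: m_dif (m_slice t mf).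
  have n9 : 0 < 9 :> R by [].
  have h3 := hoelder3 m3 mtt md md p0 p0 n9 hh.
  apply: (@le_trans _ _ (nm m3 pp (slice (totinc xi) t) * nm m3 pp (dif xi (slice f t)) * nm m3 9 (dif xi (slice f t)))%E).
    apply: le_trans h3; apply: int_mono => x; rewrite lee_fin.
      by rewrite mulr_ge0 ?totinc_ge0// sqr_ge0.
    by rewrite expr2 mulrA; exact: ler_norm.
  rewrite !EFinM; apply: lee_pmul => //; [by rewrite mule_ge0 ?nm_ge0|exact: nm_ge0|].
  by apply: lee_pmul => //; exact: nm_ge0.
have HU := H u _ mu su nu9; have HV := H v _ mv sv nv9.
have mt2 f : measurable_fun setT f -> measurable_fun setT (fun x => (totinc xi (x, t) * incr xi f (x, t) ^+ 2)%:E : \bar R).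
  move=> mf; apply/measurable_EFinP; apply: measurable_funM => //.
  by apply: measurable_funX; exact: (m_slice t (m_incr xi mf)).
have -> : cub xi t = (\int[m3]_x (totinc xi (x, t) * incr xi u (x, t) ^+ 2)%:E +
    \int[m3]_x (totinc xi (x, t) * incr xi v (x, t) ^+ 2)%:E)%E.
  rewrite -ge0_integralD//.
  - by apply: eq_integral => x _; rewrite -EFinD mulrDr.
  - by move=> x _; rewrite lee_fin mulr_ge0 ?totinc_ge0// sqr_ge0.
  - exact: mt2.
  - by move=> x _; rewrite lee_fin mulr_ge0 ?totinc_ge0// sqr_ge0.
  - exact: mt2.
apply: le_trans (leeD HU HV) _; rewrite -EFinD lee_fin /g /L le_eqVlt; apply/orP; left; apply/eqP.
ring.
Qed.

End cubic.

(** * The defect vanishes *)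
Section mollifiers.
Context {R : realType}.
Local Notation X := (R * R * R)%type.
Implicit Types (x xi : X) (a : axis) (M eps : R) (phi : X -> R).

Lemma continuous_bounded (Y : topologicalType) (f : Y -> R) (A : set Y) : A !=set0 -> compact A ->
  continuous f -> exists2 B : R, 0 <= B & forall y, A y -> `|f y| <= B.
Proof.
move=> A0 cA cf.
have cn : {within A, continuous (fun y => `|f y|)}.
  by apply: continuous_subspaceT => y; apply: continuous_comp; [exact: cf|exact: norm_continuous].
have [c _ hc] := compact_EVT_max A0 cA cn; exists `|f c| => // y Ay.
by apply: hc; rewrite inE.
Qed.

Definition box M : set X := `[- M, M] `*` `[- M, M] `*` `[- M, M].

Lemma boxP M x : box M x <-> forall a, `|co a x| <= M.
Proof.
split=> [[[h1 h2] h3] a|h].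
  by case: a; rewrite ler_norml /=; [move: h1|move: h2|move: h3]; rewrite /= in_itv.
by split; [split|]; rewrite /= in_itv /= -ler_norml; [exact: (h Ax1)|exact: (h Ax2)|exact: (h Ax3)].
Qed.

Lemma compact_box M : compact (box M).
Proof. by apply: compact_setX; [apply: compact_setX|]; exact: segment_compact. Qed.

Lemma measurable_box M : measurable (box M).
Proof. by apply: measurableX; [apply: measurableX|]; exact: measurable_itvR. Qed.

Transparent leb.
Lemma leb3_box M : 0 < M -> leb3 (box M) = ((2 * M) ^+ 3)%:E.
Proof.
move=> M0; pose I : set R := `[- M, M]%classic; have mI : measurable I by exact: measurable_itvR.
have IE' : leb I = (2 * M)%:E :> \bar R.
  rewrite /leb lebesgue_measure_itv /= lte_fin ifT; last by lra.
  by rewrite -EFinB; congr EFin; ring.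
have mII : measurable (I `*` I) by exact: measurableX.
have E2 : pm leb leb (I `*` I) = (leb I * leb I)%E by exact: pmE.
have -> : leb3 (box M) = (pm leb leb (I `*` I) * leb I)%E by exact: pmE.
by rewrite E2 IE' -!EFinM; congr EFin; ring.
Qed.
Opaque leb.

Lemma co_enorm a x : `|co a x| <= enorm x.
Proof.
rewrite -sqrtr_sqr /enorm ler_sqrt; last by rewrite !addr_ge0 ?sqr_ge0.
have h1 := sqr_ge0 x.1.1; have h2 := sqr_ge0 x.1.2; have h3 := sqr_ge0 x.2.
by case: a => /=; lra.
Qed.

Lemma cont_co a : continuous (co a : X -> R).
Proof.
case: a => x /=.
- by apply: (continuous_comp (f := fst) (g := fst)); exact: cvg_fst.
- by apply: (continuous_comp (f := fst) (g := snd)); [exact: cvg_fst|exact: cvg_snd].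
- exact: cvg_snd.
Qed.

Lemma drv_line phi x a : (forall y v, derivable phi y v) ->
  drv (fun r => phi (x + r *: un a)) (fun r => 'D_(un a) phi (x + r *: un a)).
Proof.
move=> dphi r.
have E : (fun h : R => h^-1 *: (((fun r : R => phi (x + r *: un a)) \o shift r) (h *: 1) - phi (x + r *: un a))) =
  (fun h : R => h^-1 *: ((phi \o shift (x + r *: un a)) (h *: un a) - phi (x + r *: un a))).
  apply/funext => h /=; do 3 f_equal.
  have -> : h%:A = h :> R by rewrite -[h%:A]/(h * 1) mulr1.
  by rewrite scalerDl addrCA.
split; first by rewrite /derivable E; exact: dphi.
by rewrite /derive E.
Qed.

(** Outside the box the mollifier vanishes in a neighbourhood; inside, its derivatives are bounded by
    compactness, and rescaling costs the fourth power of the parameter. *)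
Lemma mollifier_grad phi : mollifier phi -> exists M B : R, [/\ 0 < M, 0 <= B &
  forall eps, 0 < eps -> forall a xi,
    `|'D_(un a) (rescale eps phi) xi| <= eps ^- 4 * B * \1_(box (eps * M)) xi].
Proof.
move=> [sphi [M0 hM] _ _].
(* The bound M0 may be negative; the box has to be nonempty. *)
pose M : R := `|M0| + 1; have MM : 0 < M by rewrite ltr_wpDl.
have dphi y v : derivable phi y v by have [_ h] := sphi [::]; exact: h.
have cD a : continuous ('D_(un a) phi) by have [h _] := sphi [:: un a].
have box0 : box M !=set0.
  by exists 0; apply/boxP => a; case: a; rewrite /= normr0 ltW.
have Ba a := continuous_bounded box0 (@compact_box M) (cD a).
have [B1 B10 h1] := Ba Ax1; have [B2 B20 h2] := Ba Ax2; have [B3 B30 h3] := Ba Ax3.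
pose B := B1 + B2 + B3; have B0 : 0 <= B by rewrite !addr_ge0.
have hB a y : box M y -> `|'D_(un a) phi y| <= B.
  rewrite /B; case: a => by_; [apply: le_trans (h1 y by_) _|apply: le_trans (h2 y by_) _|apply: le_trans (h3 y by_) _].
  - by rewrite -addrA lerDl addr_ge0.
  - by rewrite addrAC lerDr addr_ge0.
  - by rewrite lerDr addr_ge0.
have out a y : ~ box M y -> 'D_(un a) phi y = 0.
  move=> nb; have [a' ha'] : exists a', M < `|co a' y|.
    apply/not_existsP => h; apply: nb; apply/boxP => a'; rewrite leNgt; apply/negP; exact: h.
  have E : \forall z \near y, phi z = cst 0 z.
    have cz : continuous (fun z : X => `|co a' z|).
      move=> z; apply: (continuous_comp (f := co a') (g := fun r : R => `|r|)); first exact: cont_co.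
      exact: norm_continuous.
    have : \forall z \near y, M < `|co a' z| by exact: cvgr_gt `|co a' y| (cz y) _ ha'.
    apply: filterS => z hz; apply: hM; apply: lt_le_trans (co_enorm a' z).
    by apply: le_lt_trans hz; rewrite /M (le_trans (ler_norm _))// lerDl.
  by rewrite (near_eq_derive _ E) derive_cst.
exists M, B; split => // eps e0 a xi.
have en : eps != 0 by rewrite gt_eqF.
have D : 'D_(un a) (rescale eps phi) xi = eps ^- 4 * 'D_(un a) phi (eps^-1 *: xi).
  have dl := drv_line (eps^-1 *: xi) a dphi.
  have d1 : drv (fun r => eps ^- 3 * phi (eps^-1 *: xi + (eps^-1 * r) *: un a))
     (fun r => eps ^- 3 * ('D_(un a) phi (eps^-1 *: xi + (eps^-1 * r) *: un a) * (eps^-1 * 1))).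
    by apply: drvZ; apply: (drv_comp dl); apply: drvZ; exact: drv_id.
  have -> : 'D_(un a) (rescale eps phi) xi = eps ^- 3 * ('D_(un a) phi (eps^-1 *: xi + (eps^-1 * 0) *: un a) * (eps^-1 * 1)).
    apply: (line_derive (g := fun r => eps ^- 3 * ('D_(un a) phi (eps^-1 *: xi + (eps^-1 * r) *: un a) * (eps^-1 * 1)))).
    rewrite (_ : (fun r => rescale _ _ _) = fun r => eps ^- 3 * phi (eps^-1 *: xi + (eps^-1 * r) *: un a))//.
    by apply/funext => r; rewrite /rescale scalerDr scalerA.
  by rewrite mulr0 scale0r addr0; field.
have e4 : 0 <= eps ^- 4 by rewrite invr_ge0 exprn_ge0// ltW.
have bE : box (eps * M) xi <-> box M (eps^-1 *: xi).
  have cE a' : co a' (eps^-1 *: xi) = eps^-1 * co a' xi by case: a'.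
  split=> /boxP h; apply/boxP => a'; have := h a'; rewrite cE normrM gtr0_norm ?invr_gt0//.
    by rewrite ler_pdivrMl.
  by rewrite ler_pdivrMl.
rewrite D normrM (ger0_norm e4) -mulrA ler_wpM2l// indicE.
case: (boolP (xi \in box (eps * M))) => [|] h.
  by rewrite mulr1; apply: hB; apply/bE; rewrite inE in h.
by rewrite out ?normr0 ?mulr0// => /bE h'; move: h; rewrite notin_setE; apply.
Qed.

End mollifiers.

Section defect.
Context {R : realType}.
Local Notation X := (R * R * R)%type.
Local Notation V := (R * R * R * R)%type.
Local Notation mu1 := (@lebesgue_measure R).
Local Notation mu3 := (mu1 \x mu1 \x mu1)%E.
Local Notation mu4 := (mu3 \x mu1)%E.
Variables (T Om : R) (u v w p : V -> R) (al : R -> R).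
Hypothesis fl : flow T u v w p Om al.
Implicit Types (xi : X) (t r : R) (f : V -> R).
Local Notation ta := (tau T).
Let mu := flow_mu fl.
Let mv := flow_mv fl.
Let mw := flow_mw fl.

Lemma small_axes xi (c : axis -> R) :
  {ae (ta : {measure set R -> \bar R}), forall t, forall a,
     (nm m3 pp (dif (co a xi *: un a) (slice u t)) <= (c a * al t)%:E)%E /\
     (nm m3 pp (dif (co a xi *: un a) (slice v t)) <= (c a * al t)%:E)%E} ->
  small T u v al xi (c Ax1 + c Ax2 + c Ax3).
Proof.
move=> H; apply: filterS (filterI H (filterI (flow_u fl) (flow_v fl))) => t [h [su sv]].
split; [apply: (nm_dif_axes su)|apply: (nm_dif_axes sv)] => a; [exact: (h a).1|exact: (h a).2].
Qed.

(** Each coordinate of the displacement contributes at most [c]. *)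
Lemma small_box xi c : box c xi -> small T u v al xi (3 * c).
Proof.
move=> /boxP hb; have -> : 3 * c = c + c + c by ring.
apply: (small_axes (c := fun=> c)).
apply: filterS (filterI (flow_u fl) (flow_v fl)) => t [su sv] a.
by split; [have := nm_dif_axis su a (co a xi)|have := nm_dif_axis sv a (co a xi)];
  move=> /le_trans; apply; rewrite lee_fin ler_wpM2r// (flow_al0 fl).
Qed.

Definition cubd xi (q : V) : R := totinc u v w xi q * (incr xi u q ^+ 2 + incr xi v q ^+ 2).

Lemma cubd_ge0 xi q : 0 <= cubd xi q.
Proof. by rewrite mulr_ge0 ?totinc_ge0// addr_ge0// sqr_ge0. Qed.

Lemma m_incr2 f : measurable_fun setT f -> measurable_fun setT (fun z : V * X => incr z.2 f z.1).
Proof.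
move=> mf; have mid : measurable_fun setT (fun z : V * X => z) by exact: measurable_id.
apply: measurable_funB; last by apply: (mcomp mf); exact: mfst.
apply: (mcomp mf); apply: mprod; last by apply: msnd; exact: mfst.
by apply: madd; [apply: mfst; exact: mfst|exact: msnd].
Qed.

Lemma m_cubd : measurable_fun setT (fun z : V * X => cubd z.2 z.1).
Proof.
have ma f : measurable_fun setT f -> measurable_fun setT (fun z : V * X => `|incr z.2 f z.1|).
  by move=> mf; apply: measurableT_comp => //; exact: m_incr2.
apply: measurable_funM; first by apply: measurable_funD; [apply: measurable_funD|]; exact: ma.
by apply: measurable_funD; apply: measurable_funX; exact: m_incr2.
Qed.

Lemma int_cubd xi : (\int[m4 T]_q (cubd xi q)%:E = \int[ta]_t cub u v w xi t)%E.
Proof.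
have mc : measurable_fun setT (fun q => (cubd xi q)%:E : \bar R).
  by apply/measurable_EFinP; exact: (m_cub_int fl xi).
have c0 q : (0 <= (cubd xi q)%:E :> \bar R)%E by rewrite lee_fin cubd_ge0.
exact: (tonelli2 m3 ta mc c0).
Qed.

Lemma grad_bound (d1 d2 d3 a b c K : R) : `|d1| <= K -> `|d2| <= K -> `|d3| <= K ->
  `|d1 * a + d2 * b + d3 * c| <= K * (`|a| + `|b| + `|c|).
Proof.
move=> h1 h2 h3; rewrite !mulrDr.
apply: le_trans (ler_normD _ _) _; apply: lerD; last by rewrite normrM ler_wpM2r.
by apply: le_trans (ler_normD _ _) _; apply: lerD; rewrite normrM ler_wpM2r.
Qed.

(** Tonelli moves the integral over space-time inside, where it is [cub]. The powers of [eps]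
    balance: four from the gradient, three from the volume of the box, one from [cub_le]. *)
Lemma defect_bound phi psi (M B Bp eps k C : R) : 0 < M -> 0 <= B -> 0 <= Bp -> 0 < eps ->
  0 <= k -> 0 <= C ->
  (forall a xi, `|'D_(un a) (rescale eps phi) xi| <= eps ^- 4 * B * \1_(box (eps * M)) xi) ->
  (forall q, cylinder T q -> `|psi q| <= Bp) ->
  (forall xi r, 0 <= r -> small T u v al xi r ->
     (\int[ta]_t cub u v w xi t <= (r * (k + C * r ^+ 2))%:E)%E) ->
  `|\int[mu4]_(q in cylinder T) (defect_eps phi u v w eps q * psi q)| <=
    Bp * B * 24 * M ^+ 4 * (k + C * (3 * (eps * M)) ^+ 2).
Proof.
move=> M0 B0 Bp0 e0 k0 C0 hD hpsi hc.
have eM : 0 < eps * M by exact: mulr_gt0.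
pose K := eps ^- 4 * B.
have K0 : 0 <= K by rewrite mulr_ge0// invr_ge0 exprn_ge0// ltW.
pose g (q : V) (xi : X) : \bar R := (K * \1_(box (eps * M)) xi * cubd xi q)%:E.
have g0 q xi : (0 <= g q xi)%E.
  have i0 : 0 <= \1_(box (eps * M)) xi :> R by rewrite indicE.
  by rewrite lee_fin; exact: mulr_ge0 (mulr_ge0 K0 i0) (cubd_ge0 _ _).
have mbx := @measurable_box R (eps * M).
have mi : measurable_fun setT (\1_(box (eps * M)) : X -> R) by exact: measurable_indic.
have mg : measurable_fun setT (fun z : V * X => g z.1 z.2).
  apply/measurable_EFinP; apply: measurable_funM; last exact: m_cubd.
  by apply: measurable_funM => //; apply: (mcomp mi); exact: msnd.
have mgq q : measurable_fun setT (g q) by exact: (measurable_fun_pair2 q mg).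
have mH := measurable_int2 leb3 mg g0.
pose Z := 3 * (eps * M) * (k + C * (3 * (eps * M)) ^+ 2).
have r0 : 0 <= 3 * (eps * M) by rewrite mulr_ge0// ltW.
have Z0 : 0 <= Z by rewrite mulr_ge0// addr_ge0// mulr_ge0// sqr_ge0.
have -> : Bp * B * 24 * M ^+ 4 * (k + C * (3 * (eps * M)) ^+ 2) = Bp * (K * Z * (2 * (eps * M)) ^+ 3).
  by rewrite /K /Z; field; rewrite gt_eqF.
rewrite Rintegral_mkcond; apply: I_le0.
apply: (@le_trans _ _ (\int[mu4]_(q in cylinder T) (Bp%:E * \int[leb3]_xi g q xi))%E).
  rewrite [leRHS]integral_mkcond; apply: int_mono => q; first by rewrite lee_fin.
  rewrite !patchE; case: ifP; last by rewrite normr0.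
  rewrite inE => hq; rewrite normrM mulrC EFinM.
  apply: lee_pmul; rewrite ?lee_fin//; first exact: hpsi.
  apply: le_trans (I_abs _ _) _; rewrite -ge0_leb3E//.
  apply: int_mono => xi; first by rewrite lee_fin.
  rewrite lee_fin normrM /g /cubd mulrA.
  have h0 : 0 <= increment u xi q ^+ 2 + increment v xi q ^+ 2 by rewrite addr_ge0// sqr_ge0.
  apply: ler_pM => //; last by rewrite ger0_norm.
  by apply: grad_bound; [exact: (hD Ax1)|exact: (hD Ax2)|exact: (hD Ax3)].
rewrite ge0_cylinderE; last 2 first.
- exact: emeasurable_funM.
- by move=> q; rewrite mule_ge0 ?lee_fin// integral_ge0.
rewrite ge0_integralZl//; last by move=> q _; rewrite integral_ge0.
rewrite EFinM; apply: lee_wpmul2l; first by rewrite lee_fin.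
rewrite tonelli_swap//.
apply: (@le_trans _ _ (\int[leb3]_xi ((K * Z)%:E * (\1_(box (eps * M)) xi)%:E))%E).
  apply: int_mono => xi; first exact: integral_ge0.
  rewrite /g indicE; case: (boolP (xi \in _)) => hx; last first.
    by rewrite mule0 (eq_integral (fun=> 0%E)) ?integral0// => q _; rewrite mulr0 mul0r.
  rewrite mule1 EFinM.
  have -> : (\int[m4 T]_q (K * 1%:R * cubd xi q)%:E = K%:E * \int[m4 T]_q (cubd xi q)%:E)%E.
    rewrite -ge0_integralZl//.
    - by apply: eq_integral => q _; rewrite mulr1 EFinM.
    - by apply/measurable_EFinP; exact: (m_cub_int fl xi).
    - by move=> q _; rewrite lee_fin cubd_ge0.
  apply: lee_wpmul2l; first by rewrite lee_fin.
  by rewrite int_cubd; apply: hc => //; apply: small_box; rewrite inE in hx.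
rewrite ge0_integralZl//; last 2 first.
- exact/measurable_EFinP.
- by rewrite lee_fin mulr_ge0.
have -> : (\int[leb3]_xi (\1_(box (eps * M)) xi)%:E = leb3 (box (eps * M)))%E.
  by rewrite integral_indic// setIT.
by rewrite leb3_box// -EFinM.
Qed.

Lemma defect_zero phi : 0 < T -> mollifier phi -> is_defect T phi u v w (fun=> 0).
Proof.
move=> T0 hm psi [spsi _ _].
have [M [B [M0 B0 hD]]] := mollifier_grad hm.
have cpsi : continuous psi by have [h _] := spsi [::].
have [Bp Bp0 hpsi] : exists2 Bp : R, 0 <= Bp & forall q, cylinder T q -> `|psi q| <= Bp.
  have cK : compact (@cube R `*` `[0, T]).
    by apply: compact_setX; [apply: compact_setX; [apply: compact_setX|]|]; exact: segment_compact.
  have K0 : @cube R `*` `[0, T] !=set0.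
    by exists (0, 0, 0, 0); do ![split] => //=; rewrite in_itv /= lexx ?ler01// ltW.
  have [Bp Bp0 h] := continuous_bounded K0 cK cpsi; exists Bp => // q [hq ht].
  by apply: h; split=> //; move: ht; rewrite /= !in_itv/= => /andP[/ltW -> /ltW ->].
apply/cvgrPdist_le => e e0.
pose Q := Bp * B * 24 * M ^+ 4 + 1.
have Q0 : 0 < Q by have M0' := ltW M0; rewrite ltr_wpDl// !mulr_ge0.
have k0 : 0 < e / (2 * Q) by rewrite divr_gt0// mulr_gt0.
have [C C0 hC] := cub_le fl k0.
pose S := C * (3 * M) ^+ 2 + 1.
have S0 : 0 < S by rewrite ltr_wpDl// mulr_ge0// sqr_ge0.
have h0 : 0 < e / (2 * Q * S) by rewrite divr_gt0// !mulr_gt0.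
near=> eps.
have e1 : 0 < eps by near: eps; exact: nbhs_right_gt.
have e2 : eps <= 1 by near: eps; exact: nbhs_right_le.
have e3 : eps <= e / (2 * Q * S) by near: eps; exact: nbhs_right_le.
rewrite sub0r normrN.
apply: le_trans (defect_bound M0 B0 Bp0 e1 (ltW k0) C0 (hD _ e1) hpsi hC) _.
have c0 : 0 <= C * (3 * (eps * M)) ^+ 2 by rewrite mulr_ge0// sqr_ge0.
apply: (@le_trans _ _ (Q * (e / (2 * Q) + C * (3 * (eps * M)) ^+ 2))).
  by rewrite ler_wpM2r ?addr_ge0// ?(ltW k0)// /Q lerDl.
have h1 : C * (3 * (eps * M)) ^+ 2 <= eps * S.
  have -> : C * (3 * (eps * M)) ^+ 2 = eps * (eps * (C * (3 * M) ^+ 2)) by ring.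
  rewrite ler_wpM2l ?(ltW e1)//.
  have c1 : 0 <= C * (3 * M) ^+ 2 by rewrite mulr_ge0// sqr_ge0.
  apply: (@le_trans _ _ (1 * (C * (3 * M) ^+ 2))); first by rewrite ler_wpM2r.
  by rewrite mul1r lerDl.
have h2 : eps * S <= e / (2 * Q).
  apply: (@le_trans _ _ (e / (2 * Q * S) * S)); first by rewrite ler_wpM2r// ltW.
  by rewrite le_eqVlt; apply/orP; left; apply/eqP; field; rewrite !gt_eqF.
apply: (@le_trans _ _ (Q * (e / (2 * Q) + e / (2 * Q)))).
  by rewrite ler_wpM2l ?(ltW Q0)// lerD2l (le_trans h1).
by rewrite le_eqVlt; apply/orP; left; apply/eqP; field; rewrite gt_eqF.
Unshelve. all: by end_near. Qed.

End defect.

(** * Commutator identities *)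
Section tensor.
Context d d' (X : measurableType d) (Y : measurableType d') {R : realType}.
Variables (m : {sigma_finite_measure set X -> \bar R}) (m' : {sigma_finite_measure set Y -> \bar R}).

Lemma int_tensor (f : X -> R) (g : Y -> R) : ig m f -> ig m' g ->
  \int[pm m m']_z (f z.1 * g z.2) = (\int[m]_x f x) * \int[m']_y g y.
Proof.
move=> if_ ig_; rewrite fubini2; last exact: ig_tensor.
rewrite -IZ//; apply: I_eq => y /=; exact: IZr.
Qed.
End tensor.

Section pairing.
Context {R : realType}.
Local Notation X := (R * R * R)%type.
Local Notation mm := (pm (@m3 R) (@m3 R)).
Variable n : nat.
Implicit Types (a : axis) (A B f U : X -> R).

Let mid d (Z : measurableType d) : measurable_fun setT (fun z : Z => z) := @measurable_id d Z setT.

Let mdif : measurable_fun setT (fun z : X * X => z.2 - z.1).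
Proof. by apply: madd; [exact: msnd|apply: mopp; exact: mfst]. Qed.

Lemma bd_dker3 a : bd (@dker3 R n a).
Proof.
pose H (x : X) := \sum_(J : idx n) eb J 0 * deb a J x.
have E : dker3 n a = H by apply/funext => x; rewrite /H sum_eb_deb subr0.
by rewrite E; apply: bd_sum => J; apply: bdM; [exact: bd_cst|exact: bd_deb].
Qed.

Lemma bd_ker3 : bd (@ker3 R n).
Proof.
pose H (x : X) := \sum_(J : idx n) eb J 0 * eb J x.
have E : ker3 n = H by apply/funext => x; rewrite /H sum_eb subr0.
by rewrite E; apply: bd_sum => J; apply: bdM; [exact: bd_cst|exact: bd_eb].
Qed.

(** The bilinear form whose kernel is a derivative of the localising kernel. Such a derivative is
    odd, so the form is skew ([skewC]) and kills constants ([skew_one]). *)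
Definition skew a A B : R := \int[mm]_z (A z.1 * B z.2 * dker3 n a (z.2 - z.1)).

Lemma ig_skew a A B : ig m3 A -> ig m3 B -> ig mm (fun z => A z.1 * B z.2 * dker3 n a (z.2 - z.1)).
Proof.
move=> iA iB; apply: (igM_bd (ig_tensor iA iB)); first by apply: (mcomp (m_dker3 n a)); exact: mdif.
exact: (bd_comp (fun z : X * X => z.2 - z.1) (bd_dker3 a)).
Qed.

Definition dcoef a A (J : idx n) : R := \int[m3]_x (A x * deb a J x).

Lemma skewE a A B : ig m3 A -> ig m3 B -> skew a A B = \sum_(J : idx n) coef A J * dcoef a B J.
Proof.
move=> iA iB.
have iAJ (J : idx n) : ig m3 (fun x => A x * eb J x) by exact: ig_eb.
have iBJ (J : idx n) : ig m3 (fun x => B x * deb a J x) by exact: ig_deb.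
transitivity (\int[mm]_z \sum_(J : idx n) (A z.1 * eb J z.1) * (B z.2 * deb a J z.2)).
  apply: I_eq => z; rewrite -sum_eb_deb mulr_sumr; apply: eq_bigr => J _; ring.
rewrite I_sum => [|J]; last exact: (ig_tensor (iAJ J) (iBJ J)).
by apply: eq_bigr => J _; rewrite -(int_tensor (iAJ J) (iBJ J)).
Qed.

Lemma skewC a A B : ig m3 A -> ig m3 B -> skew a A B = - skew a B A.
Proof.
move=> iA iB.
have iAJ (J : idx n) : ig m3 (fun x => A x * deb a J x) by exact: ig_deb.
have iBJ (J : idx n) : ig m3 (fun x => B x * eb J x) by exact: ig_eb.
have iJ (J : idx n) := ig_tensor (iAJ J) (iBJ J).
rewrite (skewE a iB iA).
transitivity (\int[mm]_z - \sum_(J : idx n) (A z.1 * deb a J z.1) * (B z.2 * eb J z.2)).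
  apply: I_eq => z; have := @sum_deb_eb R n a z.1 z.2 => /(congr1 -%R); rewrite opprK => <-.
  rewrite mulrN mulr_sumr; congr (- _); apply: eq_bigr => J _; ring.
transitivity (- \int[mm]_z \sum_(J : idx n) (A z.1 * deb a J z.1) * (B z.2 * eb J z.2)).
  by rewrite -mulN1r -IZ; [apply: I_eq => z; rewrite mulN1r|exact: ig_sum].
rewrite I_sum//; congr (- _); apply: eq_bigr => J _.
by rewrite (int_tensor (iAJ J) (iBJ J)) mulrC.
Qed.

Lemma ig_one : ig m3 ((fun=> 1) : X -> R).
Proof. by apply: ig_bd; [exact: m3_setT|exact: measurable_cst|exact: bd_cst]. Qed.

Lemma skew_one a A : ig m3 A -> skew a A (fun=> 1) = 0.
Proof.
move=> iA; rewrite skewE//; last exact: ig_one.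
rewrite big1// => J _; rewrite /dcoef (_ : \int[m3]_x (1 * deb a J x) = 0) ?mulr0//.
by rewrite -[RHS](int_deb a J); apply: I_eq => x; rewrite mul1r.
Qed.

(** The cubic product is expanded into six terms. Two of them depend on one point only and are
    killed by [skew_one]; the others pair up by skewness. *)
Lemma ig_cubic a f U : ig m3 f -> ig m3 U -> ig m3 (fun x => f x ^+ 2) ->
  ig m3 (fun x => U x * f x) -> ig m3 (fun x => U x * f x ^+ 2) ->
  ig mm (fun z => (U z.2 - U z.1) * (f z.2 - f z.1) ^+ 2 * dker3 n a (z.2 - z.1)) /\
  \int[mm]_z ((U z.2 - U z.1) * (f z.2 - f z.1) ^+ 2 * dker3 n a (z.2 - z.1)) =
    2 * skew a (fun x => f x ^+ 2) U - 4 * skew a f (fun x => U x * f x).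
Proof.
move=> if_ iU iff iUf iUff; have i1 := ig_one.
pose K A B (z : X * X) := A z.1 * B z.2 * dker3 n a (z.2 - z.1).
have E z : (U z.2 - U z.1) * (f z.2 - f z.1) ^+ 2 * dker3 n a (z.2 - z.1) =
  K (fun=> 1) (fun x => U x * f x ^+ 2) z - K (fun x => U x * f x ^+ 2) (fun=> 1) z
  + (K (fun x => f x ^+ 2) U z - K U (fun x => f x ^+ 2) z)
  + 2 * (K (fun x => U x * f x) f z - K f (fun x => U x * f x) z) by rewrite /K; ring.
have k1 := ig_skew a i1 iUff; have k2 := ig_skew a iUff i1.
have k3 := ig_skew a iff iU; have k4 := ig_skew a iU iff.
have k5 := ig_skew a iUf if_; have k6 := ig_skew a if_ iUf.
have j1 := igB k1 k2; have j2 := igB k3 k4; have j3 := igB k5 k6.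
have j4 := igD j1 j2; have j5 := igZ 2 j3.
rewrite (funext E); split; first exact: igD j4 j5.
transitivity (skew a (fun=> 1) (fun x => U x * f x ^+ 2) - skew a (fun x => U x * f x ^+ 2) (fun=> 1)
  + (skew a (fun x => f x ^+ 2) U - skew a U (fun x => f x ^+ 2))
  + 2 * (skew a (fun x => U x * f x) f - skew a f (fun x => U x * f x))).
  by rewrite (ID j4 j5) (ID j1 j2) (IZ 2 j3) (IB k1 k2) (IB k3 k4) (IB k5 k6).
rewrite (skewC a i1 iUff) !skew_one// (skewC a iU iff) (skewC a iUf if_); ring.
Qed.

Definition sym A B : R := \int[mm]_z (A z.1 * B z.2 * ker3 n (z.2 - z.1)).

Lemma ig_sym A B : ig m3 A -> ig m3 B -> ig mm (fun z => A z.1 * B z.2 * ker3 n (z.2 - z.1)).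
Proof.
move=> iA iB; apply: (igM_bd (ig_tensor iA iB)); first by apply: (mcomp (m_ker3 n)); exact: mdif.
exact: (bd_comp (fun z : X * X => z.2 - z.1) bd_ker3).
Qed.

Lemma symE A B : ig m3 A -> ig m3 B -> sym A B = \sum_(J : idx n) coef A J * coef B J.
Proof.
move=> iA iB.
have iAJ (J : idx n) : ig m3 (fun x => A x * eb J x) by exact: ig_eb.
have iBJ (J : idx n) : ig m3 (fun x => B x * eb J x) by exact: ig_eb.
transitivity (\int[mm]_z \sum_(J : idx n) (A z.1 * eb J z.1) * (B z.2 * eb J z.2)).
  apply: I_eq => z; rewrite -sum_eb mulr_sumr; apply: eq_bigr => J _; ring.
rewrite I_sum => [|J]; last exact: (ig_tensor (iAJ J) (iBJ J)).
by apply: eq_bigr => J _; rewrite -(int_tensor (iAJ J) (iBJ J)).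
Qed.

Lemma sym_one A : ig m3 A -> sym (fun=> 1) A = \int[m3]_x A x.
Proof.
move=> iA; have i1 := ig_one; rewrite /sym (fubini2 (ig_sym i1 iA)).
apply: I_eq => y /=.
have mk : measurable_fun setT (fun x : X => ker3 n (y - x)).
  by apply: (mcomp (m_ker3 n)); apply: madd; [exact: measurable_cst|exact: mopp].
have ik : ig m3 (fun x : X => ker3 n (y - x)).
  by apply: ig_bd => //; [exact: m3_setT|exact: (bd_comp (fun x : X => y - x) bd_ker3)].
have -> : \int[m3]_x (1 * A y * ker3 n (y - x)) = A y * \int[m3]_x ker3 n (y - x).
  by rewrite -IZ//; apply: I_eq => x; rewrite mul1r.
suff -> : \int[m3]_x ker3 n (y - x) = 1 by rewrite mulr1.
have kP := @ker32P R; apply: EFin_inj; rewrite IE// -(k_int kP n y).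
by apply: eq_integral => x _; rewrite (k_sym kP).
Qed.

(** The coefficients of [f] lose only what the kernel-weighted increments see. *)
Lemma coef_sq f : ig m3 f -> ig m3 (fun x => f x ^+ 2) ->
  ig mm (fun z => (f z.2 - f z.1) ^+ 2 * ker3 n (z.2 - z.1)) /\
  \int[mm]_z ((f z.2 - f z.1) ^+ 2 * ker3 n (z.2 - z.1)) =
    2 * (\int[m3]_x (f x ^+ 2) - \sum_(J : idx n) coef f J ^+ 2).
Proof.
move=> if_ iff; have i1 := ig_one.
pose K A B (z : X * X) := A z.1 * B z.2 * ker3 n (z.2 - z.1).
have E z : (f z.2 - f z.1) ^+ 2 * ker3 n (z.2 - z.1) =
  K (fun=> 1) (fun x => f x ^+ 2) z + K (fun x => f x ^+ 2) (fun=> 1) z - 2 * K f f z by rewrite /K; ring.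
have k1 := ig_sym i1 iff; have k2 := ig_sym iff i1; have k3 := igZ 2 (ig_sym if_ if_).
rewrite (funext E); split; first exact: igB (igD k1 k2) k3.
transitivity (sym (fun=> 1) (fun x => f x ^+ 2) + sym (fun x => f x ^+ 2) (fun=> 1) - 2 * sym f f).
  by rewrite (IB (igD k1 k2) k3) (ID k1 k2) (IZ 2 (ig_sym if_ if_)).
have symC A B : ig m3 A -> ig m3 B -> sym A B = sym B A.
  by move=> iA iB; rewrite !symE//; apply: eq_bigr => J _; rewrite mulrC.
rewrite (symC _ _ iff i1) sym_one// symE//.
have -> : \sum_(J : idx n) coef f J ^+ 2 = \sum_(J : idx n) coef f J * coef f J.
  by apply: eq_bigr => J _; rewrite expr2.
ring.
Qed.

End pairing.

(** * The energy balance of the coefficients *)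
Section kernel_weights.
Context {R : realType}.
Local Notation X := (R * R * R)%type.
Local Notation mm := (pm (@m3 R) (@m3 R)).
Local Notation sn x := (sin (pi * x)).
Implicit Types (x y xi : X) (n : nat) (f : X -> R).

(** For fixed [x] the inner variable is translated by [x], and the integrals are exchanged. *)
Lemma int_increments (h : X -> R) (c : X * X -> R) : measurable_fun setT h -> (forall x, 0 <= h x) ->
  torus_periodic h -> measurable_fun setT c -> (forall z, 0 <= c z) ->
  (forall x, torus_periodic (fun y => c (x, y))) ->
  (\int[mm]_z (h (z.2 - z.1) * c z)%:E = \int[m3]_xi ((h xi)%:E * \int[m3]_x (c (x, (x + xi)%R))%:E))%E.
Proof.
move=> mh h0 ph mc c0 pc.
have mid : measurable_fun setT (fun z : X * X => z) by exact: measurable_id.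
have mD : measurable_fun setT (fun z : X * X => z.2 - z.1).
  by apply: madd; [exact: msnd|apply: mopp; exact: mfst].
have mS : measurable_fun setT (fun z : X * X => (z.1, z.1 + z.2)).
  by apply: mprod; [exact: mfst|apply: madd; [exact: mfst|exact: msnd]].
have mF : measurable_fun setT (fun z : X * X => (h (z.2 - z.1) * c z)%:E).
  by apply/measurable_EFinP; apply: measurable_funM => //; exact: (mcomp mh mD).
rewrite (tonelli1 m3 m3 mF) => [|z]; last by rewrite lee_fin mulr_ge0.
have E x : (\int[m3]_y (h (y - x) * c (x, y))%:E = \int[m3]_xi (h xi * c (x, (x + xi)%R))%:E)%E.
  rewrite -(@ge0_m3_translate R (fun y => (h (y - x) * c (x, y))%:E) x).
  - by apply: eq_integral => xi _; rewrite addrK [x + xi]addrC.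
  - exact: (measurable_fun_pair2 x mF).
  - by move=> y; rewrite lee_fin mulr_ge0.
  - move=> y; have [p1 p2 p3] := pc x y; have [q1 q2 q3] := ph (y - x).
    by split; rewrite addrAC ?p1 ?p2 ?p3 ?q1 ?q2 ?q3.
under eq_integral => x _ do rewrite /= E.
have mG : measurable_fun setT (fun z : X * X => (h z.2 * c (z.1, z.1 + z.2))%:E : \bar R).
  apply/measurable_EFinP; apply: measurable_funM; first exact: (mcomp mh (msnd mid)).
  exact: (mcomp mc mS).
rewrite (tonelli_swap m3 m3 (f := fun x xi => (h xi * c (x, x + xi))%:E)) => //; last first.
  by move=> x xi; rewrite lee_fin mulr_ge0.
apply: eq_integral => xi _; rewrite -ge0_integralZl//.
- have mS1 : measurable_fun setT (fun x : X => (x, x + xi)).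
    by apply: mprod => //; apply: madd => //; exact: measurable_cst.
  by apply/measurable_EFinP; exact: (mcomp mc mS1).
- by move=> x _; rewrite lee_fin.
- by rewrite lee_fin.
Qed.

(** A distance to the lattice of integer points. *)
Definition sr xi : R := `|sn xi.1.1| + `|sn xi.1.2| + `|sn xi.2|.

Lemma sr_ge0 xi : 0 <= sr xi. Proof. by rewrite !addr_ge0. Qed.

Let msn : measurable_fun setT (fun r : R => sn r).
Proof. by apply: cont_meas; exact: (drv_cont drv_sn). Qed.

Lemma m_sr : measurable_fun setT sr.
Proof.
have h (g : X -> R) : measurable_fun setT g -> measurable_fun setT (fun x => `|sn (g x)|).
  by move=> mg; apply: measurableT_comp => //; exact: (mcomp msn mg).
by apply: measurable_funD; [apply: measurable_funD|]; apply: h;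
  [apply: mfst; exact: mfst|apply: msnd; exact: mfst|exact: msnd].
Qed.

Lemma sr_periodic : torus_periodic sr.
Proof. by move=> x; split; rewrite /sr /= ?addr0 sn1 normrN. Qed.

Lemma int_prod3 (f g h : R -> R) (a b c : R) : measurable_fun setT f -> measurable_fun setT g ->
  measurable_fun setT h -> (forall r, 0 <= f r) -> (forall r, 0 <= g r) -> (forall r, 0 <= h r) ->
  (\int[nu]_r (f r)%:E = a%:E)%E -> (\int[nu]_r (g r)%:E = b%:E)%E -> (\int[nu]_r (h r)%:E = c%:E)%E ->
  (\int[m3]_x (f x.1.1 * g x.1.2 * h x.2)%:E = (a * b * c)%:E)%E.
Proof.
move=> mf mg mh f0 g0 h0 fa gb hc.
rewrite ge0_m3E; last 2 first.
- apply/measurable_EFinP; apply: measurable_funM; last by apply: (mcomp mh); exact: msnd.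
  by apply: measurable_funM; [apply: (mcomp mf); apply: mfst; exact: mfst|apply: (mcomp mg); apply: msnd; exact: mfst].
- by move=> x; rewrite lee_fin !mulr_ge0.
have c0 : 0 <= c by rewrite -lee_fin -hc integral_ge0// => r _; rewrite lee_fin.
have b0 : 0 <= b by rewrite -lee_fin -gb integral_ge0// => r _; rewrite lee_fin.
have E1 r1 r2 : (\int[nu]_r3 (f r1 * g r2 * h r3)%:E = (f r1 * c * g r2)%:E)%E.
  have -> : f r1 * c * g r2 = f r1 * g r2 * c by ring.
  rewrite [RHS]EFinM -hc -ge0_integralZl//; [exact/measurable_EFinP|by move=> x _; rewrite lee_fin|by rewrite lee_fin mulr_ge0].
have E2 r1 : (\int[nu]_r2 \int[nu]_r3 (f r1 * g r2 * h r3)%:E = (c * b * f r1)%:E)%E.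
  under eq_integral => r2 _ do rewrite E1.
  have -> : c * b * f r1 = f r1 * c * b by ring.
  rewrite [RHS]EFinM -gb -ge0_integralZl//; [exact/measurable_EFinP|by move=> x _; rewrite lee_fin|by rewrite lee_fin mulr_ge0].
under eq_integral => r1 _ do rewrite E2.
have -> : a * b * c = c * b * a by ring.
rewrite [RHS]EFinM -fa -ge0_integralZl//; [exact/measurable_EFinP|by move=> x _; rewrite lee_fin|by rewrite lee_fin mulr_ge0].
Qed.

(** The two other factors of the kernel have integral 1. *)
Lemma int_ker3_co n (F : R -> R) (c : R) (a : axis) : measurable_fun setT F -> (forall r, 0 <= F r) ->
  (\int[nu]_r (ker n r * F r)%:E = c%:E)%E -> (\int[m3]_x (ker3 n x * F (co a x))%:E = c%:E)%E.
Proof.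
move=> mF F0 Fc; have mk := @mker R n; have k0 := @ker_ge0 R n; have k1 := @int_ker R n.
have mkF : measurable_fun setT (fun r => ker n r * F r) by exact: measurable_funM.
have kF0 r : 0 <= ker n r * F r by exact: mulr_ge0.
case: a.
- have := int_prod3 mkF mk mk kF0 k0 k0 Fc k1 k1; rewrite !mulr1 => <-.
  by apply: eq_integral => x _; rewrite /ker3 /=; congr EFin; ring.
- have := int_prod3 mk mkF mk k0 kF0 k0 k1 Fc k1; rewrite mulr1 mul1r => <-.
  by apply: eq_integral => x _; rewrite /ker3 /=; congr EFin; ring.
- have := int_prod3 mk mk mkF k0 k0 kF0 k1 k1 Fc; rewrite !mul1r => <-.
  by apply: eq_integral => x _; rewrite /ker3 /=; congr EFin; ring.
Qed.

Lemma int_ker3_sum n (c d : R) (k : nat) : ~~ odd k ->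
  (\int[nu]_r (ker n r * sn r ^+ k)%:E = d%:E)%E -> 0 <= c ->
  (forall xi, sr xi ^+ k <= c * (sn (co Ax1 xi) ^+ k + sn (co Ax2 xi) ^+ k + sn (co Ax3 xi) ^+ k)) ->
  (\int[m3]_xi (ker3 n xi * sr xi ^+ k)%:E <= (c * (3 * d))%:E)%E.
Proof.
move=> ek hd c0 hc.
have e0 (r : R) : 0 <= sn r ^+ k by exact: exprn_even_ge0.
have mF : measurable_fun setT (fun r : R => sn r ^+ k) by apply: measurable_funX; exact: msn.
have h a := int_ker3_co a mF e0 hd.
have mco a : measurable_fun setT (fun xi : X => (ker3 n xi * sn (co a xi) ^+ k)%:E : \bar R).
  apply/measurable_EFinP; apply: measurable_funM; first exact: m_ker3.
  by apply: (mcomp mF); case: a; [apply: mfst; exact: mfst|apply: msnd; exact: mfst|exact: msnd].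
have p0 a xi : (0 <= (ker3 n xi * sn (co a xi) ^+ k)%:E :> \bar R)%E by rewrite lee_fin mulr_ge0// ker3_ge0.
apply: (@le_trans _ _ (\int[m3]_xi (c%:E * ((ker3 n xi * sn (co Ax1 xi) ^+ k)%:E + (ker3 n xi * sn (co Ax2 xi) ^+ k)%:E + (ker3 n xi * sn (co Ax3 xi) ^+ k)%:E)))%E).
  apply: int_mono => xi; first by rewrite lee_fin mulr_ge0 ?ker3_ge0// exprn_ge0// sr_ge0.
  rewrite -!EFinD -EFinM lee_fin -!mulrDr mulrCA; apply: ler_wpM2l; [exact: ker3_ge0|exact: hc].
rewrite ge0_integralZl//; last 2 first.
- by apply: emeasurable_funD => //; exact: emeasurable_funD.
- by move=> x _; rewrite !adde_ge0.
rewrite ge0_integralD//; last 2 first.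
- by move=> x _; rewrite adde_ge0.
- exact: emeasurable_funD.
rewrite ge0_integralD// !h -!EFinD -EFinM lee_fin.
by rewrite le_eqVlt; apply/orP; left; apply/eqP; ring.
Qed.

Lemma int_ker3_sr2 n : (\int[m3]_xi (ker3 n xi * sr xi ^+ 2)%:E <= (9 / (2 * n%:R + 2))%:E :> \bar R)%E.
Proof.
have := @int_ker3_sum n 3 _ 2 isT (int_ker_sn2 n) (ler0n _ 3); rewrite mulrA -natrM.
apply=> xi; rewrite /sr /=.
have n2 (r : R) : r ^+ 2 = `|r| ^+ 2 by rewrite real_normK ?num_real.
rewrite (n2 (sn xi.1.1)) (n2 (sn xi.1.2)) (n2 (sn xi.2)).
move: `|sn xi.1.1| `|sn xi.1.2| `|sn xi.2| => a b c.
by have := sqr_ge0 (a - b); have := sqr_ge0 (a - c); have := sqr_ge0 (b - c); nra.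
Qed.

Lemma int_ker3_sr4 n :
  (\int[m3]_xi (ker3 n xi * sr xi ^+ 4)%:E <= (243 / ((2 * n%:R + 2) * (2 * n%:R + 4)))%:E :> \bar R)%E.
Proof.
have := @int_ker3_sum n 27 _ 4 isT (int_ker_sn4 n) (ler0n _ 27).
rewrite !mulrA -!natrM; apply=> xi; rewrite /sr /=.
have n4 (r : R) : r ^+ 4 = (`|r| ^+ 2) ^+ 2 by rewrite -exprM -normrX ger0_norm// exprn_even_ge0.
rewrite (n4 (sn xi.1.1)) (n4 (sn xi.1.2)) (n4 (sn xi.2)).
move: `|sn xi.1.1| `|sn xi.1.2| `|sn xi.2| => a b c.
have sq (x y z : R) : (x + y + z) ^+ 2 <= 3 * (x ^+ 2 + y ^+ 2 + z ^+ 2).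
  by have := sqr_ge0 (x - y); have := sqr_ge0 (x - z); have := sqr_ge0 (y - z); nra.
have -> : (a + b + c) ^+ 4 = ((a + b + c) ^+ 2) ^+ 2 by rewrite -exprM.
have h1 := sq a b c; have h2 := sq (a ^+ 2) (b ^+ 2) (c ^+ 2).
apply: (@le_trans _ _ ((3 * (a ^+ 2 + b ^+ 2 + c ^+ 2)) ^+ 2)).
  by rewrite lerXn2r// nnegrE ?sqr_ge0// mulr_ge0// !addr_ge0// sqr_ge0.
by rewrite exprMn; lra.
Qed.

End kernel_weights.

Section loss.
Context {R : realType}.
Local Notation X := (R * R * R)%type.
Local Notation mm := (pm (@m3 R) (@m3 R)).
Local Notation sn x := (sin (pi * x)).
Implicit Types (x y xi : X) (n : nat) (f : X -> R).
Let p0 := @pp0 R.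

Lemma nm_dif_sr f (A : R) xi : stat f A -> (nm m3 pp (dif xi f) <= (sr xi * A)%:E)%E.
Proof.
move=> sf; have -> : sr xi = `|sn (co Ax1 xi)| + `|sn (co Ax2 xi)| + `|sn (co Ax3 xi)| by [].
by apply: (nm_dif_axes sf (c := fun a => `|sn (co a xi)|)) => a; exact: (nm_dif_sn sf).
Qed.

Lemma stat_sq f (A : R) : stat f A -> ig m3 (fun x => f x ^+ 2).
Proof.
move=> [mf _ fA _]; apply/igP; split; first exact: measurable_funX.
apply: le_lt_trans (ltry (A * A)); apply: le_trans (int_mul_le mf mf fA fA).
by apply: int_mono => x; rewrite ?lee_fin// expr2.
Qed.

Let mD : measurable_fun setT (fun z : X * X => z.2 - z.1).
Proof. by apply: madd; [exact: msnd|apply: mopp; exact: mfst]. Qed.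

(** By [coef_sq] the loss is an average of squared increments, of order the second moment of the
    kernel. *)
Lemma coef_loss n f (A : R) : stat f A ->
  `|\int[m3]_x (f x ^+ 2) - \sum_(J : idx n) coef f J ^+ 2| <= 9 * A ^+ 2 / (2 * n%:R + 2).
Proof.
move=> sf; have [mf pf fA _] := sf; have [_ E] := coef_sq n (stat_ig sf) (stat_sq sf).
have A0 := stat_ge0 sf.
apply: (@le_trans _ _ `|2 * (\int[m3]_x (f x ^+ 2) - \sum_(J : idx n) coef f J ^+ 2)|).
  by rewrite normrM [`|2|]ger0_norm// ler_peMl// ler1n.
rewrite -E; apply: I_le0.
have mc : measurable_fun setT (fun z : X * X => (f z.2 - f z.1) ^+ 2).
  by apply: measurable_funX; apply: measurable_funB; apply: (mcomp mf); [exact: msnd|exact: mfst].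
have k0 := @ker3_ge0 R n.
have -> : (\int[mm]_z `|(f z.2 - f z.1) ^+ 2 * ker3 n (z.2 - z.1)|%:E =
   \int[mm]_z (ker3 n (z.2 - z.1) * (f z.2 - f z.1) ^+ 2)%:E)%E.
  by apply: eq_integral => z _; rewrite mulrC ger0_norm// mulr_ge0// sqr_ge0.
rewrite (int_increments (c := fun z => (f z.2 - f z.1) ^+ 2))//.
- apply: (@le_trans _ _ (\int[m3]_xi ((A ^+ 2)%:E * (ker3 n xi * sr xi ^+ 2)%:E))%E).
    apply: int_mono => xi.
      by rewrite mule_ge0 ?lee_fin// integral_ge0// => x _; rewrite lee_fin sqr_ge0.
    have E2 : A ^+ 2 * (ker3 n xi * sr xi ^+ 2) = ker3 n xi * (sr xi * A * (sr xi * A)) by ring.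
    rewrite -EFinM E2 [leRHS]EFinM; apply: lee_wpmul2l; first by rewrite lee_fin.
    have md := m_dif xi mf; have nd := nm_dif_sr xi sf.
    apply: le_trans (int_mul_le md md nd nd).
    apply: int_mono => x; first by rewrite lee_fin sqr_ge0.
    by rewrite lee_fin -expr2; exact: ler_norm.
  rewrite ge0_integralZl//.
  + rewrite [9 * _]mulrC -mulrA [leRHS]EFinM; apply: lee_wpmul2l; first by rewrite lee_fin sqr_ge0.
    exact: int_ker3_sr2.
  + apply/measurable_EFinP; apply: measurable_funM; first exact: m_ker3.
    by apply: measurable_funX; exact: m_sr.
  + by move=> x _; rewrite lee_fin mulr_ge0// sqr_ge0.
  + by rewrite lee_fin sqr_ge0.
- exact: m_ker3.
- exact: ker3_periodic.
- by move=> z; exact: sqr_ge0.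
- by move=> x y; have [h1 h2 h3] := pf y; rewrite /= h1 h2 h3.
Qed.

End loss.

Lemma balance_algebra (R : realFieldType) (s0 s1 s2 s3 s4 s5 s6 s7 s8 s9 s10 s11 s12 s13 Om s : R) :
  s0 + s1 + s2 = 0 -> s3 + s4 + s5 = 0 -> s6 + s7 = 0 ->
  4 * (s8 + s9 + s10 + Om * s + s6 + (s11 + s12 + s13 + - Om * s + s7)) =
  - (2 * s0 - 4 * s8 + (2 * s1 - 4 * s9) + (2 * s2 - 4 * s10) +
     (2 * s3 - 4 * s11 + (2 * s4 - 4 * s12) + (2 * s5 - 4 * s13))).
Proof. lra. Qed.

Section rate.
Context {R : realType}.
Local Notation X := (R * R * R)%type.
Local Notation mm := (pm (@m3 R) (@m3 R)).
Local Notation sn x := (sin (pi * x)).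
Variables (u v w p : X -> R) (A Om : R) (n : nat).
Hypotheses (su : stat u A) (sv : stat v A).
Hypotheses (tw : torus w) (wA : (nm m3 pp w <= (2 * A)%:E)%E) (ip : ig m3 p).
Hypothesis hdiv : forall J : idx n,
  \int[m3]_x (u x * deb Ax1 J x + v x * deb Ax2 J x + w x * deb Ax3 J x) = 0.
Hypothesis hp : forall J : idx n, \int[m3]_x (p x * deb Ax3 J x) = 0.
Let p0 := @pp0 R.

Definition rhs (f g : X -> R) (c : R) (ax : axis) (J : idx n) : R := \int[m3]_x
  (f x * (u x * deb Ax1 J x + v x * deb Ax2 J x + w x * deb Ax3 J x) + c * g x * eb J x + p x * deb ax J x).

Let A0 := stat_ge0 su.
Let mw : measurable_fun setT w := tw.1.
Let iu := stat_ig su.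
Let iv := stat_ig sv.
Let iw : ig m3 w.
Proof. by apply: (ig_nm (@pp1 R)) => //; apply: le_lt_trans wA _; rewrite ltry. Qed.

Let ig2 (f U : X -> R) (a b : R) : measurable_fun setT f -> measurable_fun setT U ->
  (nm m3 pp U <= a%:E)%E -> (nm m3 pp f <= b%:E)%E -> ig m3 (fun x => U x * f x).
Proof.
move=> mf mU fa Ub; apply/igP; split; first exact: measurable_funM.
exact: le_lt_trans (int_mul_le mU mf fa Ub) (ltry _).
Qed.

Let ig3 (f U : X -> R) (a : R) : stat f A -> measurable_fun setT U ->
  (nm m3 pp U <= a%:E)%E -> ig m3 (fun x => U x * f x ^+ 2).
Proof.
move=> sf mU Ua; have [mf _ fA _] := sf.
have hh : pp^-1 + pp^-1 + 9^-1 = 1 :> R by rewrite /pp; field.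
have n9 : 0 < 9 :> R by [].
have h3 := hoelder3 m3 mU mf mf p0 p0 n9 hh.
apply/igP; split; first by apply: measurable_funM => //; exact: measurable_funX.
apply: (@le_lt_trans _ _ (a%:E * A%:E * (7 * A)%:E)%E); last by rewrite -!EFinM ltry.
apply: (@le_trans _ _ (nm m3 pp U * nm m3 pp f * nm m3 9 f)%E).
  by apply: le_trans h3; apply: int_mono => x; rewrite ?lee_fin// expr2 mulrA.
apply: lee_pmul; [by rewrite mule_ge0 ?nm_ge0|exact: nm_ge0| |exact: sobolev].
by apply: lee_pmul => //; exact: nm_ge0.
Qed.

Let mu := stat_meas su.
Let mv := stat_meas sv.
Let uA := stat_nm su.
Let vA := stat_nm sv.

Definition flux (z : X * X) : R := ((u z.2 - u z.1) * dker3 n Ax1 (z.2 - z.1) +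
   (v z.2 - v z.1) * dker3 n Ax2 (z.2 - z.1) + (w z.2 - w z.1) * dker3 n Ax3 (z.2 - z.1)) *
   ((u z.2 - u z.1) ^+ 2 + (v z.2 - v z.1) ^+ 2).

(** The divergence condition, tested with every basis function. *)
Lemma skew_div (B : X -> R) : ig m3 B -> skew n Ax1 B u + skew n Ax2 B v + skew n Ax3 B w = 0.
Proof.
move=> iB; rewrite !skewE// -!big_split/= big1// => J _.
have := hdiv J.
have i1 := ig_deb Ax1 J iu; have i2 := ig_deb Ax2 J iv; have i3 := ig_deb Ax3 J iw.
rewrite (ID (igD i1 i2) i3) (ID i1 i2) -/(dcoef _ _ _) -/(dcoef _ _ _) -/(dcoef _ _ _) => h.
by rewrite -!mulrDr h mulr0.
Qed.

Lemma rhs_sum (f g : X -> R) c ax : stat f A -> ig m3 g ->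
  \sum_(J : idx n) coef f J * rhs f g c ax J =
    skew n Ax1 f (fun x => u x * f x) + skew n Ax2 f (fun x => v x * f x) + skew n Ax3 f (fun x => w x * f x)
    + c * (\sum_(J : idx n) coef f J * coef g J) + skew n ax f p.
Proof.
move=> sf ig_; have [mf _ fA _] := sf; have if_ := stat_ig sf.
have j1 := ig2 mf mu uA fA; have j2 := ig2 mf mv vA fA; have j3 := ig2 mf mw wA fA.
rewrite !skewE// mulr_sumr -!big_split /=; apply: eq_bigr => J _.
have k1 := ig_deb Ax1 J j1; have k2 := ig_deb Ax2 J j2; have k3 := ig_deb Ax3 J j3.
have k4 := igZ c (ig_eb J ig_); have k5 := ig_deb ax J ip.
have -> : rhs f g c ax J = dcoef Ax1 (fun x => u x * f x) J + dcoef Ax2 (fun x => v x * f x) J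
    + dcoef Ax3 (fun x => w x * f x) J + c * coef g J + dcoef ax p J.
  rewrite /rhs /dcoef /coef -(IZ c (ig_eb J ig_)) -(ID k1 k2) -(ID (igD k1 k2) k3) -(ID (igD (igD k1 k2) k3) k4).
  rewrite -(ID (igD (igD (igD k1 k2) k3) k4) k5); apply: I_eq => x; ring.
ring.
Qed.

(** The pressure terms are [skew_div] tested with the pressure, up to the vertical one, which
    vanishes because the pressure does not depend on the height. In the expansion of the flux
    ([ig_cubic]) the terms with a squared component vanish by [skew_div] as well. *)
Lemma rate_identity :
  4 * \sum_(J : idx n) (coef u J * rhs u v Om Ax1 J + coef v J * rhs v u (- Om) Ax2 J) = - \int[mm]_z flux z.
Proof.
rewrite big_split /= !rhs_sum//.
have sp : skew n Ax1 u p + skew n Ax2 v p = 0.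
  have := skew_div ip; rewrite (skewC n Ax1 ip iu) (skewC n Ax2 ip iv) (skewC n Ax3 ip iw).
  rewrite (skewE n Ax3 iw ip) big1 => [|J _]; last by rewrite /dcoef hp mulr0.
  by move=> h; lra.
have sc : \sum_(J : idx n) coef v J * coef u J = \sum_(J : idx n) coef u J * coef v J.
  by apply: eq_bigr => J _; rewrite mulrC.
have iuu := stat_sq su; have ivv := stat_sq sv.
have [f1 e1] := ig_cubic n Ax1 iu iu iuu (ig2 mu mu uA uA) (ig3 su mu uA).
have [f2 e2] := ig_cubic n Ax2 iu iv iuu (ig2 mu mv vA uA) (ig3 su mv vA).
have [f3 e3] := ig_cubic n Ax3 iu iw iuu (ig2 mu mw wA uA) (ig3 su mw wA).
have [g1 d1] := ig_cubic n Ax1 iv iu ivv (ig2 mv mu uA vA) (ig3 sv mu uA).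
have [g2 d2] := ig_cubic n Ax2 iv iv ivv (ig2 mv mv vA vA) (ig3 sv mv vA).
have [g3 d3] := ig_cubic n Ax3 iv iw ivv (ig2 mv mw wA vA) (ig3 sv mw wA).
have du := skew_div iuu; have dv := skew_div ivv.
have a1 := igD f1 f2; have a2 := igD a1 f3; have b1 := igD g1 g2; have b2 := igD b1 g3.
have -> : \int[mm]_z flux z =
  (2 * skew n Ax1 (fun x => u x ^+ 2) u - 4 * skew n Ax1 u (fun x => u x * u x)
  + (2 * skew n Ax2 (fun x => u x ^+ 2) v - 4 * skew n Ax2 u (fun x => v x * u x))
  + (2 * skew n Ax3 (fun x => u x ^+ 2) w - 4 * skew n Ax3 u (fun x => w x * u x)))
  + (2 * skew n Ax1 (fun x => v x ^+ 2) u - 4 * skew n Ax1 v (fun x => u x * v x)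
  + (2 * skew n Ax2 (fun x => v x ^+ 2) v - 4 * skew n Ax2 v (fun x => v x * v x))
  + (2 * skew n Ax3 (fun x => v x ^+ 2) w - 4 * skew n Ax3 v (fun x => w x * v x))).
  rewrite -e1 -e2 -e3 -d1 -d2 -d3 -(ID f1 f2) -(ID a1 f3) -(ID g1 g2) -(ID b1 g3) -(ID a2 b2).
  by apply: I_eq => z; rewrite /flux; ring.
rewrite sc; exact: balance_algebra.
Qed.

End rate.

Section rate_bound.
Context {R : realType}.
Local Notation X := (R * R * R)%type.
Local Notation mm := (pm (@m3 R) (@m3 R)).
Implicit Types (u v w p : X -> R).

Definition cubint u v w (z : X * X) : R := (`|u z.2 - u z.1| + `|v z.2 - v z.1| + `|w z.2 - w z.1|) *
  ((u z.2 - u z.1) ^+ 2 + (v z.2 - v z.1) ^+ 2).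

Lemma cubint_ge0 u v w z : 0 <= cubint u v w z.
Proof. by rewrite mulr_ge0 ?addr_ge0// sqr_ge0. Qed.

Lemma flux_le u v w k z : `|flux u v w k.+1 z| <=
  32 * pi * k.+1%:R * (ker3 k (z.2 - z.1) * sr (z.2 - z.1)) * cubint u v w z.
Proof.
rewrite /flux /cubint normrM; set xi := z.2 - z.1; rewrite [leRHS]mulrA.
have q0 : 0 <= (u z.2 - u z.1) ^+ 2 + (v z.2 - v z.1) ^+ 2 by rewrite addr_ge0// sqr_ge0.
apply: ler_pM => //; last by rewrite ger0_norm.
have K a : `|dker3 k.+1 a xi| <= 32 * pi * k.+1%:R * (ker3 k xi * sr xi).
  apply: le_trans (dker3_le k a xi) _.
  have h0 : 0 <= 32 * pi * k.+1%:R :> R by rewrite !mulr_ge0// pi_ge0.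
  rewrite [leRHS]mulrA; apply: ler_wpM2l; first by rewrite mulr_ge0 ?ker3_ge0.
  rewrite /sr.
  case: a => /=; [by rewrite -addrA lerDl addr_ge0|by rewrite addrAC lerDr addr_ge0|by rewrite lerDr addr_ge0].
have := grad_bound (u z.2 - u z.1) (v z.2 - v z.1) (w z.2 - w z.1) (K Ax1) (K Ax2) (K Ax3).
by apply: le_trans; rewrite le_eqVlt; apply/orP; left; apply/eqP; congr (`|_|); ring.
Qed.

(** The kernel of index [k.+1] is used for the coefficients, so that [dker3_le] leaves the kernel of
    index [k]. *)
Lemma rate_le u v w p (A Om : R) (k : nat) : stat u A -> stat v A -> torus w ->
  (nm m3 pp w <= (2 * A)%:E)%E -> ig m3 p ->
  (forall J : idx k.+1, \int[m3]_x (u x * deb Ax1 J x + v x * deb Ax2 J x + w x * deb Ax3 J x) = 0) ->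
  (forall J : idx k.+1, \int[m3]_x (p x * deb Ax3 J x) = 0) ->
  (`|4 * \sum_(J : idx k.+1) (coef u J * rhs u v w p u v Om Ax1 J + coef v J * rhs u v w p v u (- Om) Ax2 J)|%:E
    <= \int[m3]_xi ((32 * pi * k.+1%:R * (ker3 k xi * sr xi))%:E * \int[m3]_x (cubint u v w (x, (x + xi)%R))%:E))%E.
Proof.
move=> su sv [mw pw] wA ip hd hp; have [mu pu _ _] := su; have [mv pv _ _] := sv.
rewrite (rate_identity Om su sv (conj mw pw) wA ip hd hp) normrN.
apply: le_trans (I_abs _ _) _.
have ma (f : X -> R) : measurable_fun setT f -> measurable_fun setT (fun z : X * X => f z.2 - f z.1).
  by move=> mf; apply: measurable_funB; apply: (mcomp mf); [exact: msnd|exact: mfst].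
have mc : measurable_fun setT (cubint u v w).
  apply: measurable_funM; last by apply: measurable_funD; apply: measurable_funX; exact: ma.
  by apply: measurable_funD; [apply: measurable_funD|]; apply: measurableT_comp => //; exact: ma.
have h0 : 0 <= 32 * pi * k.+1%:R :> R by rewrite !mulr_ge0// pi_ge0.
rewrite -(int_increments (h := fun xi => 32 * pi * k.+1%:R * (ker3 k xi * sr xi)) (c := cubint u v w))//.
- by apply: int_mono => z; rewrite lee_fin// flux_le.
- by apply: measurable_funM => //; apply: measurable_funM; [exact: m_ker3|exact: m_sr].
- by move=> x; exact: mulr_ge0 h0 (mulr_ge0 (ker3_ge0 k x) (sr_ge0 x)).
- by move=> x; have [a1 a2 a3] := ker3_periodic k x; have [b1 b2 b3] := sr_periodic x; rewrite a1 a2 a3 b1 b2 b3.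
- exact: cubint_ge0.
- move=> x y; have [a1 a2 a3] := pu y; have [b1 b2 b3] := pv y; have [c1 c2 c3] := pw y.
  by rewrite /cubint /= a1 a2 a3 b1 b2 b3 c1 c2 c3.
Qed.

End rate_bound.

(** * Conservation of energy *)
Section conservation.
Context {R : realType}.
Local Notation X := (R * R * R)%type.
Local Notation V := (R * R * R * R)%type.
Variables (T Om : R) (u v w p : V -> R) (al : R -> R).
Hypothesis fl : flow T u v w p Om al.
Hypothesis T0 : 0 < T.
Implicit Types (xi : X) (t : R) (k n : nat).
Local Notation ta := (tau T).

Let cu n (J : idx n) t : R := coef (slice u t) J.
Let cv n (J : idx n) t : R := coef (slice v t) J.
Let ru n (J : idx n) t : R := \int[m3]_x mom u v w p u v Om Ax1 J (x, t).
Let rv n (J : idx n) t : R := \int[m3]_x mom u v w p v u (- Om) Ax2 J (x, t).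

(** The times at which the energy is compared: all coefficients have Lebesgue points there. *)
Record good t : Prop := Good {
  good_in : 0 < t < T ;
  good_u : stat (slice u t) (al t) ;
  good_v : stat (slice v t) (al t) ;
  good_cu : forall n (J : idx n), lebesgue_pt (tex T (cu J)) t ;
  good_cv : forall n (J : idx n), lebesgue_pt (tex T (cv J)) t }.

Lemma good_ae : {ae (ta : {measure set R -> \bar R}), forall t, good t}.
Proof.
have hu : {ae (ta : {measure set R -> \bar R}), forall t, forall n (J : idx n), lebesgue_pt (tex T (cu J)) t}.
  apply: ae_idx => n J; have [iJ _ _] := flow_momu fl J.
  by apply: filterS (ae_lebpt iJ) => t [].
have hv : {ae (ta : {measure set R -> \bar R}), forall t, forall n (J : idx n), lebesgue_pt (tex T (cv J)) t}.
  apply: ae_idx => n J; have [iJ _ _] := flow_momv fl J.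
  by apply: filterS (ae_lebpt iJ) => t [].
apply: filterS (filterI (filterI hu hv) (filterI (ae_tau_in T) (filterI (flow_u fl) (flow_v fl)))).
by move=> t [[h1 h2] [h3 [h4 h5]]]; split.
Qed.

Definition kh k xi : R := 32 * pi * k.+1%:R * (ker3 k xi * sr xi).

Lemma kh_ge0 k xi : 0 <= kh k xi.
Proof.
have h0 : 0 <= 32 * pi * k.+1%:R :> R by rewrite !mulr_ge0// pi_ge0.
exact: mulr_ge0 h0 (mulr_ge0 (ker3_ge0 k xi) (sr_ge0 xi)).
Qed.

Lemma m_kh k : measurable_fun setT (kh k).
Proof. by apply: measurable_funM => //; apply: measurable_funM; [exact: m_ker3|exact: m_sr]. Qed.

Lemma m_cub2 : measurable_fun setT (fun z : X * R => cub u v w z.1 z.2).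
Proof.
have mid : measurable_fun setT (fun z : (X * R) * X => z) by exact: measurable_id.
have mq : measurable_fun setT (fun z : (X * R) * X => ((z.2, z.1.2), z.1.1)).
  by apply: mprod; [apply: mprod; [exact: msnd|apply: msnd; exact: mfst]|apply: mfst; exact: mfst].
have mc : measurable_fun setT (fun z : (X * R) * X => (cubd u v w z.1.1 (z.2, z.1.2))%:E : \bar R).
  by apply/measurable_EFinP; exact: (mcomp (m_cubd fl) mq).
have c0 z : (0 <= (cubd u v w z.1.1 (z.2, z.1.2))%:E :> \bar R)%E by rewrite lee_fin cubd_ge0.
exact: (mint2 m3 mc c0).
Qed.

Let mK k : measurable_fun setT (fun z : X * R => ((kh k z.1)%:E * cub u v w z.1 z.2)%E).
Proof.
apply: emeasurable_funM; last exact: m_cub2.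
by apply/measurable_EFinP; apply: (mcomp (m_kh k)); exact: mfst.
Qed.

Let K0 k xi t : (0 <= (kh k xi)%:E * cub u v w xi t)%E.
Proof. by rewrite mule_ge0 ?cub_ge0// lee_fin kh_ge0. Qed.

(** The gradient of the kernel costs one factor of the distance and a factor [k.+1]; the second
    moment of the kernel compensates it, and the fourth moment is of lower order. *)
Lemma flux_time (ka C : R) : 0 <= ka -> 0 <= C ->
  (forall xi r, 0 <= r -> small T u v al xi r ->
     (\int[ta]_t cub u v w xi t <= (r * (ka + C * r ^+ 2))%:E)%E) ->
  forall k, (\int[ta]_t \int[m3]_xi ((kh k xi)%:E * cub u v w xi t) <=
    (16 * pi * (9 * ka + 243 * C / (2 * k%:R + 4)))%:E)%E.
Proof.
move=> ka0 C0 hc k.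
have -> : (\int[ta]_t \int[m3]_xi ((kh k xi)%:E * cub u v w xi t) =
   \int[m3]_xi \int[ta]_t ((kh k xi)%:E * cub u v w xi t))%E.
  by symmetry; apply: (tonelli_swap m3 ta (f := fun xi t => ((kh k xi)%:E * cub u v w xi t)%E)).
pose c : R := 32 * pi * k.+1%:R; have c0 : 0 <= c by rewrite !mulr_ge0// pi_ge0.
have k0 := @ker3_ge0 R k; have s0 := @sr_ge0 R.
have mk2 : measurable_fun setT (fun xi : X => (ker3 k xi * sr xi ^+ 2)%:E : \bar R).
  by apply/measurable_EFinP; apply: measurable_funM; [exact: m_ker3|apply: measurable_funX; exact: m_sr].
have mk4 : measurable_fun setT (fun xi : X => (ker3 k xi * sr xi ^+ 4)%:E : \bar R).
  by apply/measurable_EFinP; apply: measurable_funM; [exact: m_ker3|apply: measurable_funX; exact: m_sr].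
have n2 xi : (0 <= (ker3 k xi * sr xi ^+ 2)%:E :> \bar R)%E by rewrite lee_fin mulr_ge0// exprn_ge0.
have n4 xi : (0 <= (ker3 k xi * sr xi ^+ 4)%:E :> \bar R)%E by rewrite lee_fin mulr_ge0// exprn_ge0.
have cka : 0 <= c * ka by exact: mulr_ge0.
have cC : 0 <= c * C by exact: mulr_ge0.
apply: (@le_trans _ _ (\int[m3]_xi ((c * ka)%:E * (ker3 k xi * sr xi ^+ 2)%:E + (c * C)%:E * (ker3 k xi * sr xi ^+ 4)%:E))%E).
  apply: int_mono => xi; first exact: integral_ge0.
  rewrite ge0_integralZl//; last 3 first.
  - exact: (m_cub fl xi).
  - by move=> t _; exact: cub_ge0.
  - by rewrite lee_fin kh_ge0.
  have sm : small T u v al xi (sr xi).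
    apply: filterS (filterI (flow_u fl) (flow_v fl)) => t [su sv].
    by split; exact: nm_dif_sr.
  apply: (@le_trans _ _ ((kh k xi)%:E * (sr xi * (ka + C * sr xi ^+ 2))%:E)%E).
    by apply: lee_wpmul2l; [rewrite lee_fin kh_ge0|exact: hc].
  by rewrite -!EFinM -EFinD lee_fin /kh -/c le_eqVlt; apply/orP; left; apply/eqP; ring.
rewrite ge0_integralD//; last 4 first.
- by move=> x _; rewrite mule_ge0// lee_fin.
- exact: emeasurable_funM.
- by move=> x _; rewrite mule_ge0// lee_fin.
- exact: emeasurable_funM.
rewrite !ge0_integralZl//.
have i2 := @int_ker3_sr2 R k; have i4 := @int_ker3_sr4 R k.
apply: (@le_trans _ _ ((c * ka)%:E * (9 / (2 * k%:R + 2))%:E + (c * C)%:E * (243 / ((2 * k%:R + 2) * (2 * k%:R + 4)))%:E)%E).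
  by apply: leeD; apply: lee_wpmul2l; rewrite ?lee_fin.
rewrite -!EFinM -EFinD lee_fin /c le_eqVlt; apply/orP; left; apply/eqP.
have k00 : 0 <= k%:R :> R by [].
by rewrite -[k.+1%:R]natr1; field; apply/andP; split; apply/negP => /eqP E; lra.
Qed.

Definition modal n t : R := \sum_(J : idx n) (cu J t ^+ 2 + cv J t ^+ 2).

(** The squares of the coefficients are differentiated one by one and the densities are summed
    before the bound is taken, since the cancellations occur in the sum. *)
Lemma modal_diff (D : R) k t1 t2 : good t1 -> good t2 -> t1 < t2 ->
  (\int[ta]_t \int[m3]_xi ((kh k xi)%:E * cub u v w xi t) <= (2 * D)%:E)%E ->
  `|modal k.+1 t2 - modal k.+1 t1| <= D.
Proof.
move=> [/andP[t10 t1T] _ _ lu1 lv1] [/andP[t20 t2T] _ _ lu2 lv2] t12 hD.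
pose Fu (J : idx k.+1) t := 2 * cu J t * ru J t * win t1 t2 t.
pose Fv (J : idx k.+1) t := 2 * cv J t * rv J t * win t1 t2 t.
have HU (J : idx k.+1) : ig ta (Fu J) /\ cu J t2 ^+ 2 - cu J t1 ^+ 2 = \int[ta]_t Fu J t.
  by have [ia if_ H] := flow_momu fl J; exact: (weak_square T0 ia if_ H (lu1 _ J) (lu2 _ J) t10 t12 t2T).
have HV (J : idx k.+1) : ig ta (Fv J) /\ cv J t2 ^+ 2 - cv J t1 ^+ 2 = \int[ta]_t Fv J t.
  by have [ia if_ H] := flow_momv fl J; exact: (weak_square T0 ia if_ H (lv1 _ J) (lv2 _ J) t10 t12 t2T).
have iUV (J : idx k.+1) : ig ta (fun t => Fu J t + Fv J t) := igD (HU J).1 (HV J).1.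
have -> : modal k.+1 t2 - modal k.+1 t1 = \int[ta]_t \sum_(J : idx k.+1) (Fu J t + Fv J t).
  rewrite I_sum// /modal -sumrB; apply: eq_bigr => J _.
  rewrite (ID (HU J).1 (HV J).1) -(HU J).2 -(HV J).2; ring.
apply: I_le0.
have iS := ig_sum (index_enum (idx k.+1)) iUV.
pose H t := (\int[m3]_xi ((kh k xi)%:E * cub u v w xi t))%E.
have mH : measurable_fun setT H by exact: (mint1 m3 (mK k) (fun z => K0 k z.1 z.2)).
have H0 t : (0 <= H t)%E by exact: integral_ge0.
apply: (@le_trans _ _ (\int[ta]_t ((2^-1)%:E * H t))%E); last first.
  rewrite ge0_integralZl//.
  have -> : D = 2^-1 * (2 * D) by field.
  by rewrite EFinM; apply: lee_wpmul2l => //; rewrite lee_fin.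
apply: int_ae_le.
- by apply/measurable_EFinP; apply: measurableT_comp => //; exact: ig_meas iS.
- exact: emeasurable_funM.
- by move=> t; rewrite lee_fin.
- by move=> t; rewrite mule_ge0 ?lee_fin.
apply: filterS (filterI (filterI (flow_u fl) (flow_v fl)) (filterI (flow_w fl) (filterI (flow_p fl) (filterI (flow_div fl) (flow_pz fl))))).
move=> t [[su sv] [[tw wA] [ip [hd hz]]]].
have rate := rate_le Om su sv tw wA ip (hd k.+1) (hz k.+1).
have -> : \sum_(J : idx k.+1) (Fu J t + Fv J t) =
   2^-1 * win t1 t2 t * (4 * \sum_(J : idx k.+1) (cu J t * ru J t + cv J t * rv J t)).
  by rewrite !mulr_sumr; apply: eq_bigr => J _; rewrite /Fu /Fv; field.
rewrite normrM EFinM; apply: lee_pmul; rewrite ?lee_fin//.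
  rewrite normrM [`|2^-1|]ger0_norm// -[leRHS]mulr1 ler_wpM2l//.
  by rewrite /win; case: (_ && _); rewrite ?normr1// normr0.
Qed.

Definition en t : R := \int[m3]_x (slice u t x ^+ 2) + \int[m3]_x (slice v t x ^+ 2).

Lemma modal_en n t : good t -> `|en t - modal n t| <= 18 * al t ^+ 2 / (2 * n%:R + 2).
Proof.
move=> [_ su sv _ _]; have hu := coef_loss n su; have hv := coef_loss n sv.
rewrite /en /modal big_split/=.
have -> : 18 * al t ^+ 2 / (2 * n%:R + 2) = 9 * al t ^+ 2 / (2 * n%:R + 2) + 9 * al t ^+ 2 / (2 * n%:R + 2) by ring.
rewrite opprD addrACA; apply: le_trans (ler_normD _ _) _; exact: lerD.
Qed.

(** With [ka] small and then [k] large every error is below [e]. *)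
Lemma en_lt t1 t2 : good t1 -> good t2 -> t1 < t2 -> en t1 = en t2.
Proof.
move=> g1 g2 t12; apply/eqP; rewrite eq_sym -subr_eq0 -normr_le0; apply/ler_addgt0Pl => e e0; rewrite addr0.
have p3 : 0 < 144 * pi :> R by rewrite mulr_gt0// pi_gt0.
(* In the bound of [flux_time], halved, the part with [ka] is then half of [e]. *)
have ka0 : 0 < e / (144 * pi) by rewrite divr_gt0.
have [C C0 hC] := cub_le fl ka0.
pose B := 8 * pi * (243 * C) + 18 * al t1 ^+ 2 + 18 * al t2 ^+ 2.
have B0 : 0 <= B.
  have := pi_gt0 R => /ltW pi0; have a1 := sqr_ge0 (al t1); have a2 := sqr_ge0 (al t2).
  have b1 : 0 <= 8 * pi * (243 * C) by rewrite !mulr_ge0.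
  have n18 : 0 <= 18 :> R by [].
  exact: addr_ge0 (addr_ge0 b1 (mulr_ge0 n18 a1)) (mulr_ge0 n18 a2).
have eB : 0 < e / (2 * (B + 1)) by rewrite divr_gt0// mulr_gt0// ltr_wpDl.
have [k _ hk] := harm_lt eB; have {hk} := hk k (leqnn k) => /= hk.
have hF := flux_time (ltW ka0) C0 hC k.
have hM := modal_diff (D := 8 * pi * (9 * (e / (144 * pi)) + 243 * C / (2 * k%:R + 4))) g1 g2 t12.
have {hM} hM : `|modal k.+1 t2 - modal k.+1 t1| <= 8 * pi * (9 * (e / (144 * pi)) + 243 * C / (2 * k%:R + 4)).
  by apply: hM; apply: le_trans hF _; rewrite lee_fin le_eqVlt; apply/orP; left; apply/eqP; ring.
have h1 := modal_en k.+1 g1; have h2 := modal_en k.+1 g2.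
have -> : en t2 - en t1 = (en t2 - modal k.+1 t2) + (modal k.+1 t2 - modal k.+1 t1) - (en t1 - modal k.+1 t1) by ring.
apply: le_trans (ler_normB _ _) _.
apply: le_trans (lerD (ler_normD _ _) (lexx _)) _.
apply: le_trans (lerD (lerD h2 hM) h1) _.
have k00 : 0 <= k%:R :> R by [].
have d4 : 0 < 2 * k%:R + 4 :> R by rewrite ltr_wpDl// mulr_ge0.
have -> : 18 * al t2 ^+ 2 / (2 * k.+1%:R + 2) + 8 * pi * (9 * (e / (144 * pi)) + 243 * C / (2 * k%:R + 4))
   + 18 * al t1 ^+ 2 / (2 * k.+1%:R + 2) = e / 2 + B / (2 * k%:R + 4).
  have d4n : 2 * k%:R + 4 != 0 :> R by rewrite gt_eqF.
  have pin : pi != 0 :> R by rewrite gt_eqF// pi_gt0.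
  have -> : 2 * k.+1%:R + 2 = 2 * k%:R + 4 :> R by rewrite -natr1; ring.
  rewrite /B; move: (2 * k%:R + 4) d4n => d dn.
  move: (pi : R) pin => P pn.
  field.
  by rewrite ?dn ?pn.
have hB : B / (2 * k%:R + 4) <= e / 2.
  apply: (@le_trans _ _ ((B + 1) * k.+1%:R^-1)).
    have b1 : 0 <= B + 1 := addr_ge0 B0 ler01.
    apply: ler_pM => //; rewrite ?invr_ge0 ?(ltW d4)// ?lerDl//.
    by rewrite lef_pV2 ?posrE// -natr1; lra.
  apply: (@le_trans _ _ ((B + 1) * (e / (2 * (B + 1))))).
    by apply: ler_wpM2l; [exact: addr_ge0 B0 ler01|exact: ltW hk].
  have b1 : 0 < B + 1 by rewrite ltr_wpDl.
  by rewrite le_eqVlt; apply/orP; left; apply/eqP; field; rewrite gt_eqF.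
lra.
Qed.

Lemma en_good t1 t2 : good t1 -> good t2 -> en t1 = en t2.
Proof.
move=> g1 g2; have [h|h|-> //] := ltgtP t1 t2; first exact: en_lt.
by symmetry; exact: en_lt.
Qed.

Lemma torus_norm2 (f : X -> R) (A : R) : stat f A ->
  (torus_norm 2%:E f ^+ 2 = (\int[m3]_x (f x ^+ 2))%:E)%E.
Proof.
move=> sf; have [mf _ _ _] := sf; have n2 : 2 != 0 :> R by [].
rewrite torus_norm_nm// (IE (stat_sq sf)).
have -> : (\int[m3]_x (f x ^+ 2)%:E = nm m3 2 f `^ 2)%E.
  by rewrite nm_pow//; apply: eq_integral => x _; rewrite powR_mulrn// real_normK ?num_real.
have := nm_ge0 m3 2 f; case: (nm m3 2 f) => [r r0| |//].
  by rewrite -EFin_expe poweR_EFin powR_mulrn.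
by rewrite poweRyr.
Qed.

Lemma energy_en t : good t -> energy u v t = (en t)%:E.
Proof.
by move=> [_ su sv _ _]; rewrite /energy (torus_norm2 su) (torus_norm2 sv) -EFinD.
Qed.

End conservation.

Theorem proposition6p1 (R : realType) (T Omega s : R)
    (u v w p : R * R * R * R -> R)
    (hT : 0 < T)
    (hs : 1 < s)
    (hu : bochner_besov T 3 s (9 / 4)%:E u)
    (hv : bochner_besov T 3 s (9 / 4)%:E v)
    (hmean : zero_mean_hdivergence T u v)
    (hw : vertical_velocity T u v w)
    (hp : L1_torus T p)
    (hsym : [/\ even_in_z T u, even_in_z T v, even_in_z T p & odd_in_z T w])
    (hweak : hydrostatic_euler_weak T Omega u v w p) :
  (forall phi : R * R * R -> R, mollifier phi ->
     is_defect T phi u v w (fun=> 0)) /\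
  energy_conserved T u v.
Proof.
have fl := reduction hT hs hu hv hw hp hweak.
split.
  move=> phi hphi psi tpsi.
  suff E : (fun eps => \int[(@lebesgue_measure R \x @lebesgue_measure R \x @lebesgue_measure R
        \x @lebesgue_measure R)%E]_(q in cylinder T) (defect_eps phi u v w eps q * psi q)) =
      (fun eps => \int[(@lebesgue_measure R \x @lebesgue_measure R \x @lebesgue_measure R
        \x @lebesgue_measure R)%E]_(q in cylinder T)
        (defect_eps phi (cut T u) (cut T v) (cut T w) eps q * psi q)).
    by rewrite E; exact: (defect_zero fl hT hphi tpsi).
  apply/funext => eps; congr fine; apply: eq_integral => q; rewrite inE => /cyl_in q0.
  have I f xi : increment (cut T f) xi q = increment f xi q by rewrite /increment !cut_in.
  rewrite /=; congr EFin; congr (_ * _); congr fine; apply: eq_integral => xi _.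
  by rewrite !I.
have [N [mN N0 NP]] := good_ae fl.
(* The measure [tau T] does not see times outside the interval. *)
exists (N `&` `]0, T[%classic); split.
  exists (N `&` `]0, T[%classic); split => //; first by apply: measurableI => //; exact: measurable_itvR.
have g t : 0 < t < T -> ~ (N `&` `]0, T[%classic) t -> good T (cut T u) (cut T v) (amp T u v) t.
  move=> t0 nN; apply: contrapT => ng; apply: nN; split; first exact: NP.
  by rewrite /= in_itv.
move=> t1 t2 h1 h2 n1 n2; have g1 := g _ h1 n1; have g2 := g _ h2 n2.
have E t : 0 < t < T -> energy u v t = energy (cut T u) (cut T v) t.
  by move=> t0; rewrite /energy !slice_cut.
by rewrite !E// (energy_en g1) (energy_en g2) (en_good fl hT g1 g2).
Qed.
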